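(* Let $T>0$, $H\in(\frac12,1)$, $\alpha\in(1-H,1)$, $\sigma\in\mathbb R\setminus\{0\}$, $x_0\in\mathbb R$, and let $f\in C_b^2$. Let $\{x(t)\}_{t\in[0,T]}$ be the unique strong solution of $$x(t)=x_0+\frac1{\Gamma(\alpha)}\int_0^t(t-s)^{\alpha-1}f(x(s))\,\mathrm ds+\frac{\sigma}{\Gamma(\alpha)}\int_0^t(t-s)^{\alpha-1}\,\mathrm dW_H(s),\qquad t\in[0,T].$$ For an integer $N\ge1$ put $h=T/N$, $t_n=nh$ ($n=0,1,\dots,N$), and define the Euler--Maruyama approximations by $$x_n=x_0+\frac1{\Gamma(\alpha)}\sum_{j=1}^nf(x_{j-1})\int_{t_{j-1}}^{t_j}(t_n-s)^{\alpha-1}\,\mathrm ds+\frac{\sigma}{\Gamma(\alpha)}\int_0^{t_n}(t_n-s)^{\alpha-1}\,\mathrm dW_H(s),\qquad n=1,\dots,N.$$ Then there exists a positive constant $C$ independent of $h$ (equivalently of $N$) such that $$\|q_{x(t_n)}-q_{x_n}\|_{L^1(\mathbb R;\mathbb R)}\le C\,h^{\alpha+H-1}\qquad\text{for all } n\in\{1,2,\dots,N\},$$ where $q_{x(t_n)}$ and $q_{x_n}$ denote the probability density functions of $x(t_n)$ and $x_n$, respectively.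
   Context: $W_H$ is a fractional Brownian motion with Hurst index $H$ (centered Gaussian process with covariance $H(2H-1)\int_0^t\int_0^s|u-v|^{2H-2}\mathrm du\,\mathrm dv$) on a complete filtered probability space $(\Omega,\mathscr F,\{\mathscr F_t\}_{t\in[0,T]},\mathbb P)$ satisfying the usual conditions. The stochastic integral of a deterministic function against $W_H$ is the Wiener integral: the isometric extension of $\mathbf 1_{[0,t]}\mapsto W_H(t)$ to the Hilbert space $\mathcal H$ obtained by closing the step functions on $[0,T]$ under the scalar product $\langle\varphi,\phi\rangle_{\mathcal H}=H(2H-1)\int_0^T\int_0^T\varphi(u)\phi(v)|u-v|^{2H-2}\mathrm du\,\mathrm dv$. $\Gamma$ is the Gamma function. For an integer $m\ge1$, $C_b^m$ is the space of (not necessarily bounded) functions $f:\mathbb R\to\mathbb R$ whose derivatives of orders $1,\dots,m$ exist, are continuous and bounded. Under the stated hypotheses ($f$ is Lipschitz) the equation has a unique strong solution, and the laws of $x(t_n)$ and $x_n$, $n\ge1$, are absolutely continuous with respect to Lebesgue measure, so that the densities are defined. *)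

(* Defs.v *)
From HB Require Import structures.
From mathcomp Require Import all_boot all_order all_algebra.
From mathcomp Require Import all_classical all_reals all_analysis.

Set Implicit Arguments.
Unset Strict Implicit.
Unset Printing Implicit Defensive.

Import Order.TTheory GRing.Theory Num.Theory.
Import numFieldNormedType.Exports.

Local Open Scope classical_set_scope.
Local Open Scope ring_scope.

Definition Gamma (R : realType) (a : R) : R :=
  \int[lebesgue_measure]_(u in `]0, +oo[) (u `^ (a - 1) * expR (- u)).

(* f itself is not required to be bounded. *)
Definition Cb (R : realType) (m : nat) (f : R -> R) : Prop :=
  forall k : nat, (1 <= k <= m)%N ->
    [/\ forall x : R, derivable (derive1n k.-1 f) x 1,
        continuous (derive1n k f)
      & exists M : R, forall x : R, `|derive1n k f x| <= M].

(* Only the indices t in [0, T] matter, here and for all processes below. *)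
Record usual_filtration (R : realType) (d : measure_display)
    (Omega : measurableType d) (P : probability Omega R) (T : R)
    (F : R -> set (set Omega)) : Prop := UsualFiltration {
  usual_sigma : forall t : R, t \in `[0, T] -> sigma_algebra setT (F t);
  usual_measurable : forall t : R, t \in `[0, T] -> F t `<=` measurable;
  usual_monotone : forall s t : R,
    s \in `[0, T] -> t \in `[0, T] -> s <= t -> F s `<=` F t;
  usual_right_continuous : forall t : R,
    t \in `[0, T[ -> \bigcap_(s in `]t, T]) F s = F t;
  usual_space_complete : measure_is_complete P;
  usual_complete : P.-negligible `<=` F 0 }.

Definition adapted (R : realType) (d : measure_display)
    (Omega : measurableType d) (T : R)
    (F : R -> set (set Omega)) (X : R -> Omega -> R) : Prop :=
  forall t : R, t \in `[0, T] ->
    forall A : set R, measurable A -> F t (X t @^-1` A).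

(* Dirac laws count as Gaussian; they are listed separately because
   normal_prob m 0 is not the Dirac mass at m. *)
Definition gaussian (R : realType) (d : measure_display)
    (Omega : measurableType d) (P : probability Omega R)
    (X : Omega -> R) : Prop :=
  (exists m s : R, s != 0 /\
     forall A : set R, measurable A -> P (X @^-1` A) = normal_prob m s A) \/
  (exists m : R,
     forall A : set R, measurable A -> P (X @^-1` A) = \d_m A).

Definition gaussian_process (R : realType) (d : measure_display)
    (Omega : measurableType d) (P : probability Omega R) (T : R)
    (X : R -> Omega -> R) : Prop :=
  forall (n : nat) (a t : 'I_n -> R), (forall i, t i \in `[0, T]) ->
    gaussian P (fun w => \sum_(i < n) a i * X (t i) w).

Definition fbm_kernel (R : realType) (H : R) (z : R * R) : R :=
  `|z.1 - z.2| `^ (2 * H - 2).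

Definition is_fbm (R : realType) (d : measure_display)
    (Omega : measurableType d) (P : probability Omega R) (T H : R)
    (W : R -> {RV P >-> R}) : Prop :=
  [/\ gaussian_process P T W,
      forall t : R, t \in `[0, T] -> ('E_P[W t] = 0)%E
    & forall s t : R, s \in `[0, T] -> t \in `[0, T] ->
        covariance P (W t) (W s) =
        ((H * (2 * H - 1))%:E *
         \int[lebesgue_measure \x lebesgue_measure]_(z in `[0%R, t] `*` `[0%R, s])
            (fbm_kernel H z)%:E)%E].

(* The double integral defining <phi, psi>_H converges absolutely. *)
Definition fbm_integrable (R : realType) (T H : R) (phi psi : R -> R) : Prop :=
  (lebesgue_measure \x lebesgue_measure)%E.-integrable (`[0, T] `*` `[0, T])
    (EFin \o (fun z : R * R => phi z.1 * psi z.2 * fbm_kernel H z)).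

Definition fbm_inner (R : realType) (T H : R) (phi psi : R -> R) : R :=
  H * (2 * H - 1) *
  \int[(lebesgue_measure \x lebesgue_measure)%E]_(z in `[0, T] `*` `[0, T])
    (phi z.1 * psi z.2 * fbm_kernel H z).

(* A list c of pairs (a, t) encodes the step function \sum a * 1_[0, t],
   whose integral against W is \sum a * W t. *)
Definition step_fun (R : realType) (c : seq (R * R)) (u : R) : R :=
  \sum_(p <- c) p.1 * \1_(`[0, p.2] : set R) u.

Definition step_integral (R : realType) (Omega : Type) (W : R -> Omega -> R)
    (c : seq (R * R)) (w : Omega) : R :=
  \sum_(p <- c) p.1 * W p.2 w.

(* I is a version of the Wiener integral of phi over [0, T]: the isometry
   1_[0, t] |-> W t is extended by closure, i.e. I is the limit in L^2(P) of the
   integrals of step functions converging to phi in the Hilbert norm. As phi is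
   a function, its norm is meaningful only under fbm_integrable. *)
Definition wiener_integral (R : realType) (d : measure_display)
    (Omega : measurableType d) (P : probability Omega R) (T H : R)
    (W : R -> {RV P >-> R}) (phi : R -> R) (I : {RV P >-> R}) : Prop :=
  [/\ measurable_fun `[0, T] phi,
      fbm_integrable T H phi phi
    & exists c : nat -> seq (R * R),
      [/\ forall k p, p \in c k -> p.2 \in `[0, T],
          (fbm_inner T H (step_fun (c k) \- phi) (step_fun (c k) \- phi)
             @[k --> \oo] --> (0 : R))
        & ('E_P[fun w => ((step_integral W (c k) w - I w) ^+ 2)%R]
             @[k --> \oo] --> 0)%E]].

(* The kernel s |-> (t - s)^(alpha - 1) of the integrals over [0, t]. *)
Definition frac_kernel (R : realType) (alpha t s : R) : R :=
  \1_(`[0, t] : set R) s * (t - s) `^ (alpha - 1).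

Record strong_solution (R : realType) (d : measure_display)
    (Omega : measurableType d) (P : probability Omega R) (T H alpha sigma x0 : R)
    (F : R -> set (set Omega)) (W : R -> {RV P >-> R}) (f : R -> R)
    (x : R -> {RV P >-> R}) : Prop := StrongSolution {
  sol_adapted : adapted T F x;
  sol_continuous :
    {ae P, forall w, {within `[0, T], continuous (fun t => x t w)}};
  sol_equation : forall t : R, t \in `[0, T] ->
    exists2 G : {RV P >-> R},
      wiener_integral T H W (frac_kernel alpha t) G &
      {ae P, forall w, x t w =
         x0
         + (Gamma alpha)^-1 *
           (\int[lebesgue_measure]_(s in `[0, t])
              ((t - s) `^ (alpha - 1) * f (x s w)))
         + sigma / Gamma alpha * G w} }.

Definition euler_maruyama (R : realType) (d : measure_display)
    (Omega : measurableType d) (P : probability Omega R) (T H alpha sigma x0 : R)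
    (W : R -> {RV P >-> R}) (f : R -> R) (N : nat)
    (y : nat -> {RV P >-> R}) : Prop :=
  let h := T / N%:R in
  (forall w, y 0%N w = x0) /\
  forall n : nat, (1 <= n <= N)%N ->
    exists2 G : {RV P >-> R},
      wiener_integral T H W (frac_kernel alpha (n%:R * h)) G &
      {ae P, forall w, y n w =
         x0
         + (Gamma alpha)^-1 *
           (\sum_(1 <= j < n.+1) f (y j.-1 w) *
              (\int[lebesgue_measure]_(s in `[j.-1%:R * h, j%:R * h])
                 (n%:R * h - s) `^ (alpha - 1)))
         + sigma / Gamma alpha * G w}.

Definition is_pdf (R : realType) (d : measure_display)
    (Omega : measurableType d) (P : probability Omega R)
    (X : {RV P >-> R}) (q : R -> R) : Prop :=
  [/\ measurable_fun setT q,
      forall r : R, 0 <= q r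
    & forall A : set R, measurable A ->
        distribution P X A = (\int[lebesgue_measure]_(r in A) (q r)%:E)%E].

(* Main.v *)
Require Import Defs.
From HB Require Import structures.
From mathcomp Require Import all_boot all_order all_algebra.
From mathcomp Require Import all_classical all_reals all_analysis.
From mathcomp Require Import measurable_realfun.
From mathcomp Require Import ring lra zify.

Set Implicit Arguments.
Unset Strict Implicit.
Unset Printing Implicit Defensive.

Import Order.TTheory GRing.Theory Num.Theory.
Import numFieldNormedType.Exports.

Local Open Scope classical_set_scope.
Local Open Scope ring_scope.

(* Given the part of the noise that is independent of W_T, the noise of the equation at
   time t is rho(t) W_T plus a constant, where rho is the fractional integral of a positive
   function, the marginal of the covariance kernel. The solution and the Euler scheme thus
   become functions of one Gaussian variable, whose derivatives solve linear fractional
   equations; by an argument of Kaluza on renewal sequences they stay above c t^alpha,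
   whatever the sign of f'. An integration by parts in W_T bounds |E g(X) - E g(Y)|, for
   |g| <= 1 and without any regularity of g, by t^-alpha times a weighted L^1 norm of
   X - Y and X' - Y', and that norm is O(t^alpha h^(alpha + H - 1)) by a fractional
   Gronwall inequality, as the noise is (alpha + H - 1)-Hoelder in L^2. The comparison is
   made between the schemes of steps h and h / m; the latter converges pathwise to the
   solution as m tends to infinity. *)

(** * Calculus preliminaries *)

(** Total variation allows no regularity of the test function, so the smoothing has to come from the
    noise, and a single Gaussian direction suffices. [W T] is a convenient one: for H > 1/2 the
    covariance kernel is positive, which gives a fixed sign to the effect of [W T] on the noise at
    all times. Working with two schemes instead of the solution makes every derivative in [W T] a
    finite recursion.

    Two powers of t_n have to balance. The loss t_n^(-alpha) is not bounded on the first grid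
    points, so each difference of schemes and each second derivative is estimated with a factor
    t_n^alpha in front, obtained by feeding a uniform bound once more into the recursion. The kernel
    has no semigroup property, so the sign of the linearised equation cannot be read off an
    exponential; log-convexity of the kernel replaces it.

    The weights of the scheme are exact integrals of the kernel. Hence the weights for the step h /
    m add up to those for the step h, and only the variation of the integrand inside a coarse cell
    remains. Independence of [W T] and the residual noise enters through cosine transforms, which
    determine the joint law on the sigma-algebra of the coordinates. *)

Section power_function.
Context {R : realType}.
Implicit Types (a b c r x : R).

(** The absolute value is inert near [x]. It is there so that the same function is continuous on the
    whole line when [r] is positive, as the mean value argument of [le_of_derive_ge0] requires. *)
Lemma is_derive_powRD r c x : 0 < c + x ->
  is_derive x 1 (fun s : R => `|c + s| `^ r) (r * (c + x) `^ (r - 1)).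
Proof.
move=> cx0.
have H : is_derive x 1 (fun s : R => (c + s) `^ r) (r * (c + x) `^ (r - 1)).
  have H1 : is_derive (c + x) 1 (@powR R ^~ r) (r * (c + x) `^ (r - 1)).
    exact: is_derive1_powR.
  have H2 : is_derive x 1 (fun s : R => c + s) 1.
    by have := @is_deriveD _ _ _ (cst c) id x 1 0 1 _ _; rewrite add0r; apply.
  have := is_derive1_comp H1 H2.
  by move=> H3; apply: (is_derive_eq H3); rewrite mulr1.
have E : {near x, (fun s : R => (c + s) `^ r) =1 (fun s : R => `|c + s| `^ r)}.
  near=> s; rewrite ger0_norm//; apply/ltW.
  near: s.
  have : (fun s : R => c + s) @ x --> c + x.
    by apply: cvgD; [exact: cvg_cst|exact: cvg_id].
  by move/(_ _ (lt_nbhsr cx0)).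
case: H => Hd He; split.
  exact: near_eq_derivable E Hd.
by rewrite -(near_eq_derive _ E).
Unshelve. all: by end_near. Qed.

Lemma continuous_norm_powR_neq0 r x : x != 0 ->
  {for x, continuous (fun x : R => `|x| `^ r)}.
Proof.
move=> x0; have N0 : 0 < 0 + `|x| by rewrite add0r normr_gt0.
have H := is_derive_powRD r N0.
have := differentiable_continuous (iffLR (derivable1_diffP _ _) (@ex_derive _ _ _ _ _ _ _ H)).
move=> /= C.
have -> : (fun y : R => `|y| `^ r) = (fun s : R => `|0 + s| `^ r) \o (@Num.norm R R).
  by apply/funext => y /=; rewrite add0r normr_id.
apply: (@continuous_comp _ _ _ (@Num.norm R R)); [exact: norm_continuous|exact: C].
Qed.

Lemma continuous_norm_powR r : 0 < r -> continuous (fun x : R => `|x| `^ r).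
Proof.
move=> r0 x; have [->|x0] := eqVneq x 0; last exact: continuous_norm_powR_neq0.
apply/cvgrPdist_lt => e e0; rewrite normr0 powR0 ?gt_eqF//.
near=> y; rewrite sub0r normrN ger0_norm ?powR_ge0//.
rewrite -[e in ltRHS]powRr1 ?ltW// -(mulVf (lt0r_neq0 r0)) powRrM.
apply: gt0_ltr_powR; rewrite ?nnegrE ?powR_ge0//.
near: y; exact: (@nbhs0_lt R R^o _ (powR_gt0 _ e0)).
Unshelve. all: by end_near. Qed.

Lemma continuous_norm_powRD r c : 0 < r -> continuous (fun s : R => `|c + s| `^ r).
Proof.
move=> r0 x; apply: (@continuous_comp _ _ _ (fun s => c + s) (fun y => `|y| `^ r)).
  by apply: cvgD; [exact: cvg_cst|exact: cvg_id].
exact: continuous_norm_powR.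
Qed.

Lemma le_of_derive_ge0 (F dF : R -> R) a b : a <= b ->
  (forall x, a < x < b -> is_derive x 1 F (dF x)) ->
  (forall x, a < x < b -> 0 <= dF x) ->
  continuous F -> F a <= F b.
Proof.
rewrite le_eqVlt => /predU1P[->//|ab] FdF dF0 cF.
have H1 x : x \in `]a, b[%R -> is_derive x 1 F (dF x).
  by rewrite in_itv/= => /FdF.
have [c cab E] := MVT ab H1 (continuous_subspaceT cF).
rewrite in_itv/= in cab.
by rewrite -subr_ge0 E mulr_ge0 ?dF0// subr_ge0 ltW.
Qed.

End power_function.

Section pointwise_derivatives.
Context {R : realType}.
Implicit Types (f g : R -> R) (x df dg : R).

Lemma is_derive_funD f g x df dg : is_derive x 1 f df -> is_derive x 1 g dg ->
  is_derive x 1 (fun y => f y + g y) (df + dg).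
Proof. exact: is_deriveD. Qed.

Lemma is_derive_funB f g x df dg : is_derive x 1 f df -> is_derive x 1 g dg ->
  is_derive x 1 (fun y => f y - g y) (df - dg).
Proof. exact: is_deriveB. Qed.

Lemma is_derive_funM f g x df dg : is_derive x 1 f df -> is_derive x 1 g dg ->
  is_derive x 1 (fun y => f y * g y) (df * g x + f x * dg).
Proof.
move=> Hf Hg; apply: (is_derive_eq (is_deriveM Hf Hg)).
by rewrite /GRing.scale/= addrC mulrC.
Qed.

Lemma is_derive_funZ c f x df : is_derive x 1 f df ->
  is_derive x 1 (fun y => c * f y) (c * df).
Proof. exact: is_deriveZ. Qed.

Lemma is_derive_comp f g x df dg : is_derive (g x) 1 f df -> is_derive x 1 g dg ->
  is_derive x 1 (fun y => f (g y)) (df * dg).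
Proof. exact: is_derive1_comp. Qed.

Lemma is_derive_affine a b x : is_derive x 1 (fun y : R => a * y + b) a.
Proof.
have := is_derive_funD (is_derive_funZ a (is_derive_id x 1)) (is_derive_cst b x 1).
by rewrite mulr1 addr0.
Qed.

Lemma is_derive_continuous f (df : R -> R) : (forall x, is_derive x 1 f (df x)) ->
  continuous f.
Proof.
by move=> H x; apply: differentiable_continuous; apply/derivable1_diffP; exact: ex_derive.
Qed.

Lemma is_derive0_cst f : (forall x, is_derive x 1 f 0) -> forall x y, f x = f y.
Proof. by move=> H x y; apply: is_derive_0_is_cst. Qed.

End pointwise_derivatives.

Section limit_bounds.
Context {R : realType}.
Implicit Types (u v : nat -> R) (a l : R).

Lemma ge_of_cvg u l a : u n @[n --> \oo] --> l -> (forall n, a <= u n) -> a <= l.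
Proof.
move=> ul au; rewrite -(cvg_lim (@Rhausdorff R) ul).
by apply: limr_ge; [exact: cvgP ul|exact: nearW].
Qed.

Lemma le_of_cvg u l a : u n @[n --> \oo] --> l -> (forall n, u n <= a) -> l <= a.
Proof.
move=> ul ua; rewrite -(cvg_lim (@Rhausdorff R) ul).
by apply: limr_le; [exact: cvgP ul|exact: nearW].
Qed.

End limit_bounds.

Section pointwise_continuity.
Context {R : realType}.
Implicit Types f g : R -> R.

Lemma continuous_fun_comp f g : continuous f -> continuous g -> continuous (fun t => f (g t)).
Proof. by move=> cf cg t; apply: continuous_comp; [exact: cg|exact: cf]. Qed.

Lemma continuous_funM f g : continuous f -> continuous g -> continuous (fun t => f t * g t).
Proof. by move=> cf cg t; apply: cvgM; [exact: cf|exact: cg]. Qed.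

Lemma continuous_funB f g : continuous f -> continuous g -> continuous (fun t => f t - g t).
Proof. by move=> cf cg t; apply: cvgB; [exact: cf|exact: cg]. Qed.

Lemma continuous_funD f g : continuous f -> continuous g -> continuous (fun t => f t + g t).
Proof. by move=> cf cg t; apply: cvgD; [exact: cf|exact: cg]. Qed.

End pointwise_continuity.

(** * Volterra recursions and the inequality of Kaluza *)

Section strong_recursion.
Context {T : Type} (x0 : T) (step : nat -> (nat -> T) -> T).

(** Course-of-values recursion: [step] receives the earlier values through [nth], with the default
    [x0] from index n on. The hypothesis of [srecE] says that it looks at indices below n only. *)
Fixpoint srec_seq (n : nat) : seq T :=
  if n is m.+1 then rcons (srec_seq m) (step m (nth x0 (srec_seq m))) else [::].

Definition srec (n : nat) : T := step n (nth x0 (srec_seq n)).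

Lemma size_srec_seq n : size (srec_seq n) = n.
Proof. by elim: n => //= n IH; rewrite size_rcons IH. Qed.

Lemma nth_srec_seq n k : (k < n)%N -> nth x0 (srec_seq n) k = srec k.
Proof.
elim: n => // n IH; rewrite ltnS leq_eqVlt => /predU1P[->|kn] /=.
  by rewrite nth_rcons size_srec_seq ltnn eqxx.
by rewrite nth_rcons size_srec_seq kn IH.
Qed.

Lemma srecE n :
  (forall g h, (forall k, (k < n)%N -> g k = h k) -> step n g = step n h) ->
  srec n = step n srec.
Proof. by move=> ext; apply: ext => k kn; rewrite nth_srec_seq. Qed.

End strong_recursion.

Section convolution.
Context {R : realType}.
Implicit Types (a b c : nat -> R) (n : nat).

Definition conv a b n : R := \sum_(i < n.+1) a i * b (n - i)%N.

(** Convolution is the product of polynomials truncated at a large degree; commutativity and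
    associativity are inherited from the polynomial ring. *)
Lemma coef_poly_conv a b n K : (n < K)%N ->
  ((\poly_(i < K) a i) * (\poly_(i < K) b i))`_n = conv a b n.
Proof.
move=> nK; rewrite coefM; apply: eq_bigr => i _; rewrite !coef_poly.
have -> : (i < K)%N by have := ltn_ord i; lia.
by have -> : (n - i < K)%N by lia.
Qed.

Lemma convC a b n : conv a b n = conv b a n.
Proof. by rewrite -!(@coef_poly_conv _ _ _ n.+1)// mulrC. Qed.

Lemma convA a b c n : conv a (conv b c) n = conv (conv a b) c n.
Proof.
transitivity (((\poly_(i < n.+1) a i) *
   ((\poly_(i < n.+1) b i) * (\poly_(i < n.+1) c i)))`_n).
  rewrite coefM; apply: eq_bigr => i _; rewrite coef_poly ltn_ord.
  by rewrite coef_poly_conv//; lia.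
rewrite mulrA coefM; apply: eq_bigr => i _.
by rewrite coef_poly_conv// coef_poly; have -> : (n - i < n.+1)%N by lia.
Qed.

Lemma convDl a b c n : conv (fun k => a k + b k) c n = conv a c n + conv b c n.
Proof. by rewrite -big_split/=; apply: eq_bigr => i _; rewrite mulrDl. Qed.

Lemma convDr a b c n : conv a (fun k => b k + c k) n = conv a b n + conv a c n.
Proof. by rewrite -big_split/=; apply: eq_bigr => i _; rewrite mulrDr. Qed.

Lemma convZl x a b n : conv (fun k => x * a k) b n = x * conv a b n.
Proof. by rewrite /conv big_distrr/=; apply: eq_bigr => i _; rewrite mulrA. Qed.

Lemma eq_conv a a' b b' n : (forall k, (k <= n)%N -> a k = a' k) ->
  (forall k, (k <= n)%N -> b k = b' k) -> conv a b n = conv a' b' n.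
Proof.
move=> aa bb; apply: eq_bigr => i _; rewrite aa ?bb ?leq_subr//.
by rewrite -ltnS.
Qed.

Definition unitseq (n : nat) : R := (n == 0)%:R.

Lemma conv1 a n : conv unitseq a n = a n.
Proof.
rewrite /conv big_ord_recl/= /unitseq eqxx mul1r subn0 big1 ?addr0// => i _.
by rewrite mul0r.
Qed.

Lemma conv_low a b n : a 0%N = 0 -> conv a b n = \sum_(l < n) a (n - l)%N * b l.
Proof.
move=> a0; rewrite convC /conv big_ord_recr/= subnn a0 mulr0 addr0.
by apply: eq_bigr => i _; rewrite mulrC.
Qed.

End convolution.

Section kaluza.
Context {R : realType}.
Variable u : nat -> R.
Hypothesis u0 : u 0%N = 1.
Hypothesis u_gt0 : forall n, 0 < u n.
Hypothesis u_logconvex : forall n, u n.+1 ^+ 2 <= u n * u n.+2.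
Hypothesis u_noninc : forall n, u n.+1 <= u n.

(** The sequence r with r * u = u - delta for convolution, that is, with generating function 1 -
    1/U. In renewal theory it is the law of the first return time attached to u. *)
Definition renewal : nat -> R := srec 0
  (fun n g => if n is 0%N then 0 else u n - \sum_(k < n) g k * u (n - k)%N).

#[local] Arguments renewal : simpl never.

Lemma renewal0 : renewal 0 = 0. Proof. by []. Qed.

Lemma renewalS n : renewal n.+1 = u n.+1 - \sum_(k < n.+1) renewal k * u (n.+1 - k)%N.
Proof.
rewrite {1}/renewal srecE// => g h gh.
by congr (_ - _); apply: eq_bigr => i _; rewrite gh.
Qed.

Lemma conv_renewal n : conv renewal u n = u n - unitseq n.
Proof.
case: n => [|n]; first by rewrite /conv big_ord1 renewal0 mul0r u0 subrr.
rewrite /conv big_ord_recr/= renewalS subnn u0 mulr1 /unitseq/= subr0.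
by rewrite addrC subrK.
Qed.

Lemma u_ratio_le m n : (m <= n)%N -> u m.+1 * u n <= u n.+1 * u m.
Proof.
elim: n => [|n IH]; first by rewrite leqn0 => /eqP ->.
rewrite leq_eqVlt => /predU1P[->|]; first by rewrite mulrC.
rewrite ltnS => /IH {}IH.
rewrite -(ler_pM2r (u_gt0 n)) -mulrA (mulrC (u n.+1)) mulrA.
apply: (@le_trans _ _ (u n.+1 * u m * u n.+1)); first by rewrite ler_pM2r.
have -> : u n.+1 * u m * u n.+1 = u n.+1 ^+ 2 * u m by ring.
have -> : u n.+2 * u m * u n = (u n * u n.+2) * u m by ring.
by rewrite ler_pM2r.
Qed.

(* Kaluza: compare the renewal equation at n+1 with the one at n rescaled by u_{n+1} / u_n. *)
Lemma renewal_ge0 n : 0 <= renewal n.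
Proof.
elim/ltn_ind: n => -[|[|n]] IH; first by [].
  by rewrite renewalS big_ord1 renewal0 mul0r subr0 ltW.
rewrite renewalS subr_ge0.
have E : u n.+1 = \sum_(k < n.+2) renewal k * u (n.+1 - k)%N.
  by have := conv_renewal n.+1; rewrite /unitseq/= subr0.
rewrite -(ler_pM2r (u_gt0 n.+1)) [X in _ <= _ * X]E !big_distrl/= big_distrr/=.
apply: ler_sum => i _; rewrite mulrCA -mulrA; apply: ler_wpM2l.
  by apply: IH.
have -> : (n.+2 - i = (n.+1 - i).+1)%N by have := ltn_ord i; lia.
by apply: u_ratio_le; lia.
Qed.

Lemma u_le m n : (m <= n)%N -> u n <= u m.
Proof.
elim: n => [|n IH]; first by rewrite leqn0 => /eqP ->.
rewrite leq_eqVlt => /predU1P[->//|]; rewrite ltnS => /IH.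
exact: le_trans.
Qed.

(** Since u is nonincreasing, u_n times the partial sum of r is at most (r * u)_n, which is u_n for
    n positive. *)
Lemma sum_renewal_le1 n : \sum_(k < n.+1) renewal k <= 1.
Proof.
case: n => [|n]; first by rewrite big_ord1 renewal0.
rewrite -(ler_pM2r (u_gt0 n.+1)) mul1r big_distrl/=.
have := conv_renewal n.+1; rewrite /unitseq/= subr0 => {2}<-.
apply: ler_sum => i _; apply: ler_wpM2l; first exact: renewal_ge0.
by apply: u_le; exact: leq_subr.
Qed.

(** Sum r * u = u - delta over the indices up to n, then extend each inner partial sum of u to full
    length. This is a lower bound on the mass of r, and makes the positivity of [renewal]
    quantitative. *)
Lemma sum_u_le n : \sum_(k < n.+1) u k - 1 <=
  (\sum_(k < n.+1) renewal k) * \sum_(k < n.+1) u k.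
Proof.
have -> : \sum_(k < n.+1) u k - 1 = \sum_(k < n.+1) (u k - unitseq k).
  by rewrite sumrB; congr (_ - _); rewrite big_ord_recl/= big1 ?addr0.
have -> : \sum_(k < n.+1) (u k - unitseq k) = conv (conv renewal u) (fun=> 1) n.
  by apply: eq_bigr => i _; rewrite mulr1 conv_renewal.
rewrite -convA /conv big_distrl/=; apply: ler_sum => i _.
apply: ler_wpM2l; first exact: renewal_ge0.
under eq_bigr do rewrite mulr1.
rewrite -!(big_mkord xpredT u).
rewrite [leRHS](@big_cat_nat _ _ _ (n - i).+1)//=; last by lia.
by rewrite lerDl sumr_ge0// => k _; exact: ltW.
Qed.

End kaluza.

(** * Fractional convolution weights *)

Lemma sum_rev_ord {V : nmodType} (F : nat -> V) n :
  \sum_(l < n) F (n - l)%N = \sum_(k < n) F k.+1.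
Proof.
rewrite (reindex_inj rev_ord_inj)/=; apply: eq_bigr => i _.
by congr F; have := ltn_ord i; lia.
Qed.

Section fractional_weights.
Context {R : realType} (al : R) (al_gt0 : 0 < al) (al_lt1 : al < 1).

(** The integral of s^(al - 1) over the k-th cell [(k - 1) h, k h]; thus [fweight h (n - l)] is the
    weight of the value at t_l in the scheme at time t_n. The predecessor makes the weight at lag 0
    vanish, which lets convolutions of full length and sums over l < n agree. *)
Definition fweight (h : R) (k : nat) : R :=
  ((k%:R * h) `^ al - (k.-1%:R * h) `^ al) / al.

Lemma fweight0 h : fweight h 0 = 0.
Proof. by rewrite /fweight subrr mul0r. Qed.

Lemma fweight_ge0 h k : 0 <= h -> 0 <= fweight h k.
Proof.
move=> h0; rewrite /fweight divr_ge0 ?(ltW al_gt0)// subr_ge0.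
apply: ge0_ler_powR; rewrite ?nnegrE ?mulr_ge0 ?(ltW al_gt0)//.
by rewrite ler_wpM2r// ler_nat leq_pred.
Qed.

Lemma fweightZ h k : 0 <= h -> fweight h k = h `^ al * fweight 1 k.
Proof. by move=> h0; rewrite /fweight !mulr1 !powRM//; ring. Qed.

Lemma fweight_gt0 h k : 0 < h -> 0 < fweight h k.+1.
Proof.
move=> h0; rewrite /fweight divr_gt0// subr_gt0.
apply: gt0_ltr_powR; rewrite ?nnegrE ?mulr_ge0 ?(ltW h0)//=.
by rewrite ltr_pM2r// ltr_nat.
Qed.

Lemma sum_fweight h n : \sum_(l < n) fweight h (n - l) = (n%:R * h) `^ al / al.
Proof.
rewrite sum_rev_ord; elim: n => [|n IH].
  by rewrite big_ord0 mul0r powR0 ?gt_eqF// mul0r.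
by rewrite big_ord_recr/= IH /fweight/=; ring.
Qed.

Lemma sum_fweight_small h n e : 0 < h -> 0 < e ->
  \sum_(k < n) (if k.+1%:R * h <= e then fweight h k.+1 else 0) <= e `^ al / al.
Proof.
move=> h0 e0.
(* The weights telescope as long as the lag is at most e; the minimum keeps the induction hypothesis
   exact up to that lag and constant beyond it. *)
suff : \sum_(k < n) (if k.+1%:R * h <= e then fweight h k.+1 else 0) <=
    (Num.min (n%:R * h) e) `^ al / al.
  move=> /le_trans; apply; rewrite ler_pM2r ?invr_gt0//.
  apply: ge0_ler_powR; rewrite ?nnegrE ?(ltW al_gt0) ?(ltW e0)//.
    by rewrite le_min (ltW e0) mulr_ge0// ltW.
  by rewrite ge_min lexx orbT.
elim: n => [|n IH].
  by rewrite big_ord0 divr_ge0 ?powR_ge0// ltW.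
rewrite big_ord_recr/=; case: ifPn => [ne|_].
  rewrite min_l//.
  have E : Num.min (n%:R * h) e = n%:R * h.
    rewrite min_l// (le_trans _ ne)// ler_wpM2r ?(ltW h0)// ler_nat//.
  rewrite E in IH; apply: le_trans (lerD IH (lexx _)) _.
  by rewrite le_eqVlt; apply/orP; left; apply/eqP; rewrite /fweight/=; ring.
rewrite addr0; apply: le_trans IH _; rewrite ler_pM2r ?invr_gt0//.
apply: ge0_ler_powR; rewrite ?nnegrE ?(ltW al_gt0)//.
- by rewrite le_min (ltW e0) mulr_ge0// ltW.
- by rewrite le_min (ltW e0) mulr_ge0// ltW.
- rewrite le_min !ge_min lexx !orbT andbT.
  by rewrite ler_wpM2r ?(ltW h0)// ler_nat leqnSn.
Qed.

Lemma fweight_noninc h k : 0 <= h -> fweight h k.+2 <= fweight h k.+1.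
Proof.
move=> h0; rewrite !(@fweightZ h)// ler_wpM2l ?powR_ge0// /fweight !mulr1/=.
rewrite ler_pM2r ?invr_gt0//.
pose F (s : R) := `|k%:R + s| `^ al - `|k.+1%:R + s| `^ al.
pose dF (s : R) := al * (k%:R + s) `^ (al - 1) - al * (k.+1%:R + s) `^ (al - 1).
have : F 0 <= F 1.
  apply: (@le_of_derive_ge0 _ F dF) => //.
  - move=> x /andP[x0 x1].
    by apply: is_deriveB; apply: is_derive_powRD; rewrite ltr_wpDl.
  - move=> x /andP[x0 x1]; rewrite /dF -mulrBr mulr_ge0 ?(ltW al_gt0)//.
    rewrite subr_ge0 -!(opprB 1 al) !powRN lef_pV2 ?posrE ?powR_gt0 ?ltr_wpDl//.
    apply: ge0_ler_powR; rewrite ?nnegrE ?subr_ge0 ?(ltW al_lt1) ?addr_ge0 ?(ltW x0)//.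
    by rewrite lerD2r ler_nat.
  - move=> x; apply: cvgB; exact: continuous_norm_powRD.
rewrite /F !addr0 -!natr1 !ger0_norm ?addr_ge0// => H.
lra.
Qed.

(** With A, B, C the weights at three consecutive lags, A x^2 + 2 B x + C is the integral over a
    unit cell of the same form in three values p, q, r of the kernel. It is nonnegative because q^2
    <= p r, the kernel s^(al - 1) being log-convex, and x = - B / A gives the claim. The integral is
    replaced by the growth of the primitive F from 0 to 1. *)
Lemma fweight_logconvex h k : 0 <= h ->
  fweight h k.+2 ^+ 2 <= fweight h k.+1 * fweight h k.+3.
Proof.
move=> h0; rewrite !(@fweightZ h)//.
set A := fweight 1 k.+1; set B := fweight 1 k.+2; set C := fweight 1 k.+3.
have -> : h `^ al * A * (h `^ al * C) = (h `^ al) ^+ 2 * (A * C) by ring.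
rewrite exprMn; apply: ler_wpM2l; first exact: sqr_ge0.
have A0 : 0 < A by apply: fweight_gt0.
suff H x : 0 <= A * x ^+ 2 + 2 * B * x + C.
  have := H (- B / A).
  have -> : A * (- B / A) ^+ 2 + 2 * B * (- B / A) + C = (A * C - B ^+ 2) / A.
    by field; rewrite gt_eqF.
  by rewrite pmulr_lge0 ?invr_gt0// subr_ge0.
pose F (s : R) := x ^+ 2 * `|k%:R + s| `^ al + (2 * x * `|k.+1%:R + s| `^ al
  + `|k.+2%:R + s| `^ al).
pose dF (s : R) := x ^+ 2 * (al * (k%:R + s) `^ (al - 1)) +
  (2 * x * (al * (k.+1%:R + s) `^ (al - 1)) + al * (k.+2%:R + s) `^ (al - 1)).
have : F 0 <= F 1.
  apply: (@le_of_derive_ge0 _ F dF) => //.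
  - move=> y /andP[y0 y1].
    apply: is_deriveD; last apply: is_deriveD.
    + by apply: (@is_deriveZ _ _ _ _ (x ^+ 2)); apply: is_derive_powRD; rewrite ltr_wpDl.
    + by apply: (@is_deriveZ _ _ _ _ (2 * x)); apply: is_derive_powRD; rewrite ltr_wpDl.
    + by apply: is_derive_powRD; rewrite ltr_wpDl.
  - move=> y /andP[y0 y1].
    set p := (k%:R + y) `^ (al - 1); set q := (k.+1%:R + y) `^ (al - 1).
    set r := (k.+2%:R + y) `^ (al - 1).
    have p0 : 0 < p by rewrite powR_gt0// ltr_wpDl.
    have q0 : 0 < q by rewrite powR_gt0// ltr_wpDl.
    have r0 : 0 < r by rewrite powR_gt0// ltr_wpDl.
    have pq : q ^+ 2 <= p * r.
      have a0 : 0 < k%:R + y by rewrite ltr_wpDl.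
      have b0 : 0 < k.+1%:R + y by rewrite ltr_wpDl.
      have c0 : 0 < k.+2%:R + y by rewrite ltr_wpDl.
      rewrite /p /q /r -(powRM _ (ltW a0) (ltW c0)) expr2 -(powRM _ (ltW b0) (ltW b0)).
      rewrite -(opprB 1 al) !powRN lef_pV2 ?posrE ?powR_gt0 ?mulr_gt0//.
      apply: ge0_ler_powR; rewrite ?nnegrE ?subr_ge0 ?(ltW al_lt1) ?mulr_ge0 ?ltW//.
      rewrite -!natr1; nra.
    have -> : dF y = al * (x ^+ 2 * p + 2 * x * q + r) by rewrite /dF -/p -/q -/r; ring.
    rewrite mulr_ge0 ?(ltW al_gt0)//.
    rewrite -(pmulr_rge0 _ p0).
    have -> : p * (x ^+ 2 * p + 2 * x * q + r) = (x * p + q) ^+ 2 + (p * r - q ^+ 2).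
      by ring.
    by rewrite addr_ge0 ?sqr_ge0// subr_ge0.
  - move=> y; apply: cvgD; last apply: cvgD; last exact: continuous_norm_powRD.
      apply: cvgM; [exact: cvg_cst|exact: continuous_norm_powRD].
    apply: cvgM; [exact: cvg_cst|exact: continuous_norm_powRD].
rewrite /F !addr0 !natr1 !ger0_norm// => H.
rewrite /A /B /C /fweight !mulr1/= -[X in 0 <= X](@mulfK _ al) ?gt_eqF//.
rewrite divr_ge0 ?(ltW al_gt0)//.
set X := (X in 0 <= X).
have -> : X = (x ^+ 2 * k.+1%:R `^ al + (2 * x * k.+2%:R `^ al + k.+3%:R `^ al))
  - (x ^+ 2 * k%:R `^ al + (2 * x * k.+1%:R `^ al + k.+2%:R `^ al)).
  by rewrite /X; field; rewrite gt_eqF.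
by rewrite subr_ge0.
Qed.

End fractional_weights.

(** * Gronwall inequality and positivity for fractional Volterra recursions *)

Section fractional_gronwall.
Context {R : realType} (al : R) (al_gt0 : 0 < al) (al_lt1 : al < 1).
Local Notation fweight := (fweight al).

(* The weight e^(lam t) makes the singular kernel a contraction for large lam. *)
Lemma fractional_gronwall (L T : R) : 0 <= L -> 0 < T ->
  exists2 C : R, 0 < C &
  forall (h : R) (K : nat) (b : R) (P : nat -> R -> Prop),
    0 < h -> K%:R * h <= T -> 0 <= b ->
    (forall n r r', r <= r' -> P n r -> P n r') ->
    (forall n, (n <= K)%N -> forall r : nat -> R, (forall l, 0 <= r l) ->
      (forall l, (l < n)%N -> P l (r l)) ->
      P n (b + L * \sum_(l < n) fweight h (n - l) * r l)) ->
    forall n, (n <= K)%N -> P n (C * b).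
Proof.
move=> L0 T0.
(* [e] makes the lags up to e contribute at most 1/4 to L times the weighted sum, and [lam] makes
   the exponential reduce all lags beyond e to another 1/4. *)
pose e := (al / (4 * (L + 1))) `^ al^-1.
have L1 : 0 < L + 1 by rewrite ltr_wpDl.
have q0 : 0 < al / (4 * (L + 1)) by rewrite divr_gt0// mulr_gt0.
have e0 : 0 < e by rewrite powR_gt0.
have eal : e `^ al = al / (4 * (L + 1)).
  by rewrite /e -powRrM mulVf ?gt_eqF// powRr1// ltW.
pose A := T `^ al / al.
have A0 : 0 < A by rewrite divr_gt0// powR_gt0.
pose lam := 4 * (L + 1) * A / e.
have lam0 : 0 < lam by rewrite divr_gt0// mulr_gt0// mulr_gt0.
pose q := expR (- (lam * e)).
have B0 : 0 < 4 * (L + 1) * A by rewrite mulr_gt0// mulr_gt0.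
have qle : q <= (4 * (L + 1) * A)^-1.
  rewrite /q expRN lef_pV2 ?posrE ?expR_gt0//.
  have <- : lam * e = 4 * (L + 1) * A by rewrite /lam divfK// gt_eqF.
  by apply: le_trans (expR_ge1Dx _); rewrite lerDr.
exists (2 * expR (lam * T)); first by rewrite mulr_gt0 ?expR_gt0.
move=> h K b P h0 KhT b0 Pmono Pstep.
pose r (n : nat) := 2 * b * expR (lam * (n%:R * h)).
have r0 n : 0 <= r n by rewrite /r !mulr_ge0 ?expR_ge0.
have main n : (n <= K)%N -> L * \sum_(l < n) fweight h (n - l) * r l <= r n / 2.
  move=> nK.
  have -> : \sum_(l < n) fweight h (n - l) * r l =
      r n * \sum_(k < n) fweight h k.+1 * expR (- (lam * (k.+1%:R * h))).
    rewrite -(sum_rev_ord (fun k => fweight h k * expR (- (lam * (k%:R * h))))).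
    rewrite big_distrr/=; apply: eq_bigr => l _.
    have ln : (l <= n)%N by apply: ltnW.
    have -> : r l = r n * expR (- (lam * ((n - l)%:R * h))).
      by rewrite /r -[RHS]mulrA -expRD natrB//; congr (_ * expR _); ring.
    by rewrite mulrCA.
  set S := \sum_(k < n) _.
  suff : S <= e `^ al / al + q * A.
    move=> SB; have : L * S <= 1 / 2.
      apply: (@le_trans _ _ ((L + 1) * (e `^ al / al + q * A))).
        apply: ler_pM => //; last by rewrite lerDl.
        apply: sumr_ge0 => k _; rewrite mulr_ge0 ?expR_ge0//.
        by apply: fweight_ge0 => //; exact: ltW.
      rewrite mulrDr eal.
      have -> : (L + 1) * (al / (4 * (L + 1)) / al) = 1 / 4.
        by field; rewrite !gt_eqF.
      have : (L + 1) * (q * A) <= 1 / 4.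
        have := ler_wpM2r (ltW (mulr_gt0 L1 A0)) qle.
        have -> : (4 * (L + 1) * A)^-1 * ((L + 1) * A) = 1 / 4.
          by field; rewrite !gt_eqF.
        by move=> H; lra.
      lra.
    by move=> H; have := ler_wpM2l (r0 n) H; lra.
  apply: (@le_trans _ _ (\sum_(k < n)
    ((if k.+1%:R * h <= e then fweight h k.+1 else 0) + q * fweight h k.+1))).
    apply: ler_sum => k _.
    have w0 : 0 <= fweight h k.+1 by apply: fweight_ge0 => //; exact: ltW.
    case: ifPn => [_|]; last rewrite -ltNge => ke.
      apply: (@le_trans _ _ (fweight h k.+1)); last first.
        by rewrite lerDl mulr_ge0 ?expR_ge0.
      rewrite ler_piMr// -expR0 ler_expR oppr_le0 mulr_ge0 ?(ltW lam0)//.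
      by rewrite mulr_ge0// ltW.
    rewrite add0r mulrC ler_wpM2r// /q ler_expR lerN2 ler_wpM2l ?(ltW lam0)//.
    exact: ltW.
  rewrite big_split/= lerD//; first exact: sum_fweight_small.
  rewrite -big_distrr/= ler_wpM2l ?expR_ge0// -(sum_rev_ord (fweight h)).
  rewrite sum_fweight// /A ler_pM2r ?invr_gt0//.
  apply: ge0_ler_powR; rewrite ?nnegrE ?(ltW al_gt0) ?(ltW T0) ?mulr_ge0 ?(ltW h0)//.
  by apply: le_trans KhT; rewrite ler_wpM2r ?(ltW h0)// ler_nat.
(* [r] is a supersolution of the recursion: b + L (w * r) <= r. The conclusion is carried by a
   relation [P], only required to be upward closed in its bound, so that one lemma serves pointwise
   bounds and weighted L^1 bounds alike. *)
have claim n : (n <= K)%N -> P n (r n).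
  elim/ltn_ind: n => n IH nK.
  apply: (Pmono _ (b + L * \sum_(l < n) fweight h (n - l) * r l)); last first.
    apply: Pstep => // l ln; apply: IH => //.
    exact: leq_trans (ltnW ln) nK.
  apply: (le_trans (lerD (lexx b) (main n nK))).
  have : b <= r n / 2.
    have -> : r n / 2 = b * expR (lam * (n%:R * h)) by rewrite /r; field.
    rewrite ler_peMr// -expR0 ler_expR mulr_ge0 ?(ltW lam0) ?mulr_ge0 ?(ltW h0)//.
  lra.
move=> n nK; apply: Pmono (claim n nK).
rewrite /r mulrAC ler_wpM2r// ler_wpM2l// ler_expR ler_wpM2l ?(ltW lam0)//.
by apply: le_trans KhT; rewrite ler_wpM2r ?(ltW h0)// ler_nat.
Qed.

(* Positivity of the linearised scheme whatever the sign of the coefficients a: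
   writing a = (a + L) - L and inverting delta + L fweight by Kaluza's lemma leaves
   only nonnegative terms. *)
Lemma linear_fractional_lower_bound (L T pm : R) : 0 < L -> 0 < T -> 0 < pm ->
  exists c h0 e0 : R, [/\ 0 < c, 0 < h0, 0 < e0 &
  forall (h : R) (K : nat) (D rho a p e : nat -> R),
    0 < h -> h <= h0 -> K%:R * h <= T ->
    (forall n, (n <= K)%N ->
       D n = rho n + \sum_(l < n) fweight h (n - l) * (a l * D l)) ->
    (forall n, `|a n| <= L) ->
    (forall n, (n <= K)%N -> rho n = \sum_(l < n) fweight h (n - l) * p l + e n) ->
    (forall n, (n <= K)%N -> pm <= p n) ->
    (forall n, (n <= K)%N -> `|e n| <= e0 * (n%:R * h) `^ al) ->
    forall n, (n <= K)%N -> c * (n%:R * h) `^ al <= D n].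
Proof.
move=> L0 T0 pm0.
have T1 : 0 < 2 `^ al - 1 :> R.
  rewrite subr_gt0 -[X in X < _]/((fun=> 1) al) -powR1.
  by apply: gt0_ltr_powR; rewrite ?nnegrE// ltr1n.
pose B := 1 + L * (T `^ al / al).
have B0 : 0 < B by rewrite ltr_wpDr// mulr_ge0 ?(ltW L0)// divr_ge0 ?powR_ge0// ltW.
(* The condition h^al <= q is L w_1 <= 2^al - 1. For the sequence u = delta + L w below it means
   u_1^2 <= u_0 u_2, the only instance of log-convexity that restricts h, and it also gives u_1 <=
   u_0. *)
pose q := al * (2 `^ al - 1) / L.
have q0 : 0 < q by rewrite divr_gt0// mulr_gt0.
exists (pm / (2 * B * al)), (q `^ al^-1), (pm / (4 * B) / al).
split; rewrite ?powR_gt0 ?divr_gt0 ?mulr_gt0//.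
move=> h K D rho a p e h0 hq KhT Drec aL rhoE pge ele.
have h0' := ltW h0.
have hal : h `^ al <= q.
  have -> : q = (q `^ al^-1) `^ al by rewrite -powRrM mulVf ?gt_eqF// powRr1// ltW.
  by apply: ge0_ler_powR; rewrite ?nnegrE ?powR_ge0// ltW.
have w1 : L * fweight h 1 <= 2 `^ al - 1.
  rewrite /fweight /= mul0r powR0 ?gt_eqF// subr0 mul1r.
  have -> : 2 `^ al - 1 = L * (q / al) by rewrite /q; field; rewrite !gt_eqF.
  by rewrite ler_wpM2l ?(ltW L0)// ler_pM2r ?invr_gt0.
have two1 : 2 `^ al - 1 <= 1 :> R.
  have := @ler_powR R 2 (ler1n _ _) al 1 (ltW al_lt1).
  by rewrite powRr1//; lra.
pose u (k : nat) := if k is 0%N then 1 else L * fweight h k.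
have u_gt0 k : 0 < u k by case: k => //= k; rewrite mulr_gt0 ?fweight_gt0.
have u_noninc k : u k.+1 <= u k.
  case: k => [|k] /=; first exact: le_trans w1 two1.
  by rewrite ler_wpM2l ?(ltW L0)// fweight_noninc.
have u_logconvex k : u k.+1 ^+ 2 <= u k * u k.+2.
  case: k => [|k] /=; last first.
    have -> : L * fweight h k.+1 * (L * fweight h k.+3) =
      L ^+ 2 * (fweight h k.+1 * fweight h k.+3) by ring.
    by rewrite exprMn ler_wpM2l ?sqr_ge0// fweight_logconvex.
  rewrite mul1r expr2.
  have -> : L * fweight h 2 = (2 `^ al - 1) * (L * fweight h 1).
    rewrite /fweight/= mul0r mul1r powR0 ?gt_eqF// powRM//; field.
    by rewrite gt_eqF.
  by rewrite ler_wpM2r// (ltW (u_gt0 1%N)).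
pose r := renewal u.
have r0 : r 0%N = 0 by exact: renewal0.
have r_ge0 k : 0 <= r k by apply: renewal_ge0.
have Sr n : \sum_(k < n.+1) r k <= 1 by apply: sum_renewal_le1.
pose w := fweight h.
have uE k : u k = unitseq k + L * w k.
  by case: k => [|k] /=; rewrite /unitseq/= /w ?fweight0 ?mulr0 ?addr0 ?add0r.
have ruE n : conv r u n = L * w n.
  by rewrite conv_renewal// uE addrAC subrr add0r.
pose S := conv u D.
have DE n : D n = S n - conv r S n.
  rewrite convA (@eq_conv _ _ (fun k => L * w k) D D n)//.
  rewrite /S (@eq_conv _ u (fun k => unitseq k + L * w k) D D n)//.
  by rewrite convDl conv1 addrK.
pose qq l := p l + (a l + L) * D l.
have SE n : (n <= K)%N -> S n = conv w qq n + e n.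
  move=> nK.
  rewrite /S (@eq_conv _ u (fun k => unitseq k + L * w k) D D n)//.
  rewrite convDl conv1 convZl Drec// rhoE// /qq convDr.
  rewrite -(@conv_low _ w p)//; last exact: fweight0.
  rewrite -(@conv_low _ w (fun l => a l * D l))//; last exact: fweight0.
  rewrite (@eq_conv _ w w (fun k => (a k + L) * D k) (fun k => a k * D k + L * D k) n)//.
    rewrite convDr [conv w (fun k => L * D k) n]convC convZl [conv D w n]convC.
    ring.
  by move=> k _; rewrite mulrDl.
(* Convolution with delta - r inverts u, and r * u = L w gives w - r * w = r / L. Applied to u * D =
   w * qq + e this leaves r * qq / L + e - r * e, where r is nonnegative. *)
have De n : (n <= K)%N ->
  D n = L^-1 * conv r qq n + e n - conv r e n.
  move=> nK; rewrite DE SE//.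
  rewrite (@eq_conv _ r r S (fun k => conv w qq k + e k) n)//; last first.
    by move=> k kn; rewrite SE// (leq_trans kn nK).
  rewrite convDr convA.
  have -> : conv w qq n = L^-1 * conv r qq n + conv (conv r w) qq n.
    rewrite -convZl -convDl; apply: eq_conv => // k _.
    apply: (mulfI (lt0r_neq0 L0)); rewrite -ruE.
    rewrite (@eq_conv _ r r u (fun k => unitseq k + L * w k) k)//.
    rewrite convDr [conv r unitseq k]convC conv1.
    rewrite [conv r (fun k => L * w k) k]convC convZl [conv w r k]convC.
    by field; rewrite gt_eqF.
  ring.
pose W n := (n%:R * h) `^ al / al.
have sW n : \sum_(k < n.+1) w k = W n.
  by rewrite big_ord_recl /w fweight0 add0r/= -(sum_rev_ord w) sum_fweight.
have W0 n : 0 <= W n by rewrite divr_ge0 ?powR_ge0// ltW.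
have Wmono m n : (m <= n)%N -> W m <= W n.
  move=> mn; rewrite ler_pM2r ?invr_gt0//.
  apply: ge0_ler_powR; rewrite ?nnegrE ?(ltW al_gt0) ?mulr_ge0//.
  by rewrite ler_wpM2r// ler_nat.
have WB n : (n <= K)%N -> 1 + L * W n <= B.
  move=> nK; rewrite lerD2l ler_wpM2l ?(ltW L0)// ler_pM2r ?invr_gt0//.
  apply: ge0_ler_powR; rewrite ?nnegrE ?(ltW al_gt0) ?mulr_ge0 ?(ltW T0)//.
  by apply: le_trans KhT; rewrite ler_wpM2r// ler_nat.
have su n : \sum_(k < n.+1) u k = 1 + L * W n.
  under eq_bigr do rewrite uE.
  rewrite big_split/= -big_distrr/= sW; congr (_ + _).
  by rewrite big_ord_recl/= big1 ?addr0.
have Rlow n : (n <= K)%N -> L * W n / B <= \sum_(k < n.+1) r k.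
  move=> nK; rewrite ler_pdivrMr//.
  have := @sum_u_le _ u erefl u_gt0 u_logconvex n.
  rewrite su addrAC subrr add0r => /le_trans; apply.
  by apply: ler_wpM2l; [exact: sumr_ge0|exact: WB].
have eW n : (n <= K)%N -> `|e n| <= pm / (4 * B) * W n.
  by move=> /ele; rewrite /W mulrA mulrAC.
elim/ltn_ind => n IH nK.
have D_ge0 l : (l < n)%N -> 0 <= D l.
  move=> ln; apply: le_trans (IH l ln (leq_trans (ltnW ln) nK)).
  by rewrite mulr_ge0 ?powR_ge0// divr_ge0 ?mulr_ge0 ?ltW.
have H1 : pm * (L * W n / B) <= conv r qq n.
  apply: (@le_trans _ _ (\sum_(k < n.+1) r k * pm)).
    by rewrite -big_distrl/= mulrC ler_pM2r//; exact: Rlow.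
  (* As r_0 = 0, only the values of [qq] at indices below n occur; there D is nonnegative by
     induction, so that [qq] is at least p. *)
  apply: ler_sum => -[[|k] kn] _; first by rewrite [nat_of_ord _]/= r0 !mul0r.
  rewrite [nat_of_ord _]/=.
  apply: ler_wpM2l => //; rewrite /qq; apply: (@le_trans _ _ (p (n - k.+1)%N)).
    by apply: pge; exact: leq_trans (leq_subr _ _) nK.
  rewrite lerDl mulr_ge0//; last first.
    apply: D_ge0; rewrite ltn_subrL/=; exact: leq_ltn_trans (leq0n k) kn.
  by have := aL (n - k.+1)%N; rewrite ler_norml => /andP[+ _]; lra.
have H2 : conv r e n <= pm / (4 * B) * W n.
  apply: (@le_trans _ _ (\sum_(k < n.+1) r k * (pm / (4 * B) * W n))).
    apply: ler_sum => k _; rewrite ler_wpM2l//.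
    apply: le_trans (ler_norm _) _; apply: (le_trans (eW _ _)).
      exact: leq_trans (leq_subr _ _) nK.
    rewrite ler_wpM2l//; last by apply: Wmono; exact: leq_subr.
    by rewrite divr_ge0 ?mulr_ge0 ?ltW.
  rewrite -big_distrl/=; apply: ler_piMl; last exact: Sr.
  by apply: mulr_ge0 => //; rewrite divr_ge0 ?mulr_ge0 ?ltW.
have H3 : - (pm / (4 * B) * W n) <= e n.
  by have := eW n nK; rewrite ler_norml => /andP[].
(* The main term is at least pm W / B; the terms e and r * e cost a quarter of it each, which leaves
   half. *)
rewrite De//.
have -> : pm / (2 * B * al) * (n%:R * h) `^ al = L^-1 * (pm * (L * W n / B))
    - pm / (4 * B) * W n - pm / (4 * B) * W n.
  by rewrite /W; field; rewrite !gt_eqF.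
have : L^-1 * (pm * (L * W n / B)) <= L^-1 * conv r qq n.
  by rewrite ler_wpM2l// invr_ge0 ltW.
lra.
Qed.

End fractional_gronwall.

(** * Gaussian integrals on the line *)

Section normal_integrals.
Context {R : realType} (m s : R) (s_neq0 : s != 0).
Local Notation mu := (@lebesgue_measure R).
Local Notation phi := (normal_pdf m s).
Local Notation N := (normal_prob m s).

Lemma ge0_integral_normal_prob (f : R -> \bar R) :
  measurable_fun setT f -> (forall x, 0 <= f x)%E ->
  (\int[N]_x f x = \int[mu]_x (f x * (phi x)%:E))%E.
Proof.
move=> mf f0.
have numu := @normal_prob_dominates R m s.
rewrite -(Radon_Nikodym_SigmaFinite.change_of_variables numu)//.
apply: ae_eq_integral => //.
- apply: emeasurable_funM => //; apply: (measurable_int mu).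
  exact: Radon_Nikodym_SigmaFinite.f_integrable.
- apply: emeasurable_funM => //; apply/measurable_EFinP.
  exact: measurable_normal_pdf.
- apply: ae_eqe_mul2l.
  apply: integral_ae_eq => //=.
  + exact: Radon_Nikodym_SigmaFinite.f_integrable.
  + by apply/measurable_EFinP; exact: measurable_normal_pdf.
  + by move=> E _ mE; rewrite -Radon_Nikodym_SigmaFinite.f_integral.
Qed.

Lemma normal_pdf_expE x : phi x = normal_peak s * expR (- (x - m) ^+ 2 / (s ^+ 2 *+ 2)).
Proof. by rewrite normal_pdfE. Qed.

Lemma is_derive_normal_pdf (x : R) : is_derive x 1 phi (- ((x - m) / s ^+ 2) * phi x).
Proof.
have -> : phi = (fun x : R => normal_peak s * expR (- (x - m) ^+ 2 / (s ^+ 2 *+ 2))).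
  by apply/funext => y; rewrite normal_pdf_expE.
have H1 : is_derive x 1 (fun x : R => - (x - m) ^+ 2 / (s ^+ 2 *+ 2)) (- ((x - m) / s ^+ 2)).
  apply: is_derive_eq.
  rewrite /GRing.scale/=; field.
  by rewrite s_neq0.
have H2 := is_derive1_comp (is_derive_expR _) H1.
have H3 := @is_deriveZ _ _ _ _ (normal_peak s) x 1 _ H2.
apply: (is_derive_eq H3); rewrite /GRing.scale/=; ring.
Qed.

(** Doubling the standard deviation frees a factor exp (- y) with y = (3/8) (x - m)^2 / s^2, and exp
    y >= 1 + y absorbs the quadratic growth. *)
Lemma normal_pdf_decay : exists2 C : R, 0 < C &
  forall x : R, (1 + (x - m) ^+ 2) * phi x <= C * normal_pdf m (2 * s) x.
Proof.
have s2 : 0 < s ^+ 2 by rewrite exprn_even_gt0.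
have p0 : 0 < normal_peak s by exact: normal_peak_gt0.
have s20 : 2 * s != 0 by rewrite mulf_neq0.
have p20 : 0 < normal_peak (2 * s) by exact: normal_peak_gt0.
exists ((1 + 8 / 3 * s ^+ 2) * normal_peak s / normal_peak (2 * s)).
  by rewrite divr_gt0// mulr_gt0// ltr_pwDl// mulr_ge0// ltW.
move=> x; rewrite normal_pdf_expE normal_pdfE// /normal_fun.
rewrite [leRHS]mulrA divfK ?gt_eqF// mulrCA.
rewrite [X in _ <= X * _]mulrC -[leRHS]mulrA ler_pM2l//.
set z := x - m.
pose y := 3 / 8 * z ^+ 2 / s ^+ 2.
have y0 : 0 <= y by rewrite divr_ge0 ?(ltW s2)// mulr_ge0// sqr_ge0.
have -> : - z ^+ 2 / (s ^+ 2 *+ 2) = - y + - z ^+ 2 / ((2 * s) ^+ 2 *+ 2).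
  by rewrite /y; field.
rewrite expRD mulrA ler_wpM2r ?expR_ge0//.
rewrite expRN ler_pdivrMr ?expR_gt0//.
have -> : z ^+ 2 = 8 / 3 * s ^+ 2 * y by rewrite /y; field.
have := expR_ge1Dx y.
have : 0 <= s ^+ 2 * y by rewrite mulr_ge0// ltW.
nra.
Qed.

Lemma integrable_sqr_normal_pdf :
  mu.-integrable setT (EFin \o (fun x : R => (1 + (x - m) ^+ 2) * phi x)).
Proof.
have [C C0 HC] := normal_pdf_decay.
have H := @integrableZl _ _ _ mu setT measurableT C _ (@integrable_normal_pdf R m (2 * s)).
apply: le_integrable H => //.
  apply/measurable_EFinP; apply: measurable_funM; last exact: measurable_normal_pdf.
  apply: measurable_funD => //; apply: measurable_funX.
  exact: measurable_funB.
move=> x _ /=; rewrite lee_fin !ger0_norm//.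
- by rewrite mulr_ge0 ?normal_pdf_ge0// ltW.
- by rewrite mulr_ge0 ?normal_pdf_ge0// addr_ge0// sqr_ge0.
Qed.

Lemma normal_pdf_bound : exists2 C : R, 0 < C &
  forall x : R, (1 + `|x - m|) * phi x <= C / (1 + `|x - m|).
Proof.
have [C C0 HC] := normal_pdf_decay.
have p0 : 0 < normal_peak (2 * s) by rewrite normal_peak_gt0// mulf_neq0.
exists (2 * (C * normal_peak (2 * s))); first by rewrite !mulr_gt0.
move=> x; rewrite ler_pdivlMr; last by rewrite ltr_pwDl.
apply: (@le_trans _ _ (2 * ((1 + (x - m) ^+ 2) * phi x))).
  have := normal_pdf_ge0 m s x; set p := phi x => p_ge0.
  have := normr_ge0 (x - m); rewrite -(real_normK (num_real (x - m))); set y := `|x - m| => y0.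
  have : (1 + y) * (1 + y) <= 2 * (1 + y ^+ 2).
    by have := sqr_ge0 (1 - y); rewrite sqrrB !expr2; lra.
  move=> /(ler_wpM2r p_ge0); lra.
rewrite ler_pM2l// (le_trans (HC _))// ler_pM2l//.
by rewrite normal_pdf_ub// mulf_neq0.
Qed.

(* The boundary terms vanish and the integrals over [-n, n] converge. *)
Lemma integral_derive_decay (F dF : R -> R) (C : R) :
  (forall x : R, is_derive x 1 F (dF x)) -> continuous dF ->
  mu.-integrable setT (EFin \o dF) ->
  (forall x : R, `|F x| <= C / (1 + `|x|)) ->
  (\int[mu]_x (dF x)%:E = 0)%E.
Proof.
move=> FdF cdF idF FC.
have mdF : measurable_fun setT dF by exact: continuous_measurable_fun.
pose f (n : nat) x := ((dF x)%:E * (\1_(`[- n%:R, n%:R] : set R) x)%:E)%E.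
have cf : (\int[mu]_x f n x)%E @[n --> \oo] --> (\int[mu]_x (dF x)%:E)%E.
  have [] := @dominated_convergence _ _ _ mu setT measurableT f (EFin \o dF)
     (abse \o (EFin \o dF)) _ _ _ _ _ => //.
  - move=> n; apply: emeasurable_funM; first exact/measurable_EFinP.
    by apply/measurable_EFinP; exact: measurable_indic.
  - exact/measurable_EFinP.
  - apply: aeW => x _.
    apply: cvg_near_cst; near=> n.
    rewrite /f indicE mem_set ?mule1//=.
    rewrite in_itv/= -ler_norml; near: n; exact: nbhs_infty_ger.
  - exact: integrable_abse.
  - apply: aeW => x n _; rewrite /f indicE.
    by case: (x \in _) => /=; rewrite lee_fin ?mulr1// mulr0 normr0.
have E n : (\int[mu]_x f n.+1 x = (F n.+1%:R - F (- n.+1%:R))%:E)%E.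
  rewrite EFinB -(@continuous_FTC2 _ dF F (- n.+1%:R) n.+1%:R).
  - rewrite [RHS]integral_mkcond; apply: eq_integral => x _.
    rewrite /f patchE indicE; case: ifPn => /= _.
      by rewrite mule1.
    by rewrite mule0.
  - by have := ltr0Sn R n; lra.
  - exact: continuous_subspaceT.
  - have cF x : {for x, continuous F}.
      by apply: differentiable_continuous; apply/derivable1_diffP; exact: ex_derive.
    split; first by move=> x _; exact: ex_derive.
      by apply: cvg_at_right_filter; exact: cF.
    by apply: cvg_at_left_filter; exact: cF.
  - by move=> x _; rewrite derive1E derive_val.
have c0 : (\int[mu]_x f n x)%E @[n --> \oo] --> 0%E.
  rewrite -cvg_shiftS.
  under eq_fun do rewrite E.
  apply: cvg_EFin; first exact: nearW.
  have H : (2 * C) * (1 + n.+1%:R)^-1 @[n --> \oo] --> (2 * C) * (0 : R).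
    apply: cvgM; first exact: cvg_cst.
    have -> : (fun n : nat => (1 + n.+1%:R)^-1 : R) = [sequence harmonic n.+1]_n.
      by apply/funext => n /=; rewrite nat1r.
    by rewrite cvg_shiftS; exact: cvg_harmonic.
  rewrite mulr0 in H.
  have HN : - ((2 * C) * (1 + n.+1%:R)^-1) @[n --> \oo] --> (0 : R).
    by rewrite -oppr0; exact: cvgN.
  apply: (squeeze_cvgr _ HN H).
  near=> n; rewrite -ler_norml /=.
  have H1 := FC n.+1%:R; have H2 := FC (- n.+1%:R).
  rewrite normrN in H2; rewrite (ger0_norm (ler0n _ _)) in H1 H2.
  apply: le_trans (ler_normB _ _) _; lra.
exact: (cvg_unique _ cf c0).
Unshelve. all: by end_near. Qed.

End normal_integrals.

Section normal_moments.
Context {R : realType} (m s : R) (s_neq0 : s != 0).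
Local Notation mu := (@lebesgue_measure R).
Local Notation phi := (normal_pdf m s).

Lemma integrable_normal_growth (h : R -> R) (C : R) : measurable_fun setT h ->
  (forall x, `|h x| <= C * (1 + (x - m) ^+ 2)) ->
  mu.-integrable setT (EFin \o (fun x => h x * phi x)).
Proof.
move=> mh hC.
have H := @integrableZl _ _ _ mu setT measurableT C _ (integrable_sqr_normal_pdf m s_neq0).
apply: le_integrable H => //.
  by apply/measurable_EFinP; apply: measurable_funM => //; exact: measurable_normal_pdf.
move=> x _ /=; rewrite lee_fin normrM [leRHS]ger0_norm; last first.
  apply: mulr_ge0; last by rewrite mulr_ge0 ?normal_pdf_ge0// addr_ge0// sqr_ge0.
  have := le_trans (normr_ge0 _) (hC x).
  by rewrite pmulr_lge0// ltr_pwDl// sqr_ge0.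
by rewrite (ger0_norm (normal_pdf_ge0 _ _ _)) mulrA ler_wpM2r ?normal_pdf_ge0.
Qed.

(** Stein's identity: the derivative of g phi has zero integral, and phi' = - (x - m) / s^2 phi. *)
Lemma normal_stein (g dg : R -> R) (C : R) :
  (forall x : R, is_derive x 1 g (dg x)) -> continuous dg ->
  (forall x : R, `|g x| <= C * (1 + `|x - m|)) ->
  (forall x : R, `|dg x| <= C * (1 + (x - m) ^+ 2)) ->
  \int[mu]_x ((x - m) * g x * phi x) = s ^+ 2 * \int[mu]_x (dg x * phi x).
Proof.
move=> gdg cdg gC dgC.
have cg : continuous g by apply: is_derive_continuous gdg.
have mg : measurable_fun setT g by exact: continuous_measurable_fun.
have mdg : measurable_fun setT dg by exact: continuous_measurable_fun.
have C0 : 0 <= C.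
  have := le_trans (normr_ge0 _) (gC m).
  by rewrite subrr normr0 addr0 mulr1.
have mxm : measurable_fun setT (fun x : R => x - m) by exact: measurable_funB.
have cphi : continuous phi by exact: continuous_normal_pdf.
have [Cb Cb0 HCb] := normal_pdf_bound m s_neq0.
have i1 : mu.-integrable setT (EFin \o (fun x => dg x * phi x)).
  exact: (integrable_normal_growth mdg dgC).
have i2 : mu.-integrable setT (EFin \o (fun x => (x - m) * g x * phi x)).
  apply: (@integrable_normal_growth _ (2 * C)); first exact: measurable_funM.
  move=> x; rewrite normrM.
  apply: (@le_trans _ _ (`|x - m| * (C * (1 + `|x - m|)))); first exact: ler_wpM2l.
  rewrite -(real_normK (num_real (x - m))).
  have := normr_ge0 (x - m); set y := `|x - m| => y0.
  have : y * (1 + y) <= 2 * (1 + y ^+ 2).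
    by have := sqr_ge0 (1 - y); rewrite sqrrB !expr2; nra.
  move=> /(ler_wpM2l C0); lra.
have H := @integral_derive_decay R (fun x => g x * phi x)
   (fun x => dg x * phi x + g x * (- ((x - m) / s ^+ 2) * phi x)) (C * Cb * (1 + `|m|)).
have E x : dg x * phi x + g x * (- ((x - m) / s ^+ 2) * phi x) =
  dg x * phi x - (s ^+ 2)^-1 * ((x - m) * g x * phi x) by ring.
have i3 : mu.-integrable setT (EFin \o (fun x => (s ^+ 2)^-1 * ((x - m) * g x * phi x))).
  exact: (@integrableZl _ _ _ mu setT measurableT (s ^+ 2)^-1 _ i2).
have {}H : (\int[mu]_x (dg x * phi x - (s ^+ 2)^-1 * ((x - m) * g x * phi x))%:E = 0)%E.
  rewrite -(H _ _ _ _).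
  - by apply: eq_integral => x _; rewrite E.
  - by move=> x; apply: is_derive_funM => //; exact: is_derive_normal_pdf.
  - move=> x; apply: cvgD; apply: cvgM; [exact: cdg|exact: cphi|exact: cg|].
    apply: cvgM; last exact: cphi.
    apply: cvgN; apply: cvgM; last exact: cvg_cst.
    by apply: cvgB; [exact: cvg_id|exact: cvg_cst].
  - apply: (@eq_integrable _ _ _ mu setT measurableT
      (fun x => (dg x * phi x)%:E - ((s ^+ 2)^-1 * ((x - m) * g x * phi x))%:E)%E).
      by move=> x _; rewrite /= E.
    exact: integrableB.
  - move=> x; rewrite normrM (ger0_norm (normal_pdf_ge0 _ _ _)).
    apply: (@le_trans _ _ (C * ((1 + `|x - m|) * phi x))).
      by rewrite mulrA ler_wpM2r// normal_pdf_ge0.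
    rewrite -!mulrA; apply: ler_wpM2l => //; apply: le_trans (HCb x) _.
    apply: ler_wpM2l; first exact: ltW.
    rewrite ler_pdivlMr ?ltr_pwDl// mulrC ler_pdivrMr ?ltr_pwDl//.
    have := ler_normD (x - m) m; rewrite subrK.
    have := mulr_ge0 (normr_ge0 m) (normr_ge0 (x - m)); lra.
have : \int[mu]_x (dg x * phi x - (s ^+ 2)^-1 * ((x - m) * g x * phi x)) = 0.
  by rewrite /Rintegral H.
rewrite RintegralB// RintegralZl// => /eqP; rewrite subr_eq0 => /eqP ->.
by rewrite mulrA divff ?mul1r// expf_eq0.
Qed.

Lemma Rintegral_normal_pdf : \int[mu]_x phi x = 1.
Proof. by rewrite /Rintegral integral_normal_pdf. Qed.

Lemma normal_mean : \int[mu]_x (x * phi x) = m.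
Proof.
have H := @normal_stein (fun=> 1) (fun=> 0) 1 (fun x => @is_derive_cst R R R 1 x 1).
have {}H : \int[mu]_x ((x - m) * phi x) = 0.
  transitivity (\int[mu]_x ((x - m) * 1 * phi x)).
    by apply: eq_Rintegral => x _; rewrite mulr1.
  rewrite H.
  - have -> : (fun x : R => 0 * phi x) = (fun=> 0) by apply/funext => x; rewrite mul0r.
    by rewrite /Rintegral integral0 mulr0.
  - by move=> x; exact: cvg_cst.
  - by move=> x; rewrite normr1 mul1r lerDl.
  - by move=> x; rewrite normr0 mul1r addr_ge0// sqr_ge0.
have i1 : mu.-integrable setT (EFin \o (fun x => (x - m) * phi x)).
  apply: (@integrable_normal_growth _ 1); first exact: measurable_funB.
  move=> x; rewrite mul1r -(real_normK (num_real (x - m))).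
  by have := sqr_ge0 (1 - `|x - m|); rewrite sqrrB !expr2; have := normr_ge0 (x - m); nra.
have i2 : mu.-integrable setT (EFin \o (fun x => m * phi x)).
  exact: (@integrableZl _ _ _ mu setT measurableT m _ (integrable_normal_pdf m s)).
transitivity (\int[mu]_x ((x - m) * phi x + m * phi x)).
  by apply: eq_Rintegral => x _; rewrite mulrBl subrK.
rewrite RintegralD// H add0r RintegralZl ?Rintegral_normal_pdf ?mulr1//.
exact: integrable_normal_pdf.
Qed.

Lemma normal_variance : \int[mu]_x ((x - m) ^+ 2 * phi x) = s ^+ 2.
Proof.
have d (x : R) : is_derive x 1 (fun y : R => y - m) 1.
  have := is_derive_affine 1 (- m) x.
  by under [X in is_derive _ _ X _]eq_fun do rewrite mul1r.
have H := @normal_stein (fun x => x - m) (fun=> 1) 1 d.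
transitivity (\int[mu]_x ((x - m) * (x - m) * phi x)).
  by apply: eq_Rintegral => x _; rewrite expr2.
rewrite H.
- under eq_Rintegral do rewrite mul1r.
  by rewrite Rintegral_normal_pdf mulr1.
- by move=> x; exact: cvg_cst.
- by move=> x; rewrite mul1r lerDr.
- by move=> x; rewrite normr1 mul1r lerDl sqr_ge0.
Qed.

(** As a function c of the frequency l, the integral satisfies c' = - s^2 l c, by differentiation
    under the integral sign followed by Stein's identity. Hence c times exp (s^2 l^2 / 2) is
    constant. Cosines with an arbitrary phase stand for the complex characteristic function. *)
Lemma normal_cos_transform (a b : R) :
  \int[mu]_x (cos (a * (x - m) + b) * phi x) = expR (- (s ^+ 2 / 2 * a ^+ 2)) * cos b.
Proof.
have mxm : measurable_fun setT (fun x : R => x - m) by exact: measurable_funB.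
have mcos : measurable_fun setT (@cos R) by apply: continuous_measurable_fun; exact: continuous_cos.
have msin : measurable_fun setT (@sin R) by apply: continuous_measurable_fun; exact: continuous_sin.
pose A (l x : R) := l * (x - m) + b.
have mA l : measurable_fun setT (A l).
  by apply: measurable_funD => //; exact: measurable_funM.
pose f (l x : R) := cos (A l x) * phi x.
pose c (l : R) := \int[mu]_x f l x.
have dA (l x : R) : is_derive l 1 (fun l => A l x) (x - m).
  have := is_derive_affine (x - m) b l.
  by under [X in is_derive _ _ X _]eq_fun do rewrite mulrC.
have dAx (l x : R) : is_derive x 1 (A l) l.
  have := is_derive_affine l (b - l * m) x.
  by under [X in is_derive _ _ X _]eq_fun do rewrite addrCA addrC -mulrBr.
have if_ l : mu.-integrable setT (EFin \o f l).
  apply: (@integrable_normal_growth _ 1); first exact: measurableT_comp.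
  by move=> x; rewrite mul1r (le_trans (cos_max _))// lerDl sqr_ge0.
have df (l x : R) : is_derive l 1 (fun l => f l x) (- sin (A l x) * (x - m) * phi x).
  have H := @is_derive_comp R (@cos R) (A ^~ x) l _ _ (is_derive_cos (A l x)) (dA l x).
  apply: (is_derive_eq (is_derive_funM H (@is_derive_cst R R R (phi x) l 1))).
  by rewrite mulr0 addr0.
have c' (l : R) : is_derive l 1 c (- (s ^+ 2 * l) * c l).
  have G0 x : 0 <= (1 + (x - m) ^+ 2) * phi x.
    by rewrite mulr_ge0 ?normal_pdf_ge0// addr_ge0// sqr_ge0.
  have Ia : (`]l - 1, l + 1[%classic : set R) l by rewrite /= in_itv/=; apply/andP; split; lra.
  have E x l' : (f ^~ x)^`()%classic l' = - sin (A l' x) * (x - m) * phi x.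
    by rewrite derive1E; case: (df l' x).
  have Gub (l' x : R) : (`]l - 1, l + 1[%classic : set R) l' -> setT x ->
      `|partial1of2 f l' x| <= (1 + (x - m) ^+ 2) * phi x.
    move=> _ _; rewrite /partial1of2 E normrM (ger0_norm (normal_pdf_ge0 _ _ _)).
    rewrite ler_wpM2r ?normal_pdf_ge0// normrM normrN.
    apply: (@le_trans _ _ (1 * `|x - m|)); first by rewrite ler_wpM2r// sin_max.
    rewrite mul1r -(real_normK (num_real (x - m))).
    by have := sqr_ge0 (1 - `|x - m|); rewrite sqrrB !expr2; have := normr_ge0 (x - m); nra.
  have df1 (l' x : R) : (`]l - 1, l + 1[%classic : set R) l' -> setT x ->
      derivable (f ^~ x) l' 1.
    by move=> _ _; case: (df l' x).
  have intf l' : (`]l - 1, l + 1[%classic : set R) l' -> mu.-integrable setT (EFin \o f l').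
    by move=> _; exact: if_.
  have D1 := derivable_under_integral measurableT Ia intf df1 G0
    (integrable_sqr_normal_pdf m s_neq0) Gub.
  have D2 := differentiation_under_integral measurableT Ia intf df1 G0
    (integrable_sqr_normal_pdf m s_neq0) Gub.
  split; first exact: D1.
  rewrite derive1E in D2; rewrite D2.
  transitivity (- \int[mu]_x ((x - m) * sin (A l x) * phi x)).
    rewrite -mulN1r -RintegralZl//.
      apply: eq_Rintegral => x _; rewrite /partial1of2 E; ring.
    apply: (@integrable_normal_growth _ 1).
      by apply: measurable_funM => //; exact: measurableT_comp.
    move=> x; rewrite mul1r normrM.
    apply: (@le_trans _ _ (`|x - m| * 1)); first by rewrite ler_wpM2l// sin_max.
    rewrite mulr1 -(real_normK (num_real (x - m))).
    by have := sqr_ge0 (1 - `|x - m|); rewrite sqrrB !expr2; have := normr_ge0 (x - m); nra.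
  rewrite (@normal_stein (fun x => sin (A l x)) (fun x => cos (A l x) * l) (1 + `|l|)).
  - rewrite mulNr -[in RHS]mulrA; congr (- (_ * _)).
    rewrite /c -RintegralZl//.
    apply: eq_Rintegral => x _.
    by rewrite /f mulrAC mulrC.
  - move=> x; apply: cvgM; last exact: cvg_cst.
    apply: (@continuous_comp _ _ _ (A l) (@cos R)); last exact: continuous_cos.
    exact: (is_derive_continuous (dAx l)).
  - move=> x; apply: (le_trans (sin_max _)).
    by rewrite -[leLHS]mulr1; apply: ler_pM; rewrite ?lerDl.
  - move=> x; rewrite normrM; apply: (@le_trans _ _ (1 * `|l|)).
      by apply: ler_wpM2r => //; exact: cos_max.
    rewrite mul1r; apply: (@le_trans _ _ (1 + `|l|)); first by rewrite lerDr.
    by rewrite ler_peMr ?lerDl ?sqr_ge0// addr_ge0.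
pose e (l : R) := c l * expR (s ^+ 2 / 2 * l ^+ 2).
have de (l : R) : is_derive l 1 e 0.
  have H1 : is_derive l 1 (fun l : R => s ^+ 2 / 2 * l ^+ 2) (s ^+ 2 * l).
    have H := is_derive_funZ (s ^+ 2 / 2) (is_derive_funM (is_derive_id l 1) (is_derive_id l 1)).
    by apply: (is_derive_eq H); rewrite mul1r mulr1; field.
  have H2 := @is_derive_comp R (@expR R) (fun l : R => s ^+ 2 / 2 * l ^+ 2) l _ _ (is_derive_expR _) H1.
  apply: (is_derive_eq (is_derive_funM (c' l) H2)); ring.
have := is_derive0_cst de a 0.
rewrite /e expr0n/= mulr0 expR0 mulr1.
have -> : c 0 = cos b.
  rewrite /c; under eq_Rintegral do rewrite /f /A mul0r add0r.
  by rewrite RintegralZl ?Rintegral_normal_pdf ?mulr1//; exact: integrable_normal_pdf.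
by move=> <-; rewrite mulrCA -expRD addrC subrr expR0 mulr1.
Qed.

End normal_moments.

(** * Characteristic functions determine integrals *)

Section real_dominated_convergence.
Context {R : realType} d (E : measurableType d) (mu : {measure set E -> \bar R}).

Lemma Rintegral_dominated_cvg (D : set E) (f_ : nat -> E -> R) (f g : E -> R) :
  measurable D ->
  (forall n, measurable_fun D (f_ n)) -> measurable_fun D f ->
  {ae mu, forall e, D e -> f_ n e @[n --> \oo] --> f e} ->
  mu.-integrable D (EFin \o g) ->
  {ae mu, forall e n, D e -> `|f_ n e| <= g e} ->
  (\int[mu]_(e in D) f_ n e)%R @[n --> \oo] --> (\int[mu]_(e in D) f e)%R.
Proof.
move=> mD mf_ mf f_f ig f_g.
have [i _ H] : [/\ mu.-integrable D (EFin \o f),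
   (\int[mu]_(x in D) `|(f_ n x)%:E - (f x)%:E|)%E @[n --> \oo] --> 0%E &
   (\int[mu]_(x in D) (f_ n x)%:E)%E @[n --> \oo] --> (\int[mu]_(x in D) (f x)%:E)%E].
  apply: (dominated_convergence mD _ _ _ ig).
  - by move=> n; exact/measurable_EFinP.
  - exact/measurable_EFinP.
  - by apply: filterS f_f => e H De; apply: cvg_EFin; [exact: nearW|exact: H].
  - by apply: filterS f_g => e H n De; rewrite lee_fin; exact: H.
rewrite /Rintegral; apply: fine_cvg.
by rewrite fineK//; exact: integrable_fin_num.
Qed.

End real_dominated_convergence.

Section bounded_integrals.
Context {R : realType} d (E : measurableType d) (mu : probability E R).
Implicit Types (f g : E -> R).

Lemma bounded_integrable f (M : R) : measurable_fun setT f ->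
  (forall e, `|f e| <= M) -> mu.-integrable setT (EFin \o f).
Proof.
move=> mf fM; apply: measurable_bounded_integrable => //.
  by rewrite (le_lt_trans (probability_le1 _ _))// ltry.
exists M; split; first exact: num_real.
by move=> x Mx y _; apply: le_trans (fM y) _; exact: ltW.
Qed.

Lemma bounded_cvg_Rintegral (f_ : nat -> E -> R) f (M : R) :
  (forall n, measurable_fun setT (f_ n)) -> measurable_fun setT f ->
  (forall n e, `|f_ n e| <= M) ->
  (forall e, f_ n e @[n --> \oo] --> f e) ->
  (\int[mu]_e f_ n e)%R @[n --> \oo] --> (\int[mu]_e f e)%R.
Proof.
move=> mf_ mf fM f_f.
have iM : mu.-integrable setT (EFin \o (fun=> M)).
  by apply: (@bounded_integrable (fun=> M) `|M|) => //; exact: measurable_cst.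
by apply: (Rintegral_dominated_cvg _ mf_ mf _ iM) => //; exact: aeW.
Qed.

End bounded_integrals.

Section trigonometric_uniqueness.
Context {R : realType} d (E : measurableType d) (mu1 mu2 : probability E R).
Context {J : Type} (u : J -> E -> R).
Hypothesis mu_ : forall j, measurable_fun setT (u j).

Definition linform (l : seq (J * R)) (e : E) : R := \sum_(p <- l) p.2 * u p.1 e.

Lemma linform_cat l l' e : linform (l ++ l') e = linform l e + linform l' e.
Proof. by rewrite /linform big_cat. Qed.

Lemma linform1 j c e : linform [:: (j, c)] e = c * u j e.
Proof. by rewrite /linform big_seq1. Qed.

Lemma measurable_linform l : measurable_fun setT (linform l).
Proof.
rewrite /linform; elim: l => [|p l IH].
  by under eq_fun do rewrite big_nil; exact: measurable_cst.
under eq_fun do rewrite big_cons.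
by apply: measurable_funD => //; apply: measurable_funM.
Qed.

(** The weights K against which the two measures integrate all cosines of affine forms alike. This
    class is stable under multiplication by a bump, ordered differences and pointwise limits, which
    leads from K = 1 to indicators of intersections of half-spaces. *)
Definition trig_agree (K : E -> R) := [/\ measurable_fun setT K,
  forall e, 0 <= K e <= 1 &
  forall l b, \int[mu1]_e (cos (linform l e + b) * K e) =
              \int[mu2]_e (cos (linform l e + b) * K e)].

Lemma measurable_cos_linform l b : measurable_fun setT (fun e => cos (linform l e + b)).
Proof.
apply: (@measurableT_comp _ _ _ _ _ _ (@cos R)).
  by apply: continuous_measurable_fun; exact: continuous_cos.
by apply: measurable_funD; [exact: measurable_linform|exact: measurable_cst].
Qed.

Lemma trig_integrable (mu : probability E R) l b (K : E -> R) : measurable_fun setT K ->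
  (forall e, 0 <= K e <= 1) ->
  mu.-integrable setT (EFin \o (fun e => cos (linform l e + b) * K e)).
Proof.
move=> mK K01; apply: (@bounded_integrable _ _ _ _ _ 1).
  by apply: measurable_funM => //; exact: measurable_cos_linform.
move=> e; rewrite normrM -[leRHS]mulr1; apply: ler_pM => //; first exact: cos_max.
by have /andP[? ?] := K01 e; rewrite ger0_norm.
Qed.

Definition trig_bump (j : J) (c b : R) (e : E) : R := (1 + cos (c * u j e + b)) / 2.

Lemma trig_bump01 j c b e : 0 <= trig_bump j c b e <= 1.
Proof.
have := cos_geN1 (c * u j e + b); have := cos_le1 (c * u j e + b).
by rewrite /trig_bump => ? ?; apply/andP; split; lra.
Qed.

Lemma measurable_trig_bump j c b : measurable_fun setT (trig_bump j c b).
Proof.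
rewrite /trig_bump; apply: measurable_funM; last exact: measurable_cst.
apply: measurable_funD; first exact: measurable_cst.
apply: (@measurableT_comp _ _ _ _ _ _ (@cos R)).
  by apply: continuous_measurable_fun; exact: continuous_cos.
apply: measurable_funD; last exact: measurable_cst.
by apply: measurable_funM; [exact: measurable_cst|exact: mu_].
Qed.

Lemma itv01M (x y : R) : 0 <= x <= 1 -> 0 <= y <= 1 -> 0 <= x * y <= 1.
Proof. by move=> /andP[? ?] /andP[? ?]; rewrite mulr_ge0// mulr_ile1. Qed.

(** A product of two cosines is half the sum of the cosines of the sum and of the difference, both
    of which are again cosines of affine forms. *)
Lemma trig_agree_bump K j c b : trig_agree K ->
  trig_agree (fun e => K e * trig_bump j c b e).
Proof.
move=> [mK K01 agK]; split.
- by apply: measurable_funM => //; exact: measurable_trig_bump.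
- by move=> e; apply: itv01M => //; exact: trig_bump01.
move=> l b'.
have I (mu : probability E R) : \int[mu]_e (cos (linform l e + b') * (K e * trig_bump j c b e)) =
  2^-1 * \int[mu]_e (cos (linform l e + b') * K e) +
  4^-1 * (\int[mu]_e (cos (linform (l ++ [:: (j, c)]) e + (b' + b)) * K e) +
  \int[mu]_e (cos (linform (l ++ [:: (j, - c)]) e + (b' - b)) * K e)).
  have i l' b'' := @trig_integrable mu l' b'' K mK K01.
  have i2 := integrableD measurableT (i (l ++ [:: (j, c)]) (b' + b))
    (i (l ++ [:: (j, - c)]) (b' - b)).
  rewrite -RintegralD// -!RintegralZl//.
  rewrite -RintegralD//.
  - apply: eq_Rintegral => e _; rewrite !linform_cat !linform1 /trig_bump.
    have -> : linform l e + c * u j e + (b' + b) = (linform l e + b') + (c * u j e + b) by ring.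
    have -> : linform l e + - c * u j e + (b' - b) = (linform l e + b') - (c * u j e + b) by ring.
    by rewrite (cosD (linform l e + b') (c * u j e + b)) (cosB (linform l e + b') (c * u j e + b)); field.
  - exact: (@integrableZl _ _ _ mu setT measurableT 2^-1 _ (i _ _)).
  - exact: (@integrableZl _ _ _ mu setT measurableT 4^-1 _ i2).
by rewrite !I !agK.
Qed.

Lemma trig_agreeB K K' : trig_agree K -> trig_agree K' -> (forall e, K' e <= K e) ->
  trig_agree (fun e => K e - K' e).
Proof.
move=> [mK K01 agK] [mK' K01' agK'] KK; split.
- exact: measurable_funB.
- move=> e; have := KK e; have /andP[? ?] := K01 e; have /andP[? ?] := K01' e.
  by move=> ?; apply/andP; split; lra.
move=> l b.
have I (mu : probability E R) : \int[mu]_e (cos (linform l e + b) * (K e - K' e)) =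
  \int[mu]_e (cos (linform l e + b) * K e) - \int[mu]_e (cos (linform l e + b) * K' e).
  rewrite -RintegralB//; [|exact: trig_integrable..].
  by apply: eq_Rintegral => e _; rewrite mulrBr.
by rewrite !I agK agK'.
Qed.

Lemma trig_agree_cvg (K_ : nat -> E -> R) K : (forall n, trig_agree (K_ n)) ->
  (forall e, K_ n e @[n --> \oo] --> K e) -> trig_agree K.
Proof.
move=> agK K_K.
have mK : measurable_fun setT K.
  apply: (measurable_fun_cvg (h := K_)) => [n|e _]; last exact: K_K.
  by case: (agK n).
have K01 e : 0 <= K e <= 1.
  apply/andP; split.
    by apply: ge_of_cvg (K_K e) _ => n; case: (agK n) => _ /(_ e)/andP[].
  by apply: le_of_cvg (K_K e) _ => n; case: (agK n) => _ /(_ e)/andP[].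
split=> // l b.
have H (mu : probability E R) : (\int[mu]_e (cos (linform l e + b) * K_ n e))
    @[n --> \oo] --> (\int[mu]_e (cos (linform l e + b) * K e) : R).
  apply: (@bounded_cvg_Rintegral _ _ _ _ _ _ 1).
  - move=> n; apply: measurable_funM; first exact: measurable_cos_linform.
    by case: (agK n).
  - by apply: measurable_funM => //; exact: measurable_cos_linform.
  - move=> n e; rewrite normrM -[leRHS]mulr1; apply: ler_pM => //; first exact: cos_max.
    by case: (agK n) => _ /(_ e)/andP[? ?] _; rewrite ger0_norm.
  - by move=> e; apply: cvgM; [exact: cvg_cst|exact: K_K].
have E12 : (fun n => \int[mu1]_e (cos (linform l e + b) * K_ n e)) =
          (fun n => \int[mu2]_e (cos (linform l e + b) * K_ n e)).
  by apply/funext => n; case: (agK n).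
have H1 := H mu1; rewrite E12 in H1.
exact: (cvg_unique (@Rhausdorff R) H1 (H mu2)).
Qed.

Definition sharpen (n : nat) (y : R) : R := (1 - y ^+ n) ^+ (2 ^ n)%N.

(** One factor 1 - b^n at a time, as a difference of two admissible weights; the powers of the bump
    b are reached by repeated multiplication. *)
Lemma trig_agree_sharpen K j c b n : trig_agree K ->
  trig_agree (fun e => K e * sharpen n (trig_bump j c b e)).
Proof.
move=> agK; rewrite /sharpen.
elim: (2 ^ n)%N => [|k IH].
  by under eq_fun do rewrite expr0 mulr1.
have H m : trig_agree (fun e => K e * (1 - trig_bump j c b e ^+ n) ^+ k * trig_bump j c b e ^+ m).
  elim: m => [|m IHm]; first by under eq_fun do rewrite expr0 mulr1.
  under eq_fun do rewrite exprSr mulrA.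
  exact: trig_agree_bump.
have -> : (fun e => K e * (1 - trig_bump j c b e ^+ n) ^+ k.+1) =
  (fun e => K e * (1 - trig_bump j c b e ^+ n) ^+ k -
     K e * (1 - trig_bump j c b e ^+ n) ^+ k * trig_bump j c b e ^+ n).
  by apply/funext => e; rewrite exprSr; ring.
apply: (trig_agreeB IH (H n)) => e; rewrite ler_piMr//; first by case: IH => _ /(_ e)/andP[].
by apply: exprn_ile1; have /andP[] := trig_bump01 j c b e.
Qed.

Lemma sharpen_le12 n : sharpen n 2^-1 <= sharpen n.+1 2^-1 :> R.
Proof.
have h0 : (0 : R) <= 2^-1 by [].
have h1 : (2^-1 : R) <= 1 by lra.
rewrite /sharpen expnS exprM; apply: lerXn2r; rewrite ?nnegrE.
- by rewrite subr_ge0 exprn_ile1.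
- by rewrite exprn_ge0// subr_ge0 exprn_ile1.
- rewrite [2^-1 ^+ n.+1]exprS; have : 0 <= (2^-1 : R) ^+ n by rewrite exprn_ge0.
  set x := (2^-1 ^+ n) => x0; have := sqr_ge0 (2^-1 * x).
  have -> : (1 - 2^-1 * x) ^+ 2 = 1 - x + (2^-1 * x) ^+ 2 by field.
  lra.
Qed.

(* The sequence of Brosowski and Deutsch; at y = 1/2 it converges, to exp (-1), but
   only the convergence matters. *)
Lemma sharpen_cvg : exists c : R, forall y : R, 0 <= y <= 1 ->
  sharpen n y @[n --> \oo] --> (if y < 2^-1 then 1 else if y == 2^-1 then c else 0).
Proof.
have h0 : (0 : R) <= 2^-1 by [].
have h1 : (2^-1 : R) <= 1 by lra.
have [c cP] : exists c : R, sharpen n 2^-1 @[n --> \oo] --> c.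
  apply/cvg_ex; apply: nondecreasing_is_cvgn.
    by apply/nondecreasing_seqP => n; exact: sharpen_le12.
  exists 1 => _ [n _ <-]; apply: exprn_ile1.
    by rewrite subr_ge0 exprn_ile1.
  by rewrite gerBl exprn_ge0.
exists c => y /andP[y0 y1].
have yn n : 0 <= 1 - y ^+ n by rewrite subr_ge0 exprn_ile1.
have [yl|yg|->] := ltgtP y 2^-1; last exact: cP.
- have H : 1 - (2 * y) ^+ n @[n --> \oo] --> (1 - 0 : R).
    apply: cvgB; first exact: cvg_cst.
    by apply: cvg_expr; rewrite ger0_norm ?mulr_ge0//; lra.
  rewrite subr0 in H.
  have H1 : (fun=> 1 : R) @ \oo --> (1 : R) by exact: cvg_cst.
  apply: (squeeze_cvgr _ H H1); apply: nearW => n.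
  apply/andP; split; last first.
    by apply: exprn_ile1 => //; rewrite gerBl exprn_ge0.
  have : forall k, 1 - k%:R * y ^+ n <= (1 - y ^+ n) ^+ k.
    elim=> [|k IH]; first by rewrite mul0r subr0 expr0.
    rewrite exprS; apply: le_trans (ler_wpM2l (yn n) IH).
    have : 0 <= k%:R * (y ^+ n * y ^+ n) by rewrite mulr_ge0// mulr_ge0// exprn_ge0.
    rewrite -natr1; lra.
  move=> /(_ (2 ^ n)%N); rewrite /sharpen natrX exprMn; exact.
- have H : ((2 * y) ^+ n)^-1 @[n --> \oo] --> (0 : R).
    under eq_fun do rewrite -exprVn.
    apply: cvg_expr; rewrite ger0_norm ?invr_ge0 ?mulr_ge0//.
    by rewrite invf_lt1; lra.
  have H1 : (fun=> 0 : R) @ \oo --> (0 : R) by exact: cvg_cst.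
  apply: (squeeze_cvgr _ H1 H); apply: nearW => n.
  rewrite exprn_ge0//=.
  have p0 : 0 < (2 * y) ^+ n by rewrite exprn_gt0//; lra.
  have e1 : 1 - y ^+ n <= expR (- y ^+ n) by exact: expR_ge1Dx.
  apply: (@le_trans _ _ (expR (- y ^+ n) ^+ (2 ^ n)%N)).
    by apply: lerXn2r; rewrite ?nnegrE ?expR_ge0.
  rewrite -expRM_natr mulNr expRN natrX -exprMn (mulrC y) lef_pV2 ?posrE ?expR_gt0//.
  by apply: le_trans (expR_ge1Dx _); rewrite lerDr.
Qed.

(* 1_{u_j <= a} is a limit of trigonometric polynomials in u_j with slowly varying phases. *)
Lemma trig_agree_halfline K j a : trig_agree K ->
  trig_agree (fun e => K e * (u j e <= a)%R%:R).
Proof.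
have [c cP] := sharpen_cvg.
(* The limit of the sharpened bump as a function of the sine; the phase chosen below turns the
   cosine of the bump into that sine, and the threshold 1/2 into 0. *)
pose g (t : R) : R := if t < 0 then 1 else if t == 0 then c else 0.
pose S (L : R) e a' : R := sin ((u j e - a') / L).
move=> agK.
have agS L a' : trig_agree (fun e => K e * g (S L e a')).
  pose b := - (a' / L) - pi / 2.
  apply: (@trig_agree_cvg (fun n e => K e * sharpen n (trig_bump j L^-1 b e))).
    by move=> n; exact: trig_agree_sharpen.
  move=> e; apply: cvgM; first exact: cvg_cst.
  have tbE : trig_bump j L^-1 b e = (1 + S L e a') / 2.
    rewrite /trig_bump /S /b addrA cosBpihalf; congr ((1 + sin _) / 2).
    by rewrite mulrBl mulrC.
  have -> : g (S L e a') = (if trig_bump j L^-1 b e < 2^-1 then 1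
      else if trig_bump j L^-1 b e == 2^-1 then c else 0).
    have -> : (trig_bump j L^-1 b e < 2^-1) = (S L e a' < 0).
      by rewrite tbE; apply/idP/idP => ?; lra.
    have -> // : (trig_bump j L^-1 b e == 2^-1) = (S L e a' == 0).
    by rewrite tbE; apply/eqP/eqP => ?; lra.
  by apply: cP; exact: trig_bump01.
(* For a large period the sine of (u_j - a') / L has the sign of u_j - a'. *)
have agg a' : trig_agree (fun e => K e * g (u j e - a')).
  apply: (@trig_agree_cvg (fun n e => K e * g (S n.+1%:R e a'))).
    by move=> n; exact: agS.
  move=> e; apply: cvgM; first exact: cvg_cst.
  apply: cvg_near_cst; near=> n.
  set t := u j e - a'.
  have n0 : 0 < n.+1%:R :> R by [].
  have tn : `|t| / n.+1%:R < pi.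
    rewrite ltr_pdivrMr//.
    have p1 := @pi_gt0 R.
    have : `|t| / pi < n.+1%:R.
      apply: lt_trans (_ : n%:R < _); last by rewrite ltr_nat.
      by near: n; exact: nbhs_infty_gtr.
    by rewrite ltr_pdivrMr// mulrC.
  rewrite /S -/t /g.
  have [t0|t0|->] := ltgtP t 0; last by rewrite mul0r sin0 ltxx eqxx.
  - have : 0 < sin (- t / n.+1%:R).
      apply: sin_gt0_pi; rewrite divr_gt0 ?oppr_gt0//=.
      by rewrite -(ltr0_norm t0).
    by rewrite mulNr sinN oppr_gt0 => ->.
  - have : 0 < sin (t / n.+1%:R).
      by apply: sin_gt0_pi; rewrite divr_gt0//= -[t in t / _](gtr0_norm t0).
    by move=> s0; rewrite ltNge (ltW s0)/= gt_eqF.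
(* Thresholds decreasing strictly to a avoid the intermediate value c at the threshold itself and
   produce the closed half-line. *)
apply: (@trig_agree_cvg (fun n e => K e * g (u j e - (a + n.+1%:R^-1)))).
  by move=> n; exact: agg.
move=> e; apply: cvgM; first exact: cvg_cst.
have [ua|ua] := leP (u j e) a.
  apply: cvg_near_cst; apply: nearW => n.
  rewrite /g ifT// subr_lt0 (le_lt_trans ua)// ltrDl invr_gt0//.
apply: cvg_near_cst; near=> n.
have H : n.+1%:R^-1 < u j e - a.
  rewrite invf_plt ?posrE ?subr_gt0//.
  apply: lt_trans (_ : n%:R < _); last by rewrite ltr_nat.
  by near: n; exact: nbhs_infty_gtr.
rewrite /g ltNge subr_ge0 ltW/=; last by rewrite addrC -ltrBrDr.
by rewrite subr_eq0 gt_eqF// addrC -ltrBrDr.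
Unshelve. all: by end_near. Qed.

Definition halfspaces (l : seq (J * R)) : set E :=
  [set e | all (fun p => u p.1 e <= p.2) l].

(** Finite intersections of half-spaces form a pi-system, with concatenation of lists as
    intersection, and their indicators are weights in the sense of [trig_agree]; the zero form gives
    their probabilities. *)
Lemma trig_uniqueness :
  (forall l b, \int[mu1]_e cos (linform l e + b) = \int[mu2]_e cos (linform l e + b)) ->
  forall A, <<s range halfspaces >> A -> mu1 A = mu2 A.
Proof.
move=> ag.
have agl l : trig_agree (fun e => (all (fun p => u p.1 e <= p.2) l)%:R).
  elim: l => [|p l IH].
    split=> [|e|l b]; first exact: measurable_cst.
      by rewrite ler01 lexx.
    by under eq_Rintegral do rewrite mulr1; rewrite ag; apply: eq_Rintegral => e _; rewrite mulr1.
  have := trig_agree_halfline p.1 p.2 IH.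
  by under [X in trig_agree X -> _]eq_fun do rewrite mulrC -natrM mulnb.
have ml l : measurable (halfspaces l).
  have [m _ _] := agl l.
  have := m measurableT [set 1] (measurable_set1 1); rewrite setTI.
  suff -> : halfspaces l = (fun e => (all (fun p => u p.1 e <= p.2) l)%:R) @^-1` [set (1 : R)] by [].
  rewrite /halfspaces; apply/seteqP; split=> e /=; first by move=> ->.
  by case: all => // /esym/eqP; rewrite oner_eq0.
apply: (@g_sigma_algebra_measure_unique _ _ _ (range halfspaces) _ (fun=> setT)) => //.
- by move=> _ [l _ <-]; exact: ml.
- by move=> _; exists [::] => //; apply/seteqP; split=> e.
- by rewrite bigcup_const//; exists 0%N.
- move=> _ _ [l _ <-] [l' _ <-]; exists (l ++ l') => //.
  by apply/seteqP; split=> e; rewrite /halfspaces/= all_cat => /andP.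
- move=> _ [l _ <-].
  have [_ _ /(_ [::] 0)] := agl l.
  have I (mu : probability E R) : \int[mu]_e (cos (linform [::] e + 0) *
      (all (fun p => u p.1 e <= p.2) l)%:R) = fine (mu (halfspaces l)).
    rewrite -[halfspaces l]setIT -integral_indic//; congr fine.
    apply: eq_integral => e _; rewrite /linform big_nil addr0 cos0 mul1r indicE.
    by congr ((nat_of_bool _)%:R%:E); apply/idP/idP; rewrite inE.
  rewrite !I => H; rewrite -[LHS]fineK ?fin_num_measure// H fineK//.
  exact: fin_num_measure.
- by move=> _; rewrite (le_lt_trans (probability_le1 _ _))// ltry.
Qed.

End trigonometric_uniqueness.

Section trigonometric_uniqueness_integral.
Context {R : realType} d (E : measurableType d) (mu1 mu2 : probability E R).
Context {J : Type} (u : J -> E -> R).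
Hypothesis mu_ : forall j, measurable_fun setT (u j).
Local Notation sigma_u := (g_sigma_algebraType (range (halfspaces u))).

Lemma measurable_generator j : measurable_fun setT (u j : sigma_u -> R).
Proof.
apply: (measurability _ (@RGenOInfty.measurableE R)) => //.
move=> _ [_ [x ->] <-]; rewrite setTI.
have -> : u j @^-1` `]x, +oo[ = ~` halfspaces u [:: (j, x)].
  apply/seteqP; split=> e /=; rewrite in_itv/= andbT /halfspaces/= andbT.
    by rewrite ltNge => /negP.
  by rewrite ltNge => /negP.
by apply: measurableC; apply: sub_sigma_algebra; exists [:: (j, x)].
Qed.

Hypothesis agree : forall l b,
  \int[mu1]_e cos (linform u l e + b) = \int[mu2]_e cos (linform u l e + b).

(** The identity into the coarser space whose sigma-algebra is generated by the coordinates: pushing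
    a measure forward along it is restricting it to the sets on which cosine transforms determine
    it. *)
Let iid (e : E) : sigma_u := e.

Let miid : measurable_fun setT iid.
Proof.
apply: (measurability _ (erefl : @measurable _ sigma_u = <<s range (halfspaces u) >>)).
move=> _ [_ [l _ <-] <-]; rewrite setTI.
have -> : iid @^-1` halfspaces u l = \big[setI/setT]_(p <- l) (u p.1 @^-1` `]-oo, p.2]).
  elim: l => [|p l IH]; first by rewrite big_nil; apply/seteqP; split.
  rewrite big_cons -IH; apply/seteqP; split=> e; rewrite /halfspaces/= in_itv/=.
    by move=> /andP.
  by move=> [-> ->].
elim: l => [|p l IH]; first by rewrite big_nil; exact: measurableT.
rewrite big_cons; apply: measurableI => //.
by rewrite -[X in measurable X]setTI; apply: mu_ => //; exact: measurable_itv.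
Qed.

Lemma sigma_measurable d' (T : measurableType d') (F : sigma_u -> T) :
  measurable_fun setT F -> measurable_fun setT (F : E -> T).
Proof. by move=> mF; apply: (measurableT_comp mF miid). Qed.

Let pushforward_eq A : measurable A -> pushforward mu1 iid A = pushforward mu2 iid A.
Proof. by move=> mA; rewrite /pushforward; exact: (trig_uniqueness mu_ agree). Qed.

Lemma trig_uniqueness_ge0 (F : sigma_u -> \bar R) : measurable_fun setT F ->
  (forall e, 0 <= F e)%E -> (\int[mu1]_e F e = \int[mu2]_e F e)%E.
Proof.
move=> mF F0.
rewrite -[LHS](@ge0_integral_pushforward _ _ E sigma_u R iid miid mu1 setT F)//.
rewrite -[RHS](@ge0_integral_pushforward _ _ E sigma_u R iid miid mu2 setT F)//.
by apply: eq_measure_integral => A mA _; exact: pushforward_eq.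
Qed.

Lemma trig_uniqueness_bounded (F : sigma_u -> R) (M : R) : measurable_fun setT F ->
  (forall e, `|F e| <= M) -> \int[mu1]_e F e = \int[mu2]_e F e.
Proof.
move=> mF FM; rewrite /Rintegral; congr fine.
have i (mu : probability E R) : mu.-integrable setT (EFin \o F).
  exact: (@bounded_integrable _ _ _ mu F M (sigma_measurable mF) FM).
have mF' : measurable_fun setT (EFin \o F) by exact/measurable_EFinP.
have -> : (\int[mu1]_e (F e)%:E)%E = (\int[pushforward mu1 iid]_e (F e)%:E)%E.
  by rewrite [RHS](integral_pushforward miid mF' (i mu1)).
have -> : (\int[mu2]_e (F e)%:E)%E = (\int[pushforward mu2 iid]_e (F e)%:E)%E.
  by rewrite [RHS](integral_pushforward miid mF' (i mu2)).
by apply: eq_measure_integral => A mA _; exact: pushforward_eq.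
Qed.

End trigonometric_uniqueness_integral.

Lemma Rintegral_normal_prob {R : realType} (s : R) (f : R -> R) (M : R) : s != 0 ->
  measurable_fun setT f -> (forall x, `|f x| <= M) ->
  \int[normal_prob 0 s]_x f x = \int[lebesgue_measure]_x (f x * normal_pdf 0 s x).
Proof.
move=> s0 mf fM.
have iN : (normal_prob 0 s).-integrable setT (EFin \o f).
  exact: (@bounded_integrable _ _ _ (normal_prob 0 s) f M).
have iM : (normal_prob 0 s).-integrable setT (EFin \o (fun=> M)).
  by apply: (@bounded_integrable _ _ _ (normal_prob 0 s) _ `|M|) => //; exact: measurable_cst.
have M0 : 0 <= M by exact: le_trans (normr_ge0 _) (fM 0).
have il : (@lebesgue_measure R).-integrable setT (EFin \o (fun x => f x * normal_pdf 0 s x)).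
  apply: (@integrable_normal_growth _ 0 s s0 f M) => // x; apply: (le_trans (fM x)).
  by rewrite ler_peMr// lerDl sqr_ge0.
have iMl : (@lebesgue_measure R).-integrable setT (EFin \o (fun x => M * normal_pdf 0 s x)).
  exact: (@integrableZl _ _ _ _ setT measurableT M _ (integrable_normal_pdf 0 s)).
(* Adding M makes the integrand nonnegative, which is the case where the density formula has been
   proved. *)
have : \int[normal_prob 0 s]_x (f x + M) =
    \int[lebesgue_measure]_x (f x * normal_pdf 0 s x + M * normal_pdf 0 s x).
  rewrite /Rintegral; congr fine.
  rewrite ge0_integral_normal_prob.
  - by apply: eq_integral => x _; rewrite -EFinM mulrDl.
  - by apply/measurable_EFinP; apply: measurable_funD => //; exact: measurable_cst.
  - by move=> x; rewrite lee_fin; have := fM x; rewrite ler_norml => /andP[+ _]; lra.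
rewrite !RintegralD// RintegralZl// ?Rintegral_normal_pdf; last exact: integrable_normal_pdf.
have -> : \int[normal_prob 0 s]_x M = M.
  rewrite Rintegral_cst//= (_ : normal_prob 0 s setT = 1%E) ?mulr1//.
  exact: probability_setT.
by rewrite mulr1 => /addIr.
Qed.

(** * Conditioning on the part of the noise independent of a Gaussian variable *)

Section gaussian_disintegration.
Context {R : realType} d (Omega : measurableType d) (P : probability Omega R).
Context (s : R) (s_neq0 : s != 0) (xi : Omega -> R) {J : Type} (g : J -> Omega -> R).
Hypothesis mxi : measurable_fun setT xi.
Hypothesis mg : forall j, measurable_fun setT (g j).
Context (V : seq (J * R) -> R).
(* the characteristic function of a centred Gaussian xi independent of the centred
   Gaussian family g *)
Hypothesis cf : forall a l b,
  \int[P]_w cos (a * xi w + linform g l w + b) =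
    expR (- (s ^+ 2 / 2 * a ^+ 2)) * expR (- (V l / 2)) * cos b.

Local Notation N := (normal_prob 0 s).
Local Notation mu := (@lebesgue_measure R).
Local Notation phi := (normal_pdf 0 s).

Local Notation RxO := (measurableTypeR R * Omega)%type.

(** [None] is the Gaussian coordinate and [Some j] a member of the residual family. The second
    component is the sample point itself, so that no space of values of the family has to be
    built. *)
Definition joint_coord (j : option J) (z : RxO) : R :=
  if j is Some j then g j z.2 else z.1.

Lemma measurable_joint_coord j : measurable_fun setT (joint_coord j).
Proof. by case: j => [j|] //=; exact: measurableT_comp. Qed.

Local Notation sigma_joint := (g_sigma_algebraType (range (halfspaces joint_coord))).

Let pair_xi (w : Omega) : RxO := (xi w, w).

Let mpair : measurable_fun setT pair_xi.
Proof. exact: measurable_fun_pair. Qed.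

Let pair_mixin := isMeasurableFun.Build _ _ _ _ pair_xi mpair.
Let pair_mfun : {mfun Omega >-> RxO} :=
  HB.pack pair_xi pair_mixin.

Let lin_split l : exists a l', forall z, linform joint_coord l z = a * z.1 + linform g l' z.2.
Proof.
elim: l => [|[[j|] c] l [a [l' IH]]].
- by exists 0, [::] => z'; rewrite /linform !big_nil mul0r addr0.
- exists a, ((j, c) :: l') => z'; move: (IH z').
  by rewrite /linform !big_cons/= => ->; ring.
- exists (a + c), l' => z'; move: (IH z').
  by rewrite /linform !big_cons/= => ->; ring.
Qed.

Let mcosD (L : RxO -> R) b : measurable_fun setT L ->
  measurable_fun setT (fun z => cos (L z + b)).
Proof.
move=> mL; apply: (@measurableT_comp _ _ _ _ _ _ (@cos R)).
  by apply: continuous_measurable_fun; exact: continuous_cos.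
by apply: measurable_funD => //; exact: measurable_cst.
Qed.

Let NP : probability RxO R := (N \x P)%E.

(** The law of (xi, identity) and the product of N with P have the same cosine transforms in these
    coordinates: by [cf] for the first, by Fubini and the Gaussian transform for the second. For
    functions measurable in the coordinates, xi may thus be replaced by an independent normal
    variable while w stays fixed. *)
Let agree l b :
  \int[distribution P pair_mfun]_z cos (linform joint_coord l z + b) =
  \int[NP]_z cos (linform joint_coord l z + b).
Proof.
have mlin : measurable_fun setT (linform joint_coord l).
  by apply: measurable_linform; exact: measurable_joint_coord.
have mc := mcosD b mlin.
have mc' : measurable_fun setT (EFin \o (fun z => cos (linform joint_coord l z + b))).
  exact/measurable_EFinP.
have cos1 (z : RxO) : `|cos (linform joint_coord l z + b)| <= 1 by exact: cos_max.
have [a [l' lE]] := lin_split l.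
have i1 : P.-integrable setT
   (EFin \o (fun w => cos (linform joint_coord l (pair_xi w) + b))).
  apply: (@bounded_integrable _ _ _ P _ 1); last by move=> w; exact: cos1.
  exact: (measurableT_comp mc mpair).
have i2 : NP.-integrable setT
   (EFin \o (fun z => cos (linform joint_coord l z + b))).
  exact: (@bounded_integrable _ _ _ NP _ 1 mc cos1).
transitivity (expR (- (s ^+ 2 / 2 * a ^+ 2)) * expR (- (V l' / 2)) * cos b).
  rewrite -cf {1}/Rintegral (integral_pushforward mpair mc' i1 measurableT) /Rintegral; congr fine.
  by apply: eq_integral => w _; rewrite /= lE.
have mcw w : measurable_fun setT (fun x : R => cos (linform joint_coord l (x, w) + b)).
  exact: (measurableT_comp mc (pair2_measurable w)).
have inner w : (\int[N]_x (cos (linform joint_coord l (x, w) + b))%:E =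
   (expR (- (s ^+ 2 / 2 * a ^+ 2)) * cos (linform g l' w + b))%:E)%E.
  have iN : N.-integrable setT (EFin \o (fun x => cos (linform joint_coord l (x, w) + b))).
    apply: (@bounded_integrable _ _ _ N _ 1); [exact: mcw|move=> x; exact: cos1].
  rewrite -[LHS]fineK; last exact: integrable_fin_num.
  rewrite -[fine _]/(Rintegral _ _ _).
  rewrite (@Rintegral_normal_prob _ s _ 1)//.
  rewrite -(@normal_cos_transform _ 0 s s_neq0); congr EFin.
  by apply: eq_Rintegral => x _; rewrite lE/= subr0 addrA.
have iL : P.-integrable setT (EFin \o (fun w => cos (linform g l' w + b))).
  apply: (@bounded_integrable _ _ _ P _ 1); last by move=> w; exact: cos_max.
  apply: measurable_cos_linform; exact: mg.
rewrite {1}/Rintegral -(integral21_prod_meas1 i2) /fubini_G.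
under eq_integral do rewrite inner.
rewrite -[fine _]/(Rintegral _ _ _) RintegralZl// -mulrA; congr (_ * _).
have := cf 0 l' b.
rewrite expr0n/= mulr0 oppr0 expR0 mul1r => <-.
by apply: eq_Rintegral => w _; rewrite mul0r add0r.
Qed.

Lemma gaussian_disintegration_ge0 (F : sigma_joint -> \bar R) : measurable_fun setT F ->
  (forall z, 0 <= F z)%E ->
  (\int[P]_w F (xi w, w) = \int[P]_w \int[mu]_x (F (x, w) * (phi x)%:E))%E.
Proof.
move=> mF F0.
have mF' := sigma_measurable measurable_joint_coord mF.
have := @trig_uniqueness_ge0 _ _ _ (distribution P pair_mfun) NP _ _ measurable_joint_coord agree F mF F0.
rewrite (ge0_integral_pushforward mpair)//.
move=> ->; rewrite fubini_tonelli2//; apply: eq_integral => w _.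
rewrite /fubini_G ge0_integral_normal_prob//.
exact: (measurableT_comp mF' (pair2_measurable w)).
Qed.

Lemma gaussian_disintegration_bounded (F : sigma_joint -> R) (M : R) :
  measurable_fun setT F -> (forall z, `|F z| <= M) ->
  \int[P]_w F (xi w, w) = \int[P]_w \int[mu]_x (F (x, w) * phi x).
Proof.
move=> mF FM.
have mF' := sigma_measurable measurable_joint_coord mF.
have i1 : P.-integrable setT (EFin \o F \o pair_xi).
  apply: (@bounded_integrable _ _ _ P (F \o pair_xi) M); last by move=> w; exact: FM.
  exact: (measurableT_comp mF' mpair).
have i2 : NP.-integrable setT (EFin \o F).
  exact: (@bounded_integrable _ _ _ NP F M).
have := @trig_uniqueness_bounded _ _ _ (distribution P pair_mfun) NP _ _ measurable_joint_coord agree F M mF FM.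
have mF2 : measurable_fun setT (EFin \o (F : RxO -> R)) by exact/measurable_EFinP.
rewrite {1}/Rintegral (integral_pushforward mpair mF2 i1 measurableT).
rewrite preimage_setT => H; transitivity (\int[NP]_z F z); first exact: H.
rewrite /Rintegral -(integral21_prod_meas1 i2) /fubini_G.
congr fine; apply: eq_integral => w _.
have mFw : measurable_fun setT (fun x : R => F (x, w)).
  exact: (measurableT_comp mF' (pair2_measurable w)).
rewrite -[fine _]/(Rintegral _ _ _) -(@Rintegral_normal_prob _ s _ M)//.
rewrite /Rintegral fineK//; apply: integrable_fin_num => //.
apply: (@bounded_integrable _ _ _ N _ M); [exact: mFw|move=> x; exact: FM].
Qed.

Lemma gaussian_disintegration_le (F Bd : sigma_joint -> R) (M : R) :
  measurable_fun setT F -> (forall z, `|F z| <= M) ->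
  measurable_fun setT Bd -> (forall z, 0 <= Bd z) ->
  (forall w, `|\int[mu]_x (F (x, w) * phi x)| <= \int[mu]_x (Bd (x, w) * phi x)) ->
  (`|\int[P]_w F (xi w, w)|%:E <= \int[P]_w (Bd (xi w, w))%:E)%E.
Proof.
move=> mF FM mB B0 FB.
have mF' := sigma_measurable measurable_joint_coord mF.
have mB' := sigma_measurable measurable_joint_coord mB.
(* [fine] sends both infinities to 0, so a real-valued integral lies below the extended one in both
   uses: in absolute value on the left, and for the nonnegative bound on the right. *)
have fine_le (x : \bar R) : (`|fine x|%:E <= `|x|)%E by case: x => [r||]/=; rewrite ?normr0 ?leey ?lexx.
have fine_le0 (x : \bar R) : (0 <= x)%E -> ((fine x)%:E <= x)%E by case: x.
have mEB : measurable_fun setT (fun z : sigma_joint => (Bd z)%:E) by exact/measurable_EFinP.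
have := @gaussian_disintegration_ge0 (fun z => (Bd z)%:E) mEB.
move=> /(_ (fun z => B0 z)) ->.
rewrite (gaussian_disintegration_bounded mF FM).
pose I w := \int[mu]_x (F (x, w) * phi x).
have i2 : NP.-integrable setT (EFin \o F) by exact: (@bounded_integrable _ _ _ NP F M).
have mI : measurable_fun setT I.
  rewrite (_ : I = fine \o fubini_G N (EFin \o F)).
    by apply: measurableT_comp => //; exact: measurable_fubini_G i2.
  apply/funext => w /=; rewrite /I -(@Rintegral_normal_prob _ s _ M)//.
  exact: (measurableT_comp mF' (pair2_measurable w)).
have mI' : measurable_fun setT (EFin \o I) by exact/measurable_EFinP.
apply: (le_trans (fine_le _)).
apply: (le_trans (le_abse_integral P measurableT mI')).
have mBphi : measurable_fun setT (fun z : RxO => ((Bd z * phi z.1)%:E : \bar R)).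
  apply/measurable_EFinP; apply: measurable_funM => //.
  by apply: measurableT_comp; [exact: measurable_normal_pdf|exact: measurable_fst].
have Bphi0 (z : RxO) : (0 <= (Bd z * phi z.1)%:E :> \bar R)%E.
  by rewrite lee_fin mulr_ge0// normal_pdf_ge0.
apply: ge0_le_integral => //.
- exact: measurableT_comp.
- have := measurable_fun_fubini_tonelli_G (m1 := mu) _ mBphi Bphi0.
  by rewrite /fubini_G; under eq_fun do under eq_integral do rewrite EFinM.
- move=> w _; rewrite /= -/(I w).
  apply: (@le_trans _ _ (\int[mu]_x (Bd (x, w) * phi x))%:E); first by rewrite lee_fin; exact: FB.
  apply: fine_le0; apply: integral_ge0 => x _.
  by rewrite lee_fin mulr_ge0// normal_pdf_ge0.
Qed.

End gaussian_disintegration.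

(** * Comparing the laws of two functions of a Gaussian variable *)

Section antiderivative.
Context {R : realType} (g : R -> R) (cg : continuous g).
Local Notation mu := (@lebesgue_measure R).

Lemma continuous_itv_integrable (a b : R) : mu.-integrable `[a, b] (EFin \o g).
Proof.
apply: continuous_compact_integrable; first exact: segment_compact.
exact: continuous_subspaceT.
Qed.

Let G (a x : R) := \int[mu]_(t in `[a, x]) g t.

Let G_split (b a x : R) : b <= a -> a <= x -> G b x = G b a + G a x.
Proof.
move=> ba ax; apply/eqP; rewrite addrC -subr_eq; apply/eqP.
rewrite /G Rintegral_itvB ?bnd_simp//; last exact: continuous_itv_integrable.
rewrite Rintegral_itv_obnd_cbnd//.
apply: integrableS (continuous_itv_integrable a x) => //.
exact: subset_itv_oc_cc.
Qed.

(** The primitive vanishing at 0 is written as a difference of two integrals from a base point to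
    the left of both 0 and x. Near x the base point can be frozen, and the fundamental theorem
    applies. *)
Lemma continuous_antiderivative :
  exists gam : R -> R, forall x : R, is_derive x 1 gam (g x).
Proof.
pose gam_ (a x : R) := G a x - G a 0.
have gamE (b a x : R) : b <= a -> a <= x -> a <= 0 -> gam_ b x = gam_ a x.
  by move=> ba ax a0; rewrite /gam_ (G_split ba ax) (G_split ba a0); ring.
pose gam x := gam_ (- (`|x| + 1)) x.
exists gam => x.
pose a := - (`|x| + 3).
have ax : a < x.
  by rewrite /a; have := ler_norm (- x); rewrite normrN; lra.
have xu : x < x + 1 by lra.
have [Hd He] := continuous_FTC1_closed xu (continuous_itv_integrable a (x + 1)) ax (@cg x).
have H1 : is_derive x 1 (gam_ a) (g x).
  have HG : is_derive x 1 (G a) (g x) by split; [exact: Hd|rewrite -derive1E He].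
  have := is_derive_funB HG (@is_derive_cst R R R (G a 0) x 1).
  by rewrite subr0.
have E : {near x, gam_ a =1 gam}.
  near=> y; apply: gamE.
  - rewrite /a lerN2 -lerBrDr.
    have -> : `|x| + 3 - 1 = `|x| + 2 by ring.
    rewrite (_ : y = x + (y - x)); last by ring.
    apply: le_trans (ler_normD _ _) _; rewrite lerD2l distrC.
    apply/ltW; apply: lt_trans (_ : 1 < 2); last by lra.
    near: y; exact: (@cvgr_dist_lt _ _ _ _ _ _ x (@cvg_id _ (nbhs x)) 1).
  - by have := ler_norm (- y); rewrite normrN; lra.
  - by have := normr_ge0 y; lra.
case: H1 => D1 D2; split; first exact: near_eq_derivable E D1.
by rewrite -(near_eq_derive _ E).
Unshelve. all: by end_near. Qed.

End antiderivative.

Section density_comparison.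
Context {R : realType} (s : R) (s_neq0 : s != 0).
Local Notation mu := (@lebesgue_measure R).
Local Notation phi := (normal_pdf 0 s).
Context (X X1 X2 Y Y1 g : R -> R) (m B K : R).
Hypotheses (XX1 : forall t : R, is_derive t 1 X (X1 t))
  (X1X2 : forall t : R, is_derive t 1 X1 (X2 t))
  (YY1 : forall t : R, is_derive t 1 Y (Y1 t))
  (cX2 : continuous X2) (cY1 : continuous Y1)
  (m_gt0 : 0 < m) (X1m : forall t, m <= `|X1 t|)
  (X1B : forall t, `|X1 t| <= B) (Y1B : forall t, `|Y1 t| <= B)
  (XYB : forall t, `|X t - Y t| <= B * (1 + `|t|))
  (K_ge0 : 0 <= K) (X2K : forall t, `|X2 t| <= K * X1 t ^+ 2)
  (cg : continuous g) (g1 : forall t, `|g t| <= 1).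

Local Notation bnd := (fun t => `|X1 t - Y1 t| / m + `|X t - Y t| * (`|t| / (s ^+ 2 * m) + K)).

(* Integrate (gam(X) - gam(Y)) phi / X' by parts, where gam' = g: only one derivative
   of Y, and no lower bound on it, is needed. *)
Lemma density_comparison :
  `|\int[mu]_t ((g (X t) - g (Y t)) * phi t)| <= \int[mu]_t (bnd t * phi t).
Proof.
have [gam gamg] := continuous_antiderivative cg.
have s2 : 0 < s ^+ 2 by rewrite exprn_even_gt0.
have B0 : 0 <= B by exact: le_trans (normr_ge0 _) (X1B 0).
have X1n0 t : X1 t != 0.
  by rewrite -normr_gt0 (lt_le_trans m_gt0).
have gam_lip a b : `|gam a - gam b| <= `|a - b|.
  wlog ab : a b / b <= a.
    move=> H; have [ba|ba] := leP b a; first exact: H.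
    by rewrite distrC [leRHS]distrC; apply: H; exact: ltW.
  have [c _ ->] := MVT_segment ab (fun x _ => gamg x)
    (continuous_subspaceT (is_derive_continuous gamg)).
  by rewrite normrM ler_piMl.
have cX := is_derive_continuous XX1.
have cX1 := is_derive_continuous X1X2.
have cY := is_derive_continuous YY1.
have cgam := is_derive_continuous gamg.
have cphi : continuous phi by exact: continuous_normal_pdf.
have cX1V : continuous (fun t => (X1 t)^-1) by move=> t; apply: cvgV => //; exact: cX1.
pose dgam t := gam (X t) - gam (Y t).
have dgam_le t : `|dgam t| <= `|X t - Y t| by exact: gam_lip.
(* [u1 - u2] is the derivative of (gam(X) - gam(Y)) phi / X', divided by phi: [u1] comes from the
   difference of primitives, [u2] from phi / X'. *)
pose u1 t := (g (X t) * X1 t - g (Y t) * Y1 t) * (X1 t)^-1.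
pose u2 t := dgam t * (t / s ^+ 2 * (X1 t)^-1 + X2 t * (X1 t)^-1 * (X1 t)^-1).
pose h t := u1 t - u2 t.
have ct : continuous (fun t : R => t / s ^+ 2).
  by move=> t; apply: cvgM; [exact: cvg_id|exact: cvg_cst].
have cgX := continuous_fun_comp cg cX.
have cgY := continuous_fun_comp cg cY.
have cu1 : continuous u1.
  exact: continuous_funM (continuous_funB (continuous_funM cgX cX1) (continuous_funM cgY cY1)) cX1V.
have cu2 : continuous u2.
  apply: continuous_funM.
    exact: continuous_funB (continuous_fun_comp cgam cX) (continuous_fun_comp cgam cY).
  exact: continuous_funD (continuous_funM ct cX1V) (continuous_funM (continuous_funM cX2 cX1V) cX1V).
have ch : continuous h by exact: continuous_funB cu1 cu2.
have Vm t : `|(X1 t)^-1| <= m^-1.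
  by rewrite normrV ?unitfE// lef_pV2 ?posrE ?normr_gt0.
have u1le t : `|u1 t| <= 2 * B / m.
  rewrite normrM; apply: ler_pM => //; apply: le_trans (ler_normB _ _) _.
  rewrite !normrM mulr2n mulrDl mul1r.
  by apply: lerD; rewrite -[leRHS]mul1r; exact: ler_pM.
have X2le t : `|X2 t * (X1 t)^-1 * (X1 t)^-1| <= K.
  rewrite -mulrA -invfM normrM normrV ?unitfE ?mulf_neq0// ler_pdivrMr.
    by rewrite -expr2 normrX real_normK ?num_real.
  by rewrite normr_gt0 mulf_neq0.
have u2le t : `|u2 t| <= `|X t - Y t| * (`|t| / (s ^+ 2 * m) + K).
  rewrite normrM; apply: ler_pM => //; apply: le_trans (ler_normD _ _) _.
  have s2V : 0 < (s ^+ 2)^-1 by rewrite invr_gt0.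
  apply: lerD => //.
  rewrite (normrM _ (X1 t)^-1) (normrM t) (gtr0_norm s2V).
  have -> : `|t| / (s ^+ 2 * m) = `|t| * (s ^+ 2)^-1 * m^-1 by rewrite -mulrA -invfM.
  by apply: ler_wpM2l => //; rewrite mulr_ge0// invr_ge0 ltW.
have absmul1 (t : R) : `|t| * (1 + `|t|) <= 2 * (1 + t ^+ 2).
  rewrite -(real_normK (num_real t)); have := normr_ge0 t; set y := `|t| => y0.
  by have := sqr_ge0 (1 - y); rewrite sqrrB !expr2; nra.
have abs1 (t : R) : 1 + `|t| <= 2 * (1 + t ^+ 2).
  rewrite -(real_normK (num_real t)); have := normr_ge0 t; set y := `|t| => y0.
  by have := sqr_ge0 (1 - y); rewrite sqrrB !expr2; nra.
pose C := B * (2 / (s ^+ 2 * m) + 2 * K).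
have sm0 : 0 < (s ^+ 2 * m)^-1 by rewrite invr_gt0 mulr_gt0.
have bnd2le t : `|X t - Y t| * (`|t| / (s ^+ 2 * m) + K) <= C * (1 + t ^+ 2).
  apply: (@le_trans _ _ (B * (1 + `|t|) * (`|t| / (s ^+ 2 * m) + K))).
    by apply: ler_wpM2r => //; rewrite addr_ge0// mulr_ge0// ltW.
  rewrite /C -[leLHS]mulrA -[leRHS]mulrA; apply: ler_wpM2l => //.
  have H1 := ler_wpM2r (ltW sm0) (absmul1 t).
  have H2 := ler_wpM2r K_ge0 (abs1 t).
  have -> : (1 + `|t|) * (`|t| / (s ^+ 2 * m) + K) =
    `|t| * (1 + `|t|) / (s ^+ 2 * m) + (1 + `|t|) * K by ring.
  apply: le_trans (lerD H1 H2) _.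
  by rewrite le_eqVlt; apply/orP; left; apply/eqP; ring.
have C0 : 0 <= C.
  by rewrite mulr_ge0// addr_ge0 ?mulr_ge0// ltW.
have growth (k : R -> R) (D : R) : continuous k -> (forall t, `|k t| <= D * (1 + t ^+ 2)) ->
    mu.-integrable setT (EFin \o (fun t => k t * phi t)).
  move=> ck kD; apply: (@integrable_normal_growth _ 0 s s_neq0 k D).
    exact: continuous_measurable_fun.
  by move=> t; rewrite subr0.
have hle t : `|h t| <= (2 * B / m + C) * (1 + t ^+ 2).
  apply: le_trans (ler_normB _ _) _; rewrite mulrDl; apply: lerD.
    apply: (le_trans (u1le t)); rewrite ler_peMr ?lerDl ?sqr_ge0//.
    by rewrite divr_ge0 ?(ltW m_gt0) ?mulr_ge0.
  exact: le_trans (u2le t) (bnd2le t).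
pose F t := dgam t * (phi t * (X1 t)^-1).
have dF (t : R) : is_derive t 1 F (h t * phi t).
  have d1 := is_derive_comp (gamg (X t)) (XX1 t).
  have d2 := is_derive_comp (gamg (Y t)) (YY1 t).
  have d3 := is_derive_normal_pdf 0 s_neq0 t.
  have d4 := is_deriveV (X1n0 t) (X1X2 t).
  apply: (is_derive_eq (is_derive_funM (is_derive_funB d1 d2) (is_derive_funM d3 d4))).
  rewrite /h /u1 /u2 /dgam /GRing.scale/= subr0; field.
  by rewrite s_neq0 X1n0.
have [Cb Cb0 HCb] := normal_pdf_bound 0 s_neq0.
have intF : (\int[mu]_t (h t * phi t)%:E = 0)%E.
  apply: (@integral_derive_decay R F _ (B * Cb / m)) => //.
  - exact: continuous_funM ch cphi.
  - exact: growth ch hle.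
  - move=> t; rewrite normrM normrM (ger0_norm (normal_pdf_ge0 _ _ _)).
    have H1 := HCb t; rewrite subr0 in H1.
    apply: (@le_trans _ _ (B * (1 + `|t|) * (phi t / m))).
      apply: ler_pM => //; first by rewrite mulr_ge0 ?normal_pdf_ge0.
        exact: le_trans (dgam_le t) (XYB t).
      by apply: ler_wpM2l => //; exact: normal_pdf_ge0.
    have -> : B * (1 + `|t|) * (phi t / m) = B / m * ((1 + `|t|) * phi t) by ring.
    have -> : B * Cb / m / (1 + `|t|) = B / m * (Cb / (1 + `|t|)) by ring.
    by apply: ler_wpM2l => //; rewrite divr_ge0// ltW.
(* What remains of g(X) - g(Y) once [h] is removed. The integral of h phi is zero, so [k] carries
   the whole difference, and it is small when X - Y and X' - Y' are. *)
pose k t := g (Y t) * (Y1 t * (X1 t)^-1 - 1) + u2 t.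
have ck : continuous k.
  have c1 : continuous (fun _ : R => 1 : R) by move=> t; exact: cvg_cst.
  exact: continuous_funD (continuous_funM cgY (continuous_funB (continuous_funM cY1 cX1V) c1)) cu2.
have kle t : `|k t| <= bnd t.
  apply: le_trans (ler_normD _ _) _; apply: lerD => //.
  have -> : Y1 t * (X1 t)^-1 - 1 = (Y1 t - X1 t) * (X1 t)^-1.
    by rewrite mulrBl divff.
  rewrite !normrM distrC -[leRHS]mul1r; apply: ler_pM => //.
  exact: ler_wpM2l.
have bndle t : `|bnd t| <= (2 * B / m + C) * (1 + t ^+ 2).
  rewrite ger0_norm; last first.
    by rewrite addr_ge0// ?divr_ge0 ?(ltW m_gt0)// mulr_ge0// addr_ge0// mulr_ge0// ltW.
  rewrite mulrDl; apply: lerD => //.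
  apply: (@le_trans _ _ (2 * B / m)).
    rewrite ler_pM2r ?invr_gt0//; apply: le_trans (ler_normB _ _) _.
    by rewrite mulr2n mulrDl mul1r lerD.
  by rewrite ler_peMr ?lerDl ?sqr_ge0// divr_ge0 ?(ltW m_gt0) ?mulr_ge0.
have cbnd : continuous bnd.
  have cabs (a : R -> R) : continuous a -> continuous (fun t => `|a t|).
    by move=> ca t; apply: cvg_norm; exact: ca.
  have cc (c : R) : continuous (fun _ : R => c) by move=> t; exact: cvg_cst.
  apply: continuous_funD.
    exact: continuous_funM (cabs _ (continuous_funB cX1 cY1)) (cc m^-1).
  apply: continuous_funM (cabs _ (continuous_funB cX cY)) _.
  have cid : continuous (fun t : R => t) by move=> t; exact: cvg_id.
  exact: continuous_funD (continuous_funM (cabs _ cid) (cc (s ^+ 2 * m)^-1)) (cc K).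
have ikp : mu.-integrable setT (EFin \o (fun t => k t * phi t)).
  apply: (growth _ _ ck) => t; apply: (le_trans (kle t)).
  exact: le_trans (ler_norm _) (bndle t).
have ibp := growth _ _ cbnd bndle.
have -> : \int[mu]_t ((g (X t) - g (Y t)) * phi t) = \int[mu]_t (k t * phi t).
  transitivity (\int[mu]_t (h t * phi t + k t * phi t)).
    apply: eq_Rintegral => t _; rewrite -mulrDl; congr (_ * _).
    by rewrite /h /k /u1; field.
  rewrite RintegralD//; last exact: growth ch hle.
  by rewrite {1}/Rintegral intF add0r.
apply: le_trans (le_normr_Rintegral _ ikp) _ => //.
apply: le_Rintegral => //.
  exact: integrable_norm.
move=> t _; rewrite normrM (ger0_norm (normal_pdf_ge0 _ _ _)).
by apply: ler_wpM2r => //; exact: normal_pdf_ge0.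
Qed.

End density_comparison.

(** * Square-integrable random variables *)

Section square_integrable.
Context {R : realType} d (Omega : measurableType d) (P : probability Omega R).
Implicit Types (X Y Z : Omega -> R).

Definition sqint X := measurable_fun setT X /\ P.-integrable setT (EFin \o (fun w => X w ^+ 2)).

Definition ip X Y : R := \int[P]_w (X w * Y w).

Lemma sqint_mul X Y : sqint X -> sqint Y ->
  P.-integrable setT (EFin \o (fun w => X w * Y w)).
Proof.
move=> [mX iX] [mY iY].
apply: (le_integrable _ _ _ (integrableD measurableT iX iY)) => //.
  by apply/measurable_EFinP; exact: measurable_funM.
move=> w _ /=; rewrite lee_fin normrM; apply: le_trans (ler_norm _).
rewrite -(real_normK (num_real (X w))) -(real_normK (num_real (Y w))).
set x := `|X w|; set y := `|Y w|.
have xy0 : 0 <= x * y by rewrite mulr_ge0 ?normr_ge0.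
have -> : x ^+ 2 + y ^+ 2 = (x - y) ^+ 2 + 2 * (x * y) by ring.
have := sqr_ge0 (x - y); lra.
Qed.

Lemma sqintD X Y : sqint X -> sqint Y -> sqint (fun w => X w + Y w).
Proof.
move=> sX sY; have [mX iX] := sX; have [mY iY] := sY; split.
  exact: measurable_funD.
have i2 := integrableD measurableT iX iY.
have i3 := @integrableZl _ _ _ P setT measurableT 2 _ i2.
apply: le_integrable i3 => //.
  by apply/measurable_EFinP; apply: measurable_funX; exact: measurable_funD.
move=> w _ /=; rewrite lee_fin (ger0_norm (sqr_ge0 _)).
apply: le_trans (ler_norm _).
have -> : (X w + Y w) ^+ 2 = 2 * (X w ^+ 2 + Y w ^+ 2) - (X w - Y w) ^+ 2 by ring.
by rewrite lerBlDr lerDl sqr_ge0.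
Qed.

Lemma sqintZ (a : R) X : sqint X -> sqint (fun w => a * X w).
Proof.
move=> [mX iX]; split; first by apply: measurable_funM => //; exact: measurable_cst.
have := @integrableZl _ _ _ P setT measurableT (a ^+ 2) _ iX.
apply: eq_integrable => // w _ /=.
by rewrite exprMn EFinM.
Qed.

Lemma sqintB X Y : sqint X -> sqint Y -> sqint (fun w => X w - Y w).
Proof.
move=> sX /(sqintZ (-1)) /(sqintD sX).
by under eq_fun do rewrite mulN1r.
Qed.

Lemma sqint_cst (a : R) : sqint (fun=> a).
Proof.
split; first exact: measurable_cst.
by apply: (@bounded_integrable _ _ _ P _ (a ^+ 2)) => // w; rewrite ger0_norm// sqr_ge0.
Qed.

Lemma sqint_sum (I : Type) (s : seq I) (F : I -> Omega -> R) :
  (forall i, sqint (F i)) -> sqint (fun w => \sum_(i <- s) F i w).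
Proof.
move=> sF; elim: s => [|i s IH].
  by under eq_fun do rewrite big_nil; exact: sqint_cst.
by under eq_fun do rewrite big_cons; exact: sqintD.
Qed.

Lemma sqint_integrable X : sqint X -> P.-integrable setT (EFin \o X).
Proof.
move=> sX; have := sqint_mul sX (sqint_cst 1).
by apply: eq_integrable => // w _ /=; rewrite mulr1.
Qed.

Lemma ipC X Y : ip X Y = ip Y X.
Proof. by apply: eq_Rintegral => w _; rewrite mulrC. Qed.

Lemma ipDl X Y Z : sqint X -> sqint Y -> sqint Z ->
  ip (fun w => X w + Y w) Z = ip X Z + ip Y Z.
Proof.
move=> sX sY sZ; rewrite /ip -RintegralD//; try exact: sqint_mul.
by apply: eq_Rintegral => w _; rewrite mulrDl.
Qed.

Lemma ipZl a X Y : sqint X -> sqint Y -> ip (fun w => a * X w) Y = a * ip X Y.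
Proof.
move=> sX sY; rewrite /ip -RintegralZl//; last exact: sqint_mul.
by apply: eq_Rintegral => w _; rewrite mulrA.
Qed.

Lemma ipBl X Y Z : sqint X -> sqint Y -> sqint Z ->
  ip (fun w => X w - Y w) Z = ip X Z - ip Y Z.
Proof.
move=> sX sY sZ; rewrite /ip -RintegralB//; try exact: sqint_mul.
by apply: eq_Rintegral => w _; rewrite mulrBl.
Qed.

Lemma ip_suml (I : Type) (s : seq I) (F : I -> Omega -> R) Z :
  (forall i, sqint (F i)) -> sqint Z ->
  ip (fun w => \sum_(i <- s) F i w) Z = \sum_(i <- s) ip (F i) Z.
Proof.
move=> sF sZ; elim: s => [|i s IH].
  rewrite big_nil /ip; under eq_Rintegral do rewrite big_nil mul0r.
  by rewrite /Rintegral integral0.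
rewrite big_cons -IH -ipDl//; last exact: sqint_sum.
by congr ip; apply/funext => w; rewrite big_cons.
Qed.

Lemma ip_ge0 X : 0 <= ip X X.
Proof. by apply: Rintegral_ge0 => w _; rewrite -expr2 sqr_ge0. Qed.

Lemma ip_sqrD X Y (a b : R) : sqint X -> sqint Y ->
  ip (fun w => a * X w + b * Y w) (fun w => a * X w + b * Y w) =
  a ^+ 2 * ip X X + 2 * a * b * ip X Y + b ^+ 2 * ip Y Y.
Proof.
move=> sX sY.
have sa := sqintZ a sX; have sb := sqintZ b sY; have sab := sqintD sa sb.
rewrite ipDl// !(ipC _ (fun w => a * X w + b * Y w)) !ipDl// ?ipZl//.
rewrite !(ipC _ (fun w => a * X w)) !(ipC _ (fun w => b * Y w)) !ipZl//.
rewrite (ipC Y X); ring.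
Qed.

Lemma ip_cauchy_schwarz X Y : sqint X -> sqint Y -> `|ip X Y| <= Num.sqrt (ip X X) * Num.sqrt (ip Y Y).
Proof.
move=> sX sY.
rewrite -sqrtrM ?ip_ge0// -sqrtr_sqr ler_wsqrtr//.
have H a b : 0 <= a ^+ 2 * ip X X + 2 * a * b * ip X Y + b ^+ 2 * ip Y Y.
  by rewrite -ip_sqrD// ip_ge0.
have X0 := ip_ge0 X; have Y0 := ip_ge0 Y.
have [Yz|Yn] := eqVneq (ip Y Y) 0.
  suff -> : ip X Y = 0 by rewrite expr0n/= Yz mulr0.
  apply/eqP; apply: contraT => n0.
  (* If Y has zero norm the quadratic form is affine in its second argument; this argument gives it
     the value -1. *)
  have := H 1 (- (ip X X + 1) / (2 * ip X Y)).
  rewrite Yz mulr0 addr0 expr1n mul1r mulr1.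
  have -> : 2 * (- (ip X X + 1) / (2 * ip X Y)) * ip X Y = - (ip X X + 1) by field.
  by lra.
have Yp : 0 < ip Y Y by rewrite lt_neqAle eq_sym Yn.
have := H (ip Y Y) (- ip X Y).
have -> : ip Y Y ^+ 2 * ip X X + 2 * ip Y Y * - ip X Y * ip X Y + (- ip X Y) ^+ 2 * ip Y Y
  = ip Y Y * (ip X X * ip Y Y - ip X Y ^+ 2) by ring.
by rewrite pmulr_rge0// subr_ge0.
Qed.

Definition l2cvg (X_ : nat -> Omega -> R) X :=
  ip (fun w => X_ n w - X w) (fun w => X_ n w - X w) @[n --> \oo] --> (0 : R).

Lemma l2cvg_sqrt (X_ : nat -> Omega -> R) X : l2cvg X_ X ->
  Num.sqrt (ip (fun w => X_ n w - X w) (fun w => X_ n w - X w)) @[n --> \oo] --> (0 : R).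
Proof.
by move=> H; rewrite -sqrtr0; apply: continuous_cvg => //; exact: sqrt_continuous.
Qed.

Lemma l2cvg_ip (X_ : nat -> Omega -> R) X Y : (forall n, sqint (X_ n)) -> sqint X -> sqint Y -> l2cvg X_ X ->
  ip (X_ n) Y @[n --> \oo] --> ip X Y.
Proof.
move=> sX_ sX sY XX.
apply/subr_cvg0; apply: norm_cvg0.
have H : Num.sqrt (ip (fun w => X_ n w - X w) (fun w => X_ n w - X w)) *
    Num.sqrt (ip Y Y) @[n --> \oo] --> (0 : R).
  rewrite -(mul0r (Num.sqrt (ip Y Y))); apply: cvgM; last exact: cvg_cst.
  exact: l2cvg_sqrt.
have H0 : (fun=> 0 : R) @ \oo --> (0 : R) by exact: cvg_cst.
apply: (squeeze_cvgr _ H0 H); apply: nearW => n.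
by rewrite normr_ge0/= -ipBl// ip_cauchy_schwarz//; exact: sqintB.
Qed.

Lemma l2cvg_nrm (X_ : nat -> Omega -> R) X : (forall n, sqint (X_ n)) -> sqint X -> l2cvg X_ X ->
  ip (X_ n) (X_ n) @[n --> \oo] --> ip X X.
Proof.
move=> sX_ sX XX.
have E n : ip (X_ n) (X_ n) = ip (fun w => X_ n w - X w) (fun w => X_ n w - X w)
    + (2 * ip (X_ n) X - ip X X).
  have -> : (fun w => X_ n w - X w) = (fun w => 1 * X_ n w + (-1) * X w).
    by apply/funext => w; rewrite mul1r mulN1r.
  rewrite ip_sqrD//; ring.
under eq_fun do rewrite E.
suff : ip (fun w => X_ n w - X w) (fun w => X_ n w - X w) +
    (2 * ip (X_ n) X - ip X X) @[n --> \oo] --> (0 + (2 * ip X X - ip X X) : R).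
  by have -> : 0 + (2 * ip X X - ip X X) = ip X X by ring.
apply: cvgD; first exact: XX.
apply: cvgB; last exact: cvg_cst.
by apply: cvgM; [exact: cvg_cst|exact: (l2cvg_ip sX_ sX sX XX)].
Qed.

Lemma ip_sqr_le2 X Y : sqint X -> sqint Y ->
  ip (fun w => X w + Y w) (fun w => X w + Y w) <= 2 * ip X X + 2 * ip Y Y.
Proof.
move=> sX sY.
have E (a : R) : ip (fun w => 1 * X w + a * Y w) (fun w => 1 * X w + a * Y w) =
   ip X X + 2 * a * ip X Y + a ^+ 2 * ip Y Y.
  by rewrite ip_sqrD//; ring.
have := ip_ge0 (fun w => 1 * X w + (-1) * Y w); rewrite E.
have -> : (fun w => X w + Y w) = (fun w => 1 * X w + 1 * Y w).
  by apply/funext => w; rewrite !mul1r.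
by rewrite E; lra.
Qed.

Lemma eq_ip X X' Y Y' : X =1 X' -> Y =1 Y' -> ip X Y = ip X' Y'.
Proof. by move=> /funext -> /funext ->. Qed.

Lemma l2cvg_lin (X_ : nat -> Omega -> R) X (Y_ : nat -> Omega -> R) Y (a b : R) : (forall n, sqint (X_ n)) -> sqint X ->
  (forall n, sqint (Y_ n)) -> sqint Y -> l2cvg X_ X -> l2cvg Y_ Y ->
  l2cvg (fun n w => a * X_ n w + b * Y_ n w) (fun w => a * X w + b * Y w).
Proof.
move=> sX_ sX sY_ sY XX YY.
have H : 2 * (a ^+ 2 * ip (fun w => X_ n w - X w) (fun w => X_ n w - X w)) +
   2 * (b ^+ 2 * ip (fun w => Y_ n w - Y w) (fun w => Y_ n w - Y w)) @[n --> \oo]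
   --> (2 * (a ^+ 2 * 0) + 2 * (b ^+ 2 * 0) : R).
  apply: cvgD; apply: cvgM; (try exact: cvg_cst); apply: cvgM => //; exact: cvg_cst.
rewrite !mulr0 addr0 in H.
have H0 : (fun=> 0 : R) @ \oo --> (0 : R) by exact: cvg_cst.
apply: (squeeze_cvgr _ H0 H); apply: nearW => n.
rewrite ip_ge0/=.
have sx := sqintB (sX_ n) sX; have sy := sqintB (sY_ n) sY.
have -> : (fun w => a * X_ n w + b * Y_ n w - (a * X w + b * Y w)) =
  (fun w => (a * (X_ n w - X w)) + (b * (Y_ n w - Y w))).
  by apply/funext => w; ring.
apply: le_trans (ip_sqr_le2 (sqintZ a sx) (sqintZ b sy)) _.
rewrite !ipZl ?(ipC _ (fun w => a * _)) ?(ipC _ (fun w => b * _)) ?ipZl//;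
  try exact: sqintZ.
by rewrite le_eqVlt; apply/orP; left; apply/eqP; ring.
Qed.

(** The cosine is 1-Lipschitz, and the L^1 norm is below the L^2 norm by Cauchy-Schwarz against 1.
    This is how Gaussian transforms pass to L^2 limits. *)
Lemma l2cvg_cos (X_ : nat -> Omega -> R) X b : (forall n, sqint (X_ n)) -> sqint X -> l2cvg X_ X ->
  (\int[P]_w cos (X_ n w + b)) @[n --> \oo] --> (\int[P]_w cos (X w + b) : R).
Proof.
move=> sX_ sX XX.
have icos Y : sqint Y -> P.-integrable setT (EFin \o (fun w => cos (Y w + b))).
  move=> [mY _]; apply: (@bounded_integrable _ _ _ P _ 1); last by move=> w; exact: cos_max.
  apply: (@measurableT_comp _ _ _ _ _ _ (@cos R)).
    by apply: continuous_measurable_fun; exact: continuous_cos.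
  by apply: measurable_funD => //; exact: measurable_cst.
have cos_lip (x y : R) : `|cos x - cos y| <= `|x - y|.
  wlog xy : x y / y <= x.
    move=> H; have [yx|yx] := leP y x; first exact: H.
    by rewrite distrC [leRHS]distrC; apply: H; exact: ltW.
  have [c _ ->] := MVT_segment xy (fun x _ => is_derive_cos x)
    (continuous_subspaceT (@continuous_cos R)).
  by rewrite normrM normrN ler_piMl// sin_max.
apply/subr_cvg0; apply: norm_cvg0.
have s1 := sqint_cst 1.
have H : Num.sqrt (ip (fun w => X_ n w - X w) (fun w => X_ n w - X w)) *
    Num.sqrt (ip (fun=> 1) (fun=> 1)) @[n --> \oo] --> (0 : R).
  rewrite -(mul0r (Num.sqrt (ip (fun=> 1) (fun=> 1)))); apply: cvgM; last exact: cvg_cst.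
  exact: l2cvg_sqrt.
have H0 : (fun=> 0 : R) @ \oo --> (0 : R) by exact: cvg_cst.
apply: (squeeze_cvgr _ H0 H); apply: nearW => n.
have sD := sqintB (sX_ n) sX.
have sA : sqint (fun w => `|X_ n w - X w|).
  have [mD iD] := sD; split; first exact: measurableT_comp.
  by apply: eq_integrable iD => // w _ /=; rewrite real_normK ?num_real.
rewrite normr_ge0/= -RintegralB//; [|exact: icos..].
apply: le_trans (le_normr_Rintegral _ _) _ => //.
  exact: (integrableB measurableT (icos _ (sX_ n)) (icos _ sX)).
apply: (@le_trans _ _ (ip (fun w => `|X_ n w - X w|) (fun=> 1))).
  apply: le_Rintegral => //.
  - apply: integrable_norm; exact: (integrableB measurableT (icos _ (sX_ n)) (icos _ sX)).
  - exact: sqint_mul.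
  - move=> w _; rewrite mulr1; apply: le_trans (cos_lip _ _) _.
    by rewrite opprD addrACA subrr addr0.
apply: le_trans (ler_norm _) _; apply: le_trans (ip_cauchy_schwarz sA s1) _.
apply: ler_wpM2r; first exact: sqrtr_ge0.
rewrite ler_wsqrtr// /ip le_eqVlt; apply/orP; left; apply/eqP.
by apply: eq_Rintegral => w _; rewrite -!expr2 real_normK ?num_real.
Qed.

End square_integrable.

(** * Riesz kernels *)

Section improper_integrals.
Context {R : realType}.
Local Notation mu := (@lebesgue_measure R).
Implicit Types (f F : R -> R) (a b c r : R).

(** The integrand may be singular at both ends. The usual theorem holds on [a + e_n, b - e_n]; the
    integrals converge monotonically, the primitives by continuity at the ends. *)
Lemma ge0_open_FTC f F a b : a < b ->
  (forall x, a < x < b -> is_derive x 1 F (f x)) ->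
  (forall x, a < x < b -> {for x, continuous f}) ->
  (forall x, a < x < b -> 0 <= f x) ->
  {for a, continuous F} -> {for b, continuous F} ->
  measurable_fun setT f ->
  (\int[mu]_(x in `[a, b]) (f x)%:E = (F b - F a)%:E)%E.
Proof.
move=> ab FdF cf f0 Fa Fb mf.
pose d := (b - a) / 2.
have d0 : 0 < d by rewrite divr_gt0// subr_gt0.
pose e (n : nat) := d / n.+2%:R.
have e0 n : 0 < e n by rewrite divr_gt0.
have ed n : e n < d by rewrite ltr_pdivrMr// ltr_pMr// ltr1n.
have e_noninc m n : (m <= n)%N -> e n <= e m.
  by move=> mn; rewrite ler_pM2l// lef_pV2 ?posrE// ler_nat.
have abd : a + d = b - d by rewrite /d; field.
have ab' n : a + e n < b - e n by have := ed n; lra.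
have in_ab n x : a + e n <= x <= b - e n -> a < x < b.
  by move=> /andP[? ?]; have := e0 n => ?; apply/andP; split; lra.
pose g (n : nat) x := ((f x) * (\1_(`[a + e n, b - e n]%classic : set R) x))%:E.
have In n : (\int[mu]_(x in `]a, b[) g n x = (F (b - e n) - F (a + e n))%:E)%E.
  rewrite EFinB -(@continuous_FTC2 _ f F _ _ (ab' n)).
  - rewrite integral_mkcond [RHS]integral_mkcond; apply: eq_integral => x _.
    rewrite !patchE /g indicE.
    have [xn|xn] := boolP (x \in `[a + e n, b - e n]%classic); last first.
      by rewrite mulr0; case: ifP.
    rewrite mulr1 ifT// inE/= in_itv/=.
    by move: xn; rewrite inE/= in_itv/=; exact: in_ab.
  - apply: continuous_in_subspaceT => x; rewrite inE/= in_itv/= => /in_ab.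
    exact: cf.
  - have cF x : a + e n <= x <= b - e n -> {for x, continuous F}.
      move=> /in_ab /FdF Fx; apply: differentiable_continuous.
      by apply/derivable1_diffP; exact: ex_derive.
    have le1 := ltW (ab' n).
    split.
    + move=> x; rewrite in_itv/= => /andP[/ltW ? /ltW ?].
      by apply: (@ex_derive _ _ _ _ _ _ _ (FdF x _)); apply: (in_ab n); apply/andP.
    + by apply: cvg_at_right_filter; apply: cF; rewrite lexx.
    + by apply: cvg_at_left_filter; apply: cF; rewrite lexx andbT.
  - move=> x; rewrite in_itv/= => /andP[/ltW ? /ltW ?].
    have [_ <-] : is_derive x 1 F (f x) by apply: FdF; apply: (in_ab n); apply/andP.
    by rewrite derive1E.
have fE : (\int[mu]_(x in `[a, b]) (f x)%:E = \int[mu]_(x in `]a, b[) (f x)%:E)%E.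
  by apply: integral_itv_bndoo; apply/measurable_EFinP; exact: measurable_funTS.
have c1 : (\int[mu]_(x in `]a, b[) g n x)%E @[n --> \oo] -->
    (\int[mu]_(x in `]a, b[) (f x)%:E)%E.
  have gf x : x \in `]a, b[%classic -> (limn (g ^~ x) = (f x)%:E)%E.
    rewrite inE/= in_itv/= => /andP[ax xb].
    apply/cvg_lim => //; apply: cvg_near_cst; near=> n.
    rewrite /g indicE mem_set ?mulr1//= in_itv/=.
    have en : e n < Num.min (x - a) (b - x).
      rewrite /e ltr_pdivrMr// mulrC -ltr_pdivrMr; last by rewrite lt_min !subr_gt0 ax.
      apply: lt_trans (_ : n%:R < _); last by rewrite ltr_nat.
      by near: n; exact: nbhs_infty_gtr.
    by move: en; rewrite lt_min => /andP[? ?]; apply/andP; split; lra.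
  have -> : (\int[mu]_(x in `]a, b[) (f x)%:E = \int[mu]_(x in `]a, b[) limn (g ^~ x))%E.
    by apply: eq_integral => x /gf ->.
  apply: cvg_monotone_convergence => //.
  - move=> n; apply/measurable_EFinP; apply: measurable_funTS.
    by apply: measurable_funM => //; exact: measurable_indic.
  - move=> n x /=; rewrite in_itv/= => xab.
    by rewrite lee_fin mulr_ge0 ?f0// indicE.
  - move=> x /=; rewrite in_itv/= => xab m n mn.
    rewrite lee_fin ler_wpM2l ?f0// !indicE ler_nat.
    have [|//] := boolP (x \in `[a + e m, b - e m]%classic).
    rewrite inE/= in_itv/= => /andP[x1 x2].
    rewrite mem_set//= in_itv/=; have := e_noninc _ _ mn => ?.
    by apply/andP; split; lra.
have e_cvg : e n @[n --> \oo] --> (0 : R).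
  rewrite -(mulr0 d); apply: cvgM; first exact: cvg_cst.
  have -> : (fun n => (n.+2%:R)^-1 : R) = [sequence harmonic n.+1]_n by [].
  by rewrite cvg_shiftS; exact: cvg_harmonic.
have cb : b - e n @[n --> \oo] --> b.
  by rewrite -{2}(subr0 b); apply: cvgB; [exact: cvg_cst|].
have ca : a + e n @[n --> \oo] --> a.
  by rewrite -{2}(addr0 a); apply: cvgD; [exact: cvg_cst|].
have c2 : (F (b - e n) - F (a + e n)) @[n --> \oo] --> F b - F a.
  apply: cvgB.
    exact: (@cvg_comp _ _ _ (fun n => b - e n) F _ _ _ cb Fb).
  exact: (@cvg_comp _ _ _ (fun n => a + e n) F _ _ _ ca Fa).
have c3 : (\int[mu]_(x in `]a, b[) g n x)%E @[n --> \oo] --> (F b - F a)%:E.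
  under eq_fun do rewrite In.
  by apply: cvg_EFin; [exact: nearW|exact: c2].
by rewrite fE; exact: (cvg_unique _ c1 c3).
Unshelve. all: by end_near. Qed.

Lemma measurable_dist_powR c r : measurable_fun setT (fun s : R => `|c - s| `^ r).
Proof.
apply: (@measurableT_comp _ _ _ _ _ _ (fun x : R => x `^ r)).
  exact: measurable_powR.
by apply: measurableT_comp => //; apply: measurable_funB => //; exact: measurable_cst.
Qed.

Lemma continuous_dist_powR c r x : c - x != 0 \/ 0 < r ->
  {for x, continuous (fun s : R => `|c - s| `^ r)}.
Proof.
move=> H; apply: (@continuous_comp _ _ _ (fun s => c - s) (fun y => `|y| `^ r)).
  by apply: cvgB; [exact: cvg_cst|exact: cvg_id].
by case: H => H; [exact: continuous_norm_powR_neq0|exact: continuous_norm_powR].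
Qed.

Lemma is_derive_dist_powR_lt c r x : x < c ->
  is_derive x 1 (fun s : R => `|c - s| `^ r) (- (r * `|c - x| `^ (r - 1))).
Proof.
move=> xc; have N0 : 0 < 0 + (c - x) by rewrite add0r subr_gt0.
have H1 := is_derive_powRD r N0.
have H2 : is_derive x 1 (fun s : R => c - s) (-1).
  have := is_derive_funB (@is_derive_cst R R R c x 1) (is_derive_id x 1).
  by rewrite sub0r.
have := @is_derive_comp R (fun s : R => `|0 + s| `^ r) (fun s => c - s) x _ _ H1 H2.
under [X in is_derive _ _ X _]eq_fun do rewrite add0r.
move=> H; apply: (is_derive_eq H).
by rewrite add0r ger0_norm ?subr_ge0 ?ltW// mulrN1.
Qed.

Lemma is_derive_dist_powR_gt c r x : c < x ->
  is_derive x 1 (fun s : R => `|c - s| `^ r) (r * `|c - x| `^ (r - 1)).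
Proof.
move=> cx; have N0 : 0 < - c + x by rewrite addrC subr_gt0.
have := is_derive_powRD r N0.
have -> : (fun s : R => `|- c + s| `^ r) = (fun s : R => `|c - s| `^ r).
  by apply/funext => s; rewrite addrC distrC.
by rewrite distrC ger0_norm ?subr_ge0 ?ltW// addrC.
Qed.

(** The alternative covers two situations: an integrable singularity at c, or c away from the
    interval. In the latter r may lie below -1, as happens in the far parts of the kernels. *)
Lemma integral_dist_powR_left a b c r : a <= b -> b <= c -> r + 1 != 0 ->
  b < c \/ 0 < r + 1 ->
  (\int[mu]_(s in `[a, b]) (`|c - s| `^ r)%:E =
   (((c - a) `^ (r + 1) - (c - b) `^ (r + 1)) / (r + 1))%:E)%E.
Proof.
rewrite le_eqVlt => /predU1P[<- _ _ _|ab bc r1 H].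
  by rewrite set_itv1 integral_set1 subrr mul0r.
pose F s := - (r + 1)^-1 * `|c - s| `^ (r + 1).
have FbFa : F b - F a = ((c - a) `^ (r + 1) - (c - b) `^ (r + 1)) / (r + 1).
  rewrite /F !ger0_norm ?subr_ge0//; last by rewrite (le_trans (ltW ab)).
  by ring.
rewrite -FbFa; apply: (@ge0_open_FTC (fun s => `|c - s| `^ r) F) => //.
- move=> x /andP[_ xb].
  have H1 := is_derive_funZ (- (r + 1)^-1) (is_derive_dist_powR_lt (r + 1) (lt_le_trans xb bc)).
  by apply: (is_derive_eq H1); rewrite addrK; field.
- move=> x /andP[_ xb]; apply: continuous_dist_powR.
  by left; rewrite gt_eqF// subr_gt0 (lt_le_trans xb).
- apply: cvgM; first exact: cvg_cst.
  by apply: continuous_dist_powR; left; rewrite gt_eqF// subr_gt0 (lt_le_trans ab).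
- apply: cvgM; first exact: cvg_cst.
  apply: continuous_dist_powR; case: H => H; [left|by right].
  by rewrite gt_eqF// subr_gt0.
- exact: measurable_dist_powR.
Qed.

Lemma integral_dist_powR_right a b c r : a <= b -> c <= a -> 0 < r + 1 ->
  (\int[mu]_(s in `[a, b]) (`|c - s| `^ r)%:E =
   (((b - c) `^ (r + 1) - (a - c) `^ (r + 1)) / (r + 1))%:E)%E.
Proof.
rewrite le_eqVlt => /predU1P[<- _ _|ab ca r1].
  by rewrite set_itv1 integral_set1 subrr mul0r.
pose F s := (r + 1)^-1 * `|c - s| `^ (r + 1).
have FbFa : F b - F a = ((b - c) `^ (r + 1) - (a - c) `^ (r + 1)) / (r + 1).
  rewrite /F !(distrC c) !ger0_norm ?subr_ge0//; last by rewrite (le_trans ca (ltW ab)).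
  by ring.
rewrite -FbFa; apply: (@ge0_open_FTC (fun s => `|c - s| `^ r) F) => //.
- move=> x /andP[ax _].
  have H1 := is_derive_funZ ((r + 1)^-1) (is_derive_dist_powR_gt (r + 1) (le_lt_trans ca ax)).
  by apply: (is_derive_eq H1); rewrite addrK; field; rewrite gt_eqF.
- move=> x /andP[ax _]; apply: continuous_dist_powR.
  by left; rewrite lt_eqF// subr_lt0 (le_lt_trans ca).
- by apply: cvgM; [exact: cvg_cst|apply: continuous_dist_powR; right].
- by apply: cvgM; [exact: cvg_cst|apply: continuous_dist_powR; right].
- exact: measurable_dist_powR.
Qed.

End improper_integrals.

Section riesz_kernel.
Context {R : realType} (be : R) (be_gt0 : 0 < be) (be_lt1 : be < 1).
Local Notation mu := (@lebesgue_measure R).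

Lemma integral_indic_le (D I : set R) (c : R) (g : R -> R) : measurable D -> measurable I ->
  0 <= c -> measurable_fun setT g -> (forall v, 0 <= g v) ->
  (\int[mu]_(v in D) (c * g v * \1_I v)%:E <= c%:E * \int[mu]_(v in I) (g v)%:E)%E.
Proof.
move=> mD mI c0 mg g0.
have mg' : measurable_fun I (EFin \o g) by apply/measurable_EFinP; exact: measurable_funTS.
rewrite -ge0_integralZl//; last by move=> v _; rewrite lee_fin.
rewrite [leRHS]integral_mkcond.
apply: (@le_trans _ _ (\int[mu]_v (c * g v * \1_I v)%:E)%E).
  apply: ge0_subset_integral => //.
    apply/measurable_EFinP; apply: measurable_funM; last exact: measurable_indic.
    by apply: measurable_funM => //; exact: measurable_cst.
  by move=> v _; rewrite lee_fin !mulr_ge0.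
rewrite le_eqVlt; apply/orP; left; apply/eqP; apply: eq_integral => v _.
by rewrite patchE indicE; case: ifPn => _; rewrite ?mulr1 ?mulr0 ?EFinM.
Qed.

(** With d = b - u, the half-line below b is cut at b - d/2, u and u - d. Each of the pieces meeting
    [u - d, b] carries one singularity, integrable because th < 1 or be > 0, while the other factor
    has size a power of d. Below u - d the two distances are comparable and the decay v^(be - 1 -
    th) is integrable at infinity since be < th. Every piece scales like d^(be - th), whatever a
    is. *)
Lemma weighted_kernel_bound (th : R) : be < th -> th < 1 ->
  exists2 C : R, 0 < C & forall a b u : R, a <= b -> u < b ->
  (\int[mu]_(v in `[a, b]) (`|b - v| `^ (- th) * `|u - v| `^ (be - 1))%:E <=
   (C * (b - u) `^ (be - th))%:E)%E.
Proof.
move=> bth th1.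
have th0 : 0 < th by exact: lt_trans bth.
pose h : R := 2^-1.
have h0 : 0 < h by rewrite invr_gt0.
pose C := h `^ (be - th) / (1 - th) + h `^ (- th) / be + h `^ (- th) * h `^ be / be
   + 2 `^ (1 - be) * 2 `^ (be - th) / (th - be).
have C0 : 0 < C.
  by rewrite !addr_gt0// ?divr_gt0 ?mulr_gt0 ?powR_gt0// subr_gt0.
exists C => // a b u ab ub.
pose d := b - u.
have d0 : 0 < d by rewrite subr_gt0.
have dh0 : 0 < d * h by rewrite mulr_gt0.
have hE : h = 1 / 2 by rewrite /h mul1r.
pose A1 := (d * h) `^ (be - 1); pose A2 := (d * h) `^ (- th); pose A3 : R := 2 `^ (1 - be).
pose f1 v := A1 * `|b - v| `^ (- th) * \1_(`[b - d * h, b]%classic : set R) v.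
pose f2 v := A2 * `|u - v| `^ (be - 1) * \1_(`[u - d, u]%classic : set R) v.
pose f3 v := A2 * `|u - v| `^ (be - 1) * \1_(`[u, b - d * h]%classic : set R) v.
pose f4 v := A3 * `|b - v| `^ (be - 1 - th) * \1_(`[a, u - d]%classic : set R) v.
have negpow (x y r : R) : 0 < x -> x <= y -> r <= 0 -> y `^ r <= x `^ r.
  move=> x0 xy r0; rewrite -(opprK r) !(powRN _ (- r)) lef_pV2 ?posrE ?powR_gt0//; last exact: lt_le_trans xy.
  by apply: ge0_ler_powR; rewrite ?nnegrE ?oppr_ge0 ?(ltW x0)// (le_trans (ltW x0)).
have b1 : be - 1 <= 0 by rewrite subr_le0 ltW.
have tn : - th <= 0 by rewrite oppr_le0 ltW.
have A10 : 0 <= A1 by exact: powR_ge0.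
have A20 : 0 <= A2 by exact: powR_ge0.
have A30 : 0 <= A3 by exact: powR_ge0.
have f10 v : 0 <= f1 v by rewrite !mulr_ge0 ?powR_ge0.
have f20 v : 0 <= f2 v by rewrite !mulr_ge0 ?powR_ge0.
have f30 v : 0 <= f3 v by rewrite !mulr_ge0 ?powR_ge0.
have f40 v : 0 <= f4 v by rewrite !mulr_ge0 ?powR_ge0.
have mf (c r A : R) (I : interval R) : measurable_fun `[a, b] (fun v => (A * `|c - v| `^ r * \1_[set` I] v)%:E).
  apply/measurable_EFinP; apply: measurable_funTS; apply: measurable_funM.
    by apply: measurable_funM; [exact: measurable_cst|exact: measurable_dist_powR].
  by apply: measurable_indic; exact: measurable_itv.
have dom v : a <= v <= b -> `|b - v| `^ (- th) * `|u - v| `^ (be - 1) <= f1 v + (f2 v + (f3 v + f4 v)).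
  move=> /andP[av vb].
  have [c1|c1] := leP (b - d * h) v.
    apply: (@le_trans _ _ (f1 v)); last by rewrite lerDl !addr_ge0.
    rewrite /f1 indicE mem_set/= ?in_itv/= ?c1// mulr1 mulrC ler_wpM2r ?powR_ge0//.
    apply: negpow => //; rewrite distrC; apply: le_trans (ler_norm _).
    by rewrite hE in c1 *; rewrite /d in c1 *; lra.
  have bv : d * h <= `|b - v| by apply: le_trans (ler_norm _); lra.
  have [c2|c2] := leP u v.
    apply: (@le_trans _ _ (f3 v)); last first.
      by have := f10 v; have := f20 v; have := f40 v; lra.
    rewrite /f3 indicE mem_set/= ?in_itv/= ?c2 ?(ltW c1)// mulr1 ler_wpM2r ?powR_ge0//.
    exact: negpow.
  have [c3|c3] := leP (u - d) v.
    apply: (@le_trans _ _ (f2 v)); last first.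
      by have := f10 v; have := f30 v; have := f40 v; lra.
    rewrite /f2 indicE mem_set/= ?in_itv/= ?c3 ?(ltW c2)// mulr1 ler_wpM2r ?powR_ge0//.
    exact: negpow.
  apply: (@le_trans _ _ (f4 v)); last first.
    by have := f10 v; have := f30 v; have := f20 v; lra.
  rewrite /f4 indicE mem_set/= ?in_itv/= ?av ?(ltW c3)// mulr1.
  have bv0 : 0 < b - v by lra.
  rewrite (gtr0_norm bv0).
  have -> : (b - v) `^ (be - 1 - th) = (b - v) `^ (- th) * (b - v) `^ (be - 1).
    rewrite -powRD; first by congr (_ `^ _); ring.
    by rewrite (gt_eqF bv0) implybT.
  rewrite mulrCA; apply: ler_wpM2l; first exact: powR_ge0.
  rewrite /A3.
  (* For v below u - d one has b - v <= 2 (u - v). *)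
  have -> : 2 `^ (1 - be) * (b - v) `^ (be - 1) = ((b - v) * h) `^ (be - 1).
    rewrite powRM ?(ltW bv0) ?(ltW h0)// mulrC; congr (_ * _).
    have -> : h = 2 `^ (-1) by rewrite powR_inv1.
    by rewrite -powRrM; congr (_ `^ _); ring.
  apply: negpow => //; first by rewrite mulr_gt0.
  apply: le_trans (ler_norm _); rewrite hE; rewrite /d in c3; lra.
apply: (@le_trans _ _ (\int[mu]_(v in `[a, b]) ((f1 v)%:E + ((f2 v)%:E + ((f3 v)%:E + (f4 v)%:E))))%E).
  apply: ge0_le_integral => //.
  - apply/measurable_EFinP; apply: measurable_funTS.
    by apply: measurable_funM; exact: measurable_dist_powR.
  - by apply: emeasurable_funD; [exact: mf|apply: emeasurable_funD; [exact: mf|apply: emeasurable_funD; exact: mf]].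
have mf1 : measurable_fun `[a, b] (fun v => (f1 v)%:E) by exact: mf.
have mf2 : measurable_fun `[a, b] (fun v => (f2 v)%:E) by exact: mf.
have mf3 : measurable_fun `[a, b] (fun v => (f3 v)%:E) by exact: mf.
have mf4 : measurable_fun `[a, b] (fun v => (f4 v)%:E) by exact: mf.
have mf34 : measurable_fun `[a, b] (fun v => ((f3 v)%:E + (f4 v)%:E)%E).
  by apply: emeasurable_funD; exact: mf.
have mf234 : measurable_fun `[a, b] (fun v => ((f2 v)%:E + ((f3 v)%:E + (f4 v)%:E))%E).
  by apply: emeasurable_funD => //; exact: mf.
have f340 v : `[a, b]%classic v -> (0 <= (f3 v)%:E + (f4 v)%:E)%E by move=> _; rewrite -EFinD lee_fin addr_ge0.
have f2340 v : `[a, b]%classic v -> (0 <= (f2 v)%:E + ((f3 v)%:E + (f4 v)%:E))%E.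
  by move=> _; rewrite -!EFinD lee_fin !addr_ge0.
rewrite ge0_integralD//.
rewrite ge0_integralD//.
rewrite ge0_integralD//.
have mi (I : interval R) : measurable [set` I] by exact: measurable_itv.
have pw c r := @measurable_dist_powR R c r.
have p0 (c r v : R) : 0 <= `|c - v| `^ r by exact: powR_ge0.
have H1 : (\int[mu]_(v in `[a, b]) (f1 v)%:E <= (h `^ (be - th) / (1 - th) * d `^ (be - th))%:E)%E.
  have H := @integral_indic_le `[a, b]%classic `[b - d * h, b]%classic A1 (fun v => `|b - v| `^ (- th))
    (mi `[a, b]%R) (mi `[b - d * h, b]%R) A10 (pw _ _) (p0 _ _).
  apply: (le_trans H) => {H}.
  rewrite integral_dist_powR_left ?gerBl ?(ltW dh0)//; last 2 first.
  - by rewrite addrC gt_eqF// subr_gt0.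
  - by right; rewrite addrC subr_gt0.
  rewrite subrr powR0; last by rewrite addrC gt_eqF// subr_gt0.
  rewrite subr0 -EFinM lee_fin opprB (addrC b) subrK /A1 mulrA -powRD; last by rewrite (gt_eqF dh0) implybT.
  rewrite (_ : be - 1 + (- th + 1) = be - th); last by ring.
  by rewrite powRM ?(ltW d0) ?(ltW h0)// (addrC (- th)) le_eqVlt; apply/orP; left; apply/eqP; ring.
have be1 : be - 1 + 1 = be by ring.
have dpow : d `^ (be - th) = d `^ (- th) * d `^ be.
  rewrite -powRD; first by congr (_ `^ _); ring.
  by rewrite (gt_eqF d0) implybT.
have H2 : (\int[mu]_(v in `[a, b]) (f2 v)%:E <= (h `^ (- th) / be * d `^ (be - th))%:E)%E.
  have H := @integral_indic_le `[a, b]%classic `[u - d, u]%classic A2 (fun v => `|u - v| `^ (be - 1))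
    (mi `[a, b]%R) (mi `[u - d, u]%R) A20 (pw _ _) (p0 _ _).
  apply: (le_trans H) => {H}.
  rewrite integral_dist_powR_left ?gerBl ?(ltW d0) ?be1 ?gt_eqF//; last by right.
  rewrite subrr powR0 ?gt_eqF// subr0 -EFinM lee_fin opprB (addrC u) subrK /A2.
  by rewrite powRM ?(ltW d0) ?(ltW h0)// dpow le_eqVlt; apply/orP; left; apply/eqP; ring.
have H3 : (\int[mu]_(v in `[a, b]) (f3 v)%:E <= (h `^ (- th) * h `^ be / be * d `^ (be - th))%:E)%E.
  have H := @integral_indic_le `[a, b]%classic `[u, b - d * h]%classic A2 (fun v => `|u - v| `^ (be - 1))
    (mi `[a, b]%R) (mi `[u, b - d * h]%R) A20 (pw _ _) (p0 _ _).
  apply: (le_trans H) => {H}.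
  have ubd : u <= b - d * h by rewrite hE /d; rewrite /d in d0; lra.
  rewrite integral_dist_powR_right ?be1// subrr powR0 ?gt_eqF// subr0 -EFinM lee_fin /A2.
  have -> : b - d * h - u = d * h by rewrite hE /d; field.
  by rewrite !powRM ?(ltW d0) ?(ltW h0)// dpow le_eqVlt; apply/orP; left; apply/eqP; ring.
have H4 : (\int[mu]_(v in `[a, b]) (f4 v)%:E <= (2 `^ (1 - be) * 2 `^ (be - th) / (th - be) * d `^ (be - th))%:E)%E.
  have H := @integral_indic_le `[a, b]%classic `[a, u - d]%classic A3 (fun v => `|b - v| `^ (be - 1 - th))
    (mi `[a, b]%R) (mi `[a, u - d]%R) A30 (pw _ _) (p0 _ _).
  apply: (le_trans H) => {H}.
  have [aud|aud] := leP a (u - d); last first.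
    rewrite set_itv_ge ?bnd_simp -?ltNge// integral_set0 mule0 lee_fin.
    by rewrite mulr_ge0 ?powR_ge0// divr_ge0 ?mulr_ge0 ?powR_ge0// subr_ge0 ltW.
  have E1 : be - 1 - th + 1 = be - th by ring.
  have bth0 : be - th != 0 by rewrite subr_eq0 lt_eqF.
  rewrite integral_dist_powR_left ?E1//; last 2 first.
  - by move: d0; rewrite /d; lra.
  - by left; move: d0; rewrite /d; lra.
  rewrite -EFinM lee_fin -!mulrA ler_wpM2l//.
  have -> : b - (u - d) = 2 * d by rewrite /d; ring.
  rewrite powRM ?(ltW d0)//.
  have -> : ((b - a) `^ (be - th) - 2 `^ (be - th) * d `^ (be - th)) / (be - th) =
     2 `^ (be - th) * ((th - be)^-1 * d `^ (be - th)) - (b - a) `^ (be - th) / (th - be).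
    by field; rewrite bth0 subr_eq0 gt_eqF.
  by rewrite gerBl divr_ge0 ?powR_ge0// subr_ge0 ltW.
apply: le_trans (leeD H1 (leeD H2 (leeD H3 H4))) _.
by rewrite -!EFinD lee_fin /C !mulrDl !addrA.
all: by move=> v _; rewrite lee_fin.
Qed.

End riesz_kernel.

(** * The covariance kernel of fractional Brownian motion *)

Section interval_split.
Context {R : realType}.
Local Notation mu := (@lebesgue_measure R).

Lemma ge0_integral_itv_split (a c b : R) (f : R -> R) : a <= c -> c <= b ->
  measurable_fun setT f -> (forall x, 0 <= f x) ->
  (\int[mu]_(x in `[a, b]) (f x)%:E =
   \int[mu]_(x in `[a, c]) (f x)%:E + \int[mu]_(x in `[c, b]) (f x)%:E)%E.
Proof.
move=> ac cb mf f0.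
have mf' A : measurable_fun A (EFin \o f) by apply/measurable_EFinP; exact: measurable_funTS.
rewrite (@itv_bndbnd_setU _ _ (BLeft a) (BRight c) (BRight b)) ?bnd_simp//.
rewrite ge0_integral_setU//=; last 3 first.
- exact: mf'.
- by move=> x _; rewrite lee_fin.
- rewrite disj_set2E; apply/eqP/seteqP; split=> x //=.
  by rewrite !in_itv/= => -[/andP[_ xc]] /andP[cx _]; move: xc; rewrite leNgt cx.
by congr (_ + _)%E; apply: integral_itv_obnd_cbnd; exact: mf'.
Qed.

End interval_split.

Section fbm_kernel_integrals.
Context {R : realType} (T H : R) (T_gt0 : 0 < T) (H_gt : 2^-1 < H) (H_lt1 : H < 1).
Local Notation mu := (@lebesgue_measure R).
Local Notation RR := (measurableTypeR R * measurableTypeR R)%type.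
Local Notation D := ((`[0%R, T] : set R) `*` (`[0%R, T] : set R)).
Local Notation K := (fbm_kernel H).

Let be : R := 2 * H - 1.

Let be_gt0 : 0 < be.
Proof. by rewrite /be subr_gt0 -ltr_pdivrMl// mulr1. Qed.

Let be_lt1 : be < 1. Proof. by move: H_lt1; rewrite /be; lra. Qed.

Lemma fbm_kernelE (u v : R) : K (u, v) = `|u - v| `^ (be - 1).
Proof. rewrite /fbm_kernel /be/=; congr (_ `^ _); ring. Qed.

Lemma fbm_kernel_ge0 z : 0 <= K z.
Proof. exact: powR_ge0. Qed.

Lemma measurable_fbm_kernel : measurable_fun setT (K : RR -> R).
Proof.
apply: (@measurableT_comp _ _ _ _ _ _ (fun x : R => x `^ (2 * H - 2))).
  exact: measurable_powR.
apply: measurableT_comp => //; apply: measurable_funB.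
  exact: measurable_fst.
exact: measurable_snd.
Qed.

Lemma ge0_integral_rect (A B : set R) (f : RR -> R) : measurable A -> measurable B ->
  measurable_fun setT f -> (forall z, 0 <= f z) ->
  (\int[mu \x mu]_(z in A `*` B) (f z)%:E = \int[mu]_(x in A) \int[mu]_(y in B) (f (x, y))%:E)%E.
Proof.
move=> mA mB mf f0.
pose h (z : RR) := ((\1_A z.1 * (\1_B z.2 * f z))%:E : \bar R).
have mh : measurable_fun setT h.
  apply/measurable_EFinP; apply: measurable_funM.
    by apply: (@measurableT_comp _ _ _ _ _ _ (\1_A : R -> R)); [exact: measurable_indic|exact: measurable_fst].
  apply: measurable_funM => //.
  by apply: (@measurableT_comp _ _ _ _ _ _ (\1_B : R -> R)); [exact: measurable_indic|exact: measurable_snd].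
transitivity (\int[mu \x mu]_z h z)%E.
  rewrite integral_mkcond; apply: eq_integral => -[x y] _.
  rewrite patchE /h/= in_setX/= !indicE; case: (x \in A) => /=; rewrite ?mul0r//.
  by case: (y \in B) => /=; rewrite ?mul0r ?mulr0 ?mul1r.
rewrite fubini_tonelli1//; last first.
  by move=> z; rewrite lee_fin !mulr_ge0.
rewrite [RHS]integral_mkcond; apply: eq_integral => x _.
rewrite patchE /fubini_F/h/= indicE; case: (x \in A) => /=; last first.
  by under eq_integral do rewrite mul0r; rewrite integral0.
rewrite [RHS]integral_mkcond; apply: eq_integral => y _.
by rewrite patchE mul1r indicE; case: (y \in B); rewrite ?mul1r ?mul0r.
Qed.

Definition kernel_marginal (u : R) : R := (`|u| `^ be + `|T - u| `^ be) / be.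

Lemma integral_fbm_kernel (u : R) : 0 <= u <= T ->
  (\int[mu]_(v in `[0%R, T]) (K (u, v))%:E = (kernel_marginal u)%:E)%E.
Proof.
move=> /andP[u0 uT].
have b1 : be - 1 + 1 = be by ring.
under eq_integral do rewrite fbm_kernelE.
rewrite (ge0_integral_itv_split u0 uT)//; last exact: measurable_dist_powR.
rewrite integral_dist_powR_left ?b1 ?gt_eqF//; last by right.
rewrite integral_dist_powR_right ?b1//.
rewrite subrr subr0 powR0 ?gt_eqF// !subr0 -EFinD /kernel_marginal.
by rewrite !ger0_norm// ?subr_ge0// mulrDl.
Qed.

Lemma kernel_marginal_ge u : 0 <= u <= T -> (T / 2) `^ be / be <= kernel_marginal u.
Proof.
move=> /andP[u0 uT]; rewrite ler_wpM2r ?invr_ge0 ?(ltW be_gt0)//.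
rewrite !ger0_norm ?subr_ge0//.
have T2 : 0 <= T / 2 by rewrite divr_ge0// ltW.
have [h|h] := leP (T / 2) u.
  apply: (@le_trans _ _ (u `^ be)); last by rewrite lerDl powR_ge0.
  by apply: ge0_ler_powR; rewrite ?nnegrE// ltW.
apply: (@le_trans _ _ ((T - u) `^ be)); last by rewrite lerDr powR_ge0.
apply: ge0_ler_powR; rewrite ?nnegrE ?(subr_ge0 u T) ?(ltW be_gt0)//.
by have := T_gt0; lra.
Qed.

Lemma kernel_marginal_le u : 0 <= u <= T -> kernel_marginal u <= 2 * T `^ be / be.
Proof.
move=> /andP[u0 uT]; rewrite ler_wpM2r ?invr_ge0 ?(ltW be_gt0)//.
rewrite !ger0_norm ?subr_ge0//.
rewrite mulrDl !mul1r lerD//; apply: ge0_ler_powR; rewrite ?nnegrE ?(subr_ge0 u T) ?(ltW be_gt0) ?(ltW T_gt0)//.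
by rewrite gerBl.
Qed.

(** By homogeneity this is 1 <= z^r + (1 - z)^r for z in [0, 1], and both terms dominate their
    bases. *)
Lemma powR_holder (x y r : R) : 0 <= r <= 1 -> 0 <= x -> x <= y -> y `^ r - x `^ r <= (y - x) `^ r.
Proof.
move=> /andP[r0 r1] x0; rewrite le_eqVlt => /predU1P[->|xy].
  by rewrite subrr powR_ge0.
have y0 : 0 < y by exact: le_lt_trans xy.
have sub z : 0 <= z -> z <= 1 -> z <= z `^ r.
  move=> z0 z1; have [->|zn] := eqVneq z 0; first exact: powR_ge0.
  have zp : 0 < z by rewrite lt_neqAle eq_sym zn.
  by rewrite -[leLHS](powRr1 z0); apply: ger_powR; rewrite ?zp.
pose z := x / y.
have zE : x = y * z by rewrite /z mulrCA divff ?gt_eqF// mulr1.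
have z0 : 0 <= z by rewrite divr_ge0// ltW.
have z1 : z <= 1 by rewrite ler_pdivrMr// mul1r ltW.
have -> : y - x = y * (1 - z) by rewrite mulrBr mulr1 -zE.
clearbody z; rewrite zE !powRM ?subr_ge0 ?(ltW y0)//.
rewrite -[X in X - _]mulr1 -mulrBr ler_wpM2l ?powR_ge0//.
have H1 := sub _ z0 z1; have H2 := sub (1 - z).
have := H2 _ _; rewrite subr_ge0 gerBl => /(_ z1 z0); lra.
Qed.

Lemma kernel_marginal_holder u v : 0 <= u <= T -> 0 <= v <= T ->
  `|kernel_marginal u - kernel_marginal v| <= 2 * `|u - v| `^ be / be.
Proof.
have b01 : 0 <= be <= 1 by rewrite !ltW.
have hol (x y : R) : 0 <= x -> 0 <= y -> `| x `^ be - y `^ be | <= `|x - y| `^ be.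
  move=> x0 y0; wlog xy : x y x0 y0 / x <= y.
    by move=> W; have [/W->//|/ltW/W] := leP x y; rewrite distrC (distrC y) => ->.
  rewrite distrC (distrC x) !ger0_norm ?subr_ge0//; first exact: powR_holder.
  by apply: ge0_ler_powR; rewrite ?nnegrE// ltW.
move=> /andP[u0 uT] /andP[v0 vT].
rewrite /kernel_marginal -mulrBl normrM (@ger0_norm _ be^-1) ?invr_ge0 ?(ltW be_gt0)//.
rewrite ler_wpM2r ?invr_ge0 ?(ltW be_gt0)//.
rewrite (ger0_norm u0) (ger0_norm v0) (@ger0_norm _ (T - u)) ?(subr_ge0 u)// (@ger0_norm _ (T - v)) ?(subr_ge0 v)//.
have := hol u v u0 v0; have := hol (T - u) (T - v).
rewrite (subr_ge0 u) (subr_ge0 v) => /(_ uT vT).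
have -> : T - u - (T - v) = v - u by ring.
rewrite (distrC v).
have := ler_normD (u `^ be - v `^ be) ((T - u) `^ be - (T - v) `^ be).
have -> : u `^ be - v `^ be + ((T - u) `^ be - (T - v) `^ be) =
  u `^ be + (T - u) `^ be - (v `^ be + (T - v) `^ be) by ring.
lra.
Qed.

Lemma ge0_integral_rect2 (A B : set R) (f : RR -> R) : measurable A -> measurable B ->
  measurable_fun setT f -> (forall z, 0 <= f z) ->
  (\int[mu \x mu]_(z in A `*` B) (f z)%:E = \int[mu]_(y in B) \int[mu]_(x in A) (f (x, y))%:E)%E.
Proof.
move=> mA mB mf f0.
have m1 : measurable_fun setT (fun z : RR => (\1_A z.1 * (\1_B z.2 * f z))%R).
  apply: measurable_funM.
    by apply: (@measurableT_comp _ _ _ _ _ _ (\1_A : R -> R)); [exact: measurable_indic|exact: measurable_fst].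
  apply: measurable_funM => //.
  by apply: (@measurableT_comp _ _ _ _ _ _ (\1_B : R -> R)); [exact: measurable_indic|exact: measurable_snd].
pose h (z : RR) := ((\1_A z.1 * (\1_B z.2 * f z))%:E : \bar R).
have mh : measurable_fun setT h by exact/measurable_EFinP.
have h0 z : (0 <= h z)%E by rewrite lee_fin !mulr_ge0.
rewrite (ge0_integral_rect mA mB mf f0).
transitivity (\int[mu]_x \int[mu]_y h (x, y))%E.
  rewrite integral_mkcond; apply: eq_integral => x _.
  rewrite patchE /h/= indicE; case: (x \in A) => /=; last first.
    by under [RHS]eq_integral do rewrite mul0r; rewrite integral0.
  rewrite integral_mkcond; apply: eq_integral => y _.
  by rewrite patchE mul1r indicE; case: (y \in B); rewrite ?mul1r ?mul0r.
rewrite (fubini_tonelli h mh h0).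
rewrite [RHS]integral_mkcond; apply: eq_integral => y _.
rewrite patchE /h/=; under [LHS]eq_integral do rewrite (indicE _ B y).
case: (y \in B) => /=; last first.
  by under eq_integral do rewrite mul0r mulr0; rewrite integral0.
rewrite [RHS]integral_mkcond; apply: eq_integral => x _.
by rewrite patchE mul1r indicE; case: (x \in A); rewrite ?mul1r ?mul0r.
Qed.

Lemma measurable_rect_marginal (B : set R) (f : RR -> R) : measurable B ->
  measurable_fun setT f -> (forall z, 0 <= f z) ->
  measurable_fun setT (fun x : R => \int[mu]_(y in B) (f (x, y))%:E)%E.
Proof.
move=> mB mf f0.
have mh : measurable_fun setT (fun z : RR => ((\1_B z.2 * f z)%:E : \bar R)).
  apply/measurable_EFinP; apply: measurable_funM => //.
  by apply: (@measurableT_comp _ _ _ _ _ _ (\1_B : R -> R)); [exact: measurable_indic|exact: measurable_snd].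
have h0 (z : RR) : (0 <= (\1_B z.2 * f z)%:E :> \bar R)%E by rewrite lee_fin mulr_ge0.
rewrite (_ : (fun x => _) = fubini_F mu (fun z : RR => ((\1_B z.2 * f z)%:E : \bar R))).
  exact: measurable_fun_fubini_tonelli_F.
apply/funext => x; rewrite /fubini_F [LHS]integral_mkcond.
apply: eq_integral => y _; rewrite patchE/= indicE.
by case: (y \in B); rewrite ?mul1r ?mul0r.
Qed.

Lemma rect_integrable (f : RR -> R) : measurable_fun setT f -> (forall z, 0 <= f z) ->
  (\int[mu \x mu]_(z in D) (f z)%:E < +oo)%E -> (mu \x mu)%E.-integrable D (EFin \o f).
Proof.
move=> mf f0 fi; apply/integrableP; split.
  by apply/measurable_EFinP; exact: measurable_funTS.
by under eq_integral do rewrite /= ger0_norm//.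
Qed.

(** Schur's test with the weight (b - u)^th, for some be < th < 1: the product g(u) g(v) is split by
    Young's inequality into two terms exchanged by symmetry, and [weighted_kernel_bound] integrates
    the free variable. The resulting weighted L^2 norm still admits a singularity (b - u)^(alpha -
    1), because 2 (alpha - 1) + 2 H - 1 > -1 is the assumption alpha > 1 - H. *)
Lemma schur_bound : exists2 C : R, 0 < C & forall (g : R -> R) (b : R), 0 <= b <= T ->
  measurable_fun setT g -> (forall u, 0 <= g u) -> (forall u, b <= u -> g u = 0) ->
  (\int[mu \x mu]_(z in D) (g z.1 * g z.2 * K z)%:E <=
   C%:E * \int[mu]_(u in `[0%R, T]) (g u ^+ 2 * `|b - u| `^ be)%:E)%E.
Proof.
pose th := (1 + be) / 2.
have bth : be < th by rewrite /th; move: be_lt1; lra.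
have th1 : th < 1 by rewrite /th; move: be_lt1; lra.
have [C C0 HC] := weighted_kernel_bound be_gt0 be_lt1 bth th1.
exists C => // g b /andP[b0 bT] mg g0 gb.
pose F (z : RR) : R := 2^-1 * (g z.1 ^+ 2 * `|b - z.1| `^ th) *
  (`|b - z.2| `^ (- th) * K z * \1_(`[0, b]%classic : set R) z.2).
have F0 z : 0 <= F z by rewrite !mulr_ge0 ?sqr_ge0 ?invr_ge0 ?powR_ge0.
have m1 : measurable_fun setT (fun z : RR => z.1) by exact: measurable_fst.
have m2 : measurable_fun setT (fun z : RR => z.2) by exact: measurable_snd.
have mg1 := measurableT_comp mg m1.
have mg2 := measurableT_comp mg m2.
have md1 r := measurableT_comp (measurable_dist_powR b r) m1.
have md2 r := measurableT_comp (measurable_dist_powR b r) m2.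
have mi2 : measurable_fun setT (fun z : RR => \1_(`[0, b]%classic : set R) z.2 : R).
  apply: (@measurableT_comp _ _ _ _ _ _ (\1_(`[0, b]%classic : set R) : R -> R)); last exact: m2.
  by apply: measurable_indic; exact: measurable_itv.
have mF : measurable_fun setT F.
  apply: measurable_funM.
    apply: measurable_funM; first exact: measurable_cst.
    by apply: measurable_funM; [exact: measurable_funX|exact: (md1 th)].
  apply: measurable_funM => //; apply: measurable_funM; first exact: (md2 (- th)).
  exact: measurable_fbm_kernel.
pose F' (z : RR) := F (z.2, z.1).
have mF' : measurable_fun setT F'.
  by apply: (measurableT_comp mF); apply: measurable_fun_pair.
have mI : measurable (`[0, T] : set R) by exact: measurable_itv.
have step1 z : D z -> g z.1 * g z.2 * K z <= F z + F' z.
  case: z => u v /= [+ +]; rewrite !in_itv/= => /andP[u0 uT] /andP[v0 vT].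
  have [bu|ub] := leP b u; first by rewrite (gb u)// !mul0r; apply: addr_ge0; exact: F0.
  have [bv|vb] := leP b v; first by rewrite (gb v)// mulr0 mul0r; apply: addr_ge0; exact: F0.
  rewrite /F' /F/= !indicE !mem_set/= ?in_itv/= ?u0 ?v0 ?(ltW ub) ?(ltW vb)//.
  rewrite !mulr1 !powRN.
  have -> : K (v, u) = K (u, v) by rewrite /fbm_kernel/= distrC.
  have bu0 : 0 < b - u by rewrite subr_gt0.
  have bv0 : 0 < b - v by rewrite subr_gt0.
  rewrite !gtr0_norm//.
  set a := (b - u) `^ th; set a' := (b - v) `^ th; set k := K (u, v).
  have a0 : 0 < a by exact: powR_gt0.
  have a'0 : 0 < a' by exact: powR_gt0.
  (* The excess of the two halves over the product is a square times the kernel, divided by twice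
     the product of the weights. *)
  rewrite -subr_ge0.
  have -> : 2^-1 * (g u ^+ 2 * a) * (a'^-1 * k) + 2^-1 * (g v ^+ 2 * a') * (a^-1 * k) -
     g u * g v * k = (g u * a - g v * a') ^+ 2 * k / (2 * a * a').
    by field; rewrite !gt_eqF.
  have k0 : 0 <= k by exact: fbm_kernel_ge0.
  apply: divr_ge0; first by apply: mulr_ge0 => //; exact: sqr_ge0.
  by rewrite !mulr_ge0 ?(ltW a0) ?(ltW a'0).
pose S := (\int[mu]_(u in `[0%R, T]) (g u ^+ 2 * `|b - u| `^ be)%:E)%E.
have mS : measurable_fun (`[0, T] : set R) (fun u => (g u ^+ 2 * `|b - u| `^ be)%:E).
  apply/measurable_EFinP; apply: measurable_funTS.
  by apply: measurable_funM; [exact: measurable_funX|exact: measurable_dist_powR].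
have inner u : 0 <= u <= T ->
  (\int[mu]_(v in `[0%R, T]) (F (u, v))%:E <= (2^-1 * C)%:E * (g u ^+ 2 * `|b - u| `^ be)%:E)%E.
  move=> /andP[u0 uT].
  have [bu|ub] := leP b u.
    rewrite gb// expr0n/= mul0r mule0; under eq_integral do rewrite /F/= gb// expr0n/= mul0r mulr0 mul0r.
    by rewrite integral0.
  pose c := 2^-1 * (g u ^+ 2 * `|b - u| `^ th).
  have c0 : 0 <= c by rewrite !mulr_ge0 ?sqr_ge0 ?invr_ge0 ?powR_ge0.
  have mk : measurable_fun setT (fun v : R => `|b - v| `^ (- th) * `|u - v| `^ (be - 1)).
    by apply: measurable_funM; exact: measurable_dist_powR.
  have := @integral_indic_le R _ _ c _ mI (measurable_itv `[0, b]%R) c0 mk.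
  have -> : (\int[mu]_(v in `[0%R, T]) (c * (`|b - v| `^ (- th) * `|u - v| `^ (be - 1)) * \1_(`[0, b]%classic : set R) v)%:E =
    \int[mu]_(v in `[0%R, T]) (F (u, v))%:E)%E.
    by apply: eq_integral => v _; rewrite /F/= fbm_kernelE -/c; congr (_%:E); ring.
  move=> H1; apply: (le_trans (H1 _)) => [v|]; first by rewrite mulr_ge0 ?powR_ge0.
  have c0' : (0 <= c%:E)%E by rewrite lee_fin.
  apply: (le_trans (lee_wpmul2l c0' (HC 0 b u b0 ub))).
  rewrite -!EFinM lee_fin /c.
  have bu0 : 0 < b - u by rewrite subr_gt0.
  rewrite gtr0_norm//.
  have -> : (b - u) `^ be = (b - u) `^ th * (b - u) `^ (be - th).
    rewrite -powRD; first by congr (_ `^ _); ring.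
    by rewrite (gt_eqF bu0) implybT.
  by rewrite le_eqVlt; apply/orP; left; apply/eqP; ring.
have half (G : R -> \bar R) : (forall u, G u = \int[mu]_(v in `[0%R, T]) (F (u, v))%:E)%E ->
  (\int[mu]_(u in `[0%R, T]) G u <= (2^-1 * C)%:E * S)%E.
  move=> FG; rewrite /S -ge0_integralZl//; last 2 first.
  - by move=> u _; rewrite lee_fin mulr_ge0 ?sqr_ge0 ?powR_ge0.
  - by rewrite lee_fin mulr_ge0 ?invr_ge0// ltW.
  apply: ge0_le_integral => //.
  - by move=> u _; rewrite FG; apply: integral_ge0 => v _; rewrite lee_fin.
  - apply: measurable_funTS; rewrite (_ : G = fun u => \int[mu]_(v in `[0%R, T]) (F (u, v))%:E)%E; last exact/funext.
    exact: measurable_rect_marginal.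
  - by apply: measurable_funeM.
  - by move=> u; rewrite /= in_itv/= FG => /inner.
have E1 : (\int[mu \x mu]_(z in D) (F z)%:E <= (2^-1 * C)%:E * S)%E.
  by rewrite ge0_integral_rect//; exact: (half (fun u => \int[mu]_(v in `[0%R, T]) (F (u, v))%:E)%E).
have E2 : (\int[mu \x mu]_(z in D) (F' z)%:E <= (2^-1 * C)%:E * S)%E.
  rewrite ge0_integral_rect2//; last by move=> z; exact: F0.
  exact: (half (fun u => \int[mu]_(v in `[0%R, T]) (F (u, v))%:E)%E).
have mD : measurable (D : set RR) by exact: measurableX.
have mgK : measurable_fun setT (fun z : RR => g z.1 * g z.2 * K z).
  by apply: measurable_funM; [exact: measurable_funM|exact: measurable_fbm_kernel].
apply: (@le_trans _ _ (\int[mu \x mu]_(z in D) ((F z)%:E + (F' z)%:E))%E).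
  apply: ge0_le_integral => //.
  - by move=> z _; rewrite lee_fin !mulr_ge0 ?powR_ge0.
  - by apply/measurable_EFinP; exact: measurable_funTS.
  - by apply: emeasurable_funD; apply/measurable_EFinP; exact: measurable_funTS.
rewrite ge0_integralD//; last 4 first.
- by move=> z _; rewrite lee_fin.
- by apply/measurable_EFinP; exact: measurable_funTS.
- by move=> z _; rewrite lee_fin; exact: F0.
- by apply/measurable_EFinP; exact: measurable_funTS.
apply: (le_trans (leeD E1 E2)).
have S0 : (0 <= S)%E by apply: integral_ge0 => u _; rewrite lee_fin mulr_ge0 ?sqr_ge0 ?powR_ge0.
rewrite -ge0_muleDl ?lee_fin ?mulr_ge0 ?invr_ge0 ?(ltW C0)//.
by rewrite -EFinD (_ : 2^-1 * C + 2^-1 * C = C)//; field.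
Qed.

End fbm_kernel_integrals.

(** * The Hilbert norm of increments of the fractional kernel *)

Section fractional_kernel_energy.
Context {R : realType} (T H al : R) (T_gt0 : 0 < T) (H_gt : 2^-1 < H) (H_lt1 : H < 1).
Context (al_gt : 1 - H < al) (al_lt1 : al < 1).
Local Notation mu := (@lebesgue_measure R).
Local Notation RR := (measurableTypeR R * measurableTypeR R)%type.
Local Notation D := ((`[0%R, T] : set R) `*` (`[0%R, T] : set R)).
Local Notation K := (fbm_kernel H).
Local Notation k := (frac_kernel al).

Let be : R := 2 * H - 1.
Let ab : R := al + H - 1.

Let be_gt0 : 0 < be.
Proof. by rewrite /be subr_gt0 -ltr_pdivrMl// mulr1. Qed.

Let al_gt0 : 0 < al. Proof. by apply: lt_trans al_gt; rewrite subr_gt0. Qed.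

Let ab_gt0 : 0 < ab. Proof. by move: al_gt; rewrite /ab; lra. Qed.

Let ab_lt1 : ab < 1. Proof. by move: al_lt1 H_lt1; rewrite /ab; lra. Qed.

Lemma frac_kernelE (t u : R) : k t u = `|t - u| `^ (al - 1) * \1_(`[0, t]%classic : set R) u.
Proof.
rewrite /frac_kernel mulrC indicE; have [|] := boolP (u \in _); last by rewrite !mulr0.
by rewrite inE/= in_itv/= => /andP[_ ut]; rewrite ger0_norm// subr_ge0.
Qed.

Lemma frac_kernel_ge0 (t u : R) : 0 <= k t u.
Proof. by rewrite frac_kernelE mulr_ge0 ?powR_ge0. Qed.

Lemma frac_kernel_lt (t u : R) : 0 <= u < t -> k t u = (t - u) `^ (al - 1).
Proof.
move=> /andP[u0 ut]; rewrite /frac_kernel indicE mem_set/= ?mul1r//.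
by rewrite in_itv/= u0 ltW.
Qed.

Lemma frac_kernel_out (t u : R) : t <= u -> k t u = 0.
Proof.
move=> tu; rewrite frac_kernelE; move: tu; rewrite le_eqVlt => /predU1P[->|tu].
  by rewrite subrr normr0 powR0 ?mul0r// subr_eq0 lt_eqF.
by rewrite indicE memNset ?mulr0//= in_itv/= (leNgt u) tu andbF.
Qed.

Lemma measurable_frac_kernel (t : R) : measurable_fun setT (k t : R -> R).
Proof.
rewrite (_ : k t = fun u => `|t - u| `^ (al - 1) * \1_(`[0, t]%classic : set R) u); last first.
  by apply/funext => u; exact: frac_kernelE.
apply: measurable_funM; first exact: measurable_dist_powR.
by apply: measurable_indic; exact: measurable_itv.
Qed.

Lemma integral_frac_kernel_le (t : R) : 0 <= t ->
  (\int[mu]_(u in `[0%R, T]) (k t u)%:E <= (t `^ al / al)%:E)%E.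
Proof.
move=> t0.
have a1 : al - 1 + 1 = al by ring.
have := @integral_indic_le R _ _ 1 (fun u => `|t - u| `^ (al - 1))
  (measurable_itv `[0, T]%R) (measurable_itv `[0, t]%R) ler01 (measurable_dist_powR _ _).
move=> /(_ (fun v => powR_ge0 _ _)).
rewrite mul1e integral_dist_powR_left ?a1 ?gt_eqF//; last by right.
rewrite subr0 subrr powR0 ?gt_eqF// subr0; apply: le_trans.
rewrite le_eqVlt; apply/orP; left; apply/eqP; apply: eq_integral => u _.
by rewrite mul1r frac_kernelE.
Qed.

Let mD : measurable (D : set RR).
Proof. by apply: measurableX; exact: measurable_itv. Qed.

Let mz1 : measurable_fun setT (fun z : RR => z.1). Proof. exact: measurable_fst. Qed.
Let mz2 : measurable_fun setT (fun z : RR => z.2). Proof. exact: measurable_snd. Qed.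

Lemma integral_marginal1 (g : R -> R) : measurable_fun setT g -> (forall u, 0 <= g u) ->
  (\int[mu \x mu]_(z in D) (g z.1 * K z)%:E =
   \int[mu]_(u in `[0%R, T]) (g u * kernel_marginal T H u)%:E)%E.
Proof.
move=> mg g0; rewrite ge0_integral_rect//; last 2 first.
- by apply: measurable_funM; [exact: measurableT_comp mz1|exact: measurable_fbm_kernel].
- by move=> z; rewrite mulr_ge0 ?fbm_kernel_ge0.
apply: eq_integral => u; rewrite inE/= in_itv/= => uT.
under eq_integral do rewrite EFinM.
rewrite ge0_integralZl//=; last 3 first.
- apply/measurable_EFinP; apply: measurable_funTS.
  rewrite (_ : (fun v => _) = fun v => `|u - v| `^ (be - 1)); first exact: measurable_dist_powR.
  by apply/funext => v; rewrite fbm_kernelE.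
- by move=> v _; rewrite lee_fin fbm_kernel_ge0.
- by rewrite lee_fin.
by rewrite (integral_fbm_kernel H_gt uT) EFinM.
Qed.

Lemma integral_marginal2 (g : R -> R) : measurable_fun setT g -> (forall u, 0 <= g u) ->
  (\int[mu \x mu]_(z in D) (g z.2 * K z)%:E =
   \int[mu]_(u in `[0%R, T]) (g u * kernel_marginal T H u)%:E)%E.
Proof.
move=> mg g0; rewrite -integral_marginal1//.
have mI : measurable (`[0%R, T]%classic : set R) by exact: measurable_itv.
have m1 : measurable_fun setT (fun z : RR => g z.1 * K z).
  by apply: measurable_funM; [exact: measurableT_comp mz1|exact: measurable_fbm_kernel].
have m2 : measurable_fun setT (fun z : RR => g z.2 * K z).
  by apply: measurable_funM; [exact: measurableT_comp mz2|exact: measurable_fbm_kernel].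
have n1 (z : RR) : 0 <= g z.1 * K z by rewrite mulr_ge0 ?fbm_kernel_ge0.
have n2 (z : RR) : 0 <= g z.2 * K z by rewrite mulr_ge0 ?fbm_kernel_ge0.
rewrite (ge0_integral_rect2 mI mI m2 n2) (ge0_integral_rect mI mI m1 n1).
by apply: eq_integral => v _; apply: eq_integral => u _; rewrite /= /fbm_kernel/= distrC.
Qed.

Lemma measurable_kernel_marginal : measurable_fun setT (kernel_marginal T H).
Proof.
apply: measurable_funM => //; apply: measurable_funD.
  rewrite (_ : (fun x => _) = fun x : R => `|0 - x| `^ (2 * H - 1)); first exact: measurable_dist_powR.
  by apply/funext => x; rewrite sub0r normrN.
exact: measurable_dist_powR.
Qed.

Lemma integral_marginal_lty (g : R -> R) : measurable_fun setT g -> (forall u, 0 <= g u) ->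
  (\int[mu]_(u in `[0%R, T]) (g u)%:E < +oo)%E ->
  (\int[mu]_(u in `[0%R, T]) (g u * kernel_marginal T H u)%:E < +oo)%E.
Proof.
move=> mg g0 gi; set C := 2 * T `^ be / be.
have C0 : 0 <= C by rewrite divr_ge0 ?mulr_ge0 ?powR_ge0// ltW.
apply: (@le_lt_trans _ _ (C%:E * \int[mu]_(u in `[0%R, T]) (g u)%:E)%E); last first.
  have : (0 <= \int[mu]_(u in `[0%R, T]) (g u)%:E)%E by apply: integral_ge0 => u _; rewrite lee_fin.
  by case: (\int[mu]_(u in _) _)%E gi => // r _ _; rewrite -EFinM ltry.
rewrite -ge0_integralZl//=; last 2 first.
- by apply/measurable_EFinP; exact: measurable_funTS.
- by move=> u _; rewrite lee_fin.
have p0 u : 0 <= u <= T -> 0 <= kernel_marginal T H u.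
  by move=> uT; apply: le_trans (kernel_marginal_ge T_gt0 H_gt uT); rewrite divr_ge0 ?powR_ge0// ltW.
apply: ge0_le_integral => //.
- by move=> u /=; rewrite in_itv/= => uT; rewrite lee_fin mulr_ge0 ?p0.
- apply/measurable_EFinP; apply: measurable_funTS.
  by apply: measurable_funM => //; exact: measurable_kernel_marginal.
- by apply: measurable_funeM; apply/measurable_EFinP; exact: measurable_funTS.
- move=> u /=; rewrite in_itv/= => uT; rewrite lee_fin mulrC ler_wpM2r//.
  exact: (kernel_marginal_le T_gt0 H_gt uT).
Qed.

Lemma marginal_integrable1 (g : R -> R) : measurable_fun setT g -> (forall u, 0 <= g u) ->
  (\int[mu]_(u in `[0%R, T]) (g u)%:E < +oo)%E ->
  (mu \x mu)%E.-integrable D (EFin \o (fun z : RR => g z.1 * K z)).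
Proof.
move=> mg g0 gi; apply: rect_integrable.
- by apply: measurable_funM; [exact: measurableT_comp mz1|exact: measurable_fbm_kernel].
- by move=> z; rewrite mulr_ge0 ?fbm_kernel_ge0.
- by rewrite integral_marginal1//; exact: integral_marginal_lty.
Qed.

Lemma marginal_integrable2 (g : R -> R) : measurable_fun setT g -> (forall u, 0 <= g u) ->
  (\int[mu]_(u in `[0%R, T]) (g u)%:E < +oo)%E ->
  (mu \x mu)%E.-integrable D (EFin \o (fun z : RR => g z.2 * K z)).
Proof.
move=> mg g0 gi; apply: rect_integrable.
- by apply: measurable_funM; [exact: measurableT_comp mz2|exact: measurable_fbm_kernel].
- by move=> z; rewrite mulr_ge0 ?fbm_kernel_ge0.
- by rewrite integral_marginal2//; exact: integral_marginal_lty.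
Qed.

(** With q = x / y, both bounds reduce to q <= q^(1 - al) <= 1, and no mean value point is
    involved. *)
Lemma powR_secant (x y : R) : 0 < x -> x <= y ->
  0 <= x `^ (al - 1) - y `^ (al - 1) <= (y - x) * x `^ (al - 2).
Proof.
move=> x0 xy.
have y0 : 0 < y by exact: lt_le_trans xy.
pose q := x / y.
have q0 : 0 < q by rewrite divr_gt0.
have q1 : q <= 1 by rewrite ler_pdivrMr// mul1r.
have xq : y = x / q by rewrite /q; field; rewrite !gt_eqF.
have yE : y `^ (al - 1) = x `^ (al - 1) * q `^ (1 - al).
  rewrite xq powRM ?(ltW x0) ?invr_ge0 ?(ltW q0)//; congr (_ * _).
  rewrite -powR_inv1 ?(ltW q0)// -powRrM; congr (_ `^ _); ring.
have qq : q <= q `^ (1 - al).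
  by rewrite -[leLHS](powRr1 (ltW q0)); apply: ger_powR; [rewrite q0|move: al_gt0; lra].
have qq1 : q `^ (1 - al) <= 1.
  rewrite -[leRHS](powRr0 q); apply: ger_powR; [by rewrite q0|by rewrite subr_ge0 ltW].
have xE : x `^ (al - 1) = x * x `^ (al - 2).
  rewrite -[X in X * _](powRr1 (ltW x0)) -powRD; first by congr (_ `^ _); ring.
  by rewrite (gt_eqF x0) implybT.
have p0 : 0 <= x `^ (al - 2) by exact: powR_ge0.
have p1 : 0 <= x `^ (al - 1) by exact: powR_ge0.
have -> : x `^ (al - 1) - y `^ (al - 1) = x `^ (al - 1) * (1 - q `^ (1 - al)) by rewrite yE; ring.
apply/andP; split; first by rewrite mulr_ge0// subr_ge0.
apply: (@le_trans _ _ (x `^ (al - 1) * (1 - q))); first by rewrite ler_wpM2l// lerB.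
rewrite xE mulrAC; apply: ler_wpM2r => //.
have yq : y - x = y * (1 - q) by rewrite /q; field; rewrite gt_eqF.
by rewrite yq ler_wpM2r// subr_ge0.
Qed.

(** For s <= t the increment k_t - k_s is a difference of two nonnegative functions with disjoint
    supports: this one on [s, t], singular at t, and [increment_before] on [0, s), singular at s.
    Each is fed to [schur_bound] with its own singular point. *)
Definition increment_after (s t u : R) : R := k t u * \1_(`[s, t]%classic : set R) u.

Definition increment_before (s t u : R) : R := (k s u - k t u) * \1_(`[0%R, s[%classic : set R) u.

Lemma increment_split (s t u : R) : 0 <= s -> s <= t -> 0 <= u ->
  k t u - k s u = increment_after s t u - increment_before s t u.
Proof.
move=> s0 st u0; rewrite /increment_after /increment_before !indicE.
have [us|su] := ltP u s.
  rewrite memNset ?mulr0 ?sub0r; last by rewrite /= in_itv/= leNgt us.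
  by rewrite mem_set/= ?in_itv/= ?u0// mulr1 opprB.
have -> : (u \in `[0%R, s[%classic) = false.
  by apply: memNset; rewrite /= in_itv/= (ltNge u) su andbF.
rewrite mulr0 subr0 (frac_kernel_out su) subr0.
have [ut|tu] := leP u t; first by rewrite mem_set ?mulr1//= in_itv/= su.
by rewrite frac_kernel_out ?mul0r// ltW.
Qed.

Lemma increment_after_ge0 s t u : 0 <= increment_after s t u.
Proof. by rewrite mulr_ge0 ?frac_kernel_ge0. Qed.

Lemma increment_before_ge0 s t u : s <= t -> 0 <= increment_before s t u.
Proof.
move=> st; rewrite /increment_before indicE; have [|] := boolP (u \in _); last by rewrite mulr0.
rewrite inE/= in_itv/= => /andP[u0 us]; rewrite mulr1.
rewrite !frac_kernel_lt ?u0//; last exact: lt_le_trans st.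
have us0 : 0 < s - u by rewrite subr_gt0.
by have /andP[] := powR_secant us0 (lerB st (lexx u)).
Qed.

Lemma measurable_increment_after s t : measurable_fun setT (increment_after s t).
Proof.
apply: measurable_funM; first exact: measurable_frac_kernel.
by apply: measurable_indic; exact: measurable_itv.
Qed.

Lemma measurable_increment_before s t : measurable_fun setT (increment_before s t).
Proof.
apply: measurable_funM; first by apply: measurable_funB; exact: measurable_frac_kernel.
by apply: measurable_indic; exact: measurable_itv.
Qed.

Lemma increment_after_energy (s t : R) : 0 <= s -> s <= t ->
  (\int[mu]_(u in `[0%R, T]) (increment_after s t u ^+ 2 * `|t - u| `^ be)%:E <=
   ((t - s) `^ (2 * ab) / (2 * ab))%:E)%E.
Proof.
move=> s0 st.
have a1 : 2 * ab - 1 + 1 = 2 * ab by ring.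
have ab2 : 0 < 2 * ab by rewrite mulr_gt0.
have := @integral_indic_le R _ _ 1 (fun u => `|t - u| `^ (2 * ab - 1))
  (measurable_itv `[0, T]%R) (measurable_itv `[s, t]%R) ler01 (measurable_dist_powR _ _).
move=> /(_ (fun v => powR_ge0 _ _)).
rewrite mul1e integral_dist_powR_left ?a1 ?gt_eqF//; last by right.
rewrite subrr powR0 ?gt_eqF// subr0; apply: le_trans.
apply: ge0_le_integral => //.
- by move=> u _; rewrite lee_fin mulr_ge0 ?sqr_ge0 ?powR_ge0.
- apply/measurable_EFinP; apply: measurable_funTS; apply: measurable_funM.
    by apply: measurable_funX; exact: measurable_increment_after.
  exact: measurable_dist_powR.
- apply/measurable_EFinP; apply: measurable_funTS; apply: measurable_funM.
    by apply: measurable_funM; [exact: measurable_cst|exact: measurable_dist_powR].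
  by apply: measurable_indic; exact: measurable_itv.
- move=> u /=; rewrite in_itv/= => /andP[u0 uT]; rewrite lee_fin mul1r.
  rewrite /increment_after; have [tu|ut] := leP t u.
    by rewrite frac_kernel_out// mul0r expr0n/= mul0r mulr_ge0 ?powR_ge0.
  rewrite frac_kernel_lt ?u0// indicE; case: (u \in _) => /=; last by rewrite !mulr0 expr0n/= mul0r.
  have tu0 : 0 < t - u by rewrite subr_gt0.
  rewrite !mulr1 (gtr0_norm tu0) expr2 -!powRD ?(gt_eqF tu0) ?implybT//.
  by rewrite (_ : al - 1 + (al - 1) + be = 2 * ab - 1)// /be /ab; ring.
Qed.

(** Within distance t - s of the singularity only the size (s - u)^(al - 1) is used. Farther away
    the secant bound takes over; its contribution (t - s)^2 (s - u)^(2 ab - 3) is integrable at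
    infinity because ab < 1. *)
Lemma increment_before_energy (s t : R) : 0 <= s -> s < t ->
  (\int[mu]_(u in `[0%R, T]) (increment_before s t u ^+ 2 * `|s - u| `^ be)%:E <=
   ((t - s) `^ (2 * ab) / (2 * ab) + (t - s) `^ (2 * ab) / (2 - 2 * ab))%:E)%E.
Proof.
move=> s0 st; set tau := t - s.
have tau0 : 0 < tau by rewrite subr_gt0.
have a1 : 2 * ab - 1 + 1 = 2 * ab by ring.
have ab2 : 0 < 2 * ab by rewrite mulr_gt0.
have ab2' : 2 * ab < 2 by move: ab_lt1; lra.
pose f1 u := 1 * `|s - u| `^ (2 * ab - 1) * \1_(`[s - tau, s]%classic : set R) u.
pose f2 u := tau ^+ 2 * `|s - u| `^ (2 * ab - 3) * \1_(`[0%R, s - tau]%classic : set R) u.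
have p0 r u : 0 <= `|s - u| `^ r by exact: powR_ge0.
have mf1 : measurable_fun setT f1.
  apply: measurable_funM; last by apply: measurable_indic; exact: measurable_itv.
  by apply: measurable_funM; [exact: measurable_cst|exact: measurable_dist_powR].
have mf2 : measurable_fun setT f2.
  apply: measurable_funM; last by apply: measurable_indic; exact: measurable_itv.
  by apply: measurable_funM; [exact: measurable_cst|exact: measurable_dist_powR].
have f10 u : 0 <= f1 u by rewrite !mulr_ge0.
have f20 u : 0 <= f2 u.
  by apply: mulr_ge0 => //; apply: mulr_ge0 => //; exact: sqr_ge0.
have E1 : (\int[mu]_(u in `[0%R, T]) (f1 u)%:E <= (tau `^ (2 * ab) / (2 * ab))%:E)%E.
  have := @integral_indic_le R _ _ 1 (fun u => `|s - u| `^ (2 * ab - 1))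
    (measurable_itv `[0, T]%R) (measurable_itv `[s - tau, s]%R) ler01 (measurable_dist_powR _ _) (p0 _).
  rewrite mul1e integral_dist_powR_left ?a1 ?gt_eqF// ?gerBl ?(ltW tau0)//; last by right.
  by rewrite subrr powR0 ?gt_eqF// subr0 (_ : s - (s - tau) = tau)//; ring.
have E2 : (\int[mu]_(u in `[0%R, T]) (f2 u)%:E <= (tau `^ (2 * ab) / (2 - 2 * ab))%:E)%E.
  have := @integral_indic_le R _ _ (tau ^+ 2) (fun u => `|s - u| `^ (2 * ab - 3))
    (measurable_itv `[0, T]%R) (measurable_itv `[0, s - tau]%R) (sqr_ge0 _) (measurable_dist_powR _ _) (p0 _).
  move=> H1; apply: (le_trans H1) => {H1}.
  have [h|h] := leP 0 (s - tau); last first.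
    rewrite set_itv_ge ?bnd_simp -?ltNge// integral_set0 mule0 lee_fin.
    by rewrite divr_ge0 ?powR_ge0// subr_ge0 ltW.
  have a3 : 2 * ab - 3 + 1 = 2 * ab - 2 by ring.
  have n0 : 2 * ab - 2 != 0 by rewrite subr_eq0 lt_eqF.
  rewrite integral_dist_powR_left ?a3//; last 2 first.
  - by rewrite gerBl ltW.
  - by left; rewrite ltrBlDr ltrDl.
  rewrite -EFinM lee_fin subr0 (_ : s - (s - tau) = tau); last by ring.
  have -> : tau `^ (2 * ab) = tau ^+ 2 * tau `^ (2 * ab - 2).
    rewrite -powR_mulrn ?(ltW tau0)// -powRD; first by congr (_ `^ _); ring.
    by rewrite (gt_eqF tau0) implybT.
  rewrite -mulrA ler_wpM2l ?sqr_ge0//.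
  have -> : (s `^ (2 * ab - 2) - tau `^ (2 * ab - 2)) / (2 * ab - 2) =
     tau `^ (2 * ab - 2) / (2 - 2 * ab) - s `^ (2 * ab - 2) / (2 - 2 * ab).
    by field; rewrite n0 subr_eq0 gt_eqF.
  by rewrite gerBl divr_ge0 ?powR_ge0// subr_ge0 ltW.
rewrite EFinD; apply: le_trans (leeD E1 E2).
rewrite -ge0_integralD//; last 4 first.
- by move=> u _; rewrite lee_fin.
- by apply/measurable_EFinP; exact: measurable_funTS.
- by move=> u _; rewrite lee_fin.
- by apply/measurable_EFinP; exact: measurable_funTS.
apply: ge0_le_integral => //.
- by move=> u _; rewrite lee_fin mulr_ge0 ?sqr_ge0 ?powR_ge0.
- apply/measurable_EFinP; apply: measurable_funTS; apply: measurable_funM.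
    by apply: measurable_funX; exact: measurable_increment_before.
  exact: measurable_dist_powR.
- by apply: emeasurable_funD; apply/measurable_EFinP; exact: measurable_funTS.
move=> u /=; rewrite in_itv/= => /andP[u0 uT]; rewrite -EFinD lee_fin.
have [su|us] := leP s u.
  rewrite /increment_before indicE memNset ?mulr0 ?expr0n/= ?mul0r ?addr_ge0//.
  by rewrite in_itv/= (ltNge u) su andbF.
have us0 : 0 < s - u by rewrite subr_gt0.
have st' := lerB (ltW st) (lexx u).
have /andP[B0 B1] := powR_secant us0 st'.
have tauE : t - u - (s - u) = tau by rewrite /tau; ring.
rewrite tauE in B1.
have -> : increment_before s t u = (s - u) `^ (al - 1) - (t - u) `^ (al - 1).
  rewrite /increment_before indicE mem_set ?mulr1/= ?in_itv/= ?u0//.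
  by rewrite !frac_kernel_lt ?u0//; exact: lt_trans st.
set B := _ - _ in B0 B1 *.
have B2 : B <= (s - u) `^ (al - 1) by rewrite /B gerBl powR_ge0.
rewrite (gtr0_norm us0).
have pp (a b c : R) : a + a + b = c -> ((s - u) `^ a) ^+ 2 * (s - u) `^ b = (s - u) `^ c.
  by move=> <-; rewrite expr2 -!powRD ?(gt_eqF us0) ?implybT.
have [h|h] := leP (s - tau) u.
  apply: (@le_trans _ _ (f1 u)); last by rewrite lerDl.
  rewrite /f1 indicE mem_set/= ?in_itv/= ?h ?(ltW us)// mulr1 mul1r (gtr0_norm us0).
  rewrite -(pp (al - 1) be (2 * ab - 1)); last by rewrite /be /ab; ring.
  by rewrite ler_wpM2r ?powR_ge0// lerXn2r// nnegrE powR_ge0.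
apply: (@le_trans _ _ (f2 u)); last by rewrite lerDr.
rewrite /f2 indicE mem_set/= ?in_itv/= ?u0 ?(ltW h)// mulr1 (gtr0_norm us0).
rewrite -(pp (al - 2) be (2 * ab - 3)); last by rewrite /be /ab; ring.
rewrite mulrA -exprMn ler_wpM2r ?powR_ge0// lerXn2r// nnegrE.
by rewrite mulr_ge0 ?powR_ge0// ltW.
Qed.

(** The increment is A - B with A and B nonnegative, and the kernel is nonnegative, so the cross
    terms only lower the norm; A and B are then estimated separately. *)
Lemma fbm_inner_increment : exists2 C : R, 0 < C & forall s t : R,
  0 <= s -> s <= t -> t <= T -> fbm_integrable T H (k t \- k s) (k t \- k s) ->
  fbm_inner T H (k t \- k s) (k t \- k s) <= C * (t - s) `^ (2 * ab).
Proof.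
have [C C0 HC] := schur_bound T H_gt H_lt1.
have ab2 : 0 < 2 * ab by rewrite mulr_gt0.
have ab2' : 0 < 2 - 2 * ab by move: ab_lt1; lra.
have H0 : 0 < H by apply: lt_trans H_gt; rewrite invr_gt0.
pose Q := H * be * (C * (2 * (2 * ab)^-1 + (2 - 2 * ab)^-1)).
have Q0 : 0 < Q by rewrite !mulr_gt0// addr_gt0 ?mulr_gt0 ?invr_gt0.
exists Q => // s t s0; rewrite le_eqVlt => /predU1P[<- _ _|st tT fi].
  rewrite /fbm_inner [X in _ * X](_ : _ = 0) ?mulr0; last first.
    by rewrite /Rintegral integral0_eq// => z _ /=; rewrite !subrr !mul0r.
  by rewrite mulr_ge0 ?powR_ge0// ltW.
pose A := increment_after s t; pose B := increment_before s t.
have sT : s <= T by apply: ltW; exact: lt_le_trans tT.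
have t0 : 0 <= t by rewrite (le_trans s0)// ltW.
have A0 u : 0 <= A u by exact: increment_after_ge0.
have B0 u : 0 <= B u by apply: increment_before_ge0; exact: ltW.
have mA : measurable_fun setT A by exact: measurable_increment_after.
have mB : measurable_fun setT B by exact: measurable_increment_before.
have EA : (\int[mu \x mu]_(z in D) (A z.1 * A z.2 * K z)%:E <=
    (C * ((t - s) `^ (2 * ab) / (2 * ab)))%:E)%E.
  apply: (le_trans (HC A t _ mA A0 _)) => [|u tu|]; first by rewrite t0.
    by rewrite /A /increment_after frac_kernel_out ?mul0r.
  rewrite EFinM; apply: lee_wpmul2l; first by rewrite lee_fin ltW.
  by apply: increment_after_energy => //; exact: ltW.
have EB : (\int[mu \x mu]_(z in D) (B z.1 * B z.2 * K z)%:E <=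
    (C * ((t - s) `^ (2 * ab) / (2 * ab) + (t - s) `^ (2 * ab) / (2 - 2 * ab)))%:E)%E.
  apply: (le_trans (HC B s _ mB B0 _)) => [|u tu|]; first by rewrite s0.
    by rewrite /B /increment_before indicE memNset ?mulr0//= in_itv/= (ltNge u) tu andbF.
  rewrite EFinM; apply: lee_wpmul2l; first by rewrite lee_fin ltW.
  exact: increment_before_energy.
have mAK : measurable_fun setT (fun z : RR => A z.1 * A z.2 * K z).
  apply: measurable_funM; last exact: measurable_fbm_kernel.
  by apply: measurable_funM; [exact: measurableT_comp mz1|exact: measurableT_comp mz2].
have mBK : measurable_fun setT (fun z : RR => B z.1 * B z.2 * K z).
  apply: measurable_funM; last exact: measurable_fbm_kernel.
  by apply: measurable_funM; [exact: measurableT_comp mz1|exact: measurableT_comp mz2].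
have AK0 z : 0 <= A z.1 * A z.2 * K z by apply: mulr_ge0; [exact: mulr_ge0|exact: fbm_kernel_ge0].
have BK0 z : 0 <= B z.1 * B z.2 * K z by apply: mulr_ge0; [exact: mulr_ge0|exact: fbm_kernel_ge0].
have iA : (mu \x mu)%E.-integrable D (EFin \o (fun z : RR => A z.1 * A z.2 * K z)).
  by apply: rect_integrable => //; apply: (le_lt_trans EA); exact: ltry.
have iB : (mu \x mu)%E.-integrable D (EFin \o (fun z : RR => B z.1 * B z.2 * K z)).
  by apply: rect_integrable => //; apply: (le_lt_trans EB); exact: ltry.
have rA : \int[(mu \x mu)%E]_(z in D) (A z.1 * A z.2 * K z) <= C * ((t - s) `^ (2 * ab) / (2 * ab)).
  by rewrite -lee_fin /Rintegral fineK//; exact: integrable_fin_num.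
have rB : \int[(mu \x mu)%E]_(z in D) (B z.1 * B z.2 * K z) <=
    C * ((t - s) `^ (2 * ab) / (2 * ab) + (t - s) `^ (2 * ab) / (2 - 2 * ab)).
  by rewrite -lee_fin /Rintegral fineK//; exact: integrable_fin_num.
rewrite /fbm_inner -/be /Q -(mulrA (H * be)); apply: ler_wpM2l; first by rewrite mulr_ge0 ?(ltW H0) ?(ltW be_gt0).
apply: (@le_trans _ _ (\int[(mu \x mu)%E]_(z in D) (A z.1 * A z.2 * K z + B z.1 * B z.2 * K z))).
  apply: le_Rintegral => //.
    exact: (integrableD mD iA iB).
  move=> z /= [] ; rewrite !in_itv/= => /andP[u0 _] /andP[v0 _].
  rewrite !(increment_split s0 (ltW st))// -/A -/B -mulrDl ler_wpM2r ?fbm_kernel_ge0//.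
  rewrite -subr_ge0.
  have -> : A z.1 * A z.2 + B z.1 * B z.2 - (A z.1 - B z.1) * (A z.2 - B z.2) =
    A z.1 * B z.2 + B z.1 * A z.2 by ring.
  by apply: addr_ge0; exact: mulr_ge0.
rewrite RintegralD//; apply: (le_trans (lerD rA rB)).
by rewrite le_eqVlt; apply/orP; left; apply/eqP; ring.
Qed.

End fractional_kernel_energy.

(** * Wiener integrals *)

Section laws.
Context {R : realType} d (Omega : measurableType d) (P : probability Omega R).

Lemma law_integral (X : Omega -> R) (nu : {measure set (measurableTypeR R) -> \bar R}) (F : R -> R) :
  measurable_fun setT X -> (forall A : set R, measurable A -> P (X @^-1` A) = nu A) ->
  measurable_fun setT F -> (\int[P]_w (F (X w))%:E = \int[nu]_x (F x)%:E)%E.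
Proof.
move=> mX law mF.
have key (G : R -> \bar R) : measurable_fun setT G -> (forall x, 0 <= G x)%E ->
    (\int[P]_w G (X w) = \int[nu]_x G x)%E.
  move=> mG G0.
  rewrite -[LHS](@ge0_integral_pushforward _ _ Omega (measurableTypeR R) R X mX P setT G)//.
  by apply: eq_measure_integral => A mA _; exact: law.
have mF' : measurable_fun setT (EFin \o F) by exact/measurable_EFinP.
rewrite integralE [RHS]integralE; congr (_ - _)%E.
  rewrite -[RHS](key _ (measurable_funepos mF') (funepos_ge0 (EFin \o F))).
  by apply: eq_integral => w _; rewrite !funeposE.
rewrite -[RHS](key _ (measurable_funeneg mF') (funeneg_ge0 (EFin \o F))).
by apply: eq_integral => w _; rewrite !funenegE.
Qed.

Lemma normal_prob_integral (m s : R) (F : R -> R) : s != 0 -> measurable_fun setT F ->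
  (\int[normal_prob m s]_x (F x)%:E = \int[lebesgue_measure]_x (F x * normal_pdf m s x)%:E)%E.
Proof.
move=> s0 mF.
have mF' : measurable_fun setT (EFin \o F) by exact/measurable_EFinP.
rewrite integralE [RHS]integralE; congr (_ - _)%E.
  rewrite ge0_integral_normal_prob//; last exact: measurable_funepos.
  apply: eq_integral => x _; rewrite !funeposE/= -!EFin_max -EFinM; congr EFin.
  by rewrite maxr_pMl ?normal_pdf_ge0// mul0r.
rewrite ge0_integral_normal_prob//; last exact: measurable_funeneg.
apply: eq_integral => x _; rewrite !funenegE/= -!EFin_max -EFinM; congr EFin.
by rewrite maxr_pMl ?normal_pdf_ge0// mul0r mulNr.
Qed.

(** A zero mean fixes the parameter m in both branches of [gaussian]; the Dirac branch then obeys
    the same formula with variance 0. *)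
Lemma centered_gaussian (X : Omega -> R) : measurable_fun setT X -> gaussian P X ->
  (\int[P]_w (X w)%:E = 0)%E ->
  sqint P X /\ forall b, \int[P]_w cos (X w + b) = expR (- (ip P X X / 2)) * cos b.
Proof.
move=> mX gX EX.
have mid : measurable_fun setT (id : R -> R) by [].
have msq : measurable_fun setT (fun x : R => x ^+ 2) by exact: measurable_funX.
have mcos b : measurable_fun setT (fun x : R => cos (x + b)).
  apply: measurableT_comp; last by apply: measurable_funD => //; exact: measurable_cst.
  by apply: continuous_measurable_fun; exact: continuous_cos.
case: gX => [[m [s [s0 law]]]|[m law]].
  have m0 : m = 0.
    move: EX; rewrite (@law_integral X (normal_prob m s) _ mX law mid) normal_prob_integral// => E0.
    by have := @normal_mean R m s s0; rewrite /Rintegral E0.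
  have {m0}law : forall A : set R, measurable A -> P (X @^-1` A) = normal_prob 0 s A by rewrite -m0.
  have E2 : (\int[P]_w (X w ^+ 2)%:E = (s ^+ 2)%:E)%E.
    rewrite (@law_integral X (normal_prob 0 s) _ mX law msq) normal_prob_integral//.
    have <- := @normal_variance R 0 s s0.
    rewrite /Rintegral; under [in RHS]eq_integral do rewrite subr0.
    rewrite fineK//; apply: integrable_fin_num => //.
    apply: (@integrable_normal_growth _ 0 s s0 _ 1) => // x.
    by rewrite subr0 ger0_norm ?sqr_ge0// mul1r lerDr.
  have ipX : ip P X X = s ^+ 2.
    by rewrite /ip /Rintegral; under eq_integral do rewrite -expr2; rewrite E2.
  split=> [|b].
    split=> //; apply/integrableP; split.
      by apply/measurable_EFinP; exact: measurable_funX.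
    under eq_integral do rewrite /= ger0_norm ?sqr_ge0//.
    by rewrite E2 ltry.
  rewrite ipX /Rintegral (law_integral mX law (mcos b)) normal_prob_integral//.
  have := @normal_cos_transform R 0 s s0 1 b.
  rewrite /Rintegral; under eq_integral do rewrite subr0 mul1r.
  by move=> ->; rewrite expr1n mulr1.
have dir F : measurable_fun setT F -> (\int[P]_w (F (X w))%:E = (F m)%:E)%E.
  move=> mF; rewrite (@law_integral X (@dirac _ (measurableTypeR R) m R) _ mX law mF).
  by rewrite integral_dirac ?diracT ?mul1e//; exact/measurable_EFinP.
have m0 : m = 0 by move: EX; rewrite (dir _ mid) => -[].
have E2 : (\int[P]_w (X w ^+ 2)%:E = 0)%E by rewrite (dir _ msq) m0 expr0n.
have ipX : ip P X X = 0.
  by rewrite /ip /Rintegral; under eq_integral do rewrite -expr2; rewrite E2.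
split=> [|b].
  split=> //; apply/integrableP; split.
    by apply/measurable_EFinP; exact: measurable_funX.
  under eq_integral do rewrite /= ger0_norm ?sqr_ge0//.
  by rewrite E2 ltry.
by rewrite ipX /Rintegral (dir _ (mcos b)) m0/= add0r mul0r oppr0 expR0 mul1r.
Qed.

End laws.

Section fractional_brownian_motion.
Context {R : realType} d (Omega : measurableType d) (P : probability Omega R).
Context (T H : R) (W : R -> {RV P >-> R}).
Hypotheses (T_gt0 : 0 < T) (H_gt : 2^-1 < H) (H_lt1 : H < 1) (W_fbm : is_fbm T H W).
Local Notation mu := (@lebesgue_measure R).
Local Notation RR := (measurableTypeR R * measurableTypeR R)%type.
Local Notation D := ((`[0%R, T] : set R) `*` (`[0%R, T] : set R)).
Local Notation K := (fbm_kernel H).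
Implicit Types (c : seq (R * R)) (u : R).

Definition times_ok (c : seq (R * R)) := forall p, p \in c -> p.2 \in `[0, T].

Lemma times_okP (p : R * R) c : times_ok (p :: c) <-> p.2 \in `[0, T] /\ times_ok c.
Proof.
split=> [ok|[p0 ok] q].
  by split=> [|q qc]; apply: ok; rewrite inE ?eqxx// qc orbT.
by rewrite inE => /predU1P[->//|]; exact: ok.
Qed.

Lemma mean_W t : t \in `[0, T] -> (\int[P]_w (W t w)%:E = 0)%E.
Proof.
move=> tT; have [_ + _] := W_fbm => /(_ t tT).
by rewrite expectation.unlock.
Qed.

Lemma sqint_W t : t \in `[0, T] -> sqint P (W t).
Proof.
move=> tT; have [gW _ _] := W_fbm.
have := gW 1%N (fun=> 1) (fun=> t) (fun=> tT).
rewrite (_ : (fun w => _) = W t); last by apply/funext => w; rewrite big_ord1 mul1r.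
move=> g; by have [] := centered_gaussian _ g (mean_W tT).
Qed.

Lemma sqint_step c : times_ok c -> sqint P (step_integral W c).
Proof.
elim: c => [_|p c IH /times_okP[p0 /IH sc]].
  rewrite (_ : step_integral W [::] = fun=> 0); first exact: sqint_cst.
  by apply/funext => w; rewrite /step_integral big_nil.
rewrite (_ : step_integral W (p :: c) = fun w => p.1 * W p.2 w + step_integral W c w).
  by apply: sqintD => //; apply: sqintZ; exact: sqint_W.
by apply/funext => w; rewrite /step_integral big_cons.
Qed.

Lemma gaussian_step c : times_ok c -> gaussian P (step_integral W c).
Proof.
move=> ok; have [gW _ _] := W_fbm.
have := gW (size c) (fun i => (nth (0, 0) c i).1) (fun i => (nth (0, 0) c i).2).
rewrite (_ : (fun w => _) = step_integral W c).
  by apply => i; apply: ok; exact: mem_nth.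
by apply/funext => w; rewrite /step_integral (big_nth (0, 0)) big_mkord.
Qed.

Lemma mean_step c : times_ok c -> (\int[P]_w (step_integral W c w)%:E = 0)%E.
Proof.
elim: c => [_|p c IH /times_okP[p0 ok]].
  by apply: integral0_eq => w _; rewrite /step_integral big_nil.
have i1 : P.-integrable setT (EFin \o (fun w => p.1 * W p.2 w)).
  by apply: sqint_integrable; apply: sqintZ; exact: sqint_W.
have i2 : P.-integrable setT (EFin \o step_integral W c).
  by apply: sqint_integrable; exact: sqint_step.
transitivity (\int[P]_w ((p.1 * W p.2 w)%:E + (step_integral W c w)%:E))%E.
  by apply: eq_integral => w _; rewrite /step_integral big_cons EFinD.
rewrite integralD// IH// adde0; under eq_integral do rewrite EFinM.
rewrite integralZl ?mean_W ?mule0//.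
by apply: sqint_integrable; exact: sqint_W.
Qed.

Lemma cos_step c b : times_ok c ->
  \int[P]_w cos (step_integral W c w + b) =
  expR (- (ip P (step_integral W c) (step_integral W c) / 2)) * cos b.
Proof.
move=> ok; have [ms _] := sqint_step ok.
by have [] := centered_gaussian ms (gaussian_step ok) (mean_step ok).
Qed.

Let c_H : R := H * (2 * H - 1).

Lemma fbm_scale_gt0 : 0 < c_H.
Proof.
rewrite /c_H mulr_gt0//; first by apply: lt_trans H_gt; rewrite invr_gt0.
by rewrite subr_gt0 -ltr_pdivrMl// mulr1.
Qed.

Lemma ip_W s t : s \in `[0, T] -> t \in `[0, T] ->
  ip P (W s) (W t) = fbm_inner T H (\1_(`[0, s] : set R)) (\1_(`[0, t] : set R)).
Proof.
move=> sT tT; have [_ _ /(_ t s tT sT)] := W_fbm.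
rewrite covariance.unlock !expectation.unlock !mean_W//=.
have -> : (\int[P]_w (((W s \- cst 0) * (W t \- cst 0))%R w)%:E = \int[P]_w (W s w * W t w)%:E)%E.
  apply: eq_integral => w _; congr EFin.
  by transitivity ((W s w - 0) * (W t w - 0)); [by []|rewrite !subr0].
move=> E1; rewrite /ip /Rintegral E1 /fbm_inner.
have fZ (x : \bar R) : fine (c_H%:E * x)%E = c_H * fine x.
  case: x => [r||] //=; rewrite ?gt0_muley ?gt0_muleNy ?lte_fin ?fbm_scale_gt0//= mulr0//.
rewrite fZ; congr (_ * fine _).
rewrite [LHS]integral_mkcond [RHS]integral_mkcond; apply: eq_integral => -[u v] _.
rewrite !patchE !in_setX/= !indicE.
have sub (r x : R) : r \in `[0, T] -> x \in `[0%R, r]%classic -> x \in `[0%R, T]%classic.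
  rewrite in_itv/= => /andP[_ rT]; rewrite !inE/= !in_itv/= => /andP[-> xr].
  exact: le_trans rT.
have [us|us] := boolP (u \in `[0%R, s]%classic) => /=; last by rewrite !mul0r; case: ifP.
have [vt|vt] := boolP (v \in `[0%R, t]%classic) => /=; last by rewrite mulr0 mul0r; case: ifP.
by rewrite (sub _ _ sT us) (sub _ _ tT vt)/= !mul1r.
Qed.

Lemma step_fun_bound c : exists2 M : R, 0 <= M & forall u, `|step_fun c u| <= M.
Proof.
exists (\sum_(p <- c) `|p.1|) => [|u]; first exact: sumr_ge0.
apply: le_trans (ler_norm_sum _ _ _) _; apply: ler_sum => p _.
by rewrite normrM indicE; case: (u \in _); rewrite ?normr1 ?mulr1// normr0 mulr0.
Qed.

Lemma measurable_step_fun c : measurable_fun setT (step_fun c : R -> R).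
Proof.
rewrite (_ : step_fun c = fun u => \sum_(p <- c) p.1 * \1_(`[0%R, p.2] : set R) u)//.
apply: measurable_sum => p; apply: measurable_funM; first exact: measurable_cst.
by apply: measurable_indic; exact: measurable_itv.
Qed.

Lemma step_fun_cat c c' u : step_fun (c ++ c') u = step_fun c u + step_fun c' u.
Proof. by rewrite /step_fun big_cat. Qed.

Lemma step_integral_cat c c' w :
  step_integral W (c ++ c') w = step_integral W c w + step_integral W c' w.
Proof. by rewrite /step_integral big_cat. Qed.

Definition scale_step (a : R) (c : seq (R * R)) := [seq (a * p.1, p.2) | p <- c].

Lemma step_fun_scale a c u : step_fun (scale_step a c) u = a * step_fun c u.
Proof.
by rewrite /step_fun big_map big_distrr; apply: eq_bigr => p _ /=; rewrite mulrA.
Qed.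

Lemma step_integral_scale a c w : step_integral W (scale_step a c) w = a * step_integral W c w.
Proof.
by rewrite /step_integral big_map big_distrr; apply: eq_bigr => p _ /=; rewrite mulrA.
Qed.

Lemma times_ok_cat c c' : times_ok c -> times_ok c' -> times_ok (c ++ c').
Proof. by move=> h h' p; rewrite mem_cat => /orP[pc|pc]; [exact: h|exact: h']. Qed.

Lemma times_ok_scale a c : times_ok c -> times_ok (scale_step a c).
Proof. by move=> h p /mapP[q qc ->]; apply: (h q qc). Qed.

Let mD : measurable (D : set RR).
Proof. by apply: measurableX; exact: measurable_itv. Qed.

Lemma measurable_tensor (f g : R -> R) : measurable_fun setT f -> measurable_fun setT g ->
  measurable_fun setT (fun z : RR => f z.1 * g z.2 * K z).
Proof.
move=> mf mg; apply: measurable_funM; last exact: measurable_fbm_kernel.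
by apply: measurable_funM; [exact: (measurableT_comp mf measurable_fst)|exact: (measurableT_comp mg measurable_snd)].
Qed.

Lemma fbm_integrable_dom (f g : R -> R) (h : RR -> R) : measurable_fun setT f -> measurable_fun setT g ->
  (mu \x mu)%E.-integrable D (EFin \o h) ->
  (forall z, D z -> `|f z.1 * g z.2| * K z <= h z) -> fbm_integrable T H f g.
Proof.
move=> mf mg ih fgh; rewrite /fbm_integrable; apply: (le_integrable mD _ _ ih) => //.
  by apply/measurable_EFinP; apply: measurable_funTS; exact: measurable_tensor.
move=> z Dz /=; rewrite lee_fin normrM (@ger0_norm _ (K z)) ?fbm_kernel_ge0//.
by apply: le_trans (ler_norm _); exact: fgh.
Qed.

End fractional_brownian_motion.

(** * Approximation of the fractional kernel by step functions from below *)

Section sampled_kernels.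
Context {R : realType} (H al : R) (H_lt1 : H < 1) (al_gt : 1 - H < al) (al_lt1 : al < 1).
Local Notation k := (frac_kernel al).
Implicit Types (t u e : R) (n : nat).

(* The kernel sampled at the left end points of n cells of width e; (k t 0, 0) only
   carries the value at the origin. *)
Fixpoint sampled_kernel t e n : seq (R * R) :=
  if n is i.+1 then [:: (k t (i%:R * e), i.+1%:R * e), (- k t (i%:R * e), i%:R * e)
                       & sampled_kernel t e i]
  else [:: (k t 0, 0)].

Lemma sampled_kernelS t e n u : step_fun (sampled_kernel t e n.+1) u =
  k t (n%:R * e) * (\1_(`[0, n.+1%:R * e] : set R) u - \1_(`[0, n%:R * e] : set R) u) +
  step_fun (sampled_kernel t e n) u.
Proof. by rewrite /step_fun/= !big_cons/=; ring. Qed.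

Let ind0 (u r : R) : 0 <= u -> \1_(`[0, r] : set R) u = (u <= r)%R%:R :> R.
Proof.
move=> u0; rewrite indicE; congr (_%:R); congr nat_of_bool.
by apply/idP/idP; rewrite inE/= in_itv/= u0.
Qed.

Lemma sampled_kernel_right t e n u : 0 <= e -> 0 <= u -> n%:R * e < u ->
  step_fun (sampled_kernel t e n) u = 0.
Proof.
move=> e0 u0; elim: n => [|n IH] nu.
  move: nu; rewrite mul0r => nu.
  by rewrite /step_fun/= big_cons big_nil/= ind0// (leNgt u) nu mulr0 addr0.
have nu' : n%:R * e < u.
  by apply: le_lt_trans nu; rewrite ler_wpM2r// ler_nat.
by rewrite sampled_kernelS !ind0// (leNgt _ (n.+1%:R * e)) nu (leNgt _ (n%:R * e)) nu' subrr mulr0 add0r IH.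
Qed.

Lemma sampled_kernel_left t e n u : 0 <= e -> 0 <= u -> u <= n%:R * e ->
  exists v, [/\ 0 <= v, u - e <= v, v <= u & step_fun (sampled_kernel t e n) u = k t v].
Proof.
move=> e0 u0; elim: n => [|n IH].
  rewrite mul0r => u0'; have {u0 u0'}-> : u = 0 by apply/eqP; rewrite eq_le u0 u0'.
  exists 0; split=> //; first by rewrite sub0r oppr_le0.
  by rewrite /step_fun/= big_cons big_nil/= ind0// lexx mulr1 addr0.
move=> un; have [unn|nu] := leP u (n%:R * e).
  have [v [v0 uv vu vE]] := IH unn; exists v; split=> //.
  by rewrite sampled_kernelS !ind0// un unn subrr mulr0 add0r.
exists (n%:R * e); split; [exact: mulr_ge0| |exact: ltW|].
  by rewrite lerBlDr; move: un; rewrite -natr1 mulrDl mul1r.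
rewrite sampled_kernelS !ind0// un (leNgt u (n%:R * e)) nu/= subr0 mulr1.
by rewrite sampled_kernel_right// addr0.
Qed.

(** The cells have width t / (n + 1) but only n of them are used: the last one, where the kernel is
    unbounded, gets the value 0. As the kernel increases on [0, t), sampling at left end points
    stays below it, and the kernel itself serves as dominating function. *)
Definition kernel_step t n := sampled_kernel t (t / n.+1%:R) n.

Let cell_lt t n : 0 < t -> n%:R * (t / n.+1%:R) < t.
Proof.
move=> t0; rewrite mulrCA gtr_pMr// ltr_pdivrMr// mul1r ltr_nat//.
Qed.

Lemma frac_kernel_mono t v u : 0 <= v -> v <= u -> u < t -> k t v <= k t u.
Proof.
move=> v0 vu ut; rewrite !frac_kernel_lt ?v0 ?(le_trans v0 vu) ?(le_lt_trans vu ut)//.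
have tu : 0 < t - u by rewrite subr_gt0.
have := @powR_secant R H al H_lt1 al_gt al_lt1 _ (t - v) tu.
by rewrite lerB// => /(_ isT) /andP[]; rewrite subr_ge0.
Qed.

Lemma kernel_step_le t n u : 0 <= t -> 0 <= u -> 0 <= step_fun (kernel_step t n) u <= k t u.
Proof.
rewrite le_eqVlt => /predU1P[<-|t0] u0.
  suff -> : step_fun (kernel_step 0 n) u = 0 by rewrite lexx frac_kernel_ge0.
  rewrite /kernel_step; have k00 (x : R) : 0 <= x -> k 0 x = 0 by exact: frac_kernel_out.
  have [un|nu] := leP u (n%:R * (0 / n.+1%:R)).
    have e0 : 0 <= 0 / n.+1%:R :> R by rewrite mul0r.
    by have [v [v0 _ _ ->]] := sampled_kernel_left 0 e0 u0 un; exact: k00.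
  by rewrite sampled_kernel_right// mul0r.
have e0 : 0 <= t / n.+1%:R by rewrite divr_ge0// ltW.
have [un|nu] := leP u (n%:R * (t / n.+1%:R)).
  have [v [v0 _ vu ->]] := sampled_kernel_left t e0 u0 un.
  by rewrite frac_kernel_ge0 frac_kernel_mono// (le_lt_trans un)// cell_lt.
by rewrite sampled_kernel_right// lexx frac_kernel_ge0.
Qed.

Lemma kernel_step_cvg t u : 0 <= t -> 0 <= u ->
  step_fun (kernel_step t n) u @[n --> \oo] --> k t u.
Proof.
move=> t0 u0; have [tu|ut] := leP t u.
  have -> : (fun n => step_fun (kernel_step t n) u) = (fun=> 0).
    apply/funext => n; apply/eqP; have := kernel_step_le n t0 u0.
    by rewrite (frac_kernel_out al_lt1 tu) -eq_le eq_sym.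
  by rewrite (frac_kernel_out al_lt1 tu); exact: cvg_cst.
have tp : 0 < t by exact: le_lt_trans ut.
have tu0 : 0 < t - u by rewrite subr_gt0.
have e_cvg : t / n.+1%:R @[n --> \oo] --> (0 : R).
  rewrite -(mulr0 t); apply: cvgM; first exact: cvg_cst.
  exact: cvg_harmonic.
have c1 : `|t - u + t / n.+1%:R| `^ (al - 1) @[n --> \oo] --> `|t - u| `^ (al - 1).
  apply: (@cvg_comp _ _ _ (fun n => t - u + t / n.+1%:R) (fun x => `|x| `^ (al - 1)) _ (nbhs (t - u))).
    by rewrite -{2}(addr0 (t - u)); apply: cvgD; [exact: cvg_cst|exact: e_cvg].
  by apply: continuous_norm_powR_neq0; rewrite gt_eqF.
apply: (@squeeze_cvgr _ _ _ _ (fun n => `|t - u + t / n.+1%:R| `^ (al - 1)) (fun=> k t u)); last exact: cvg_cst; last first.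
  by rewrite frac_kernel_lt ?u0// -[X in _ --> X `^ _](gtr0_norm tu0).
near=> n; have /andP[_ ->] := kernel_step_le n t0 u0; rewrite andbT.
have e0 : 0 < t / n.+1%:R by rewrite divr_gt0.
have un : u <= n%:R * (t / n.+1%:R).
  have -> : n%:R * (t / n.+1%:R) = t - t / n.+1%:R.
    by rewrite -natr1; field; rewrite natr1 pnatr_eq0.
  rewrite lerBrDr -lerBrDl ltW//.
  near: n; exact: (cvgr_lt _ e_cvg _ tu0).
have [v [v0 uv vu ->]] := sampled_kernel_left t (ltW e0) u0 un.
rewrite frac_kernel_lt ?v0 ?(le_lt_trans vu ut)//.
have tv0 : 0 < t - v by rewrite subr_gt0 (le_lt_trans vu).
have tve : t - v <= t - u + t / n.+1%:R by move: uv; set w := t / _ => uv; lra.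
rewrite gtr0_norm; last by rewrite addr_gt0.
by have /andP[] := @powR_secant R H al H_lt1 al_gt al_lt1 _ _ tv0 tve; rewrite subr_ge0.
Unshelve. all: by end_near. Qed.

Lemma kernel_step_ok (T t : R) n : 0 <= t -> t <= T -> times_ok T (kernel_step t n).
Proof.
move=> t0 tT.
have e0 : 0 <= t / n.+1%:R by rewrite divr_ge0.
have inT m : (m <= n)%N -> m%:R * (t / n.+1%:R) \in `[0, T].
  move=> mn; rewrite in_itv/= mulr_ge0//=; apply: le_trans tT.
  rewrite mulrCA ler_piMr// ler_pdivrMr// mul1r ler_nat.
  by apply: leq_trans mn _.
rewrite /kernel_step; move: inT; set e := t / n.+1%:R; move: e {e0} => e inT.
suff main m : (m <= n)%N -> times_ok T (sampled_kernel t e m) by exact: main.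
elim: m => [_|m IH mn] p.
  by rewrite inE => /eqP-> /=; rewrite in_itv/= lexx (le_trans t0 tT).
rewrite !inE => /predU1P[->|/predU1P[->|pm]] /=; [exact: inT|by apply: inT; exact: ltnW|].
by apply: IH => //; exact: ltnW.
Qed.

End sampled_kernels.

(** * The isometry and the Gaussian space of [W] *)

Section wiener_integrals.
Context {R : realType} d (Omega : measurableType d) (P : probability Omega R).
Context (T H al : R) (W : R -> {RV P >-> R}).
Hypotheses (T_gt0 : 0 < T) (H_gt : 2^-1 < H) (H_lt1 : H < 1) (W_fbm : is_fbm T H W).
Hypotheses (al_gt : 1 - H < al) (al_lt1 : al < 1).
Local Notation mu := (@lebesgue_measure R).
Local Notation RR := (measurableTypeR R * measurableTypeR R)%type.
Local Notation D := ((`[0%R, T] : set R) `*` (`[0%R, T] : set R)).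
Local Notation K := (fbm_kernel H).
Local Notation k := (frac_kernel al).
Local Notation inner := (fbm_inner T H).
Local Notation SI := (step_integral W).
Implicit Types (c : seq (R * R)) (u t : R) (f g : R -> R).

Let mD : measurable (D : set RR).
Proof. by apply: measurableX; exact: measurable_itv. Qed.

Let al_gt0 : 0 < al. Proof. by apply: lt_trans al_gt; rewrite subr_gt0. Qed.

Lemma ae_all2 (E : RR -> Prop) : (forall z, E z) -> {ae (mu \x mu)%E, forall z, E z}.
Proof. by move=> HE; apply: aeW. Qed.

Lemma fbm_inner_cvg (f_ g_ : nat -> R -> R) f g (h : RR -> R) :
  (forall n, measurable_fun setT (f_ n)) -> (forall n, measurable_fun setT (g_ n)) ->
  measurable_fun setT f -> measurable_fun setT g ->
  (forall u, 0 <= u <= T -> f_ n u @[n --> \oo] --> f u) ->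
  (forall u, 0 <= u <= T -> g_ n u @[n --> \oo] --> g u) ->
  (mu \x mu)%E.-integrable D (EFin \o h) ->
  (forall n z, D z -> `|f_ n z.1 * g_ n z.2| * K z <= h z) ->
  inner (f_ n) (g_ n) @[n --> \oo] --> inner f g.
Proof.
move=> mf_ mg_ mf mg cf cg ih fgh; apply: cvgM; first exact: cvg_cst.
apply: (@Rintegral_dominated_cvg _ _ _ (mu \x mu)%E D _ _ h mD) => //.
- by move=> n; apply: measurable_funTS; exact: measurable_tensor.
- by apply: measurable_funTS; exact: measurable_tensor.
- apply: ae_all2 => z [/= ]; rewrite !in_itv/= => z1 z2.
  by apply: cvgM; [apply: cvgM; [exact: cf|exact: cg]|exact: cvg_cst].
- apply: ae_all2 => z n Dz.
  by rewrite normrM (@ger0_norm _ (K z)) ?fbm_kernel_ge0//; exact: fgh.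
Qed.

Lemma fbm_inner_linl (a : R) f f' g : fbm_integrable T H f g -> fbm_integrable T H f' g ->
  inner (fun u => a * f u + f' u) g = a * inner f g + inner f' g.
Proof.
move=> i i'; rewrite /fbm_inner mulrCA -mulrDr; congr (_ * _).
rewrite -RintegralZl// -RintegralD//; last exact: (integrableZl mD a i).
by apply: eq_Rintegral => z _; ring.
Qed.

Lemma fbm_inner_linr (a : R) f g g' : fbm_integrable T H f g -> fbm_integrable T H f g' ->
  inner f (fun u => a * g u + g' u) = a * inner f g + inner f g'.
Proof.
move=> i i'; rewrite /fbm_inner mulrCA -mulrDr; congr (_ * _).
rewrite -RintegralZl// -RintegralD//; last exact: (integrableZl mD a i).
by apply: eq_Rintegral => z _; ring.
Qed.

Let int1 : (\int[mu]_(u in `[0%R, T]) (cst (1 : R) u)%:E < +oo)%E.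
Proof.
rewrite (_ : (\int[mu]_(u in _) _)%E = (\int[mu]_(u in `[0%R, T]) (cst (1%:E : \bar R)) u)%E)//.
by rewrite integral_cst//= mul1e lebesgue_measure_itv/=; case: ifP => _; rewrite ?ltry.
Qed.

Let intk t : 0 <= t -> (\int[mu]_(u in `[0%R, T]) (k t u)%:E < +oo)%E.
Proof. by move=> t0; apply: le_lt_trans (integral_frac_kernel_le T H_lt1 al_gt t0) _; exact: ltry. Qed.

Lemma kernel_integrable : (mu \x mu)%E.-integrable D (EFin \o (K : RR -> R)).
Proof.
have m1 : measurable_fun setT (cst (1 : R) : R -> R) by exact: measurable_cst.
have := marginal_integrable1 T_gt0 H_gt m1 (fun=> ler01) int1.
by apply: eq_integrable => // z _ /=; rewrite mul1r.
Qed.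

Lemma bounded_fbm_integrable f g (M N : R) : measurable_fun setT f -> measurable_fun setT g ->
  (forall u, `|f u| <= M) -> (forall u, `|g u| <= N) -> fbm_integrable T H f g.
Proof.
move=> mf mg fM gN; apply: (fbm_integrable_dom mf mg (h := fun z => M * N * K z)).
  exact: (integrableZl mD (M * N) kernel_integrable).
by move=> z _; rewrite ler_wpM2r ?fbm_kernel_ge0// normrM ler_pM.
Qed.

Lemma step_fbm_integrable c c' : fbm_integrable T H (step_fun c) (step_fun c').
Proof.
have [M _ cM] := step_fun_bound c; have [N _ cN] := step_fun_bound c'.
by apply: (bounded_fbm_integrable _ _ cM cN); exact: measurable_step_fun.
Qed.

Let step1 t : step_fun [:: (1, t)] = \1_(`[0, t] : set R) :> (R -> R).
Proof. by apply/funext => u; rewrite /step_fun big_cons big_nil addr0 mul1r. Qed.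

Let stepc (p : R * R) c : step_fun (p :: c) = fun u => p.1 * step_fun [:: (1, p.2)] u + step_fun c u.
Proof. by apply/funext => u; rewrite {1}/step_fun big_cons step1. Qed.

Let SIc (p : R * R) c : SI (p :: c) = fun w => p.1 * W p.2 w + SI c w.
Proof. by apply/funext => w; rewrite /step_integral big_cons. Qed.

Let step0 : step_fun [::] = (fun=> 0) :> (R -> R).
Proof. by apply/funext => u; rewrite /step_fun big_nil. Qed.

Let SI0 : SI [::] = (fun=> 0).
Proof. by apply/funext => u; rewrite /step_integral big_nil. Qed.

Let ip0l (X : Omega -> R) : ip P (fun=> 0) X = 0.
Proof. by rewrite /ip /Rintegral integral0_eq// => w _; rewrite mul0r. Qed.

Let inner0l f : inner (fun=> 0) f = 0.
Proof. by rewrite /fbm_inner /Rintegral integral0_eq ?mulr0// => z _; rewrite !mul0r. Qed.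

Let inner0r f : inner f (fun=> 0) = 0.
Proof. by rewrite /fbm_inner /Rintegral integral0_eq ?mulr0// => z _; rewrite mulr0 mul0r. Qed.

Lemma ip_step c c' : times_ok T c -> times_ok T c' -> ip P (SI c) (SI c') = inner (step_fun c) (step_fun c').
Proof.
have base s c2 : s \in `[0, T] -> times_ok T c2 -> ip P (SI c2) (W s) = inner (step_fun c2) (step_fun [:: (1, s)]).
  move=> sT; elim: c2 => [_|p c2 IH /times_okP[p0 ok]].
    by rewrite SI0 step0 ip0l inner0l.
  rewrite SIc stepc fbm_inner_linl; [|exact: step_fbm_integrable..].
  have sW := sqint_W W_fbm p0; have sS := sqint_W W_fbm sT.
  rewrite ipDl//; [|by apply: sqintZ|exact: sqint_step W_fbm _ ok].
  by rewrite ipZl// IH// step1 (step1 s) (ip_W H_gt W_fbm p0 sT).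
move=> okc; elim: c' => [_|p c' IH /times_okP[p0 ok]].
  by rewrite SI0 step0 ipC ip0l inner0r.
rewrite SIc stepc fbm_inner_linr; [|exact: step_fbm_integrable..].
have sW := sqint_W W_fbm p0; have sc := sqint_step W_fbm okc.
rewrite ipC ipDl//; [|by apply: sqintZ|exact: sqint_step W_fbm _ ok].
by rewrite ipZl// ipC base// (ipC P (SI c')) IH.
Qed.

Definition step_sub c c' := c ++ scale_step (-1) c'.

Let step_subE c c' u : step_fun (step_sub c c') u = step_fun c u - step_fun c' u.
Proof. by rewrite step_fun_cat step_fun_scale mulN1r. Qed.

Let SI_sub c c' w : SI (step_sub c c') w = SI c w - SI c' w.
Proof. by rewrite step_integral_cat step_integral_scale mulN1r. Qed.

Lemma ip_step_sub c c' : times_ok T c -> times_ok T c' ->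
  ip P (fun w => SI c w - SI c' w) (fun w => SI c w - SI c' w) =
  inner (fun u => step_fun c u - step_fun c' u) (fun u => step_fun c u - step_fun c' u).
Proof.
move=> ok ok'; have ok2 : times_ok T (step_sub c c').
  by apply: times_ok_cat => //; exact: times_ok_scale.
rewrite -(_ : SI (step_sub c c') = fun w => SI c w - SI c' w); last by apply/funext => w.
rewrite -(_ : step_fun (step_sub c c') = fun u => step_fun c u - step_fun c' u); last by apply/funext => u.
exact: ip_step.
Qed.


(** The first chaos of [W], the L^2 closure of the step integrals. Cosine transforms with the
    Gaussian form are stable under these limits. *)
Definition wiener_space (X : Omega -> R) := sqint P X /\
  exists c : nat -> seq (R * R), (forall n, times_ok T (c n)) /\ l2cvg P (fun n => SI (c n)) X.

Lemma wiener_space_cos X b : wiener_space X ->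
  \int[P]_w cos (X w + b) = expR (- (ip P X X / 2)) * cos b.
Proof.
move=> [sX [c [ok cX]]].
have sc n : sqint P (SI (c n)) by exact: sqint_step W_fbm _ (ok n).
have c1 := @l2cvg_cos _ _ _ P _ X b sc sX cX.
have c2 : \int[P]_w cos (SI (c n) w + b) @[n --> \oo] --> expR (- (ip P X X / 2)) * cos b.
  under eq_fun do rewrite (cos_step W_fbm)//.
  apply: cvgM; last exact: cvg_cst.
  apply: (@cvg_comp _ _ _ (fun n => - (ip P (SI (c n)) (SI (c n)) / 2)) expR _ (nbhs (- (ip P X X / 2)))).
    apply: cvgN; apply: cvgM; last exact: cvg_cst.
    exact: (l2cvg_nrm sc sX cX).
  exact: continuous_expR.
exact: (cvg_unique _ c1 c2).
Qed.

Lemma wiener_space_lin X Y (a b : R) : wiener_space X -> wiener_space Y ->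
  wiener_space (fun w => a * X w + b * Y w).
Proof.
move=> [sX [c [ok cX]]] [sY [c' [ok' cY]]]; split.
  by apply: sqintD; exact: sqintZ.
exists (fun n => scale_step a (c n) ++ scale_step b (c' n)); split=> [n|].
  by apply: times_ok_cat; exact: times_ok_scale.
have sc n : sqint P (SI (c n)) by exact: sqint_step W_fbm _ (ok n).
have sc' n : sqint P (SI (c' n)) by exact: sqint_step W_fbm _ (ok' n).
have := l2cvg_lin a b sc sX sc' sY cX cY.
rewrite [X in _ -> l2cvg P X _](_ : _ = fun n w => a * SI (c n) w + b * SI (c' n) w)//.
by apply/funext => n; apply/funext => w; rewrite step_integral_cat !step_integral_scale.
Qed.

Lemma wiener_space_W t : t \in `[0, T] -> wiener_space (W t).
Proof.
move=> tT; split; first exact: sqint_W W_fbm _ tT.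
exists (fun=> [:: (1, t)]); split=> [n p|]; first by rewrite inE => /eqP->.
rewrite /l2cvg (_ : (fun n => _) = fun=> 0); first exact: cvg_cst.
apply/funext => n; rewrite /ip /Rintegral integral0_eq// => w _.
by rewrite /step_integral big_cons big_nil mul1r addr0 subrr mul0r.
Qed.

Lemma wiener_integral_space phi (G : {RV P >-> R}) : wiener_integral T H W phi G -> wiener_space G.
Proof.
move=> [_ _ [c [ok _]]]; rewrite expectation.unlock => /fine_cvgP[[N _ fin] c0].
have mS n w : SI (c n) w = SI (c n) w by [].
have okc n : times_ok T (c n) by exact: ok.
have sc n : sqint P (SI (c n)) by exact: sqint_step W_fbm _ (okc n).
have mG : measurable_fun setT (G : Omega -> R) by exact: measurable_funPT.
have sG : sqint P G.
  have sD : sqint P (fun w => SI (c N) w - G w).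
    split; first by apply: measurable_funB => //; case: (sc N).
    apply/integrableP; split.
      apply/measurable_EFinP; apply: measurable_funX; apply: measurable_funB => //.
      by case: (sc N).
    have := fin N (leqnn N); rewrite /= fin_numElt => /andP[_].
    by under [in X in _ -> X]eq_integral do rewrite /= ger0_norm ?sqr_ge0//.
  rewrite (_ : (G : Omega -> R) = fun w => SI (c N) w - (SI (c N) w - G w)).
    exact: sqintB.
  by apply/funext => w; rewrite opprB addrC subrK.
by split=> //; exists c; split.
Qed.

(** A Wiener integral comes with some approximating sequence of step functions. Comparison with that
    sequence transfers the convergence to the explicit samples, which are nonnegative and dominated
    by the kernel; all later covariances are computed along them. *)
Lemma kernel_step_l2cvg t (G : {RV P >-> R}) : 0 <= t <= T -> wiener_integral T H W (k t) G ->
  l2cvg P (fun n => SI (kernel_step al t n)) G.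
Proof.
move=> /andP[t0 tT] wG; have [sG _] := wiener_integral_space wG.
case: wG => [mk ik [c [okc c0]]]; rewrite expectation.unlock => /fine_cvgP[_ b0].
have ok j : times_ok T (c j) by exact: okc.
have sc n : sqint P (SI (c n)) by exact: sqint_step W_fbm _ (ok n).
have okn n : times_ok T (kernel_step al t n) by exact: kernel_step_ok.
have sn n : sqint P (SI (kernel_step al t n)) by exact: sqint_step W_fbm _ (okn n).
have mkt : measurable_fun setT (k t) by exact: measurable_frac_kernel.
pose a j := inner (fun u => k t u - step_fun (c j) u) (fun u => k t u - step_fun (c j) u).
pose b j := ip P (fun w => SI (c j) w - G w) (fun w => SI (c j) w - G w).
have a_cvg : a j @[j --> \oo] --> (0 : R).
  move: c0; rewrite (_ : (fun j => inner _ _) = a)//; apply/funext => j.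
  rewrite /a /fbm_inner; congr (_ * _); apply: eq_Rintegral => z _ /=.
  by congr (_ * _); ring.
have b_cvg : b j @[j --> \oo] --> (0 : R).
  move: b0; rewrite /b /ip /Rintegral /comp/=.
  by under eq_fun do under eq_integral do rewrite expr2.
have near_a j : ip P (fun w => SI (kernel_step al t n) w - SI (c j) w)
    (fun w => SI (kernel_step al t n) w - SI (c j) w) @[n --> \oo] --> a j.
  under eq_fun do rewrite (ip_step_sub (okn _) (ok j)).
  have [M M0 cM] := step_fun_bound (c j).
  (* The expansion of (k_t(u) + M) (k_t(v) + M) K(u, v). The quadratic term is integrable by
     definition of the Wiener integral, the others through the marginal of the kernel. *)
  pose hh (z : RR) := (k t z.1 * k t z.2 * K z + M * (k t z.1 * K z)) +
                     (M * (k t z.2 * K z) + M * M * K z).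
  have ms n : measurable_fun setT (fun u => step_fun (kernel_step al t n) u - step_fun (c j) u).
    by apply: measurable_funB; exact: measurable_step_fun.
  have mk' : measurable_fun setT (fun u => k t u - step_fun (c j) u).
    by apply: measurable_funB => //; exact: measurable_step_fun.
  apply: (fbm_inner_cvg (h := hh)) => //.
  - by move=> u /andP[u0 _]; apply: cvgB; [exact: (kernel_step_cvg H_lt1 al_gt al_lt1)|exact: cvg_cst].
  - by move=> u /andP[u0 _]; apply: cvgB; [exact: (kernel_step_cvg H_lt1 al_gt al_lt1)|exact: cvg_cst].
  - have i1 := marginal_integrable1 T_gt0 H_gt mkt (frac_kernel_ge0 al t) (intk t0).
    have i2 := marginal_integrable2 T_gt0 H_gt mkt (frac_kernel_ge0 al t) (intk t0).
    exact: (integrableD mD (integrableD mD ik (integrableZl mD M i1))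
      (integrableD mD (integrableZl mD M i2) (integrableZl mD (M * M) kernel_integrable))).
  - move=> n z /= [] ; rewrite !in_itv/= => /andP[z10 _] /andP[z20 _].
    have -> : hh z = (k t z.1 + M) * (k t z.2 + M) * K z by rewrite /hh; ring.
    rewrite ler_wpM2r ?fbm_kernel_ge0// normrM.
    have bd u : 0 <= u -> `|step_fun (kernel_step al t n) u - step_fun (c j) u| <= k t u + M.
      move=> u0; apply: le_trans (ler_normB _ _) _; apply: lerD => //.
      have /andP[s0 sk] := kernel_step_le H_lt1 al_gt al_lt1 n t0 u0.
      by rewrite ger0_norm.
    by apply: ler_pM => //; exact: bd.
apply/cvgrPdist_lt => e e0.
(* The squared norm of a sum is at most twice the sum of the squared norms: 2 (e/4) + 2 (e/8) stays
   below e. *)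
have e8 : 0 < e / 8 by rewrite divr_gt0.
have [j [aj bj]] : exists j, a j < e / 8 /\ b j < e / 8.
  have n1 : \forall j \near \oo, a j < e / 8 by exact: (cvgr_lt _ a_cvg).
  have n2 : \forall j \near \oo, b j < e / 8 by exact: (cvgr_lt _ b_cvg).
  have [N _ HN] : \forall j \near \oo, a j < e / 8 /\ b j < e / 8.
    by near=> j; split; near: j.
  by exists N; exact: (HN N (leqnn N)).
have aj' : a j < e / 4 by move: aj; lra.
near=> n; rewrite sub0r normrN ger0_norm ?ip_ge0//.
have h1 : ip P (fun w => SI (kernel_step al t n) w - SI (c j) w)
    (fun w => SI (kernel_step al t n) w - SI (c j) w) < e / 4.
  by near: n; exact: (cvgr_lt _ (near_a j) _ aj').
have s1 : sqint P (fun w => SI (kernel_step al t n) w - SI (c j) w) by exact: sqintB.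
have s2 : sqint P (fun w => SI (c j) w - G w) by exact: sqintB.
have := ip_sqr_le2 s1 s2.
rewrite (_ : (fun w => _ + _) = fun w => SI (kernel_step al t n) w - G w); last first.
  by apply/funext => w; rewrite addrA subrK.
move: bj h1; rewrite /b; lra.
Unshelve. all: by end_near. Qed.

Lemma l2cvg_ip2 (X_ Y_ : nat -> Omega -> R) (X Y : Omega -> R) :
  (forall n, sqint P (X_ n)) -> sqint P X -> (forall n, sqint P (Y_ n)) -> sqint P Y ->
  l2cvg P X_ X -> l2cvg P Y_ Y -> ip P (X_ n) (Y_ n) @[n --> \oo] --> ip P X Y.
Proof.
move=> sX_ sX sY_ sY cX cY.
have polar Z Z' : sqint P Z -> sqint P Z' -> ip P Z Z' =
    (ip P (fun w => 1 * Z w + 1 * Z' w) (fun w => 1 * Z w + 1 * Z' w) - ip P Z Z - ip P Z' Z') / 2.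
  by move=> sZ sZ'; rewrite ip_sqrD//; field.
rewrite polar//; under eq_fun do rewrite polar//.
have s1 n : sqint P (fun w => 1 * X_ n w + 1 * Y_ n w) by apply: sqintD; exact: sqintZ.
have s2 : sqint P (fun w => 1 * X w + 1 * Y w) by apply: sqintD; exact: sqintZ.
apply: cvgM; last exact: cvg_cst.
apply: cvgB; last exact: (l2cvg_nrm sY_ sY cY).
apply: cvgB; last exact: (l2cvg_nrm sX_ sX cX).
exact: (l2cvg_nrm s1 s2 (l2cvg_lin 1 1 sX_ sX sY_ sY cX cY)).
Qed.


Let ok_step t n : 0 <= t <= T -> times_ok T (kernel_step al t n).
Proof. by move=> /andP[t0 tT]; exact: kernel_step_ok. Qed.

Let sq_step t n : 0 <= t <= T -> sqint P (SI (kernel_step al t n)).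
Proof. by move=> tT; apply: (sqint_step W_fbm); exact: ok_step. Qed.

Let scale_gt0 : 0 < H * (2 * H - 1).
Proof. exact: fbm_scale_gt0. Qed.

(** The definition of the Wiener integral gives integrability of each kernel against itself. For two
    different times, Fatou's lemma is applied to the nonnegative samples, whose Hilbert products
    equal covariances and converge to that of the two integrals. *)
Lemma kernel_tensor_integrable s t (Gs Gt : {RV P >-> R}) : 0 <= s <= T -> 0 <= t <= T ->
  wiener_integral T H W (k s) Gs -> wiener_integral T H W (k t) Gt ->
  fbm_integrable T H (k s) (k t).
Proof.
move=> sT tT ws wt.
have [sGs _] := wiener_integral_space ws; have [sGt _] := wiener_integral_space wt.
have cs := kernel_step_l2cvg sT ws; have ct := kernel_step_l2cvg tT wt.
have s1 n : sqint P (SI (kernel_step al s n)) by exact: sq_step.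
have s2 n : sqint P (SI (kernel_step al t n)) by exact: sq_step.
have c12 := l2cvg_ip2 s1 sGs s2 sGt cs ct.
have /andP[s0 _] := sT; have /andP[t0 _] := tT.
pose F n (z : RR) := (step_fun (kernel_step al s n) z.1 * step_fun (kernel_step al t n) z.2 * K z)%:E.
have mF n : measurable_fun D (F n).
  apply/measurable_EFinP; apply: measurable_funTS.
  by apply: measurable_tensor; exact: measurable_step_fun.
have F0 n z : D z -> (0 <= F n z)%E.
  move=> /= []; rewrite !in_itv/= => /andP[u0 _] /andP[v0 _]; rewrite lee_fin.
  have /andP[? _] := kernel_step_le H_lt1 al_gt al_lt1 n s0 u0.
  have /andP[? _] := kernel_step_le H_lt1 al_gt al_lt1 n t0 v0.
  by apply: mulr_ge0; [exact: mulr_ge0|exact: fbm_kernel_ge0].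
have mks : measurable_fun setT (k s) by exact: measurable_frac_kernel.
have mkt : measurable_fun setT (k t) by exact: measurable_frac_kernel.
apply: rect_integrable.
- exact: measurable_tensor.
- by move=> z; apply: mulr_ge0; [apply: mulr_ge0; exact: frac_kernel_ge0|exact: fbm_kernel_ge0].
have intF n : (\int[mu \x mu]_(z in D) F n z)%E =
    ((H * (2 * H - 1))^-1 * ip P (SI (kernel_step al s n)) (SI (kernel_step al t n)))%:E.
  rewrite (ip_step (ok_step sT) (ok_step tT)) /fbm_inner mulKf ?gt_eqF// /Rintegral fineK//.
  by apply: integrable_fin_num => //; exact: step_fbm_integrable.
have := fatou (mu \x mu)%E mD mF F0.
have lim1 : limn_einf (fun n => \int[mu \x mu]_(z in D) F n z)%E =
    ((H * (2 * H - 1))^-1 * ip P Gs Gt)%:E.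
  have /cvg_limn_einf_sup[] // : (\int[mu \x mu]_(z in D) F n z)%E @[n --> \oo] -->
    ((H * (2 * H - 1))^-1 * ip P Gs Gt)%:E.
  under eq_fun do rewrite intF.
  apply: cvg_EFin; first exact: nearW.
  by apply: cvgM; [exact: cvg_cst|exact: c12].
rewrite lim1 => fat.
have lim2 : (\int[mu \x mu]_(z in D) limn_einf (F ^~ z) =
    \int[mu \x mu]_(z in D) (k s z.1 * k t z.2 * K z)%:E)%E.
  apply: eq_integral => z; rewrite inE/= => -[]; rewrite !in_itv/= => /andP[u0 _] /andP[v0 _].
  have /cvg_limn_einf_sup[] // : F n z @[n --> \oo] --> (k s z.1 * k t z.2 * K z)%:E.
  apply: cvg_EFin; first exact: nearW.
  apply: cvgM; last exact: cvg_cst.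
  by apply: cvgM; exact: (kernel_step_cvg H_lt1 al_gt al_lt1).
by rewrite lim2 in fat; apply: le_lt_trans fat _; exact: ltry.
Qed.

(** The isometry holds for step functions and passes to the limit by domination: the four products
    of k_t and k_s against the covariance kernel are integrable by [kernel_tensor_integrable]. *)
Lemma wiener_increment_ip s t (Gs Gt : {RV P >-> R}) : 0 <= s <= T -> 0 <= t <= T ->
  wiener_integral T H W (k s) Gs -> wiener_integral T H W (k t) Gt ->
  fbm_integrable T H (k t \- k s) (k t \- k s) /\
  ip P (fun w => Gt w - Gs w) (fun w => Gt w - Gs w) = inner (k t \- k s) (k t \- k s).
Proof.
move=> sT tT ws wt.
have [sGs _] := wiener_integral_space ws; have [sGt _] := wiener_integral_space wt.
have cs := kernel_step_l2cvg sT ws; have ct := kernel_step_l2cvg tT wt.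
have s1 n : sqint P (SI (kernel_step al s n)) by exact: sq_step.
have s2 n : sqint P (SI (kernel_step al t n)) by exact: sq_step.
have /andP[s0 _] := sT; have /andP[t0 _] := tT.
have mks : measurable_fun setT (k s) by exact: measurable_frac_kernel.
have mkt : measurable_fun setT (k t) by exact: measurable_frac_kernel.
have mkk : measurable_fun setT (k t \- k s) by exact: measurable_funB.
pose hh (z : RR) := (k t z.1 * k t z.2 * K z + k t z.1 * k s z.2 * K z) +
  (k s z.1 * k t z.2 * K z + k s z.1 * k s z.2 * K z).
have ihh : (mu \x mu)%E.-integrable D (EFin \o hh).
  have i1 := kernel_tensor_integrable tT tT wt wt.
  have i2 := kernel_tensor_integrable tT sT wt ws.
  have i3 := kernel_tensor_integrable sT tT ws wt.
  have i4 := kernel_tensor_integrable sT sT ws ws.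
  exact: (integrableD mD (integrableD mD i1 i2) (integrableD mD i3 i4)).
have dom (a b : R -> R) z : D z -> (forall u, 0 <= u -> `|a u| <= k t u + k s u) ->
    (forall u, 0 <= u -> `|b u| <= k t u + k s u) -> `|a z.1 * b z.2| * K z <= hh z.
  move=> /= [] ; rewrite !in_itv/= => /andP[z10 _] /andP[z20 _] ha hb.
  have -> : hh z = (k t z.1 + k s z.1) * (k t z.2 + k s z.2) * K z by rewrite /hh; ring.
  by rewrite ler_wpM2r ?fbm_kernel_ge0// normrM; apply: ler_pM => //; [exact: ha|exact: hb].
have bk u : 0 <= u -> `|(k t \- k s) u| <= k t u + k s u.
  move=> u0; apply: le_trans (ler_normB _ _) _.
  by rewrite !ger0_norm ?frac_kernel_ge0.
split.
  by apply: (fbm_integrable_dom mkk mkk ihh) => z Dz; exact: dom.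
have c1 : ip P (fun w => SI (kernel_step al t n) w - SI (kernel_step al s n) w)
    (fun w => SI (kernel_step al t n) w - SI (kernel_step al s n) w) @[n --> \oo] -->
    ip P (fun w => Gt w - Gs w) (fun w => Gt w - Gs w).
  have := l2cvg_lin 1 (-1) s2 sGt s1 sGs ct cs => c.
  have e1 (X Y : Omega -> R) : (fun w => X w - Y w) = (fun w => 1 * X w + (-1) * Y w).
    by apply/funext => w; rewrite mul1r mulN1r.
  rewrite e1; under eq_fun do rewrite e1.
  apply: l2cvg_nrm c => [n|]; apply: sqintD; exact: sqintZ.
have c2 : ip P (fun w => SI (kernel_step al t n) w - SI (kernel_step al s n) w)
    (fun w => SI (kernel_step al t n) w - SI (kernel_step al s n) w) @[n --> \oo] -->
    inner (k t \- k s) (k t \- k s).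
  under eq_fun do rewrite (ip_step_sub (ok_step tT) (ok_step sT)).
  have mst n : measurable_fun setT (fun u => step_fun (kernel_step al t n) u - step_fun (kernel_step al s n) u).
    by apply: measurable_funB; exact: measurable_step_fun.
  have bst n u : 0 <= u -> `|step_fun (kernel_step al t n) u - step_fun (kernel_step al s n) u| <= k t u + k s u.
    move=> u0; apply: le_trans (ler_normB _ _) _.
    have /andP[a1 a2] := kernel_step_le H_lt1 al_gt al_lt1 n s0 u0.
    have /andP[a3 a4] := kernel_step_le H_lt1 al_gt al_lt1 n t0 u0.
    by rewrite !ger0_norm// lerD.
  apply: (fbm_inner_cvg (h := hh)) => //.
  - by move=> u /andP[u0 _]; apply: cvgB; exact: (kernel_step_cvg H_lt1 al_gt al_lt1).
  - by move=> u /andP[u0 _]; apply: cvgB; exact: (kernel_step_cvg H_lt1 al_gt al_lt1).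
  - by move=> n z Dz; exact: (dom _ _ z Dz (bst n) (bst n)).
exact: (cvg_unique _ c1 c2).
Qed.

Lemma wiener_increment : exists2 C : R, 0 < C & forall s t (Gs Gt : {RV P >-> R}),
  0 <= s <= T -> 0 <= t <= T ->
  wiener_integral T H W (k s) Gs -> wiener_integral T H W (k t) Gt ->
  ip P (fun w => Gt w - Gs w) (fun w => Gt w - Gs w) <= C * `|t - s| `^ (2 * (al + H - 1)).
Proof.
have [C C0 HC] := fbm_inner_increment T H_gt H_lt1 al_gt al_lt1.
exists C => // s t Gs Gt; wlog st : s t Gs Gt / s <= t.
  move=> W1 sT tT ws wt; have [st|/ltW ts] := leP s t; first exact: W1.
  have := W1 t s Gt Gs ts tT sT wt ws; rewrite distrC.
  rewrite (_ : ip P (fun w => Gs w - Gt w) (fun w => Gs w - Gt w) =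
    ip P (fun w => Gt w - Gs w) (fun w => Gt w - Gs w))//.
  by rewrite /ip; apply: eq_Rintegral => w _; ring.
move=> sT tT ws wt; have [i ->] := wiener_increment_ip sT tT ws wt.
rewrite ger0_norm ?subr_ge0//; apply: HC => //; first by case/andP: sT.
by case/andP: tT.
Qed.

(** The terminal value is the integral of the indicator of [0, T], so the second variable of the
    Hilbert product can be integrated out. *)
Lemma wiener_ip_terminal t (G : {RV P >-> R}) : 0 <= t <= T -> wiener_integral T H W (k t) G ->
  ip P G (W T) = H * (2 * H - 1) * \int[mu]_(u in `[0%R, T]) (k t u * kernel_marginal T H u).
Proof.
move=> tT wG; have [sG _] := wiener_integral_space wG.
have ct := kernel_step_l2cvg tT wG.
have st n : sqint P (SI (kernel_step al t n)) by exact: sq_step.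
have /andP[t0 _] := tT.
have TT : T \in `[0, T] by rewrite in_itv/= lexx ltW.
have sW := sqint_W W_fbm TT.
have c1 := l2cvg_ip st sG sW ct.
have mkt : measurable_fun setT (k t) by exact: measurable_frac_kernel.
have ok1 : times_ok T [:: (1, T)] by move=> p; rewrite inE => /eqP->.
have WE : SI [:: (1, T)] = W T.
  by apply/funext => w; rewrite /step_integral big_cons big_nil mul1r addr0.
have c2 : ip P (SI (kernel_step al t n)) (W T) @[n --> \oo] --> inner (k t) (step_fun [:: (1, T)]).
  rewrite -WE; under eq_fun do rewrite (ip_step (ok_step tT) ok1).
  apply: (fbm_inner_cvg (h := fun z => k t z.1 * K z)) => //.
  - by move=> n; exact: measurable_step_fun.
  - by move=> n; exact: measurable_step_fun.
  - exact: measurable_step_fun.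
  - by move=> u /andP[u0 _]; exact: (kernel_step_cvg H_lt1 al_gt al_lt1).
  - by move=> u _; exact: cvg_cst.
  - exact: (marginal_integrable1 T_gt0 H_gt mkt (frac_kernel_ge0 al t) (intk t0)).
  - move=> n z /= [] ; rewrite !in_itv/= => /andP[z10 _] _.
    rewrite ler_wpM2r ?fbm_kernel_ge0// step1 normrM.
    have /andP[a1 a2] := kernel_step_le H_lt1 al_gt al_lt1 n t0 z10.
    rewrite ger0_norm// -[leRHS]mulr1 ler_pM// indicE.
    by case: (_ \in _); rewrite ?normr1// normr0.
have -> : ip P G (W T) = inner (k t) (step_fun [:: (1, T)]) by exact: (cvg_unique _ c1 c2).
rewrite /fbm_inner; congr (_ * _).
rewrite /Rintegral -(integral_marginal1 T H_gt mkt (frac_kernel_ge0 al t)).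
congr fine; apply: eq_integral => z; rewrite inE/= => -[_ z2].
by rewrite step1 indicE mem_set// mulr1.
Qed.

Lemma variance_terminal_gt0 : 0 < ip P (W T) (W T).
Proof.
have TT : T \in `[0, T] by rewrite in_itv/= lexx ltW.
rewrite (ip_W H_gt W_fbm TT TT) /fbm_inner mulr_gt0//.
have m1 : measurable_fun setT (cst (1 : R) : R -> R) by exact: measurable_cst.
have E1 : (\int[mu \x mu]_(z in D) (\1_(`[0%R, T] : set R) z.1 * \1_(`[0%R, T] : set R) z.2 * K z)%:E =
    \int[mu]_(u in `[0%R, T]) (cst 1 u * kernel_marginal T H u)%:E)%E.
  rewrite -(integral_marginal1 T H_gt m1 (fun=> ler01)).
  by apply: eq_integral => z; rewrite inE/= => -[z1 z2]; rewrite !indicE !mem_set//= !mul1r.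
rewrite /Rintegral E1.
have lty := integral_marginal_lty T_gt0 H_gt m1 (fun=> ler01) int1.
pose pm := (T / 2) `^ (2 * H - 1) / (2 * H - 1).
have pm0 : 0 < pm.
  by rewrite divr_gt0 ?powR_gt0 ?divr_gt0// subr_gt0 -ltr_pdivrMl// mulr1.
have ge : ((pm * T)%:E <= \int[mu]_(u in `[0%R, T]) (cst 1 u * kernel_marginal T H u)%:E)%E.
  apply: (@le_trans _ _ (\int[mu]_(u in `[0%R, T]) (cst (pm%:E : \bar R)) u)%E).
    rewrite integral_cst//= lebesgue_measure_itv/= lte_fin T_gt0 -EFinD subr0 -EFinM//.
  apply: ge0_le_integral => //.
  - by move=> u _; rewrite lee_fin ltW.
  - apply/measurable_EFinP; apply: measurable_funTS; apply: measurable_funM => //.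
    exact: measurable_kernel_marginal.
  - move=> u /=; rewrite in_itv/= => uT; rewrite lee_fin mul1r.
    exact: (kernel_marginal_ge T_gt0 H_gt uT).
apply: fine_gt0; rewrite lty andbT; apply: lt_le_trans ge.
by rewrite lte_fin mulr_gt0.
Qed.

End wiener_integrals.

(** * The Euler scheme and its derivatives in the terminal value *)

Section euler_field.
Context {R : realType} (Omega : Type) (al x0 kap sk : R) (f f1 f2 : R -> R).
Hypotheses (ff1 : forall x : R, is_derive x 1 f (f1 x))
  (f1f2 : forall x : R, is_derive x 1 f1 (f2 x)) (cf2 : continuous f2).
Local Notation fw := (fweight al).
Context (h : R) (rho : nat -> R) (gam : nat -> Omega -> R).
Implicit Types (n : nat) (z : R * Omega).

(* The Euler scheme as a function of the value z.1 of the terminal variable W_T and of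
   the sample point z.2 that determines the part of the noise independent of W_T;
   euler_tangent and euler_tangent2 are its first two derivatives in z.1. *)
Definition euler : nat -> R * Omega -> R := srec (fun=> 0) (fun n g z =>
  x0 + kap * \sum_(l < n) fw h (n - l) * f (g l z) + sk * (rho n * z.1 + gam n z.2)).

Definition euler_tangent : nat -> R * Omega -> R := srec (fun=> 0) (fun n g z =>
  kap * \sum_(l < n) fw h (n - l) * (f1 (euler l z) * g l z) + sk * rho n).

Definition euler_tangent2 : nat -> R * Omega -> R := srec (fun=> 0) (fun n g z =>
  kap * \sum_(l < n) fw h (n - l) *
    (f2 (euler l z) * euler_tangent l z ^+ 2 + f1 (euler l z) * g l z)).

Local Notation E := euler.
Local Notation E1 := euler_tangent.
Local Notation E2 := euler_tangent2.

Lemma eulerE n z : E n z =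
  x0 + kap * \sum_(l < n) fw h (n - l) * f (E l z) + sk * (rho n * z.1 + gam n z.2).
Proof.
rewrite {1}/euler srecE// => g g' gg'; apply/funext => z'.
by congr (_ + _ * _ + _); apply: eq_bigr => l _; rewrite gg'.
Qed.

Lemma euler_tangentE n z : E1 n z =
  kap * \sum_(l < n) fw h (n - l) * (f1 (E l z) * E1 l z) + sk * rho n.
Proof.
rewrite {1}/euler_tangent srecE// => g g' gg'; apply/funext => z'.
by congr (_ * _ + _); apply: eq_bigr => l _; rewrite gg'.
Qed.

Lemma euler_tangent2E n z : E2 n z =
  kap * \sum_(l < n) fw h (n - l) * (f2 (E l z) * E1 l z ^+ 2 + f1 (E l z) * E2 l z).
Proof.
rewrite {1}/euler_tangent2 srecE// => g g' gg'; apply/funext => z'.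
by congr (_ * _); apply: eq_bigr => l _; rewrite gg'.
Qed.

Lemma is_derive_sum_ord n (F : nat -> R -> R) (dF : nat -> R) (x : R) :
  (forall i, (i < n)%N -> is_derive x 1 (F i) (dF i)) ->
  is_derive x 1 (fun y : R => \sum_(i < n) F i y) (\sum_(i < n) dF i).
Proof.
elim: n => [|n IH] FdF.
  rewrite big_ord0 (_ : (fun y => _) = fun=> 0); first exact: is_derive_cst.
  by apply/funext => y; rewrite big_ord0.
rewrite big_ord_recr/= (_ : (fun y => _) = fun y => \sum_(i < n) F i y + F n y); last first.
  by apply/funext => y; rewrite big_ord_recr.
by apply: is_derive_funD; [apply: IH => i ni; apply: FdF; exact: ltnW|exact: FdF].
Qed.

Lemma continuous_sum_ord n (F : nat -> R -> R) :
  (forall i, (i < n)%N -> continuous (F i)) ->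
  continuous (fun y : R => \sum_(i < n) F i y).
Proof.
elim: n => [|n IH] cF.
  rewrite (_ : (fun y => _) = fun=> 0); first by move=> y; exact: cvg_cst.
  by apply/funext => y; rewrite big_ord0.
rewrite (_ : (fun y => _) = fun y => \sum_(i < n) F i y + F n y); last first.
  by apply/funext => y; rewrite big_ord_recr.
by apply: continuous_funD; [apply: IH => i ni; apply: cF; exact: ltnW|exact: cF].
Qed.

Lemma is_derive_euler n w (s : R) : is_derive s 1 (fun s => E n (s, w)) (E1 n (s, w)).
Proof.
elim/ltn_ind: n s => n IH s.
rewrite (_ : (fun s => _) = fun s => (kap * \sum_(l < n) fw h (n - l) * f (E l (s, w)) +
   (sk * rho n * s + (x0 + sk * gam n w)))); last first.
  by apply/funext => s'; rewrite eulerE/=; ring.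
rewrite euler_tangentE; apply: is_derive_funD; last exact: is_derive_affine.
apply: is_derive_funZ; apply: (@is_derive_sum_ord _ (fun l s => fw h (n - l) * f (E l (s, w)))
  (fun l => fw h (n - l) * (f1 (E l (s, w)) * E1 l (s, w)))) => i ni.
apply: is_derive_funZ.
exact: (@is_derive_comp _ f (fun s => E i (s, w)) s _ _ (ff1 _) (IH i ni s)).
Qed.

Lemma is_derive_euler_tangent n w (s : R) : is_derive s 1 (fun s => E1 n (s, w)) (E2 n (s, w)).
Proof.
elim/ltn_ind: n s => n IH s.
rewrite (_ : (fun s => _) = fun s => (kap * \sum_(l < n) fw h (n - l) * (f1 (E l (s, w)) * E1 l (s, w)) +
   (0 * s + sk * rho n))); last first.
  by apply/funext => s'; rewrite euler_tangentE/=; ring.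
rewrite euler_tangent2E -[X in is_derive _ _ _ X]addr0; apply: is_derive_funD; last exact: is_derive_affine.
apply: is_derive_funZ; apply: (@is_derive_sum_ord _ (fun l s => fw h (n - l) * (f1 (E l (s, w)) * E1 l (s, w)))
  (fun l => fw h (n - l) * (f2 (E l (s, w)) * E1 l (s, w) ^+ 2 + f1 (E l (s, w)) * E2 l (s, w)))) => i ni.
apply: is_derive_funZ.
have -> : f2 (E i (s, w)) * E1 i (s, w) ^+ 2 + f1 (E i (s, w)) * E2 i (s, w) =
  (f2 (E i (s, w)) * E1 i (s, w)) * E1 i (s, w) + f1 (E i (s, w)) * E2 i (s, w) by ring.
apply: (@is_derive_funM _ (fun s => f1 (E i (s, w))) (fun s => E1 i (s, w))); last exact: IH.
exact: (@is_derive_comp _ f1 (fun s => E i (s, w)) s _ _ (f1f2 _) (is_derive_euler i w s)).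
Qed.

Lemma continuous_euler n w : continuous (fun s : R => E n (s, w)).
Proof. exact: (is_derive_continuous (is_derive_euler n w)). Qed.

Lemma continuous_euler_tangent n w : continuous (fun s : R => E1 n (s, w)).
Proof. exact: (is_derive_continuous (is_derive_euler_tangent n w)). Qed.

Lemma continuous_euler_tangent2 n w : continuous (fun s : R => E2 n (s, w)).
Proof.
elim/ltn_ind: n => n IH.
rewrite (_ : (fun s => _) = fun s => kap * \sum_(l < n) fw h (n - l) *
   (f2 (E l (s, w)) * E1 l (s, w) ^+ 2 + f1 (E l (s, w)) * E2 l (s, w))); last first.
  by apply/funext => s'; rewrite euler_tangent2E.
have cc (a : R) : continuous (fun _ : R => a) by move=> y; exact: cvg_cst.
apply: continuous_funM; first exact: cc.
apply: (@continuous_sum_ord _ (fun l s => fw h (n - l) *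
   (f2 (E l (s, w)) * E1 l (s, w) ^+ 2 + f1 (E l (s, w)) * E2 l (s, w)))) => i ni.
apply: continuous_funM; first exact: cc.
apply: continuous_funD.
  apply: continuous_funM; first by apply: continuous_fun_comp => //; exact: continuous_euler.
  by apply: continuous_funM; exact: continuous_euler_tangent.
apply: continuous_funM; last exact: IH.
apply: continuous_fun_comp; last exact: continuous_euler.
exact: (is_derive_continuous f1f2).
Qed.

End euler_field.

Section euler_field_measurability.
Context {R : realType} (al x0 kap sk : R) (f f1 f2 : R -> R).
Hypotheses (ff1 : forall x : R, is_derive x 1 f (f1 x))
  (f1f2 : forall x : R, is_derive x 1 f1 (f2 x)).
Context d (Omega : measurableType d) (g : nat -> Omega -> R).
Context (h : R) (rho : nat -> R) (idx : nat -> nat).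
Local Notation sigma_joint := (g_sigma_algebraType (range (halfspaces (joint_coord g)))).
Local Notation E := (euler al x0 kap sk f h rho (fun n => g (idx n))).
Local Notation E1 := (euler_tangent al x0 kap sk f f1 h rho (fun n => g (idx n))).

Let mcont (F : R -> R) : continuous F -> measurable_fun setT F.
Proof. exact: continuous_measurable_fun. Qed.

(** Measurability is with respect to the coordinates of the noise, as the disintegration demands.
    The map [idx] lets a coarse scheme read its noise from the family attached to the fine grid, so
    that both schemes live on the same sigma-algebra. *)
Lemma measurable_euler n : measurable_fun setT (E n : sigma_joint -> R).
Proof.
elim/ltn_ind: n => n IH.
rewrite (_ : E n = fun z => x0 + kap * \sum_(l < n) fweight al h (n - l) * f (E l z) +
   sk * (rho n * z.1 + g (idx n) z.2)); last by apply/funext => z; rewrite eulerE.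
have m1 : measurable_fun setT (fun z : sigma_joint => z.1).
  exact: (@measurable_generator _ _ _ _ (joint_coord g) None).
have m2 : measurable_fun setT (fun z : sigma_joint => g (idx n) z.2).
  exact: (@measurable_generator _ _ _ _ (joint_coord g) (Some (idx n))).
apply: measurable_funD.
  apply: measurable_funD; first exact: measurable_cst.
  apply: measurable_funM; first exact: measurable_cst.
  apply: measurable_sum => l; apply: measurable_funM; first exact: measurable_cst.
  apply: measurableT_comp; last exact: IH.
  by apply: mcont; exact: (is_derive_continuous ff1).
apply: measurable_funM; first exact: measurable_cst.
by apply: measurable_funD => //; apply: measurable_funM => //; exact: measurable_cst.
Qed.

Lemma measurable_euler_tangent n : measurable_fun setT (E1 n : sigma_joint -> R).
Proof.
elim/ltn_ind: n => n IH.
rewrite (_ : E1 n = fun z => kap * \sum_(l < n) fweight al h (n - l) * (f1 (E l z) * E1 l z) +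
   sk * rho n); last by apply/funext => z; rewrite euler_tangentE.
apply: measurable_funD; last exact: measurable_cst.
apply: measurable_funM; first exact: measurable_cst.
apply: measurable_sum => l; apply: measurable_funM; first exact: measurable_cst.
apply: measurable_funM; last exact: IH.
apply: measurableT_comp; last exact: measurable_euler.
by apply: mcont; exact: (is_derive_continuous f1f2).
Qed.

End euler_field_measurability.

(** * Uniform bounds on the derivatives of the scheme *)

Section euler_field_bounds.
Context {R : realType} (al T x0 kap sk L Mr : R) (f f1 f2 : R -> R).
Hypotheses (al_gt0 : 0 < al) (al_lt1 : al < 1) (T_gt0 : 0 < T) (sk_neq0 : sk != 0)
  (L_gt0 : 0 < L) (Mr_ge0 : 0 <= Mr)
  (f1L : forall x : R, `|f1 x| <= L) (f2L : forall x : R, `|f2 x| <= L).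
Local Notation fw := (fweight al).
Local Notation E := (euler al x0 kap sk f).
Local Notation E1 := (euler_tangent al x0 kap sk f f1).
Local Notation E2 := (euler_tangent2 al x0 kap sk f f1 f2).

Lemma norm_conv_le n (h : R) (B r : nat -> R) : 0 <= h -> (forall l, (l < n)%N -> `|B l| <= r l) ->
  `|\sum_(l < n) fw h (n - l) * B l| <= \sum_(l < n) fw h (n - l) * r l.
Proof.
move=> h0 Br; apply: le_trans (ler_norm_sum _ _ _) _; apply: ler_sum => l _.
by rewrite normrM ger0_norm ?fweight_ge0// ler_wpM2l ?fweight_ge0// Br.
Qed.

Lemma euler_tangent_bound : exists2 C : R, 0 < C &
  forall (Omega : Type) (h : R) (K : nat) (rho : nat -> R) (gam : nat -> Omega -> R),
  0 < h -> K%:R * h <= T -> (forall n, (n <= K)%N -> `|rho n| <= Mr) ->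
  forall n, (n <= K)%N -> forall z, `|E1 h rho gam n z| <= C.
Proof.
have L0 : 0 <= `|kap| * L by rewrite mulr_ge0// ltW.
have [C C0 HC] := fractional_gronwall al_gt0 L0 T_gt0.
exists (C * (`|sk| * Mr) + 1); first by rewrite ltr_wpDl// !mulr_ge0// ltW.
move=> Omega h K rho gam h0 KT rhoM n nK z.
apply: (@le_trans _ _ (C * (`|sk| * Mr))); last by rewrite lerDl.
apply: (HC h K (`|sk| * Mr) (fun n r => `|E1 h rho gam n z| <= r)) => //.
- by rewrite mulr_ge0.
- by move=> n' r r' rr' /le_trans; apply.
move=> n' n'K r r0 IH; rewrite euler_tangentE addrC.
apply: le_trans (ler_normD _ _) _; rewrite !normrM; apply: lerD.
  by rewrite ler_wpM2l// rhoM.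
rewrite -mulrA ler_wpM2l// big_distrr/=.
have -> : \sum_(i < n') L * (fw h (n' - i) * r i) = \sum_(i < n') fw h (n' - i) * (L * r i).
  by apply: eq_bigr => i _; ring.
apply: (@norm_conv_le n' h (fun l => f1 (E h rho gam l z) * E1 h rho gam l z) (fun i => L * r i) (ltW h0)) => l ln; rewrite normrM.
by apply: ler_pM => //; exact: IH.
Qed.

(** The second derivative has no direct noise term. A uniform bound inserted once more into its
    recursion therefore gains the factor t_n^alpha, and X'' / X'^2 is of order t_n^(-alpha) only. *)
Lemma euler_tangent2_bound : exists2 C : R, 0 < C &
  forall (Omega : Type) (h : R) (K : nat) (rho : nat -> R) (gam : nat -> Omega -> R),
  0 < h -> K%:R * h <= T -> (forall n, (n <= K)%N -> `|rho n| <= Mr) ->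
  forall n, (n <= K)%N -> forall z, `|E2 h rho gam n z| <= C * (n%:R * h) `^ al.
Proof.
have [C1 C10 HC1] := euler_tangent_bound.
have L0 : 0 <= `|kap| * L by rewrite mulr_ge0// ltW.
have [C C0 HC] := fractional_gronwall al_gt0 L0 T_gt0.
pose Ta := T `^ al / al.
have Ta0 : 0 <= Ta by rewrite divr_ge0 ?powR_ge0// ltW.
pose b := `|kap| * L * C1 ^+ 2 * Ta.
have b0 : 0 <= b.
  exact: (mulr_ge0 (mulr_ge0 (mulr_ge0 (normr_ge0 _) (ltW L_gt0)) (sqr_ge0 _)) Ta0).
pose Q := `|kap| * (L * C1 ^+ 2 + L * (C * b)) / al.
have Q0 : 0 <= Q.
  rewrite /Q; apply: divr_ge0; last exact: ltW.
  apply: mulr_ge0 => //; apply: addr_ge0.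
    exact: (mulr_ge0 (ltW L_gt0) (sqr_ge0 _)).
  exact: (mulr_ge0 (ltW L_gt0) (mulr_ge0 (ltW C0) b0)).
exists (Q + 1); first by rewrite ltr_wpDl.
move=> Omega h K rho gam h0 KT rhoM.
have step n (r : nat -> R) z : (n <= K)%N -> (forall l, (l < n)%N -> `|E2 h rho gam l z| <= r l) ->
    `|E2 h rho gam n z| <= `|kap| * \sum_(l < n) fw h (n - l) * (L * C1 ^+ 2 + L * r l).
  move=> nK Hr; rewrite euler_tangent2E normrM ler_wpM2l//.
  apply: (@norm_conv_le n h (fun l => f2 (E h rho gam l z) * E1 h rho gam l z ^+ 2 + f1 (E h rho gam l z) * E2 h rho gam l z) (fun l => L * C1 ^+ 2 + L * r l) (ltW h0)) => l ln.
  have lK : (l <= K)%N by apply: ltnW; exact: leq_trans nK.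
  apply: le_trans (ler_normD _ _) _; apply: lerD; rewrite normrM.
    apply: ler_pM => //; rewrite normrX lerXn2r ?nnegrE ?normr_ge0 ?(ltW C10)//.
    exact: (HC1 _ h K).
  by apply: ler_pM => //; exact: Hr.
have sumT n : (n <= K)%N -> \sum_(l < n) fw h (n - l) <= Ta.
  move=> nK; rewrite sum_fweight// /Ta ler_wpM2r ?invr_ge0 ?(ltW al_gt0)//.
  apply: ge0_ler_powR; rewrite ?nnegrE ?(ltW al_gt0) ?(ltW T_gt0)// ?mulr_ge0 ?(ltW h0)//.
  by apply: le_trans KT; rewrite ler_wpM2r ?(ltW h0)// ler_nat.
have bd n z : (n <= K)%N -> `|E2 h rho gam n z| <= C * b.
  move=> nK; apply: (HC h K b (fun n r => `|E2 h rho gam n z| <= r)) => //.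
    by move=> n' r r' rr' /le_trans; apply.
  move=> n' n'K r r0 IH; apply: (le_trans (step _ _ _ n'K IH)).
  have -> : \sum_(l < n') fw h (n' - l) * (L * C1 ^+ 2 + L * r l) =
      L * C1 ^+ 2 * \sum_(l < n') fw h (n' - l) + L * \sum_(l < n') fw h (n' - l) * r l.
    by rewrite !big_distrr -big_split; apply: eq_bigr => l _ /=; ring.
  rewrite mulrDr !mulrA lerD2r /b -!mulrA.
  rewrite ler_wpM2l// ler_wpM2l ?(ltW L_gt0)//.
  rewrite ler_wpM2l ?(ltW C10)// ler_wpM2l ?(ltW C10)//; exact: sumT.
move=> n nK z; apply: (le_trans (step n (fun=> C * b) z nK _)) => [l ln|].
  by apply: bd; apply: ltnW; exact: leq_trans nK.
rewrite -big_distrl/= sum_fweight//.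
apply: (@le_trans _ _ (Q * (n%:R * h) `^ al)).
  by rewrite le_eqVlt; apply/orP; left; apply/eqP; rewrite /Q; field; rewrite gt_eqF.
by rewrite ler_wpM2r ?powR_ge0// lerDl.
Qed.

(** Divided by [sk], the tangent solves the linear equation of [linear_fractional_lower_bound] with
    coefficients kap f'(X_l), bounded by |kap| L uniformly in the sample point. *)
Lemma euler_tangent_lower_bound (pm : R) : kap != 0 -> 0 < pm ->
  exists c h0 e0 : R, [/\ 0 < c, 0 < h0, 0 < e0 &
  forall (Omega : Type) (h : R) (K : nat) (rho p e : nat -> R) (gam : nat -> Omega -> R),
    0 < h -> h <= h0 -> K%:R * h <= T ->
    (forall n, (n <= K)%N -> rho n = \sum_(l < n) fw h (n - l) * p l + e n) ->
    (forall n, (n <= K)%N -> pm <= p n) ->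
    (forall n, (n <= K)%N -> `|e n| <= e0 * (n%:R * h) `^ al) ->
    forall n, (n <= K)%N -> forall z, c * (n%:R * h) `^ al <= `|E1 h rho gam n z|].
Proof.
move=> kap0 pm0.
have L0 : 0 < `|kap| * L by rewrite mulr_gt0// normr_gt0.
have [c [h0 [e0 [c0 h00 e00 HC]]]] := linear_fractional_lower_bound al_gt0 al_lt1 L0 T_gt0 pm0.
exists (`|sk| * c), h0, e0; split=> //; first by rewrite mulr_gt0// normr_gt0.
move=> Omega h K rho p e gam h1 h2 KT rhoE pmp ebd n nK z.
have := HC h K (fun n => sk^-1 * E1 h rho gam n z) rho (fun l => kap * f1 (E h rho gam l z)) p e
  h1 h2 KT _ _ rhoE pmp ebd n nK.
have H1 : forall n : nat, (n <= K)%N -> sk^-1 * E1 h rho gam n z = rho n +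
    \sum_(l < n) fw h (n - l) * (kap * f1 (E h rho gam l z) * (sk^-1 * E1 h rho gam l z)).
  move=> n' _; rewrite euler_tangentE mulrDr mulKf// addrC; congr (_ + _).
  by rewrite !big_distrr/=; apply: eq_bigr => l _; ring.
have H2 : forall n : nat, `|kap * f1 (E h rho gam n z)| <= `|kap| * L.
  by move=> n'; rewrite normrM ler_wpM2l.
move=> /(_ H1 H2) Hn.
rewrite [E1 h rho gam n z](_ : _ = sk * (sk^-1 * E1 h rho gam n z)); last by rewrite mulVKf.
rewrite -mulrA normrM ler_wpM2l//.
by apply: le_trans Hn _; exact: ler_norm.
Qed.

End euler_field_bounds.

(** * Weighted error estimates *)

Section lipschitz.
Context {R : realType}.

Lemma lipschitz_of_derive (f f1 : R -> R) (L : R) : (forall x : R, is_derive x 1 f (f1 x)) ->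
  (forall x, `|f1 x| <= L) -> forall x y, `|f x - f y| <= L * `|x - y|.
Proof.
move=> ff1 f1L.
have mono (e : R) x y : e ^+ 2 = 1 -> x <= y -> e * (f y - f x) <= L * (y - x).
  move=> e1 xy.
  have dF (z : R) : is_derive z 1 (fun z : R => L * z - e * f z) (L * 1 - e * f1 z).
    by apply: is_derive_funB; apply: is_derive_funZ.
  have e1' : `|e| = 1 by apply/eqP; rewrite -sqrp_eq1 ?normr_ge0// -normrX e1 normr1.
  have /= := @le_of_derive_ge0 R (fun z => L * z - e * f z) (fun z => L * 1 - e * f1 z) x y xy
    (fun z _ => dF z).
  have d0 z : x < z < y -> 0 <= L * 1 - e * f1 z.
    move=> _; rewrite mulr1 subr_ge0; apply: le_trans (ler_norm _) _.
    by rewrite normrM e1' mul1r.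
  by move=> /(_ d0 (is_derive_continuous dF)); lra.
move=> x y; wlog xy : x y / x <= y.
  by move=> W; have [/W//|/ltW/W] := leP x y; rewrite distrC (distrC y).
have := mono 1 x y; have := mono (-1) x y; rewrite sqrrN expr1n mul1r mulN1r.
move=> /(_ erefl xy) h1 /(_ erefl xy) h2.
rewrite distrC (distrC x) (ger0_norm (_ : 0 <= y - x)) ?subr_ge0//.
by rewrite ler_norml; apply/andP; split; lra.
Qed.

End lipschitz.

Section weighted_norm.
Context {R : realType} d (Omega : measurableType d) (P : probability Omega R).
Context (xi : Omega -> R) (sxi : sqint P xi).
Implicit Types (A B : Omega -> R) (r : R).

(** The weight 1 + |xi| absorbs the factor |t| which the logarithmic derivative of the Gaussian
    density puts on X - Y. As a relation between a function and a bound it can be the predicate of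
    [fractional_gronwall]. *)
Definition wle A r := measurable_fun setT A /\
  (\int[P]_w ((1 + `|xi w|) * `|A w|)%:E <= r%:E)%E.

Let mxi : measurable_fun setT xi. Proof. by case: sxi. Qed.

Let mweight A : measurable_fun setT A -> measurable_fun setT (fun w => ((1 + `|xi w|) * `|A w|)%:E).
Proof.
move=> mA; apply/measurable_EFinP; apply: measurable_funM.
  by apply: measurable_funD; [exact: measurable_cst|exact: measurableT_comp].
exact: measurableT_comp.
Qed.

Let weight0 A w : (0 <= ((1 + `|xi w|) * `|A w|)%:E)%E.
Proof. by rewrite lee_fin mulr_ge0 ?addr_ge0. Qed.

Lemma wle_le A r r' : r <= r' -> wle A r -> wle A r'.
Proof. by move=> rr' [mA Ar]; split=> //; apply: (le_trans Ar); rewrite lee_fin. Qed.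

Lemma wle_dom A B r : measurable_fun setT A -> (forall w, `|A w| <= `|B w|) -> wle B r -> wle A r.
Proof.
move=> mA AB [mB Br]; split=> //; apply: le_trans Br; apply: ge0_le_integral => //.
- exact: mweight.
- exact: mweight.
- by move=> w _; rewrite lee_fin ler_wpM2l// addr_ge0.
Qed.

Lemma wle_norm A r : wle A r -> wle (fun w => `|A w|) r.
Proof.
move=> h; have [mA _] := h; apply: (wle_dom _ _ h) => [|w]; last by rewrite normr_id.
exact: measurableT_comp.
Qed.

Lemma wleD A B r r' : wle A r -> wle B r' -> wle (fun w => A w + B w) (r + r').
Proof.
move=> [mA Ar] [mB Br]; split; first exact: measurable_funD.
rewrite EFinD; apply: le_trans (leeD Ar Br).
rewrite -ge0_integralD//; [|exact: mweight..].
apply: ge0_le_integral => //.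
- by apply: mweight; exact: measurable_funD.
- by apply: emeasurable_funD; exact: mweight.
- move=> w _; rewrite -EFinD lee_fin -mulrDr ler_wpM2l ?addr_ge0//.
  exact: ler_normD.
Qed.

Lemma wleZ (a : R) A r : wle A r -> wle (fun w => a * A w) (`|a| * r).
Proof.
move=> [mA Ar]; split.
  by apply: measurable_funM => //; exact: measurable_cst.
rewrite EFinM; apply: (@le_trans _ _ (`|a|%:E * \int[P]_w ((1 + `|xi w|) * `|A w|)%:E)%E).
  rewrite -ge0_integralZl//; last exact: mweight.
  rewrite le_eqVlt; apply/orP; left; apply/eqP; apply: eq_integral => w _.
  by rewrite -EFinM normrM; congr EFin; ring.
by apply: lee_wpmul2l => //; rewrite lee_fin.
Qed.

Let wle0 : wle (fun=> 0) 0.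
Proof.
split; first exact: measurable_cst.
by rewrite integral0_eq// => w _; rewrite normr0 mulr0.
Qed.

Lemma wle_sum n (A : nat -> Omega -> R) (r : nat -> R) :
  (forall l, (l < n)%N -> wle (A l) (r l)) ->
  wle (fun w => \sum_(l < n) A l w) (\sum_(l < n) r l).
Proof.
elim: n => [|n IH] Ar.
  by rewrite big_ord0; under eq_fun do rewrite big_ord0; exact: wle0.
rewrite big_ord_recr/=; under eq_fun do rewrite big_ord_recr/=.
by apply: wleD; [apply: IH => l ln; apply: Ar; exact: ltnW|exact: Ar].
Qed.

Lemma wle_wsum n (c : nat -> R) (B : nat -> Omega -> R) (r : nat -> R) A :
  measurable_fun setT A -> (forall l, (l < n)%N -> 0 <= c l) ->
  (forall w, `|A w| <= \sum_(l < n) c l * `|B l w|) ->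
  (forall l, (l < n)%N -> wle (B l) (r l)) -> wle A (\sum_(l < n) c l * r l).
Proof.
move=> mA c0 AB Br.
have H : wle (fun w => \sum_(l < n) c l * `|B l w|) (\sum_(l < n) c l * r l).
  apply: (@wle_sum _ (fun l w => c l * `|B l w|) (fun l => c l * r l)) => l ln.
  by rewrite -{2}(ger0_norm (c0 l ln)); apply: wleZ; apply: wle_norm; exact: Br.
apply: (wle_dom mA _ H) => w; apply: le_trans (AB w) _.
exact: ler_norm.
Qed.

(** Young's inequality (1 + |xi|) |G| <= q (1 + xi^2) + G^2 / q keeps the bound linear in q, so an
    L^2 rate becomes the same weighted L^1 rate. *)
Lemma wle_l2 (G : Omega -> R) (q : R) : 0 < q -> sqint P G -> ip P G G <= q ^+ 2 ->
  wle G ((2 + ip P xi xi) * q).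
Proof.
move=> q0 sG Gq; have [mG iG] := sG; have [_ ix] := sxi.
split=> //.
have ic : P.-integrable setT (EFin \o (fun=> 1 : R)) by exact: sqint_integrable (sqint_cst P 1).
have ix1 : P.-integrable setT (EFin \o (fun w => 1 + xi w ^+ 2)) by exact: (integrableD measurableT ic ix).
have i1 : P.-integrable setT (EFin \o (fun w => q * (1 + xi w ^+ 2))) by exact: (integrableZl measurableT q ix1).
have i2 : P.-integrable setT (EFin \o (fun w => q^-1 * G w ^+ 2)).
  exact: (integrableZl measurableT q^-1 iG).
apply: (@le_trans _ _ (\int[P]_w (q * (1 + xi w ^+ 2) + q^-1 * G w ^+ 2)%:E)%E).
  apply: ge0_le_integral => //.
  - exact: mweight.
  - by apply: (measurable_int P); exact: (integrableD measurableT i1 i2).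
  - move=> w _; rewrite lee_fin.
    set x := `|xi w|; set y := `|G w|.
    rewrite -(real_normK (num_real (xi w))) -(real_normK (num_real (G w))) -/x -/y.
    have -> : q * (1 + x ^+ 2) + q^-1 * y ^+ 2 = (1 + x) * y +
      ((q * (1 + x) - y) ^+ 2 + (q * (1 - x)) ^+ 2 + y ^+ 2) / (2 * q).
      by field; rewrite gt_eqF.
    by rewrite lerDl divr_ge0 ?addr_ge0 ?sqr_ge0 ?mulr_ge0// ltW.
rewrite (_ : (\int[P]_w _)%E = (\int[P]_w (q * (1 + xi w ^+ 2) + q^-1 * G w ^+ 2))%:E); last first.
  by rewrite /Rintegral fineK//; apply: integrable_fin_num => //; exact: (integrableD measurableT i1 i2).
rewrite lee_fin RintegralD// RintegralZl// RintegralZl// RintegralD//.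
have -> : \int[P]_w (1 : R) = 1.
  rewrite /Rintegral (_ : (\int[P]_w _)%E = (\int[P]_w (cst (1%:E : \bar R)) w)%E)//.
  by rewrite integral_cst//= mul1e probability_setT.
have -> : \int[P]_w (xi w ^+ 2) = ip P xi xi by [].
have -> : \int[P]_w (G w ^+ 2) = ip P G G by [].
have : q^-1 * ip P G G <= q.
  by rewrite ler_pdivrMl// -expr2.
by lra.
Qed.

Lemma wle_cst (a : R) : wle (fun=> a) (`|a| * (2 + ip P xi xi)).
Proof.
have h1 : wle (fun=> 1) (2 + ip P xi xi).
  rewrite -[X in wle _ X]mulr1; apply: wle_l2 => //; first exact: sqint_cst.
  rewrite /ip expr1n /Rintegral.
  rewrite (_ : (\int[P]_w _)%E = (\int[P]_w (cst (1%:E : \bar R)) w)%E); last first.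
    by apply: eq_integral => w _; rewrite mulr1.
  by rewrite integral_cst//= mul1e probability_setT.
by have := wleZ a h1; under eq_fun do rewrite mulr1.
Qed.

End weighted_norm.

(** * Increments and block sums of fractional convolutions *)

Section convolution_increments.
Context {R : realType} (al : R) (al_gt0 : 0 < al) (al_lt1 : al < 1).
Local Notation fw := (fweight al).
Implicit Types (i j l n m : nat) (h : R) (B : nat -> R).

Lemma sum_ord_addn n m (F : nat -> R) :
  \sum_(i < n + m) F i = \sum_(i < n) F i + \sum_(j < m) F (n + j)%N.
Proof. by rewrite big_split_ord. Qed.

Lemma fweight_noninc_add h i j : 0 <= h -> fw h (i.+1 + j) <= fw h i.+1.
Proof.
move=> h0; elim: j => [|j IH]; first by rewrite addn0.
by apply: le_trans IH; rewrite addnS addSn; exact: fweight_noninc.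
Qed.

Lemma conv_increment_weight h i j l : 0 <= h -> (l < i)%N -> 0 <= fw h (i - l) - fw h (i + j - l).
Proof.
move=> h0 li; rewrite subr_ge0.
have -> : (i + j - l)%N = ((i - l).-1.+1 + j)%N by lia.
have -> : fw h (i - l) = fw h (i - l).-1.+1 by congr (fw h _); lia.
exact: fweight_noninc_add.
Qed.

Lemma conv_increment h i j B : 0 <= h ->
  `|\sum_(l < i + j) fw h (i + j - l) * B l - \sum_(l < i) fw h (i - l) * B l| <=
  \sum_(l < i) (fw h (i - l) - fw h (i + j - l)) * `|B l| + \sum_(l < j) fw h (j - l) * `|B (i + l)%N|.
Proof.
move=> h0; rewrite (sum_ord_addn i j (fun l => fw h (i + j - l) * B l)).
rewrite addrAC -sumrB; apply: le_trans (ler_normD _ _) _; apply: lerD.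
  apply: le_trans (ler_norm_sum _ _ _) _; apply: ler_sum => l _.
  by rewrite -mulrBl normrM distrC (ger0_norm (conv_increment_weight j h0 (ltn_ord l))).
apply: le_trans (ler_norm_sum _ _ _) _; apply: ler_sum => l _.
by rewrite subnDl normrM ger0_norm// fweight_ge0.
Qed.

(** The weights decrease with the lag, so the differences are nonnegative and the sums telescope to
    ((ih)^al - ((i+j)h)^al + 2 (jh)^al) / al. *)
Lemma sum_increment_weights h i j : 0 <= h ->
  \sum_(l < i) (fw h (i - l) - fw h (i + j - l)) + \sum_(l < j) fw h (j - l) <= 2 * (j%:R * h) `^ al / al.
Proof.
move=> h0; rewrite sumrB.
have := sum_ord_addn i j (fun l => fw h (i + j - l)).
rewrite sum_fweight//; under [X in _ = _ + X -> _]eq_bigr do rewrite subnDl.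
rewrite !sum_fweight// => E.
have -> : \sum_(i0 < i) fw h (i + j - i0) = ((i + j)%:R * h) `^ al / al - (j%:R * h) `^ al / al by rewrite E; ring.
have le : (i%:R * h) `^ al / al <= ((i + j)%:R * h) `^ al / al.
  rewrite ler_wpM2r ?invr_ge0 ?(ltW al_gt0)//; apply: ge0_ler_powR; rewrite ?nnegrE ?mulr_ge0 ?(ltW al_gt0)//.
  by rewrite ler_wpM2r// ler_nat leq_addr.
lra.
Qed.

Lemma sum_ord_blocks n m (F : nat -> R) :
  \sum_(i < n * m) F i = \sum_(l < n) \sum_(j < m) F (l * m + j)%N.
Proof.
elim: n => [|n IH]; first by rewrite mul0n !big_ord0.
by rewrite mulSnr sum_ord_addn IH big_ord_recr.
Qed.

(** Exact integration is additive over cells: the m fine weights inside a coarse cell make up its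
    weight. A fine and a coarse convolution then differ only by the variation of the integrand
    within blocks, which is [block_conv]. *)
Lemma fweight_block h n l m : 0 <= h -> (l < n)%N ->
  \sum_(j < m) fw h (n * m - (l * m + j)) = fw (m%:R * h) (n - l).
Proof.
move=> h0 ln; pose k := ((n - l).-1 * m)%N.
have nl : (n - l)%N = (n - l).-1.+1 by lia.
have -> : \sum_(j < m) fw h (n * m - (l * m + j)) = \sum_(j < m) fw h (k + (m - j)).
  apply: eq_bigr => j _; congr (fw h _).
  by rewrite subnDA -mulnBl nl mulSnr -addnBA// ltnW.
rewrite (sum_rev_ord (fun q => fw h (k + q))).
have tel q : \sum_(j < q) fw h (k + j.+1) = (((k + q)%:R * h) `^ al - (k%:R * h) `^ al) / al.
  elim: q => [|q IH]; first by rewrite big_ord0 addn0 subrr mul0r.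
  rewrite big_ord_recr/= IH /fweight addnS/=.
  by field; rewrite gt_eqF.
rewrite tel /fweight; congr ((_ `^ _ - _ `^ _) / _).
  by rewrite mulrA -natrM; congr (_%:R * _); rewrite nl mulSnr.
by rewrite mulrA -natrM.
Qed.

Lemma block_conv h n m B (C : nat -> R) : 0 <= h ->
  \sum_(i < n * m) fw h (n * m - i) * B i - \sum_(l < n) fw (m%:R * h) (n - l) * C l =
  \sum_(l < n) \sum_(j < m) fw h (n * m - (l * m + j)) * (B (l * m + j)%N - C l).
Proof.
move=> h0; rewrite (sum_ord_blocks n m (fun i => fw h (n * m - i) * B i)) -sumrB.
apply: eq_bigr => l _; rewrite -(fweight_block m h0 (ltn_ord l)) big_distrl -sumrB/=.
by apply: eq_bigr => j _; ring.
Qed.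

End convolution_increments.

Section scheme_estimates.
Context {R : realType} d (Omega : measurableType d) (P : probability Omega R).
Context (xi : Omega -> R) (sxi : sqint P xi).
Context (al ab T x0 kap sk L : R) (f : R -> R).
Hypotheses (al_gt0 : 0 < al) (al_lt1 : al < 1) (ab_gt0 : 0 < ab) (ab_le : ab <= al) (T_gt0 : 0 < T)
  (L_ge0 : 0 <= L) (mf : measurable_fun setT f) (flip : forall x y, `|f x - f y| <= L * `|x - y|).
Local Notation fw := (fweight al).
Local Notation wle := (wle P xi).
Implicit Types (h : R) (K n m i j l : nat) (X G B C u : nat -> Omega -> R) (A : Omega -> R).

Let m1 : R := 2 + ip P xi xi.

Let m1_gt0 : 0 < m1. Proof. by rewrite /m1 ltr_wpDr// ip_ge0. Qed.

Let Ta : R := T `^ al / al.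

Let Ta_ge0 : 0 <= Ta. Proof. by rewrite divr_ge0 ?powR_ge0// ltW. Qed.

Lemma wle_comp_lip A (r : R) : wle A r -> wle (fun w => f (A w)) (`|f 0| * m1 + L * r).
Proof.
move=> h; have [mA _] := h.
have H : wle (fun w => `|f 0| + L * `|A w|) (`|f 0| * m1 + L * r).
  apply: (wleD sxi); first by rewrite -{2}(normr_id (f 0)); exact: wle_cst.
  by rewrite -{2}(ger0_norm L_ge0); apply: (wleZ sxi); exact: wle_norm.
apply: (wle_dom sxi _ _ H) => [|w]; first exact: measurableT_comp.
rewrite (@ger0_norm _ (_ + _)) ?addr_ge0 ?mulr_ge0//.
have := flip (A w) 0; rewrite subr0 => H1.
by have := ler_normD (f 0) (f (A w) - f 0); rewrite addrC subrK; lra.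
Qed.

Lemma wle_lip A A' (r : R) : measurable_fun setT A -> measurable_fun setT A' ->
  wle (fun w => A w - A' w) r -> wle (fun w => f (A w) - f (A' w)) (L * r).
Proof.
move=> mA mA' h; have H := wleZ sxi L h; rewrite (ger0_norm L_ge0) in H.
apply: (wle_dom sxi _ _ H) => [|w]; last by rewrite normrM (ger0_norm L_ge0).
by apply: measurable_funB; exact: measurableT_comp.
Qed.

Let sum_fw_le h K n : 0 < h -> K%:R * h <= T -> (n <= K)%N -> \sum_(l < n) fw h (n - l) <= Ta.
Proof.
move=> h0 KT nK; rewrite sum_fweight// /Ta ler_wpM2r ?invr_ge0 ?(ltW al_gt0)//.
apply: ge0_ler_powR; rewrite ?nnegrE ?(ltW al_gt0) ?(ltW T_gt0) ?mulr_ge0 ?(ltW h0)//.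
by apply: le_trans KT; rewrite ler_wpM2r ?(ltW h0)// ler_nat.
Qed.

(** The noise G is arbitrary here; the estimates below see it through its weighted size and its
    increments. *)
Definition scheme h K X G := forall i, (i <= K)%N -> forall w,
  X i w = x0 + kap * \sum_(l < i) fw h (i - l) * f (X l w) + sk * G i w.

Lemma wle_conv h n B (r : nat -> R) : 0 <= h -> (forall l, measurable_fun setT (B l)) ->
  (forall l, (l < n)%N -> wle (B l) (r l)) ->
  wle (fun w => \sum_(l < n) fw h (n - l) * B l w) (\sum_(l < n) fw h (n - l) * r l).
Proof.
move=> h0 mB Br; apply: (@wle_wsum _ _ _ P xi sxi n (fun l => fw h (n - l)) B r) => //.
- apply: measurable_sum => l; apply: measurable_funM => //; exact: measurable_cst.
- by move=> l _; exact: fweight_ge0.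
- move=> w; apply: le_trans (ler_norm_sum _ _ _) _; apply: ler_sum => l _.
  by rewrite normrM ger0_norm ?fweight_ge0.
Qed.

Lemma scheme_wle_bound (g0 : R) : 0 <= g0 -> exists2 C : R, 0 < C & forall h K X G,
  0 < h -> K%:R * h <= T -> scheme h K X G -> (forall i, measurable_fun setT (X i)) ->
  (forall i, (i <= K)%N -> wle (G i) g0) -> forall i, (i <= K)%N -> wle (X i) C.
Proof.
move=> g00.
have L0 : 0 <= `|kap| * L by rewrite mulr_ge0.
have [C C0 HC] := fractional_gronwall al_gt0 L0 T_gt0.
have fm : 0 <= `|f 0| * m1 by rewrite mulr_ge0// ltW.
pose b := `|x0| * m1 + `|kap| * (`|f 0| * m1 * Ta) + `|sk| * g0.
have b0 : 0 <= b.
  exact: (addr_ge0 (addr_ge0 (mulr_ge0 (normr_ge0 _) (ltW m1_gt0))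
    (mulr_ge0 (normr_ge0 _) (mulr_ge0 fm Ta_ge0))) (mulr_ge0 (normr_ge0 _) g00)).
exists (C * b + 1); first by rewrite ltr_wpDl// mulr_ge0// ltW.
move=> h K X G h0 KT sch mX Gg i iK.
apply: (@wle_le _ _ _ _ _ _ (C * b)); first by rewrite lerDl.
apply: (HC h K b (fun n r => wle (X n) r)) => //.
  by move=> n r r' rr'; exact: wle_le.
move=> n nK r r0 IH.
have -> : X n = fun w => (x0 + kap * \sum_(l < n) fw h (n - l) * f (X l w)) + sk * G n w.
  by apply/funext => w; exact: sch.
have H1 : wle (fun w => \sum_(l < n) fw h (n - l) * f (X l w))
    (\sum_(l < n) fw h (n - l) * (`|f 0| * m1 + L * r l)).
  apply: (@wle_conv h n (fun l w => f (X l w)) (fun l => `|f 0| * m1 + L * r l) (ltW h0)).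
    by move=> l; exact: measurableT_comp.
  by move=> l ln; apply: wle_comp_lip; exact: IH.
have H2 := wleD sxi (wleD sxi (wle_cst sxi x0) (wleZ sxi kap H1)) (wleZ sxi sk (Gg n nK)).
apply: (wle_le _ H2).
have -> : \sum_(l < n) fw h (n - l) * (`|f 0| * m1 + L * r l) =
  `|f 0| * m1 * \sum_(l < n) fw h (n - l) + L * \sum_(l < n) fw h (n - l) * r l.
  by rewrite !big_distrr -big_split; apply: eq_bigr => l _ /=; ring.
have : `|kap| * (`|f 0| * m1 * \sum_(l < n) fw h (n - l)) <= `|kap| * (`|f 0| * m1 * Ta).
  apply: ler_wpM2l => //; apply: ler_wpM2l => //; exact: (sum_fw_le h0 KT nK).
rewrite /b -/m1 mulrDr !mulrA; lra.
Qed.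

Let powR_al_ab (x : R) : 0 <= x -> x <= T -> x `^ al <= T `^ (al - ab) * x `^ ab.
Proof.
move=> x0' xT; have [->|xn] := eqVneq x 0.
  by rewrite !powR0 ?gt_eqF ?mulr0// (lt_le_trans ab_gt0).
rewrite (_ : x `^ al = x `^ (al - ab) * x `^ ab); last first.
  by rewrite -powRD ?subrK// (negPf xn) implybT.
rewrite ler_wpM2r ?powR_ge0//; apply: ge0_ler_powR; rewrite ?nnegrE ?(ltW T_gt0)//.
by rewrite subr_ge0.
Qed.

Let Q : R := 2 * T `^ (al - ab) / al.

Let Q_ge0 : 0 <= Q.
Proof. by rewrite divr_ge0 ?mulr_ge0 ?powR_ge0// ltW. Qed.

Let sum_increment_weights_ab h K i j : 0 < h -> K%:R * h <= T -> (i + j <= K)%N ->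
  \sum_(l < i) (fw h (i - l) - fw h (i + j - l)) + \sum_(l < j) fw h (j - l) <= Q * (j%:R * h) `^ ab.
Proof.
move=> h0 KT ijK; apply: (le_trans (sum_increment_weights al_gt0 _ _ (ltW h0))).
have jh0 : 0 <= j%:R * h by rewrite mulr_ge0// ltW.
have jT : j%:R * h <= T.
  by apply: le_trans KT; rewrite ler_wpM2r ?(ltW h0)// ler_nat (leq_trans (leq_addl i j)).
have := powR_al_ab jh0 jT => H.
rewrite /Q -!mulrA ler_wpM2l// mulrA mulrAC.
by rewrite ler_wpM2r ?invr_ge0 ?(ltW al_gt0)// .
Qed.

Lemma conv_increment_bound h K i j (b : nat -> R) (M : R) : 0 < h -> K%:R * h <= T -> (i + j <= K)%N ->
  (forall l, (l < K)%N -> `|b l| <= M) -> 0 <= M ->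
  `|\sum_(l < i + j) fw h (i + j - l) * b l - \sum_(l < i) fw h (i - l) * b l| <=
    Q * M * (j%:R * h) `^ ab.
Proof.
move=> h0 KT ijK bM M0.
apply: (le_trans (conv_increment al_gt0 al_lt1 _ _ _ (ltW h0))).
have := ler_wpM2l M0 (sum_increment_weights_ab h0 KT ijK).
rewrite (_ : M * (Q * _) = Q * M * (j%:R * h) `^ ab); last by ring.
apply: le_trans; rewrite mulrDr !big_distrr/=; apply: lerD; apply: ler_sum => l _.
  rewrite mulrC; apply: ler_wpM2r; first exact: (conv_increment_weight al_gt0 al_lt1 j (ltW h0) (ltn_ord l)).
  by apply: bM; apply: leq_trans ijK; rewrite ltn_addr.
rewrite mulrC ler_wpM2r ?fweight_ge0 ?(ltW h0)//.
by apply: bM; apply: leq_trans ijK; rewrite ltn_add2l.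
Qed.

(** The drift is a convolution with bounded integrand, hence of order al in time; on [0, T] this is
    better than the order ab <= al of the noise, which decides. *)
Lemma scheme_wle_increment (g0 g1 : R) : 0 <= g0 -> 0 <= g1 -> exists2 C : R, 0 < C & forall h K X G,
  0 < h -> K%:R * h <= T -> scheme h K X G -> (forall i, measurable_fun setT (X i)) ->
  (forall i, (i <= K)%N -> wle (G i) g0) ->
  (forall i j, (i + j <= K)%N -> wle (fun w => G (i + j)%N w - G i w) (g1 * (j%:R * h) `^ ab)) ->
  forall i j, (i + j <= K)%N -> wle (fun w => X (i + j)%N w - X i w) (C * (j%:R * h) `^ ab).
Proof.
move=> g00 g10; have [C0 C00 HC0] := scheme_wle_bound g00.
pose M := `|f 0| * m1 + L * C0.
have M0 : 0 <= M by apply: addr_ge0; rewrite mulr_ge0// ltW.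
exists (`|kap| * (Q * M) + `|sk| * g1 + 1).
  rewrite ltr_wpDl//.
  exact: (addr_ge0 (mulr_ge0 (normr_ge0 _) (mulr_ge0 Q_ge0 M0)) (mulr_ge0 (normr_ge0 _) g10)).
move=> h K X G h0 KT sch mX Gg Gi i j ijK.
have iK : (i <= K)%N by apply: leq_trans ijK; exact: leq_addr.
have fX l : (l <= K)%N -> wle (fun w => f (X l w)) M.
  by move=> lK; apply: wle_comp_lip; exact: (HC0 h K X G).
pose S w := \sum_(l < i + j) fw h (i + j - l) * f (X l w) - \sum_(l < i) fw h (i - l) * f (X l w).
have E : (fun w => X (i + j)%N w - X i w) = fun w => kap * S w + sk * (G (i + j)%N w - G i w).
  by apply/funext => w; rewrite !sch// /S; ring.
pose S1 w := \sum_(l < i) (fw h (i - l) - fw h (i + j - l)) * `|f (X l w)|.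
pose S2 w := \sum_(l < j) fw h (j - l) * `|f (X (i + l)%N w)|.
have H1 : wle S1 (\sum_(l < i) (fw h (i - l) - fw h (i + j - l)) * M).
  apply: (@wle_sum _ _ _ P xi sxi i (fun l w => (fw h (i - l) - fw h (i + j - l)) * `|f (X l w)|)
    (fun l => (fw h (i - l) - fw h (i + j - l)) * M)) => l li.
  rewrite -{2}(ger0_norm (conv_increment_weight al_gt0 al_lt1 j (ltW h0) li)).
  apply: (wleZ sxi); apply: (wle_norm sxi); apply: fX.
  by apply: ltnW; exact: leq_trans iK.
have H2 : wle S2 (\sum_(l < j) fw h (j - l) * M).
  apply: (@wle_sum _ _ _ P xi sxi j (fun l w => fw h (j - l) * `|f (X (i + l)%N w)|)
    (fun l => fw h (j - l) * M)) => l lj.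
  rewrite -{2}(ger0_norm (fweight_ge0 al_gt0 (j - l) (ltW h0))).
  apply: (wleZ sxi); apply: (wle_norm sxi); apply: fX.
  by apply: leq_trans ijK; rewrite leq_add2l ltnW.
have mS : measurable_fun setT S.
  have ms n : measurable_fun setT (fun w => \sum_(l < n) fw h (n - l) * f (X l w)).
    apply: measurable_sum => l; apply: measurable_funM; first exact: measurable_cst.
    exact: measurableT_comp.
  exact: measurable_funB.
have S10 w : 0 <= S1 w.
  by apply: sumr_ge0 => l _; rewrite mulr_ge0//; exact: (conv_increment_weight al_gt0 al_lt1 j (ltW h0)).
have S20 w : 0 <= S2 w by apply: sumr_ge0 => l _; rewrite mulr_ge0// fweight_ge0// ltW.
have HS : wle S (Q * M * (j%:R * h) `^ ab).
  apply: (wle_le (r := \sum_(l < i) (fw h (i - l) - fw h (i + j - l)) * M + \sum_(l < j) fw h (j - l) * M)).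
    have -> : \sum_(l < i) (fw h (i - l) - fw h (i + j - l)) * M + \sum_(l < j) fw h (j - l) * M =
        (\sum_(l < i) (fw h (i - l) - fw h (i + j - l)) + \sum_(l < j) fw h (j - l)) * M.
      by rewrite mulrDl !mulr_suml.
    rewrite (_ : Q * M * _ = Q * (j%:R * h) `^ ab * M); last by ring.
    by apply: ler_wpM2r => //; exact: (sum_increment_weights_ab h0 KT ijK).
  apply: (wle_dom sxi mS _ (wleD sxi H1 H2)) => w.
  rewrite [leRHS]ger0_norm ?addr_ge0//.
  exact: (conv_increment al_gt0 al_lt1 i j (fun l => f (X l w)) (ltW h0)).
rewrite E; apply: (wle_le _ (wleD sxi (wleZ sxi kap HS) (wleZ sxi sk (Gi i j ijK)))).
have := powR_ge0 (j%:R * h) ab; set y := _ `^ ab => y0.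
rewrite mulrDl mul1r mulrDl !mulrA; lra.
Qed.

(** Gronwall on the coarse grid, the defect inside a block being b1 plus a multiple of the error at
    its left end. The uniform bound so obtained is inserted once more into the recursion to gain the
    factor t_n^al. *)
Lemma block_gronwall (L' : R) : 0 <= L' -> exists2 C : R, 0 < C & forall h m N u B (D : nat -> Omega -> R) (b1 : R),
  0 < h -> (0 < m)%N -> N%:R * (m%:R * h) <= T -> 0 <= b1 ->
  (forall n, measurable_fun setT (u n)) ->
  (forall n, (n <= N)%N -> forall w, u n w = kap *
    (\sum_(i < n * m) fw h (n * m - i) * B i w - \sum_(l < n) fw (m%:R * h) (n - l) * D l w)) ->
  (forall l j, (l < N)%N -> (j < m)%N -> forall r, wle (u l) r ->
    wle (fun w => B (l * m + j)%N w - D l w) (b1 + L' * r)) ->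
  forall n, (n <= N)%N -> wle (u n) (C * b1 * (n%:R * (m%:R * h)) `^ al).
Proof.
move=> L'0; have L0 : 0 <= `|kap| * L' by rewrite mulr_ge0.
have [C C0 HC] := fractional_gronwall al_gt0 L0 T_gt0.
pose q := `|kap| * (1 + L' * (C * (`|kap| * Ta))) / al.
have q0 : 0 <= q.
  exact: (divr_ge0 (mulr_ge0 (normr_ge0 _) (addr_ge0 ler01 (mulr_ge0 L'0 (mulr_ge0 (ltW C0)
    (mulr_ge0 (normr_ge0 _) Ta_ge0))))) (ltW al_gt0)).
exists (q + 1); first by rewrite ltr_wpDl.
move=> h m N u B D b1 h0 m0 NT b10 mu uE BD.
have mh0 : 0 < m%:R * h by rewrite mulr_gt0// ltr0n.
have step n (r : nat -> R) : (n <= N)%N -> (forall l, (l < n)%N -> wle (u l) (r l)) ->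
    wle (u n) (`|kap| * \sum_(l < n) fw (m%:R * h) (n - l) * (b1 + L' * r l)).
  move=> nN Hr.
  pose S w := \sum_(l < n) \sum_(j < m) fw h (n * m - (l * m + j)) * `|B (l * m + j)%N w - D l w|.
  have HS : wle S (\sum_(l < n) fw (m%:R * h) (n - l) * (b1 + L' * r l)).
    apply: (@wle_sum _ _ _ P xi sxi n (fun l w => \sum_(j < m) fw h (n * m - (l * m + j)) * `|B (l * m + j)%N w - D l w|)
      (fun l => fw (m%:R * h) (n - l) * (b1 + L' * r l))) => l ln.
    rewrite -(fweight_block al_gt0 al_lt1 m (ltW h0) ln) big_distrl/=.
    apply: (@wle_sum _ _ _ P xi sxi m (fun j w => fw h (n * m - (l * m + j)) * `|B (l * m + j)%N w - D l w|)
      (fun j => fw h (n * m - (l * m + j)) * (b1 + L' * r l))) => j jm.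
    rewrite -{2}(ger0_norm (fweight_ge0 al_gt0 (n * m - (l * m + j)) (ltW h0))).
    apply: (wleZ sxi); apply: (wle_norm sxi); apply: BD => //; last exact: Hr.
    exact: leq_trans nN.
  apply: (wle_dom sxi (mu n) _ (wle_le (lexx _) _)) => [w|]; last first.
    have := wleZ sxi `|kap| HS; rewrite normr_id => H; exact: H.
  rewrite /= uE//.
  have /= -> := block_conv al_gt0 al_lt1 n m (fun i => B i w) (fun l => D l w) (ltW h0).
  rewrite normrM normrM normr_id ler_wpM2l//.
  have S0 : 0 <= S w.
    by apply: sumr_ge0 => l _; apply: sumr_ge0 => j _; rewrite mulr_ge0// fweight_ge0// ltW.
  rewrite (ger0_norm S0); apply: le_trans (ler_norm_sum _ _ _) _; apply: ler_sum => l _.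
  apply: le_trans (ler_norm_sum _ _ _) _; apply: ler_sum => j _.
  by rewrite normrM ger0_norm// fweight_ge0// ltW.
pose b := `|kap| * (b1 * Ta).
have b0 : 0 <= b by rewrite mulr_ge0// mulr_ge0.
have split n (r : nat -> R) : \sum_(l < n) fw (m%:R * h) (n - l) * (b1 + L' * r l) =
  b1 * \sum_(l < n) fw (m%:R * h) (n - l) + L' * \sum_(l < n) fw (m%:R * h) (n - l) * r l.
  by rewrite !big_distrr -big_split; apply: eq_bigr => l _ /=; ring.
have bd n : (n <= N)%N -> wle (u n) (C * b).
  move=> nN; apply: (HC (m%:R * h) N b (fun n r => wle (u n) r)) => //.
    by move=> n' r r' rr'; exact: wle_le.
  move=> n' n'N r r0 IH; apply: (wle_le _ (step n' r n'N IH)).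
  rewrite split mulrDr !mulrA lerD2r /b -!mulrA ler_wpM2l// ler_wpM2l//.
  exact: (sum_fw_le mh0 NT n'N).
move=> n nN; apply: (wle_le _ (step n (fun=> C * b) nN _)) => [|l ln]; last first.
  by apply: bd; apply: ltnW; exact: leq_trans nN.
rewrite -big_distrl/= sum_fweight//.
apply: (@le_trans _ _ (q * b1 * (n%:R * (m%:R * h)) `^ al)).
  by rewrite le_eqVlt; apply/orP; left; apply/eqP; rewrite /q /b; field; rewrite gt_eqF.
by rewrite ler_wpM2r ?powR_ge0// ler_wpM2r// lerDl.
Qed.

End scheme_estimates.

(** * The weak error between two grids *)

Section weak_comparison.
Context {R : realType} d (Omega : measurableType d) (P : probability Omega R).
Context (T al ab x0 kap sk L s pm CG CG0 : R) (f f1 f2 p rho : R -> R).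
Context (xi : Omega -> R) (G : R -> Omega -> R) (V : forall J : Type, (J -> R) -> seq (J * R) -> R).
Hypotheses (T_gt0 : 0 < T) (al_gt0 : 0 < al) (al_lt1 : al < 1) (ab_gt0 : 0 < ab) (ab_le : ab <= al).
Hypotheses (kap_neq0 : kap != 0) (sk_neq0 : sk != 0) (L_gt0 : 0 < L) (s_neq0 : s != 0).
Hypotheses (ff1 : forall x : R, is_derive x 1 f (f1 x)) (f1f2 : forall x : R, is_derive x 1 f1 (f2 x))
  (cf2 : continuous f2) (f1L : forall x, `|f1 x| <= L) (f2L : forall x, `|f2 x| <= L).
Hypotheses (sxi : sqint P xi) (sG : forall t, sqint P (G t)) (CG_ge0 : 0 <= CG) (CG0_ge0 : 0 <= CG0)
  (G_bound : forall t, 0 <= t <= T -> ip P (G t) (G t) <= CG0)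
  (G_incr : forall t u, 0 <= t <= T -> 0 <= u <= T ->
    ip P (fun w => G u w - G t w) (fun w => G u w - G t w) <= CG * `|u - t| `^ (2 * ab)).
Hypotheses (pm_gt0 : 0 < pm) (p_ge : forall t, 0 <= t <= T -> pm <= p t)
  (rhoE : forall t, rho t = ip P (G t) xi / s ^+ 2)
  (rho_sum : forall e : R, 0 < e -> exists2 h1 : R, 0 < h1 & forall h K n,
     0 < h -> h <= h1 -> K%:R * h <= T -> (n <= K)%N ->
     `|rho (n%:R * h) - \sum_(l < n) fweight al h (n - l) * p (l%:R * h)| <= e * (n%:R * h) `^ al).
Local Notation Gp := (fun t w => G t w - rho t * xi w).
Hypothesis cf : forall (J : Type) (tm : J -> R) a l b,
  \int[P]_w cos (a * xi w + linform (fun j => Gp (tm j)) l w + b) =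
    expR (- (s ^+ 2 / 2 * a ^+ 2)) * expR (- (V tm l / 2)) * cos b.
Local Notation mu := (@lebesgue_measure R).
Local Notation phi := (normal_pdf 0 s).
Local Notation fw := (fweight al).
Local Notation wle := (wle P xi).
Local Notation gr h := (fun j : nat => Gp (j%:R * h)).

(** Here [h] is the fine step and m h the coarse one. Both schemes are functions of [xi] and of the
    residual noise at the fine grid points, the coarse one reading every m-th of them, so that a
    single disintegration serves both. *)
Definition fine_euler (h : R) := euler al x0 kap sk f h (fun j => rho (j%:R * h)) (gr h).
Definition fine_tangent (h : R) := euler_tangent al x0 kap sk f f1 h (fun j => rho (j%:R * h)) (gr h).
Definition fine_tangent2 (h : R) := euler_tangent2 al x0 kap sk f f1 f2 h (fun j => rho (j%:R * h)) (gr h).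
Definition coarse_euler (h : R) (m : nat) :=
  euler al x0 kap sk f (m%:R * h) (fun j => rho ((j * m)%:R * h)) (fun j => gr h (j * m)%N).
Definition coarse_tangent (h : R) (m : nat) :=
  euler_tangent al x0 kap sk f f1 (m%:R * h) (fun j => rho ((j * m)%:R * h)) (fun j => gr h (j * m)%N).

Let mxi : measurable_fun setT xi. Proof. by case: sxi. Qed.

Let mG t : measurable_fun setT (G t). Proof. by case: (sG t). Qed.

Let mGp t : measurable_fun setT (Gp t).
Proof. by apply: measurable_funB => //; apply: measurable_funM => //; exact: measurable_cst. Qed.

Let m1 : R := 2 + ip P xi xi.

Let m1_gt0 : 0 < m1. Proof. by rewrite /m1 ltr_wpDr// ip_ge0. Qed.

Let flip := lipschitz_of_derive ff1 f1L.
Let f1lip := lipschitz_of_derive f1f2 f2L.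

Let mf : measurable_fun setT f.
Proof. by apply: continuous_measurable_fun; exact: (is_derive_continuous ff1). Qed.

Let mf1 : measurable_fun setT f1.
Proof. by apply: continuous_measurable_fun; exact: (is_derive_continuous f1f2). Qed.

Lemma wle_G_bound : exists2 g0 : R, 0 <= g0 & forall t, 0 <= t <= T -> wle (G t) g0.
Proof.
have q0 : 0 < Num.sqrt CG0 + 1 by rewrite ltr_wpDl// sqrtr_ge0.
exists (m1 * (Num.sqrt CG0 + 1)); first by rewrite mulr_ge0// ltW.
move=> t tT; apply: (wle_l2 sxi q0 (sG t)); apply: (le_trans (G_bound tT)).
by rewrite sqrrD1 sqr_sqrtr// -addrA lerDl addr_ge0 ?mulrn_wge0 ?sqrtr_ge0.
Qed.

Lemma wle_G_increment : exists2 g1 : R, 0 <= g1 & forall t u, 0 <= t <= T -> 0 <= u <= T ->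
  wle (fun w => G u w - G t w) (g1 * `|u - t| `^ ab).
Proof.
have q0 : 0 < Num.sqrt CG + 1 by rewrite ltr_wpDl// sqrtr_ge0.
exists (m1 * (Num.sqrt CG + 1)); first by rewrite mulr_ge0// ltW.
move=> t u tT uT; have [->|ut] := eqVneq u t.
  rewrite subrr normr0 powR0 ?gt_eqF// mulr0.
  have := wle_cst sxi 0; rewrite normr0 mul0r.
  by under [X in _ -> wle X _]eq_fun do rewrite subrr.
have ut0 : 0 < `|u - t| by rewrite normr_gt0 subr_eq0.
rewrite -mulrA; apply: (wle_l2 sxi); first by rewrite mulr_gt0// powR_gt0.
  exact: sqintB.
apply: (le_trans (G_incr tT uT)).
have -> : `|u - t| `^ (2 * ab) = (`|u - t| `^ ab) ^+ 2.
  by rewrite -powR_mulrn ?powR_ge0// -powRrM mulrC.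
rewrite exprMn ler_wpM2r ?sqr_ge0// sqrrD1 sqr_sqrtr// -addrA lerDl.
by rewrite addr_ge0 ?mulrn_wge0 ?sqrtr_ge0.
Qed.

Let s2 : 0 < s ^+ 2. Proof. by rewrite exprn_even_gt0. Qed.

Lemma rho_bound : exists2 M : R, 0 <= M & forall t, 0 <= t <= T -> `|rho t| <= M.
Proof.
exists (Num.sqrt CG0 * Num.sqrt (ip P xi xi) / s ^+ 2).
  exact: (divr_ge0 (mulr_ge0 (sqrtr_ge0 _) (sqrtr_ge0 _)) (ltW s2)).
move=> t tT; rewrite rhoE normrM (@ger0_norm _ (_^-1)) ?invr_ge0 ?(ltW s2)//.
rewrite ler_wpM2r ?invr_ge0 ?(ltW s2)//.
apply: (le_trans (ip_cauchy_schwarz (sG t) sxi)).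
by rewrite ler_wpM2r ?sqrtr_ge0// ler_wsqrtr// G_bound.
Qed.

Lemma rho_increment : exists2 M : R, 0 <= M & forall t u, 0 <= t <= T -> 0 <= u <= T ->
  `|rho u - rho t| <= M * `|u - t| `^ ab.
Proof.
exists (Num.sqrt CG * Num.sqrt (ip P xi xi) / s ^+ 2).
  exact: (divr_ge0 (mulr_ge0 (sqrtr_ge0 _) (sqrtr_ge0 _)) (ltW s2)).
move=> t u tT uT.
have -> : rho u - rho t = ip P (fun w => G u w - G t w) xi / s ^+ 2.
  by rewrite !rhoE ipBl// mulrBl.
rewrite normrM (@ger0_norm _ (_^-1)) ?invr_ge0 ?(ltW s2)//.
rewrite mulrAC ler_wpM2r ?invr_ge0 ?(ltW s2)//.
have sd : sqint P (fun w => G u w - G t w) by exact: sqintB.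
apply: (le_trans (ip_cauchy_schwarz sd sxi)).
rewrite mulrAC ler_wpM2r ?sqrtr_ge0//.
apply: (le_trans (ler_wsqrtr (G_incr tT uT))).
have -> : `|u - t| `^ (2 * ab) = (`|u - t| `^ ab) ^+ 2.
  by rewrite -powR_mulrn ?powR_ge0// -powRrM mulrC.
by rewrite sqrtrM// sqrtr_sqr ger0_norm ?powR_ge0.
Qed.

Lemma fine_scheme h K : scheme al x0 kap sk f h K (fun i w => fine_euler h i (xi w, w))
  (fun i => G (i%:R * h)).
Proof. by move=> i _ w; rewrite /fine_euler eulerE/=; congr (_ + _ * _); ring. Qed.

Let msig (g : nat -> Omega -> R) (F : R * Omega -> R) : (forall j, measurable_fun setT (g j)) ->
  measurable_fun setT (F : g_sigma_algebraType (range (halfspaces (joint_coord g))) -> R) ->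
  measurable_fun setT (fun w => F (xi w, w)).
Proof.
move=> mg mF.
have mF' := sigma_measurable (measurable_joint_coord mg) mF.
have mp : measurable_fun setT (fun w => (xi w : measurableTypeR R, w)) by exact: measurable_fun_pair.
exact: (measurableT_comp mF' mp).
Qed.

Lemma measurable_fine_euler h i : measurable_fun setT (fun w => fine_euler h i (xi w, w)).
Proof.
apply: (@msig (gr h)) => [j|]; first exact: mGp.
exact: (@measurable_euler _ _ _ _ _ _ _ ff1 _ _ (gr h) _ _ id i).
Qed.

Lemma measurable_fine_tangent h i : measurable_fun setT (fun w => fine_tangent h i (xi w, w)).
Proof.
apply: (@msig (gr h)) => [j|]; first exact: mGp.
exact: (@measurable_euler_tangent _ _ _ _ _ _ _ _ ff1 f1f2 _ _ (gr h) _ _ id i).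
Qed.

Lemma measurable_coarse_euler h m i : measurable_fun setT (fun w => coarse_euler h m i (xi w, w)).
Proof.
apply: (@msig (gr h)) => [j|]; first exact: mGp.
exact: (@measurable_euler _ _ _ _ _ _ _ ff1 _ _ (gr h) _ _ (fun j => (j * m)%N) i).
Qed.

Lemma measurable_coarse_tangent h m i : measurable_fun setT (fun w => coarse_tangent h m i (xi w, w)).
Proof.
apply: (@msig (gr h)) => [j|]; first exact: mGp.
exact: (@measurable_euler_tangent _ _ _ _ _ _ _ _ ff1 f1f2 _ _ (gr h) _ _ (fun j => (j * m)%N) i).
Qed.


(** For the tangents, f'(X) X' - f'(Y) Y' is split in three: the increment of X' inside a block, the
    difference of f' at X and Y against the bounded X', where the bound on f'' enters, and f'(Y)
    times the error at the left end, which the Gronwall argument absorbs. *)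
Lemma block_estimates : exists2 C : R, 0 < C & forall h m N n, 0 < h -> (0 < m)%N ->
  N%:R * (m%:R * h) <= T -> (n <= N)%N ->
  wle (fun w => fine_euler h (n * m) (xi w, w) - coarse_euler h m n (xi w, w))
    (C * (m%:R * h) `^ ab * (n%:R * (m%:R * h)) `^ al) /\
  wle (fun w => fine_tangent h (n * m) (xi w, w) - coarse_tangent h m n (xi w, w))
    (C * (m%:R * h) `^ ab * (n%:R * (m%:R * h)) `^ al).
Proof.
have [g0 g00 Hg0] := wle_G_bound; have [g1 g10 Hg1] := wle_G_increment.
have [Mr Mr0 HMr] := rho_bound; have [r1 r10 Hr1] := rho_increment.
have L0 := ltW L_gt0.
have [CX CX0 HCX] := scheme_wle_increment sxi x0 kap sk al_gt0 al_lt1 ab_gt0 ab_le T_gt0 L0 mf flip g00 g10.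
have [CB CB0 HCB] := block_gronwall sxi kap al_gt0 al_lt1 T_gt0 L0.
have [CD CD0 HCD] := euler_tangent_bound x0 kap sk f al_gt0 T_gt0 L_gt0 Mr0 f1L.
pose Q := 2 * T `^ (al - ab) / al.
have Q0 : 0 <= Q by rewrite /Q divr_ge0 ?mulr_ge0 ?powR_ge0// ltW.
have LCD0 : 0 <= L * CD by rewrite mulr_ge0// ltW.
pose CI := `|kap| * (Q * (L * CD)) + `|sk| * r1.
have CI0 : 0 <= CI.
  exact: (addr_ge0 (mulr_ge0 (normr_ge0 _) (mulr_ge0 Q0 LCD0)) (mulr_ge0 (normr_ge0 _) r10)).
(* The first summand is the contribution of [w1] below, the second that of [w2'], with the error of
   the schemes themselves bounded on [0, T]. *)
pose C4 := L * CI * m1 + CD * (L * (CX + CB * (L * CX) * T `^ al)).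
have LCX0 : 0 <= L * CX by rewrite mulr_ge0// ltW.
have C40 : 0 <= C4.
  apply: addr_ge0; first exact: (mulr_ge0 (mulr_ge0 L0 CI0) (ltW m1_gt0)).
  exact: (mulr_ge0 (ltW CD0) (mulr_ge0 L0 (addr_ge0 (ltW CX0) (mulr_ge0 (mulr_ge0 (ltW CB0) LCX0) (powR_ge0 _ _))))).
exists (CB * (L * CX) + CB * C4 + 1).
  rewrite ltr_wpDl//; exact: (addr_ge0 (mulr_ge0 (ltW CB0) LCX0) (mulr_ge0 (ltW CB0) C40)).
move=> h m N n h0 m0 NT nN.
pose H := (m%:R * h) `^ ab.
have H0 : 0 <= H by exact: powR_ge0.
have mh0 : 0 < m%:R * h by rewrite mulr_gt0// ltr0n.
have KT : (N * m)%:R * h <= T by rewrite natrM -mulrA.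
have rng i : (i <= N * m)%N -> 0 <= i%:R * h <= T.
  move=> iK; rewrite mulr_ge0 ?(ltW h0)//=; apply: le_trans KT.
  by rewrite ler_wpM2r ?(ltW h0)// ler_nat.
pose X i w := fine_euler h i (xi w, w).
pose Y i w := coarse_euler h m i (xi w, w).
pose X' i w := fine_tangent h i (xi w, w).
pose Y' i w := coarse_tangent h m i (xi w, w).
have mX i : measurable_fun setT (X i) by exact: measurable_fine_euler.
have mY i : measurable_fun setT (Y i) by exact: measurable_coarse_euler.
have mX' i : measurable_fun setT (X' i) by exact: measurable_fine_tangent.
have mY' i : measurable_fun setT (Y' i) by exact: measurable_coarse_tangent.
have blk l j : (l < N)%N -> (j < m)%N -> (l * m + j <= N * m)%N.
  move=> lN jm; apply: (@leq_trans (l.+1 * m)); first by rewrite mulSnr leq_add2l ltnW.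
  by rewrite leq_mul2r lN orbT.
have jH j : (j < m)%N -> (j%:R * h) `^ ab <= H.
  move=> jm; apply: ge0_ler_powR; rewrite ?nnegrE ?(ltW ab_gt0) ?mulr_ge0 ?(ltW h0)//.
  by rewrite ler_wpM2r ?(ltW h0)// ler_nat ltnW.
have incr i j : (i + j)%:R * h - i%:R * h = j%:R * h by rewrite natrD; ring.
have incX l j : (l < N)%N -> (j < m)%N -> wle (fun w => X (l * m + j)%N w - X (l * m)%N w) (CX * H).
  move=> lN jm.
  have := HCX h (N * m)%N X (fun i => G (i%:R * h)) h0 KT (@fine_scheme h (N * m)%N) mX.
  move=> /(_ (fun i iK => Hg0 _ (rng i iK))) HX.
  apply: (wle_le (r := CX * (j%:R * h) `^ ab)); first by rewrite ler_wpM2l ?(ltW CX0)// jH.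
  apply: HX; last exact: blk.
  move=> i j' ijK.
  have iK : (i <= N * m)%N by apply: leq_trans ijK; exact: leq_addr.
  have := Hg1 _ _ (rng _ iK) (rng _ ijK).
  by rewrite incr ger0_norm// mulr_ge0// ltW.
have LH0 : 0 <= L * (CX * H) by rewrite mulr_ge0// mulr_ge0// ltW.
pose u i w := X (i * m)%N w - Y i w.
have mu_ i : measurable_fun setT (u i) by exact: measurable_funB.
have wu i : (i <= N)%N -> wle (u i) (CB * (L * (CX * H)) * (i%:R * (m%:R * h)) `^ al).
  apply: (HCB h m N u (fun i w => f (X i w)) (fun l w => f (Y l w)) (L * (CX * H)) h0 m0 NT LH0 mu_).
    move=> k _ w; rewrite /u /X /Y /fine_euler /coarse_euler !eulerE/=; ring.
  move=> l j lN jm r ur; rewrite -mulrDr; apply: (wle_lip sxi L0 mf flip) => //.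
  have := wleD sxi (incX l j lN jm) ur; rewrite /u.
  by under eq_fun do rewrite addrA subrK.
have X'CD i w : (i <= N * m)%N -> `|X' i w| <= CD.
  move=> iK; apply: (HCD Omega h (N * m)%N) => // k kK.
  by apply: HMr; exact: rng.
have rngc k : (k <= N)%N -> (k * m <= N * m)%N by move=> kN; rewrite leq_mul2r kN orbT.
(* This increment is bounded pointwise in w: the tangent is uniformly bounded and its noise term is
   the deterministic function rho. *)
have incX' l j w : (l < N)%N -> (j < m)%N -> `|X' (l * m + j)%N w - X' (l * m)%N w| <= CI * H.
  move=> lN jm.
  have lmK : (l * m <= N * m)%N by apply: rngc; exact: ltnW.
  rewrite /X' /fine_tangent !euler_tangentE.
  set S1 := \sum_(_ < l * m + j) _; set S2 := \sum_(_ < l * m) _.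
  have -> : kap * S1 + sk * rho ((l * m + j)%:R * h) - (kap * S2 + sk * rho ((l * m)%:R * h)) =
    kap * (S1 - S2) + sk * (rho ((l * m + j)%:R * h) - rho ((l * m)%:R * h)) by ring.
  apply: le_trans (ler_normD _ _) _; rewrite !normrM.
  have c1 : `|S1 - S2| <= Q * (L * CD) * (j%:R * h) `^ ab.
    apply: (@conv_increment_bound R al ab T al_gt0 al_lt1 ab_gt0 ab_le T_gt0 h (N * m)%N (l * m)%N j
      (fun i => f1 (fine_euler h i (xi w, w)) * fine_tangent h i (xi w, w)) (L * CD)) => //.
      exact: blk.
    move=> i iK; rewrite normrM; apply: ler_pM => //.
    by apply: X'CD; exact: ltnW.
  have c2 : `|rho ((l * m + j)%:R * h) - rho ((l * m)%:R * h)| <= r1 * (j%:R * h) `^ ab.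
    have := Hr1 _ _ (rng _ lmK) (rng _ (blk l j lN jm)).
    by rewrite incr (ger0_norm (_ : 0 <= j%:R * h))// mulr_ge0// ltW.
  apply: (@le_trans _ _ (CI * (j%:R * h) `^ ab)); last by rewrite ler_wpM2l// jH.
  rewrite /CI mulrDl -!mulrA; apply: lerD; rewrite ler_wpM2l//.
  by move: c1; rewrite -!mulrA.
pose u' i w := X' (i * m)%N w - Y' i w.
have mu' i : measurable_fun setT (u' i) by exact: measurable_funB.
have b10 : 0 <= C4 * H by rewrite mulr_ge0.
have wu' i : (i <= N)%N -> wle (u' i) (CB * (C4 * H) * (i%:R * (m%:R * h)) `^ al).
  apply: (HCB h m N u' (fun i w => f1 (X i w) * X' i w) (fun l w => f1 (Y l w) * Y' l w) (C4 * H) h0 m0 NT b10 mu').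
    move=> k _ w; rewrite /u' /X' /Y' /X /Y /fine_tangent /coarse_tangent !euler_tangentE/=.
    by rewrite /fine_euler /coarse_euler; ring.
  move=> l j lN jm r ur.
  have lmK : (l * m <= N * m)%N by apply: rngc; exact: ltnW.
  have w1 : wle (fun w => f1 (X (l * m + j)%N w) * (X' (l * m + j)%N w - X' (l * m)%N w)) (L * CI * H * m1).
    have := wle_cst sxi (L * CI * H); rewrite (@ger0_norm _ (L * CI * H)) ?mulr_ge0// => wc.
    apply: (wle_dom sxi _ _ wc) => [|w].
      apply: measurable_funM; first exact: measurableT_comp.
      exact: measurable_funB.
    rewrite normrM -mulrA [leRHS]ger0_norm ?mulr_ge0//; apply: ler_pM => //.
    exact: incX'.
  have w2 : wle (fun w => CD * (f1 (X (l * m + j)%N w) - f1 (Y l w)))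
      (CD * (L * (CX * H + CB * (L * (CX * H)) * T `^ al))).
    rewrite -{2}(ger0_norm (ltW CD0)); apply: (wleZ sxi); apply: (wle_lip sxi L0 mf1 f1lip) => //.
    have := wleD sxi (incX l j lN jm) (wu l (ltnW lN)); rewrite /u.
    under [X in wle X _ -> _]eq_fun do rewrite addrA subrK.
    apply: wle_le; rewrite lerD2l ler_wpM2l ?(mulr_ge0 (ltW CB0) LH0)//.
    apply: ge0_ler_powR; rewrite ?nnegrE ?(ltW al_gt0) ?(ltW T_gt0) ?mulr_ge0 ?(ltW h0)//.
    by apply: le_trans NT; rewrite ler_wpM2r ?(ltW mh0)// ler_nat ltnW.
  have w2' : wle (fun w => (f1 (X (l * m + j)%N w) - f1 (Y l w)) * X' (l * m)%N w)
      (CD * (L * (CX * H + CB * (L * (CX * H)) * T `^ al))).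
    apply: (wle_dom sxi _ _ w2) => [|w].
      by apply: measurable_funM => //; apply: measurable_funB; exact: measurableT_comp.
    rewrite !normrM mulrC (ger0_norm (ltW CD0)) ler_wpM2r//.
    exact: X'CD.
  have w3 : wle (fun w => f1 (Y l w) * (X' (l * m)%N w - Y' l w)) (L * r).
    have := wleZ sxi L ur; rewrite (ger0_norm L0) => wL.
    apply: (wle_dom sxi _ _ wL) => [|w].
      by apply: measurable_funM; [exact: measurableT_comp|exact: measurable_funB].
    by rewrite !normrM (ger0_norm L0) ler_wpM2r.
  have := wleD sxi (wleD sxi w1 w2') w3.
  rewrite (_ : (fun w => _ + _ + _) = fun w => f1 (X (l * m + j)%N w) * X' (l * m + j)%N w - f1 (Y l w) * Y' l w); last first.
    by apply/funext => w; ring.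
  apply: wle_le; rewrite lerD2r /C4 le_eqVlt; apply/orP; left; apply/eqP; ring.
have t0 : 0 <= (n%:R * (m%:R * h)) `^ al by exact: powR_ge0.
split.
  apply: (wle_le _ (wu n nN)); rewrite ler_wpM2r// -/H mulrA -mulrA (mulrA L) mulrA.
  by rewrite ler_wpM2r// -addrA lerDl addr_ge0// mulr_ge0// ltW.
apply: (wle_le _ (wu' n nN)); rewrite ler_wpM2r// -/H mulrA.
by rewrite ler_wpM2r// -addrA addrC -addrA lerDl addr_ge0// mulr_ge0// ltW.
Qed.

(** With y = t_n^alpha: the derivative of the fine scheme is at least c0 y, its second derivative at
    most CH y, and the errors are O(y H^ab) with H = T/N. In the bound of [density_comparison] all
    powers of y cancel. The thresholds of the lower bound concern the fine step alone, so a large m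
    meets them for every N. *)
Lemma euler_weak_error : exists2 C : R, 0 < C & forall N n, (0 < N)%N -> (0 < n <= N)%N ->
  \forall m \near \oo, forall g : R -> R, continuous g -> (forall t, `|g t| <= 1) ->
  `|\int[P]_w (g (fine_euler (T / N%:R / m%:R) (n * m) (xi w, w)) -
               g (coarse_euler (T / N%:R / m%:R) m n (xi w, w)))| <= C * (T / N%:R) `^ ab.
Proof.
have [Mr Mr0 HMr] := rho_bound.
have [CE CE0 HCE] := block_estimates.
have [CD CD0 HCD] := euler_tangent_bound x0 kap sk f al_gt0 T_gt0 L_gt0 Mr0 f1L.
have [CH CH0 HCH] := euler_tangent2_bound x0 kap sk f al_gt0 T_gt0 L_gt0 Mr0 f1L f2L.
have [c0 [h0 [e0 [c00 h00 e00 Hlow]]]] :=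
  euler_tangent_lower_bound x0 f al_gt0 al_lt1 T_gt0 sk_neq0 L_gt0 f1L kap_neq0 pm_gt0.
have [h1 h10 Hh1] := rho_sum e00.
pose A2 := (s ^+ 2 * c0)^-1 + CH / c0 ^+ 2.
have A20 : 0 < A2.
  by apply: addr_gt0; [rewrite invr_gt0 mulr_gt0|rewrite divr_gt0 ?exprn_gt0].
exists (CE / c0 + CE * A2); first by rewrite addr_gt0 ?divr_gt0 ?mulr_gt0.
move=> N n N0 /andP[n0 nN].
have TN0 : 0 < T / N%:R by rewrite divr_gt0// ltr0n.
near=> m.
have m0 : (0 < m)%N by near: m; exact: nbhs_infty_gt.
have m0' : 0 < m%:R :> R by rewrite ltr0n.
set h := T / N%:R / m%:R.
have hp : 0 < h by rewrite divr_gt0.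
have mhE : m%:R * h = T / N%:R by rewrite /h mulrC divfK// gt_eqF.
have hmin : h <= Num.min h0 h1.
  rewrite /h ler_pdivrMr// -ler_pdivrMl ?lt_min ?h00//.
  by near: m; exact: nbhs_infty_ger.
move: hmin; rewrite le_min => /andP[hh0 hh1] g cg g1.
have N0' : N%:R != 0 :> R by rewrite pnatr_eq0 -lt0n.
have NT : N%:R * (m%:R * h) <= T by rewrite mhE mulrC divfK.
have KT : (N * m)%:R * h <= T by rewrite natrM -mulrA.
have rng i : (i <= N * m)%N -> 0 <= i%:R * h <= T.
  move=> iK; rewrite mulr_ge0 ?(ltW hp)//=; apply: le_trans KT.
  by rewrite ler_wpM2r ?(ltW hp)// ler_nat.
have nmK : (n * m <= N * m)%N by rewrite leq_mul2r nN orbT.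
pose y := (n%:R * (m%:R * h)) `^ al.
have y0 : 0 < y by rewrite powR_gt0// mulr_gt0 ?ltr0n// mulr_gt0.
have nmE : (n * m)%:R * h = n%:R * (m%:R * h) by rewrite natrM mulrA.
pose mm := c0 * y.
have mm0 : 0 < mm by rewrite mulr_gt0.
pose KK := CH * y / mm ^+ 2.
have KK0 : 0 <= KK by exact: (divr_ge0 (mulr_ge0 (ltW CH0) (ltW y0)) (exprn_ge0 _ (ltW mm0))).
pose X z := fine_euler h (n * m) z; pose Y z := coarse_euler h m n z.
pose X1 z := fine_tangent h (n * m) z; pose Y1 z := coarse_tangent h m n z.
pose X2 z := fine_tangent2 h (n * m) z.
pose F z := g (X z) - g (Y z).
pose Bd (z : R * Omega) := `|X1 z - Y1 z| / mm + `|X z - Y z| * (`|z.1| / (s ^+ 2 * mm) + KK).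
have Bd0 z : 0 <= Bd z.
  apply: addr_ge0; first by rewrite divr_ge0// ltW.
  by apply: mulr_ge0 => //; apply: addr_ge0 => //; rewrite divr_ge0// mulr_ge0 ?sqr_ge0// ltW.
have mgr j : measurable_fun setT (gr h j) by exact: mGp.
have mXs : measurable_fun setT (X : g_sigma_algebraType (range (halfspaces (joint_coord (gr h)))) -> R).
  exact: (@measurable_euler _ _ _ _ _ _ _ ff1 _ _ (gr h) _ _ id _).
have mYs : measurable_fun setT (Y : g_sigma_algebraType (range (halfspaces (joint_coord (gr h)))) -> R).
  exact: (@measurable_euler _ _ _ _ _ _ _ ff1 _ _ (gr h) _ _ (fun j => (j * m)%N) _).
have mX1s : measurable_fun setT (X1 : g_sigma_algebraType (range (halfspaces (joint_coord (gr h)))) -> R).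
  exact: (@measurable_euler_tangent _ _ _ _ _ _ _ _ ff1 f1f2 _ _ (gr h) _ _ id _).
have mY1s : measurable_fun setT (Y1 : g_sigma_algebraType (range (halfspaces (joint_coord (gr h)))) -> R).
  exact: (@measurable_euler_tangent _ _ _ _ _ _ _ _ ff1 f1f2 _ _ (gr h) _ _ (fun j => (j * m)%N) _).
have mgc : measurable_fun setT g by exact: continuous_measurable_fun.
have mF : measurable_fun setT (F : g_sigma_algebraType (range (halfspaces (joint_coord (gr h)))) -> R).
  by apply: measurable_funB; exact: measurableT_comp.
have mfst : measurable_fun setT (fun z : g_sigma_algebraType (range (halfspaces (joint_coord (gr h)))) => z.1).
  exact: (@measurable_generator _ _ _ _ (joint_coord (gr h)) None).
have mBd : measurable_fun setT (Bd : g_sigma_algebraType (range (halfspaces (joint_coord (gr h)))) -> R).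
  apply: measurable_funD.
    apply: measurable_funM; last exact: measurable_cst.
    by apply: measurableT_comp => //; exact: measurable_funB.
  apply: measurable_funM; first by apply: measurableT_comp => //; exact: measurable_funB.
  apply: measurable_funD; last exact: measurable_cst.
  apply: measurable_funM; last exact: measurable_cst.
  exact: measurableT_comp.
have FM z : `|F z| <= 2 by apply: le_trans (ler_normB _ _) _; have := g1 (X z); have := g1 (Y z); lra.
have X1CD z : `|X1 z| <= CD.
  by apply: (HCD Omega h (N * m)%N) => // k kK; apply: HMr; exact: rng.
have Y1CD z : `|Y1 z| <= CD.
  apply: (HCD Omega (m%:R * h) N) => //; first by rewrite mulr_gt0.
  by move=> k kN; apply: HMr; apply: rng; rewrite leq_mul2r kN orbT.
have FB w : `|\int[mu]_x (F (x, w) * phi x)| <= \int[mu]_x (Bd (x, w) * phi x).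
  have dX (t : R) : is_derive t 1 (fun s => X (s, w)) (X1 (t, w)) by exact: is_derive_euler.
  have dY (t : R) : is_derive t 1 (fun s => Y (s, w)) (Y1 (t, w)) by exact: is_derive_euler.
  have dX1 (t : R) : is_derive t 1 (fun s => X1 (s, w)) (X2 (t, w)).
    by apply: is_derive_euler_tangent.
  have cX2 : continuous (fun s => X2 (s, w)) by apply: (continuous_euler_tangent2 ff1 f1f2 cf2).
  have cY1 : continuous (fun s => Y1 (s, w)) by apply: (continuous_euler_tangent ff1 f1f2).
  (* [B] depends on w. It only controls growth in the Gaussian variable, for integrability and
     boundary terms, and is absent from the estimate of [density_comparison]. *)
  pose B := `|X (0, w) - Y (0, w)| + 2 * CD.
  have CDB : CD <= B by rewrite /B; have := normr_ge0 (X (0, w) - Y (0, w)); move: CD0; lra.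
  have X1m t : mm <= `|X1 (t, w)|.
    have low := Hlow Omega h (N * m)%N (fun j => rho (j%:R * h)) (fun l => p (l%:R * h))
      (fun k => rho (k%:R * h) - \sum_(l < k) fw h (k - l) * p (l%:R * h)) (gr h) hp hh0 KT.
    have := low _ _ _ (n * m)%N nmK (t, w); rewrite nmE; apply.
    - by move=> k _; rewrite addrC subrK.
    - by move=> k kK; apply: p_ge; exact: rng.
    - by move=> k kK; apply: (Hh1 h (N * m)%N).
  apply: (density_comparison s_neq0 dX dX1 dY cX2 cY1 mm0 X1m _ _ _ KK0 _ cg g1 (B := B)).
  - by move=> t; apply: le_trans (X1CD _) CDB.
  - by move=> t; apply: le_trans (Y1CD _) CDB.
  - move=> t; have lX := lipschitz_of_derive dX (fun s => X1CD (s, w)) t 0.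
    have lY := lipschitz_of_derive dY (fun s => Y1CD (s, w)) t 0.
    rewrite subr0 in lX lY.
    have -> : X (t, w) - Y (t, w) = (X (0, w) - Y (0, w)) + ((X (t, w) - X (0, w)) - (Y (t, w) - Y (0, w))) by ring.
    apply: le_trans (ler_normD _ _) _.
    have := ler_normB (X (t, w) - X (0, w)) (Y (t, w) - Y (0, w)).
    rewrite /B; set q := `|X (0, w) - Y (0, w)|.
    have q0 : 0 <= q * `|t| by exact: (mulr_ge0 (normr_ge0 _) (normr_ge0 _)).
    by rewrite mulrDr mulr1 mulrDl; move: lX lY CD0; lra.
  - move=> t; have b2 : `|X2 (t, w)| <= CH * y.
      rewrite /y -nmE; apply: (HCH Omega h (N * m)%N) => // k kK.
      by apply: HMr; exact: rng.
    apply: (le_trans b2); rewrite /KK -[leLHS](divfK (_ : mm ^+ 2 != 0)) ?expf_neq0 ?gt_eqF//.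
    apply: ler_wpM2l; first exact: KK0.
    by rewrite -(real_normK (num_real (X1 (t, w)))) lerXn2r ?nnegrE ?(ltW mm0).
have := @gaussian_disintegration_le _ _ _ P s s_neq0 xi nat (gr h) mxi mgr _ (cf (fun j : nat => j%:R * h))
  F Bd 2 mF FM mBd Bd0 FB.
have [wU wU'] := HCE h m N n hp m0 NT nN.
(* [Bd] is bounded by (1 + |xi|) Z, and Z has its weighted norm controlled by [block_estimates]. *)
pose Z w := mm^-1 * `|X1 (xi w, w) - Y1 (xi w, w)| + (y^-1 * A2) * `|X (xi w, w) - Y (xi w, w)|.
have wZ : wle Z (`|mm^-1| * (CE * (m%:R * h) `^ ab * y) + `|y^-1 * A2| * (CE * (m%:R * h) `^ ab * y)).
  by apply: (wleD sxi); apply: (wleZ sxi); apply: (wle_norm sxi).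
have Z0 w : 0 <= Z w.
  by apply: addr_ge0; rewrite mulr_ge0// ?mulr_ge0// ?invr_ge0 ltW.
have EZ : `|mm^-1| * (CE * (m%:R * h) `^ ab * y) + `|y^-1 * A2| * (CE * (m%:R * h) `^ ab * y) =
    (CE / c0 + CE * A2) * (T / N%:R) `^ ab.
  rewrite !ger0_norm ?mulr_ge0 ?invr_ge0 ?(ltW mm0) ?(ltW y0) ?(ltW A20)// mhE /mm.
  by field; rewrite !gt_eqF.
rewrite EZ in wZ => le1.
rewrite -lee_fin; apply: (le_trans le1); case: wZ => mZ; apply: le_trans.
apply: ge0_le_integral => //.
- by move=> w _; rewrite lee_fin.
- by apply/measurable_EFinP; exact: (@msig (gr h)).
- apply/measurable_EFinP; apply: measurable_funM.
    by apply: measurable_funD; [exact: measurable_cst|exact: measurableT_comp].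
  exact: measurableT_comp.
- move=> w _; rewrite lee_fin (ger0_norm (Z0 w)) /Bd /Z/=.
  set a := `|X1 _ - _|; set b := `|X _ - _|; set x := `|xi w|.
  have x0' : 0 <= x by exact: normr_ge0.
  have a0 : 0 <= a by exact: normr_ge0.
  have b0 : 0 <= b by exact: normr_ge0.
  have KE : KK = y^-1 * (CH / c0 ^+ 2) by rewrite /KK /mm; field; rewrite !gt_eqF.
  have sE : x / (s ^+ 2 * mm) = x * (y^-1 * (s ^+ 2 * c0)^-1).
    by rewrite /mm; field; rewrite s_neq0 !gt_eqF.
  rewrite sE KE -subr_ge0.
  have -> : (1 + x) * (mm^-1 * a + y^-1 * A2 * b) -
      (a / mm + b * (x * (y^-1 * (s ^+ 2 * c0)^-1) + y^-1 * (CH / c0 ^+ 2))) =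
      x * (mm^-1 * a) + b * (y^-1 * (s ^+ 2 * c0)^-1) + x * b * (y^-1 * (CH / c0 ^+ 2)).
    by rewrite /A2; ring.
  have p1 : 0 <= y^-1 by rewrite invr_ge0 ltW.
  have p2 : 0 <= (s ^+ 2 * c0)^-1 by rewrite invr_ge0 mulr_ge0 ?sqr_ge0// ltW.
  have p3 : 0 <= CH / c0 ^+ 2 by rewrite divr_ge0 ?exprn_ge0 ?(ltW CH0) ?(ltW c00).
  have p4 : 0 <= mm^-1 by rewrite invr_ge0 ltW.
  exact: (addr_ge0 (addr_ge0 (mulr_ge0 x0' (mulr_ge0 p4 a0)) (mulr_ge0 b0 (mulr_ge0 p1 p2)))
    (mulr_ge0 (mulr_ge0 x0' b0) (mulr_ge0 p1 p3))).
Unshelve. all: by end_near. Qed.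

End weak_comparison.

(** * From test functions to densities *)

Section continuous_approximation.
Context {R : realType} d (Omega : measurableType d) (P : probability Omega R).
Context (X Y : Omega -> R) (mX : measurable_fun setT X) (mY : measurable_fun setT Y).
Implicit Types (g k : R -> R) (A : set R).

Let err k g w : R := `|k (X w) - g (X w)| + `|k (Y w) - g (Y w)|.

Let merr k g : measurable_fun setT k -> measurable_fun setT g -> measurable_fun setT (err k g).
Proof.
move=> mk mg; apply: measurable_funD; apply: measurableT_comp => //;
  by apply: measurable_funB; exact: measurableT_comp.
Qed.

Let err_le2 k g w : (forall t, 0 <= k t <= 1) -> (forall t, 0 <= g t <= 1) -> `|err k g w| <= 2.
Proof.
move=> k01 g01; rewrite ger0_norm ?addr_ge0//.
have b t : `|k t - g t| <= 1.
  by rewrite ler_norml; have := k01 t; have := g01 t => /andP[? ?] /andP[? ?]; apply/andP; split; lra.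
by have := b (X w); have := b (Y w); rewrite /err; lra.
Qed.

Let ierr k g : measurable_fun setT k -> measurable_fun setT g ->
  (forall t, 0 <= k t <= 1) -> (forall t, 0 <= g t <= 1) -> P.-integrable setT (EFin \o err k g).
Proof.
by move=> mk mg k01 g01; apply: (@bounded_integrable _ _ _ P _ 2); [exact: merr|move=> w; exact: err_le2].
Qed.

(** Approximation in L^1 under the laws of X and Y simultaneously, by continuous functions with
    values in [0, 1]. Closure under complement, product and pointwise limits makes the sets with
    approximable indicator a sigma-algebra. *)
Definition continuously_approximable k := [/\ measurable_fun setT k, forall t, 0 <= k t <= 1 &
  forall e : R, 0 < e -> exists g, [/\ continuous g, forall t, 0 <= g t <= 1 &
    \int[P]_w (`|k (X w) - g (X w)| + `|k (Y w) - g (Y w)|) <= e]].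

Lemma approximable_continuous g : continuous g -> (forall t, 0 <= g t <= 1) ->
  continuously_approximable g.
Proof.
move=> cg g01; split=> //; first exact: continuous_measurable_fun.
move=> e e0; exists g; split=> //.
under eq_Rintegral do rewrite !subrr normr0 addr0.
by rewrite /Rintegral integral0 ltW.
Qed.

Lemma approximable_compl k : continuously_approximable k -> continuously_approximable (fun t => 1 - k t).
Proof.
move=> [mk k01 ak]; split.
- by apply: measurable_funB => //; exact: measurable_cst.
- by move=> t; have /andP[? ?] := k01 t; apply/andP; split; lra.
move=> e /ak[g [cg g01 ge]]; exists (fun t => 1 - g t); split.
- by apply: continuous_funB => // t; exact: cvg_cst.
- by move=> t; have /andP[? ?] := g01 t; apply/andP; split; lra.
- apply: le_trans ge; rewrite le_eqVlt; apply/orP; left; apply/eqP; apply: eq_Rintegral => w _.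
  have e1 (a b : R) : `|1 - a - (1 - b)| = `|a - b|.
    by rewrite distrC; congr `|_|; ring.
  by rewrite !e1.
Qed.

Lemma approximable_mul k k' : continuously_approximable k -> continuously_approximable k' ->
  continuously_approximable (fun t => k t * k' t).
Proof.
move=> [mk k01 ak] [mk' k'01 ak']; split.
- exact: measurable_funM.
- by move=> t; exact: itv01M.
move=> e e0; have e2 : 0 < e / 2 by rewrite divr_gt0.
have [g [cg g01 ge]] := ak _ e2; have [g' [cg' g'01 ge']] := ak' _ e2.
exists (fun t => g t * g' t); split.
- exact: continuous_funM.
- by move=> t; exact: itv01M.
have mg : measurable_fun setT g by exact: continuous_measurable_fun.
have mg' : measurable_fun setT g' by exact: continuous_measurable_fun.
apply: (@le_trans _ _ (\int[P]_w (err k g w + err k' g' w))).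
  apply: le_Rintegral => //.
  - apply: (@ierr (fun t => k t * k' t) (fun t => g t * g' t)); try exact: measurable_funM.
      by move=> t; exact: itv01M.
    by move=> t; exact: itv01M.
  - exact: (integrableD measurableT (ierr mk mg k01 g01) (ierr mk' mg' k'01 g'01)).
  - move=> w _; have e1 (t : R) : `|k t * k' t - g t * g' t| <= `|k t - g t| + `|k' t - g' t|.
      rewrite (_ : k t * k' t - g t * g' t = (k t - g t) * k' t + g t * (k' t - g' t)); last by ring.
      apply: le_trans (ler_normD _ _) _; rewrite !normrM.
      have /andP[a0 a1] := k'01 t; have /andP[b0 b1] := g01 t.
      rewrite (ger0_norm a0) (ger0_norm b0); apply: lerD.
        by rewrite ler_piMr.
      by rewrite ler_piMl.
    by have := e1 (X w); have := e1 (Y w); rewrite /err; lra.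
rewrite RintegralD//; try exact: ierr.
by move: ge ge'; rewrite /err; lra.
Qed.

Lemma approximable_lim (k_ : nat -> R -> R) k : (forall n, continuously_approximable (k_ n)) ->
  (forall t, k_ n t @[n --> \oo] --> k t) -> continuously_approximable k.
Proof.
move=> ak ck.
have k01 t : 0 <= k t <= 1.
  apply/andP; split; [apply: (ge_of_cvg (ck t))|apply: (le_of_cvg (ck t))] => n;
    by have [_ /(_ t) /andP[] //] := ak n.
have mk : measurable_fun setT k.
  by apply: (measurable_fun_cvg (h := k_)) => [n|t _]; [case: (ak n)|exact: ck].
split=> // e e0.
have e2 : 0 < e / 2 by rewrite divr_gt0.
have c0 : (\int[P]_w err k (k_ n) w)%R @[n --> \oo] --> (\int[P]_w (fun=> 0 : R) w)%R.
  apply: (@bounded_cvg_Rintegral _ _ _ P (fun n => err k (k_ n)) (fun=> 0) 2).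
  - by move=> n; apply: merr => //; case: (ak n).
  - exact: measurable_cst.
  - by move=> n w; apply: err_le2 => //; case: (ak n).
  - move=> w; have cc t : `|k t - k_ n t| @[n --> \oo] --> (0 : R).
      rewrite -(normr0 R) -(subrr (k t)); apply: cvg_norm.
      by apply: cvgB; [exact: cvg_cst|exact: ck].
    by rewrite -(addr0 (0 : R)); apply: cvgD; exact: cc.
rewrite {2}/Rintegral integral0/= in c0.
have [N _ HN] : \forall n \near \oo, \int[P]_w err k (k_ n) w < e / 2 by exact: (cvgr_lt _ c0).
have {}HN := HN N (leqnn N).
have [mN N01 /(_ _ e2)[g [cg g01 ge]]] := ak N.
have mg : measurable_fun setT g by exact: continuous_measurable_fun.
exists g; split=> //; rewrite /= in HN.
apply: (@le_trans _ _ (\int[P]_w (err k (k_ N) w + err (k_ N) g w))).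
  apply: le_Rintegral => //.
  - exact: (@ierr k g).
  - exact: (integrableD measurableT (ierr mk mN k01 N01) (ierr mN mg N01 g01)).
  - move=> w _; rewrite /err.
    have := ler_normD (k (X w) - k_ N (X w)) (k_ N (X w) - g (X w)).
    have := ler_normD (k (Y w) - k_ N (Y w)) (k_ N (Y w) - g (Y w)).
    by rewrite !addrA !subrK; lra.
rewrite RintegralD//; try exact: ierr.
by move: ge HN; rewrite /err; lra.
Qed.

(** The truncation of y to [0, 1], written with absolute values so that its continuity is immediate.
    With slopes n it approximates the indicator of an open half-line. *)
Let clamp01 (y : R) : R := (`|y| - `|y - 1| + 1) / 2.

Let clampE (y : R) : clamp01 y = if y <= 0 then 0 else if y <= 1 then y else 1.
Proof.
rewrite /clamp01; case: ifPn => [y0|]; first by rewrite ler0_norm// ler0_norm; lra.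
rewrite -ltNge => y0; case: ifPn => [y1|]; first by rewrite gtr0_norm// ler0_norm; lra.
by rewrite -ltNge => y1; rewrite !gtr0_norm//; lra.
Qed.

Lemma approximable_measurable A : measurable A -> continuously_approximable (\1_A : R -> R).
Proof.
move=> mA; have gA : (<<s @RGenOInfty.G R >>) A.
  change ((@RGenOInfty.G R).-sigma.-measurable A).
  by have <- := @RGenOInfty.measurableE R.
suff S : sigma_algebra setT [set B : set R | continuously_approximable (\1_B : R -> R)].
  suff sub : @RGenOInfty.G R `<=` [set B : set R | continuously_approximable (\1_B : R -> R)].
    exact: (smallest_sub S sub gA).
  move=> _ [a ->] /=.
  apply: (@approximable_lim (fun n t => clamp01 (n%:R * (t - a)))).
    move=> n; apply: approximable_continuous => [|t]; last first.
      rewrite clampE; case: ifPn => [_|]; first by rewrite lexx ler01.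
      by rewrite -ltNge => /ltW n0; case: ifPn => [n1|_]; rewrite ?n0 ?n1 ?lexx ?ler01.
    have c1 : continuous (fun t : R => n%:R * (t - a)).
      move=> t; apply: cvgM; first exact: cvg_cst.
      by apply: cvgB; [exact: cvg_id|exact: cvg_cst].
    move=> t; apply: cvgM; last exact: cvg_cst.
    apply: cvgD; last exact: cvg_cst.
    apply: cvgB; apply: cvg_norm; first exact: c1.
    by apply: cvgB; [exact: c1|exact: cvg_cst].
  move=> t; have [ta|at_] := leP t a.
    rewrite indicE memNset; last by rewrite /= in_itv/= andbT ltNge ta.
    under eq_fun do rewrite clampE mulr_ge0_le0 ?subr_le0//.
    exact: cvg_cst.
  rewrite indicE mem_set/=; last by rewrite in_itv/= andbT.
  apply: cvg_near_cst; near=> n; rewrite clampE.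
  have ta0 : 0 < t - a by rewrite subr_gt0.
  have n1 : 1 < n%:R * (t - a).
    rewrite -ltr_pdivrMr//; near: n; exact: nbhs_infty_gtr.
  by rewrite !leNgt n1 (lt_trans ltr01 n1).
split=> /=.
- rewrite indic0; apply: approximable_continuous => [t|t]; first exact: cvg_cst.
  by rewrite lexx ler01.
- move=> B /approximable_compl; rewrite (_ : (fun t => _) = \1_(setT `\` B))//.
  by apply/funext => t; rewrite !indicE in_setD in_setT/=; case: (t \in B); rewrite ?subrr ?subr0.
- move=> F HF.
  (* A countable union is the limit of finite ones, and a finite union is built from complements and
     products of indicators. *)
  pose U n : set R := \big[setU/set0]_(i < n) F i.
  have aU n : continuously_approximable (\1_(U n) : R -> R).
    elim: n => [|n IH].
      rewrite /U big_ord0 indic0; apply: approximable_continuous => [t|t]; first exact: cvg_cst.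
      by rewrite lexx ler01.
    have := approximable_compl (approximable_mul (approximable_compl IH) (approximable_compl (HF n))).
    rewrite (_ : (fun t => _) = \1_(U n.+1))//; apply/funext => t.
    rewrite /U big_ord_recr/= !indicE in_setU; case: (t \in F n); case: (t \in _) => /=; by ring.
  apply: (approximable_lim aU) => t.
  have [[i _ Fit]|nF] := pselect ((\bigcup_i F i) t).
    rewrite indicE mem_set/=; last by exists i.
    apply: cvg_near_cst; near=> n; rewrite indicE mem_set//= /U.
    have ni : (i < n)%N by near: n; exact: nbhs_infty_gt.
    by rewrite (bigD1 (Ordinal ni))//=; left.
  rewrite indicE memNset//; apply: cvg_near_cst; near=> n; rewrite indicE memNset// => H; apply: nF.
  by move: H; rewrite /U -bigcup_mkord => -[i _ Fit]; exists i.
Unshelve. all: by end_near. Qed.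

Lemma continuous_test_functions (eps : R) :
  (forall g, continuous g -> (forall t, `|g t| <= 1) -> `|\int[P]_w (g (X w) - g (Y w))| <= eps) ->
  forall A, measurable A -> `|fine (P (X @^-1` A)) - fine (P (Y @^-1` A))| <= eps.
Proof.
move=> Hg A mA; apply/ler_addgt0Pr => e e0.
have [mk k01 /(_ e e0)[g [cg g01 ge]]] := approximable_measurable mA.
have mg : measurable_fun setT g by exact: continuous_measurable_fun.
have ind (Z : Omega -> R) : measurable_fun setT Z ->
    \int[P]_w (\1_A (Z w) : R) = fine (P (Z @^-1` A)).
  move=> mZ; rewrite /Rintegral; congr fine.
  rewrite (_ : (\int[P]_w _)%E = (\int[P]_w (\1_(Z @^-1` A) w)%:E)%E)//.
  by rewrite integral_indic ?setIT// -[X in measurable X]setTI; exact: mZ.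
have bi (h : R -> R) (Z : Omega -> R) : measurable_fun setT h -> measurable_fun setT Z ->
    (forall t, 0 <= h t <= 1) -> P.-integrable setT (EFin \o (fun w => h (Z w))).
  move=> mh mZ h01; apply: (@bounded_integrable _ _ _ P _ 1); first exact: measurableT_comp.
  by move=> w; have /andP[h0 h1] := h01 (Z w); rewrite ger0_norm.
rewrite -!ind//.
have g1 t : `|g t| <= 1 by have /andP[h0 h1] := g01 t; rewrite ger0_norm.
have iAX := bi _ _ mk mX k01; have iAY := bi _ _ mk mY k01.
have igX := bi _ _ mg mX g01; have igY := bi _ _ mg mY g01.
have iDX : P.-integrable setT (EFin \o (fun w => \1_A (X w) - g (X w) : R)).
  exact: (integrableB measurableT iAX igX).
have iDY : P.-integrable setT (EFin \o (fun w => \1_A (Y w) - g (Y w) : R)).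
  exact: (integrableB measurableT iAY igY).
have iDD : P.-integrable setT (EFin \o (fun w => (\1_A (X w) - g (X w)) - (\1_A (Y w) - g (Y w)) : R)).
  exact: (integrableB measurableT iDX iDY).
have := Hg g cg g1.
have -> : \int[P]_w (\1_A (X w) : R) - \int[P]_w (\1_A (Y w) : R) =
   \int[P]_w (g (X w) - g (Y w)) + \int[P]_w ((\1_A (X w) - g (X w)) - (\1_A (Y w) - g (Y w))).
  rewrite (RintegralB measurableT igX igY) (RintegralB measurableT iDX iDY).
  by rewrite (RintegralB measurableT iAX igX) (RintegralB measurableT iAY igY); ring.
move=> H1; apply: le_trans (ler_normD _ _) _; apply: lerD => //.
apply: le_trans ge; apply: (le_trans (le_normr_Rintegral measurableT iDD)).
apply: le_Rintegral => //.
- exact: (integrable_norm iDD).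
- exact: (@ierr (\1_A) g).
- by move=> w _; exact: ler_normB.
Qed.

End continuous_approximation.

(** * Uniform continuity and product integration *)

Section heine.
Context {R : realType}.

(** Uniform continuity from the covering form of compactness: each point of [0, T] has a
    neighbourhood on which all small radii work, and compactness makes the radius common. *)
Lemma heine (u : R -> R) (T e : R) : {within `[0, T], continuous u} -> 0 < e ->
  exists2 del : R, 0 < del & forall x y, 0 <= x <= T -> 0 <= y <= T -> `|x - y| < del -> `|u x - u y| < e.
Proof.
move=> /subspace_continuousP cu e0.
have nc := (compact_near_coveringP _).1 (@segment_compact R 0 T).
pose Pd (del x : R) := 0 <= x <= T -> forall y, 0 <= y <= T -> `|x - y| < del -> `|u x - u y| < e.
have := nc R (0^'+) Pd _ _.
have key : forall x : R, `[0, T]%classic x -> \forall x' \near x & del \near 0^'+, Pd del x'.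
  move=> x xT.
  have e2 : 0 < e / 2 by rewrite divr_gt0.
  have /cvgrPdist_lt/(_ _ e2) := cu x xT; rewrite near_withinE => /nbhs_ballP[eta /= eta0 Heta].
  have eta2 : 0 < eta / 2 by rewrite divr_gt0.
  near=> x' del; rewrite /Pd/= => x'T y yT xy.
  have h1 : ball x (eta / 2) x' by near: x'; exact: nbhsx_ballx.
  have h2 : del < eta / 2 by near: del; exact: nbhs_right_lt.
  have b1 : `|u x - u x'| < e / 2.
    apply: Heta; last by rewrite /= in_itv.
    by move: h1; rewrite /ball/= => h1; lra.
  have b2 : `|u x - u y| < e / 2.
    apply: Heta; last by rewrite /= in_itv.
    move: h1; rewrite /ball/= => h1.
    have := ler_normD (x - x') (x' - y); rewrite addrA subrK; lra.
  have := ler_normD (u x' - u x) (u x - u y); rewrite addrA subrK (distrC (u x') (u x)); lra.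
move=> /(_ _ key) H.
have Hn : \forall del \near 0^'+, (0 < del) /\ (`[0, T]%classic `<=` Pd del).
  by near=> del; split; [near: del; exact: nbhs_right_gt|near: del; exact: H].
have [del [d0 Hd]] := filter_ex Hn.
by exists del => // x y xT yT xy; apply: Hd => //; rewrite /= in_itv.
Unshelve. all: by end_near. Qed.

End heine.

Section kernel_sums.
Context {R : realType} (al : R) (al_gt0 : 0 < al) (al_lt1 : al < 1).
Local Notation mu := (@lebesgue_measure R).
Local Notation fw := (fweight al).

Lemma integrable_dist_powR (t : R) : 0 <= t ->
  mu.-integrable `[0, t] (EFin \o (fun s => `|t - s| `^ (al - 1))).
Proof.
move=> t0; apply/integrableP; split.
  by apply/measurable_EFinP; apply: measurable_funTS; exact: measurable_dist_powR.
have a1 : al - 1 + 1 = al by ring.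
under eq_integral do rewrite /= ger0_norm ?powR_ge0//.
by rewrite integral_dist_powR_left ?a1 ?gt_eqF ?ltry//; right.
Qed.

Lemma cell_weight (h : R) (n l : nat) : 0 < h -> (l < n)%N ->
  \int[mu]_(s in `[l%:R * h, l.+1%:R * h]) (`|n%:R * h - s| `^ (al - 1)) = fw h (n - l).
Proof.
move=> h0 ln; have a1 : al - 1 + 1 = al by ring.
rewrite /Rintegral integral_dist_powR_left ?a1 ?gt_eqF//; last 3 first.
- by rewrite ler_wpM2r ?(ltW h0)// ler_nat.
- by rewrite ler_wpM2r ?(ltW h0)// ler_nat.
- by right.
rewrite /fweight/= -!mulrBl -!natrB//; last exact: ltnW.
by congr ((_ - (_%:R * _) `^ _) / _); lia.
Qed.

(** The kernel is integrated exactly and u is frozen at left end points, so the error is the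
    oscillation of u in a cell times the mass of the kernel. It serves both for the paths of the
    solution and for the correlation with the terminal value. *)
Lemma cell_integral_error (h : R) (n : nat) (u : R -> R) (M e : R) : 0 < h -> 0 <= e ->
  measurable_fun `[0, n%:R * h] u ->
  (forall s, 0 <= s <= n%:R * h -> `|u s| <= M) ->
  (forall l s, (l < n)%N -> l%:R * h <= s <= l.+1%:R * h -> `|u s - u (l%:R * h)| <= e) ->
  `|\int[mu]_(s in `[0, n%:R * h]) (`|n%:R * h - s| `^ (al - 1) * u s) -
     \sum_(l < n) fw h (n - l) * u (l%:R * h)| <= e * ((n%:R * h) `^ al / al).
Proof.
move=> h0 e0 mu_ uM ue.
set t := n%:R * h.
have t0 : 0 <= t by rewrite mulr_ge0// ltW.
pose F s := `|t - s| `^ (al - 1) * u s.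
have iK := integrable_dist_powR t0.
have mI : measurable (`[0, t]%classic : set (measurableTypeR R)) by exact: measurable_itv.
have iF : mu.-integrable `[0, t] (EFin \o F).
  have iMK : mu.-integrable `[0, t] (EFin \o (fun s => M * `|t - s| `^ (al - 1))).
    exact: (integrableZl mI M iK).
  apply: (le_integrable mI _ _ iMK) => //.
    apply/measurable_EFinP; apply: measurable_funM => //.
    by apply: measurable_funTS; exact: measurable_dist_powR.
  move=> s /=; rewrite in_itv/= => sT; rewrite lee_fin normrM ger0_norm ?powR_ge0//.
  rewrite mulrC [leRHS]ger0_norm; last by rewrite mulr_ge0 ?powR_ge0// (le_trans _ (uM _ sT)).
  by rewrite ler_wpM2r ?powR_ge0// uM.
have sub a b : 0 <= a -> b <= t -> `[a, b]%classic `<=` `[0%R, t]%classic.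
  move=> a0 bt s /=; rewrite !in_itv/= => /andP[as_ sb].
  by rewrite (le_trans a0 as_) (le_trans sb bt).
have iFs a b : 0 <= a -> b <= t -> mu.-integrable `[a, b] (EFin \o F).
  by move=> a0 bt; apply: (integrableS _ _ _ iF) => //; exact: sub.
have iKs a b : 0 <= a -> b <= t -> mu.-integrable `[a, b] (EFin \o (fun s => `|t - s| `^ (al - 1))).
  by move=> a0 bt; apply: (integrableS _ _ _ iK) => //; exact: sub.
suff main k : (k <= n)%N -> `|\int[mu]_(s in `[0, k%:R * h]) F s - \sum_(l < k) fw h (n - l) * u (l%:R * h)| <=
    e * \sum_(l < k) fw h (n - l).
  by have := main n (leqnn n); rewrite sum_fweight.
elim: k => [_|k IH kn].
  by rewrite mul0r set_itv1 Rintegral_set1 !big_ord0 subrr normr0 mulr0.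
have kt : k.+1%:R * h <= t by rewrite ler_wpM2r ?(ltW h0)// ler_nat.
have k0 : 0 <= k%:R * h by rewrite mulr_ge0// ltW.
have kk : k%:R * h <= k.+1%:R * h by rewrite ler_wpM2r ?(ltW h0)// ler_nat.
have splitF : \int[mu]_(s in `[0, k.+1%:R * h]) F s =
    \int[mu]_(s in `[0, k%:R * h]) F s + \int[mu]_(s in `[k%:R * h, k.+1%:R * h]) F s.
  have := @Rintegral_itvB R F (BLeft 0) (BRight (k.+1%:R * h)) (k%:R * h) (iFs _ _ (lexx 0) kt).
  rewrite !bnd_simp => /(_ k0 kk).
  rewrite Rintegral_itv_obnd_cbnd => [<-|]; first by rewrite addrC subrK.
  apply: (integrableS _ _ _ (iFs _ _ k0 kt)) => // s /=.
  by rewrite !in_itv/= => /andP[/ltW -> ->].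
rewrite splitF !big_ord_recr/= mulrDr.
have cell : `|\int[mu]_(s in `[k%:R * h, k.+1%:R * h]) F s - fw h (n - k) * u (k%:R * h)| <= e * fw h (n - k).
  have iKc := iKs _ _ k0 kt.
  have mC : measurable (`[k%:R * h, k.+1%:R * h]%classic : set (measurableTypeR R)) by exact: measurable_itv.
  have iZ : mu.-integrable `[k%:R * h, k.+1%:R * h] (EFin \o (fun s => u (k%:R * h) * `|t - s| `^ (al - 1))).
    exact: (integrableZl mC _ iKc).
  have iE : mu.-integrable `[k%:R * h, k.+1%:R * h] (EFin \o (fun s => e * `|t - s| `^ (al - 1))).
    exact: (integrableZl mC _ iKc).
  rewrite -!(cell_weight h0 kn) -/t.
  rewrite (mulrC _ (u _)) -(RintegralZl (u (k%:R * h)) mC iKc) -(RintegralZl e mC iKc).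
  rewrite -(RintegralB mC (iFs _ _ k0 kt) iZ).
  have iD : mu.-integrable `[k%:R * h, k.+1%:R * h]
      (EFin \o (fun s => F s - u (k%:R * h) * `|t - s| `^ (al - 1))).
    exact: (integrableB mC (iFs _ _ k0 kt) iZ).
  apply: le_trans (le_normr_Rintegral _ iD) _ => //.
  apply: le_Rintegral => //.
  - exact: integrable_norm.
  - move=> s /=; rewrite in_itv/= => sk.
    rewrite /F (mulrC (u _)) -mulrBr normrM ger0_norm ?powR_ge0// mulrC.
    by rewrite ler_wpM2r ?powR_ge0// ue.
have := IH (ltnW kn); move: cell.
set a := \int[mu]_(_ in _) _; set b := \int[mu]_(_ in _) _.
set c := \sum_(_ < _) _ * _ => cell I.
rewrite (_ : b + a - (c + fw h (n - k) * u (k%:R * h)) = (b - c) + (a - fw h (n - k) * u (k%:R * h))); last by ring.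
by apply: le_trans (ler_normD _ _) _; apply: lerD.
Qed.

End kernel_sums.

(** * From probabilities of sets to the L^1 distance of densities *)

Section density_distance.
Context {R : realType} d (Omega : measurableType d) (P : probability Omega R).
Local Notation mu := (@lebesgue_measure R).

Lemma pdf_integral (X : {RV P >-> R}) q : is_pdf X q -> mu.-integrable setT (EFin \o q) /\
  forall A : set R, measurable A -> (\int[mu]_(r in A) (q r)%:E = (fine (P (X @^-1` A)))%:E)%E.
Proof.
case=> mq q0 qE.
have E (A : set R) : measurable A -> (\int[mu]_(r in A) (q r)%:E = (fine (P (X @^-1` A)))%:E)%E.
  by move=> mA; rewrite -(qE _ mA) -[LHS]fineK//; exact: (fin_num_measure (distribution P X)).
split=> //; apply/integrableP; split; first exact/measurable_EFinP.
under eq_integral do rewrite /= ger0_norm//.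
by rewrite E//= ltry.
Qed.

Lemma pdf_L1_half (X Y : {RV P >-> R}) p q (B : set R) : is_pdf X p -> is_pdf Y q -> measurable B ->
  (forall r, B r -> q r <= p r) ->
  (\int[mu]_(r in B) (`|p r - q r|)%:E <= (`|fine (P (X @^-1` B)) - fine (P (Y @^-1` B))|)%:E)%E.
Proof.
move=> hx hy mB qp; have [ix Ex] := pdf_integral hx; have [iy Ey] := pdf_integral hy.
have -> : (\int[mu]_(r in B) (`|p r - q r|)%:E = \int[mu]_(r in B) ((p r)%:E - (q r)%:E))%E.
  by apply: eq_integral => r; rewrite inE => Br; rewrite ger0_norm ?subr_ge0 ?qp// EFinB.
rewrite integralB_EFin//; [|by apply: integrableS ix|by apply: integrableS iy].
by rewrite Ex// Ey// -EFinB lee_fin ler_norm.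
Qed.

(** Scheffe's argument: on the set where one density dominates, and on its complement, the L^1
    distance is a difference of probabilities. The two halves account for the factor 2. *)
Lemma pdf_L1_le (X Y : {RV P >-> R}) qx qy (eps : R) : is_pdf X qx -> is_pdf Y qy ->
  (forall A : set R, measurable A -> `|fine (P (X @^-1` A)) - fine (P (Y @^-1` A))| <= eps) ->
  ('N[mu]_1[EFin \o (qx \- qy)%R] <= (2 * eps)%:E)%E.
Proof.
move=> hx hy He; have [mx _ _] := hx; have [my _ _] := hy.
pose A : set R := [set r | qy r <= qx r].
have mB : measurable_fun setT (qx \- qy) by exact: measurable_funB.
have mA : measurable A.
  rewrite (_ : A = setT `&` (qx \- qy) @^-1` `[0, +oo[%classic); last first.
    by apply/seteqP; split=> r /=; rewrite in_itv/= andbT subr_ge0 => //; case.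
  by apply: mB => //; exact: measurable_itv.
have mD : measurable_fun setT (EFin \o (fun r : R => `|qx r - qy r|)).
  by apply/measurable_EFinP; apply: measurableT_comp.
rewrite Lnorm1 -(setUv A) (ge0_integral_setU mu mA (measurableC mA)); first last.
- by apply/disj_setPS => r [Ar]; apply.
- by move=> r _; exact: abse_ge0.
- by rewrite setUv; exact: mD.
rewrite mulr_natl mulr2n EFinD; apply: leeD.
  apply: le_trans (pdf_L1_half hx hy mA _) _ => //.
  by rewrite lee_fin He.
under eq_integral do rewrite /= distrC.
apply: le_trans (pdf_L1_half hy hx (measurableC mA) _) _.
  by move=> r /negP; rewrite -ltNge => /ltW.
by rewrite lee_fin distrC He//; exact: measurableC.
Qed.

End density_distance.

Section weak_limit.
Context {R : realType} d (Omega : measurableType d) (P : probability Omega R).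

(** Z is meant for the fine schemes, which converge almost surely, and [Y_] for the coarse ones,
    which are versions of one fixed variable for every positive m. The bound on test functions
    survives the limit because g is continuous and bounded. *)
Lemma ae_weak_limit (X Y : Omega -> R) (Z Y_ : nat -> Omega -> R) (eps : R) :
  measurable_fun setT X -> measurable_fun setT Y ->
  (forall m, measurable_fun setT (Z m)) -> (forall m, measurable_fun setT (Y_ m)) ->
  {ae P, forall w, Z m w @[m --> \oo] --> X w} ->
  (forall m, (0 < m)%N -> {ae P, forall w, Y_ m w = Y w}) ->
  (\forall m \near \oo, forall g : R -> R, continuous g -> (forall t, `|g t| <= 1) ->
     `|\int[P]_w (g (Z m w) - g (Y_ m w))| <= eps) ->
  forall g : R -> R, continuous g -> (forall t, `|g t| <= 1) -> `|\int[P]_w (g (X w) - g (Y w))| <= eps.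
Proof.
move=> mX mY mZ mY_ aZ aY H g cg g1.
have mg : measurable_fun setT g by exact: continuous_measurable_fun.
have c : (\int[P]_w (g (Z m w) - g (Y_ m w))) @[m --> \oo] --> \int[P]_w (g (X w) - g (Y w)).
  apply: (@Rintegral_dominated_cvg _ _ _ P setT (fun m w => g (Z m w) - g (Y_ m w)) _ (fun=> 2)) => //.
  - by move=> m; apply: measurable_funB; exact: measurableT_comp.
  - by apply: measurable_funB; exact: measurableT_comp.
  - have aY' : {ae P, forall w m, (0 < m)%N -> Y_ m w = Y w}.
      apply: ae_foralln => m; have [m0|m0] := ltnP 0%N m.
        by apply: filterS (aY m m0) => w ->.
      by apply: aeW.
    apply: filterS2 aZ aY' => w Zw Yw _.
    apply: cvgB; first exact: (cvg_comp _ _ Zw (cg _)).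
    by apply: cvg_near_cst; exists 1%N => // m m0 /=; rewrite Yw.
  - by apply: (@bounded_integrable _ _ _ P (fun=> 2) 2) => // w; rewrite ger0_norm.
  - by apply: aeW => w m _; apply: (le_trans (ler_normB _ _)); rewrite -[2]/(1 + 1) lerD.
have cn : `|\int[P]_w (g (Z m w) - g (Y_ m w))| @[m --> \oo] --> `|\int[P]_w (g (X w) - g (Y w))|.
  exact: cvg_norm.
rewrite -(cvg_lim _ cn)//; apply: limr_le; first by apply/cvg_ex; eexists; exact: cn.
by apply: filterS H => m; exact.
Qed.

End weak_limit.

(** * Convergence of the refined scheme along a fixed path *)

Section pathwise_convergence.
Context {R : realType} (al T x0 kap sk L : R) (f : R -> R).
Hypotheses (al_gt0 : 0 < al) (al_lt1 : al < 1) (T_gt0 : 0 < T) (L_gt0 : 0 < L).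
Hypotheses (cf : continuous f) (flip : forall x y, `|f x - f y| <= L * `|x - y|).
Local Notation fw := (fweight al).
Local Notation mu := (@lebesgue_measure R).
Local Notation hh N m := (T / N%:R / m%:R).

(** The noise is the same in both equations and cancels. Consistency comes from the uniform
    continuity of f(u) and the exact weights, stability from [fractional_gronwall], whose constant
    does not depend on the grid. *)
Lemma euler_path_cvg (u g : R -> R) (Z : nat -> nat -> R) (N n : nat) : (0 < N)%N -> (n <= N)%N ->
  {within `[0, T], continuous u} ->
  (forall m i, (0 < m)%N -> (i <= N * m)%N ->
    u (i%:R * hh N m) = x0 + kap * \int[mu]_(s in `[0, i%:R * hh N m])
      ((i%:R * hh N m - s) `^ (al - 1) * f (u s)) + sk * g (i%:R * hh N m)) ->
  (forall m i, Z m i = x0 + kap * \sum_(l < i) fw (hh N m) (i - l) * f (Z m l) + sk * g (i%:R * hh N m)) ->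
  Z m (n * m)%N @[m --> \oo] --> u (n%:R * (T / N%:R)).
Proof.
move=> N0 nN cu uE ZE.
have cfu : {within `[0, T], continuous (f \o u)}.
  by move=> s; apply: (@continuous_comp (subspace _) _ _ u f s); [exact: cu|exact: cf].
have [M HM] : exists M, forall s, 0 <= s <= T -> `|f (u s)| <= M.
  have cn : {within `[0, T], continuous (fun s => `|f (u s)|)}.
    move=> s; apply: (@continuous_comp (subspace _) _ _ (f \o u) (fun y : R => `|y|) s); first exact: cfu.
    exact: norm_continuous.
  have [c _ Hc] := EVT_max (ltW T_gt0) cn.
  by exists `|f (u c)| => s sT; apply: Hc; rewrite in_itv.
have mfu : measurable_fun `[0, T] (f \o u) by exact: subspace_continuous_measurable_fun.
have L0 : 0 <= `|kap| * L by rewrite mulr_ge0// ltW.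
have [C C0 HC] := fractional_gronwall al_gt0 L0 T_gt0.
apply/cvgrPdist_le => e e0.
pose Ta := T `^ al / al.
have Ta0 : 0 <= Ta by rewrite divr_ge0 ?powR_ge0// ltW.
pose q := C * (`|kap| * Ta) + 1.
have q1 : 0 <= C * (`|kap| * Ta) by exact: (mulr_ge0 (ltW C0) (mulr_ge0 (normr_ge0 _) Ta0)).
have q0 : 0 < q by rewrite ltr_wpDl.
have eq0 : 0 < e / q by rewrite divr_gt0.
have [del del0 Hdel] := heine cfu eq0.
have N0' : 0 < N%:R :> R by rewrite ltr0n.
near=> m.
have m0 : (0 < m)%N by near: m; exact: nbhs_infty_gt.
pose h := hh N m.
have m0' : 0 < m%:R :> R by rewrite ltr0n.
have h0 : 0 < h by exact: (divr_gt0 (divr_gt0 T_gt0 N0') m0').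
have hdel : h < del.
  rewrite /h ltr_pdivrMr// -ltr_pdivrMl// mulrC; near: m; exact: nbhs_infty_gtr.
have NmT : (N * m)%:R * h = T by rewrite /h natrM; field; rewrite !gt_eqF.
pose b := `|kap| * (e / q * Ta).
have b0 : 0 <= b by exact: (mulr_ge0 (normr_ge0 _) (mulr_ge0 (ltW eq0) Ta0)).
have := HC h (N * m)%N b (fun i r => `|Z m i - u (i%:R * h)| <= r) h0.
rewrite NmT => /(_ (lexx _) b0) K.
have step : `|Z m (n * m)%N - u ((n * m)%:R * h)| <= C * b.
  apply: K; last by rewrite leq_mul2r nN orbT.
    by move=> i r r' rr' /le_trans; apply.
  move=> i iN r r0 Hr.
  have i0 : 0 <= i%:R * h by rewrite mulr_ge0// ltW.
  have ihT : i%:R * h <= T by rewrite -NmT ler_wpM2r ?ler_nat// ltW.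
  rewrite ZE uE// -/h.
  set S1 := \sum_(_ < _) _; set I1 := \int[mu]_(_ in _) _.
  have -> : x0 + kap * S1 + sk * g (i%:R * h) - (x0 + kap * I1 + sk * g (i%:R * h)) = kap * (S1 - I1).
    by ring.
  rewrite normrM; pose Q := \sum_(l < i) fw h (i - l) * f (u (l%:R * h)).
  have E1 : `|I1 - Q| <= e / q * Ta.
    have -> : I1 = \int[mu]_(s in `[0, i%:R * h]) (`|i%:R * h - s| `^ (al - 1) * (f \o u) s).
      by apply: eq_Rintegral => s; rewrite inE/= in_itv/= => /andP[_ si]; rewrite ger0_norm ?subr_ge0.
    have mfi : measurable_fun `[0, i%:R * h] (f \o u).
      apply: measurable_funS mfu => // s /=.
      by rewrite !in_itv/= => /andP[-> si]; exact: (le_trans si).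
    apply: (le_trans (cell_integral_error (M := M) (e := e / q) al_gt0 al_lt1 h0 (ltW eq0) mfi _ _)).
    - by move=> s /andP[s0 si]; apply: HM; rewrite s0 (le_trans si).
    - move=> l s li /andP[ls sl].
      have l0 : 0 <= l%:R * h by rewrite mulr_ge0// ltW.
      have lT : l.+1%:R * h <= T by apply: le_trans ihT; rewrite ler_wpM2r ?ler_nat// ltW.
      have sT : s <= T by exact: (le_trans sl).
      apply/ltW/Hdel; first by rewrite (le_trans l0 ls).
        by rewrite l0 (le_trans ls).
      rewrite ger0_norm ?subr_ge0//; apply: le_lt_trans hdel.
      by rewrite lerBlDr (le_trans sl)// -natr1 mulrDl mul1r addrC.
    apply: ler_wpM2l; first exact: ltW.
    rewrite ler_wpM2r ?invr_ge0 ?(ltW al_gt0)//.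
    by apply: ge0_ler_powR; rewrite ?nnegrE ?(ltW al_gt0) ?(ltW T_gt0).
  have E2 : `|S1 - Q| <= L * \sum_(l < i) fw h (i - l) * r l.
    rewrite /S1 /Q -sumrB mulr_sumr; apply: le_trans (ler_norm_sum _ _ _) _; apply: ler_sum => l _.
    have f0 := fweight_ge0 al_gt0 (i - l) (ltW h0).
    rewrite -mulrBr normrM (ger0_norm f0) [leRHS]mulrCA; apply: ler_wpM2l => //.
    by apply: (le_trans (flip _ _)); rewrite ler_wpM2l ?(ltW L_gt0)// Hr.
  rewrite /b -(mulrA `|kap| L) -mulrDr ler_wpM2l//.
  have := ler_distD Q S1 I1; rewrite (distrC Q) => T1.
  by apply: (le_trans T1); rewrite addrC lerD.
have uE' : (n * m)%:R * h = n%:R * (T / N%:R).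
  by rewrite /h natrM; field; rewrite !gt_eqF.
rewrite distrC -uE'; apply: (le_trans step).
have -> : C * b = e * ((C * (`|kap| * Ta)) / q) by rewrite /b; ring.
rewrite -[leRHS]mulr1 ler_wpM2l ?(ltW e0)// ler_pdivrMr// mul1r /q.
by rewrite lerDl.
Unshelve. all: by end_near. Qed.

End pathwise_convergence.

(** * The noise of the equation *)

Section driving_noise.
Context {R : realType} d (Omega : measurableType d) (P : probability Omega R).
Context (T H al : R) (W : R -> {RV P >-> R}).
Hypotheses (T_gt0 : 0 < T) (H_gt : 2^-1 < H) (H_lt1 : H < 1) (W_fbm : is_fbm T H W).
Hypotheses (al_gt : 1 - H < al) (al_lt1 : al < 1).
Local Notation mu := (@lebesgue_measure R).
Local Notation k := (frac_kernel al).
Local Notation be := (2 * H - 1).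
Local Notation xi := (W T : Omega -> R).
Local Notation ka := (kernel_marginal T H).
Local Notation fw := (fweight al).

Let al_gt0 : 0 < al. Proof. by move: H_lt1 al_gt; lra. Qed.

Let be_gt0 : 0 < be. Proof. by move: H_gt; lra. Qed.

Lemma ip_eq0_ae (X : Omega -> R) : sqint P X -> ip P X X <= 0 -> {ae P, forall w, X w = 0}.
Proof.
move=> sX X0; have [mX iX] := sX.
have mX2 : measurable_fun setT (EFin \o (fun w => X w ^+ 2)) by exact: (measurable_int P).
have E : (\int[P]_w `|(EFin \o (fun w => (X w ^+ 2)%R)) w| = 0)%E.
  have <- : ((ip P X X)%:E = 0)%E by congr EFin; apply/eqP; rewrite eq_le X0 ip_ge0.
  rewrite /ip /Rintegral fineK; last by apply: integrable_fin_num => //; exact: sqint_mul.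
  by apply: eq_integral => w _; rewrite /= ger0_norm ?sqr_ge0// expr2.
have := (ae_eq_integral_abs P measurableT mX2).1 E.
apply: filterS => w /(_ I) /= /eqP.
by rewrite eqe sqrf_eq0 => /eqP.
Qed.

(** The kernel at time 0 vanishes on [0, T], its value at the origin being 0 to a negative power,
    which is 0 by convention. The noise at time 0 is therefore null, in accordance with the initial
    value of the scheme. *)
Lemma wiener_integral0 (G : {RV P >-> R}) : wiener_integral T H W (k 0) G -> {ae P, forall w, G w = 0}.
Proof.
move=> wG; have T0 : (0 : R) <= 0 <= T by apply/andP; split=> //; exact: ltW.
have sG : sqint P G by case: (wiener_integral_space W_fbm wG).
have c := kernel_step_l2cvg T_gt0 H_gt H_lt1 W_fbm al_gt al_lt1 T0 wG.
have ok n : times_ok T (kernel_step al 0 n).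
  exact: (@kernel_step_ok _ al T 0 n (lexx _) (ltW T_gt0)).
have ss n : sqint P (step_integral W (kernel_step al 0 n)) by exact: (sqint_step W_fbm (ok n)).
have z n : ip P (step_integral W (kernel_step al 0 n)) (step_integral W (kernel_step al 0 n)) = 0.
  rewrite (ip_step T_gt0 H_gt W_fbm (ok n) (ok n)) /fbm_inner /Rintegral.
  rewrite [X in fine X](_ : _ = 0%E) ?mulr0// integral0_eq// => -[u v] /= [u0 _].
  have u0' : 0 <= u by move: u0; rewrite in_itv/= => /andP[].
  have := kernel_step_le H_lt1 al_gt al_lt1 n (lexx 0) u0'.
  rewrite (frac_kernel_out al_lt1 u0') => u00.
  have -> : step_fun (kernel_step al 0 n) u = 0 by apply/eqP; rewrite eq_le andbC.
  by rewrite !mul0r.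
apply: (ip_eq0_ae sG); have c1 := l2cvg_nrm ss sG c.
have c2 : ip P (step_integral W (kernel_step al 0 n)) (step_integral W (kernel_step al 0 n)) @[n --> \oo] --> (0 : R).
  by under eq_fun do rewrite z; exact: cvg_cst.
by rewrite (_ : ip P G G = 0)//; exact: (cvg_unique _ c1 c2).
Qed.

(** The increment estimate with equal times bounds the squared distance of the two versions by 0. *)
Lemma wiener_versions t (G G' : {RV P >-> R}) : 0 <= t <= T ->
  wiener_integral T H W (k t) G -> wiener_integral T H W (k t) G' -> {ae P, forall w, G w = G' w}.
Proof.
move=> tT wG wG'.
have [C C0 HC] := wiener_increment T_gt0 H_gt H_lt1 W_fbm al_gt al_lt1.
have sG : sqint P G by case: (wiener_integral_space W_fbm wG).
have sG' : sqint P G' by case: (wiener_integral_space W_fbm wG').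
have := HC _ _ _ _ tT tT wG' wG; rewrite subrr normr0 powR0 ?mulr0; last first.
  by rewrite mulf_neq0// gt_eqF//; move: al_gt; lra.
move=> /(ip_eq0_ae (sqintB sG sG')); apply: filterS => w /eqP.
by rewrite subr_eq0 => /eqP.
Qed.

Lemma wiener_ip_terminal_itv t (G : {RV P >-> R}) : 0 <= t <= T -> wiener_integral T H W (k t) G ->
  ip P G xi = H * be * \int[mu]_(u in `[0%R, t]) (`|t - u| `^ (al - 1) * ka u).
Proof.
move=> tT wG; have /andP[_ t1] := tT.
rewrite (wiener_ip_terminal T_gt0 H_gt H_lt1 W_fbm al_gt al_lt1 tT wG); congr (_ * _).
rewrite /Rintegral; congr fine; rewrite [LHS]integral_mkcond [RHS]integral_mkcond.
apply: eq_integral => u _; rewrite !patchE frac_kernelE indicE.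
have [ut|ut] := boolP (u \in (`[0%R, t]%classic : set R)).
  have -> : u \in (`[0%R, T]%classic : set R).
    by move: ut; rewrite !inE/= !in_itv/= => /andP[-> ut]; exact: le_trans t1.
  by rewrite mulr1.
by rewrite mulr0 mul0r; case: ifP.
Qed.

(** The correlation with the terminal value is a fractional integral of the marginal [ka], here
    replaced by its product integration sum. The error is small compared with t_n^alpha uniformly in
    n, as [linear_fractional_lower_bound] requires of its perturbation. *)
Lemma terminal_correlation_sum (c e : R) : 0 < c -> 0 < e -> exists2 h1 : R, 0 < h1 &
  forall h K n (G : {RV P >-> R}), 0 < h -> h <= h1 -> K%:R * h <= T -> (n <= K)%N ->
    wiener_integral T H W (k (n%:R * h)) G ->
    `|ip P G xi / c - \sum_(l < n) fw h (n - l) * (H * be / c * ka (l%:R * h))| <= e * (n%:R * h) `^ al.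
Proof.
move=> c0 e0; have H0 : 0 < H by move: H_gt; lra.
pose a := H * be / c.
have a0 : 0 < a by exact: (divr_gt0 (mulr_gt0 H0 be_gt0) c0).
pose E := e * al / a.
have E0 : 0 < E by exact: (divr_gt0 (mulr_gt0 e0 al_gt0) a0).
have Eb : 0 < E * be / 2 by by apply: divr_gt0 => //; exact: mulr_gt0.
(* This step h1 solves 2 h1^be / be = E, the left side being the Hoelder bound on the oscillation of
   [ka] in a cell of width h1. *)
exists ((E * be / 2) `^ be^-1); first exact: powR_gt0.
move=> h K n G h0 hh1 KT nK wG.
have nT : n%:R * h <= T by apply: le_trans KT; rewrite ler_wpM2r ?ler_nat// ltW.
have n0 : 0 <= n%:R * h by rewrite mulr_ge0// ltW.
have nTT : 0 <= n%:R * h <= T by rewrite n0.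
rewrite (wiener_ip_terminal_itv nTT wG).
set I := \int[mu]_(_ in _) _.
have -> : H * be * I / c = a * I by rewrite /a; ring.
have -> : \sum_(l < n) fw h (n - l) * (H * be / c * ka (l%:R * h)) =
    a * \sum_(l < n) fw h (n - l) * ka (l%:R * h).
  by rewrite mulr_sumr; apply: eq_bigr => l _; rewrite /a mulrCA.
rewrite -mulrBr normrM (gtr0_norm a0).
have -> : e * (n%:R * h) `^ al = a * (E * ((n%:R * h) `^ al / al)).
  by rewrite /E; field; rewrite !gt_eqF.
rewrite ler_wpM2l ?(ltW a0)//.
have mk : measurable_fun `[0, n%:R * h] ka.
  by apply: measurable_funTS; exact: measurable_kernel_marginal.
apply: (cell_integral_error (M := 2 * T `^ be / be) al_gt0 al_lt1 h0 (ltW E0) mk).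
  move=> s /andP[s0 sn]; have sT : 0 <= s <= T by rewrite s0 (le_trans sn).
  rewrite ger0_norm ?(kernel_marginal_le T_gt0 H_gt sT)//.
  apply: le_trans _ (kernel_marginal_ge T_gt0 H_gt sT).
  by rewrite divr_ge0 ?powR_ge0// ltW.
move=> l s ln /andP[ls sl].
have l0 : 0 <= l%:R * h by rewrite mulr_ge0// ltW.
have lT : l.+1%:R * h <= T by apply: le_trans nT; rewrite ler_wpM2r ?ler_nat// ltW.
have sT : 0 <= s <= T by rewrite (le_trans l0 ls) (le_trans sl).
have lT' : 0 <= l%:R * h <= T by rewrite l0; apply: le_trans lT; rewrite ler_wpM2r ?ler_nat// ltW.
apply: (le_trans (kernel_marginal_holder H_gt H_lt1 sT lT')).
rewrite ler_pdivrMr// -ler_pdivlMl// [leRHS]mulrC.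
have sl' : `|s - l%:R * h| <= h.
  by rewrite ger0_norm ?subr_ge0// lerBlDr (le_trans sl)// -natr1 mulrDl mul1r addrC.
have P1 : `|s - l%:R * h| `^ be <= ((E * be / 2) `^ be^-1) `^ be.
  by apply: ge0_ler_powR; rewrite ?nnegrE ?(ltW be_gt0) ?powR_ge0// (le_trans sl').
by apply: (le_trans P1); rewrite -powRrM mulVf ?gt_eqF// powRr1// ltW.
Qed.

(** Subtracting the regression on [W T] makes every residual orthogonal to it. All combinations stay
    in the Gaussian space, so the variance of the sum splits and the transform factorises, which
    expresses independence. *)
Lemma residual_noise_cos (J : Type) (G : J -> Omega -> R) (rho : J -> R) (a b : R) l :
  (forall j, wiener_space T W (G j)) -> (forall j, rho j = ip P (G j) xi / ip P xi xi) ->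
  let L := linform (fun j w => G j w - rho j * W T w) l in
  \int[P]_w cos (a * W T w + L w + b) =
    expR (- (ip P xi xi / 2 * a ^+ 2)) * expR (- (ip P L L / 2)) * cos b.
Proof.
move=> wG rE L; have T1 : T \in `[0, T] by rewrite in_itv/= lexx ltW.
have wx := wiener_space_W W_fbm T1.
have v0 := variance_terminal_gt0 T_gt0 H_gt W_fbm.
have lin X Y (c c' : R) := @wiener_space_lin _ _ _ _ _ _ _ W_fbm X Y c c'.
have wg j : wiener_space T W (fun w => G j w - rho j * W T w).
  rewrite (_ : (fun w => _) = (fun w => 1 * G j w + (- rho j) * W T w)); first exact: lin.
  by apply/funext => w; rewrite mul1r mulNr.
have wL : wiener_space T W L.
  rewrite /L; elim: l {L} => [|p l IH].
    rewrite (_ : linform _ _ = (fun w => 0 * W T w + 0 * W T w)); first exact: lin.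
    by apply/funext => w; rewrite /linform big_nil !mul0r addr0.
  rewrite (_ : linform _ _ = (fun w => p.2 * (G p.1 w - rho p.1 * W T w) +
      1 * linform (fun j w => G j w - rho j * W T w) l w)); first exact: lin.
  by apply/funext => w; rewrite /linform big_cons mul1r.
have sx : sqint P xi by case: wx.
have sg j : sqint P (fun w => G j w - rho j * W T w) by case: (wg j).
have sL : sqint P L by case: wL.
have ort : ip P xi L = 0.
  rewrite ipC (_ : L = fun w => \sum_(p <- l) p.2 * (G p.1 w - rho p.1 * W T w))//.
  rewrite (@ip_suml _ _ _ _ _ l (fun p w => p.2 * (G p.1 w - rho p.1 * W T w)))//; last first.
    by move=> p; apply: sqintZ.
  rewrite big1// => p _; rewrite ipZl// ipBl//; [|by case: (wG p.1)|exact: sqintZ].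
  by rewrite ipZl// rE divfK ?gt_eqF// subrr mulr0.
have -> : \int[P]_w cos (a * W T w + L w + b) = \int[P]_w cos ((a * W T w + 1 * L w) + b).
  by apply: eq_Rintegral => w _; rewrite mul1r.
rewrite (wiener_space_cos W_fbm b (lin _ _ a 1 wx wL)) ip_sqrD// ort.
by rewrite -expRD; congr (expR _ * _); field.
Qed.

(** The scheme is rewritten with the convolution weights, for one prescribed choice of versions of
    the noise and outside one null set common to all n. The index 0 is included, since the noise
    vanishes there. *)
Lemma euler_maruyama_fweight (sigma x0 : R) (f : R -> R) N (y : nat -> {RV P >-> R}) (G : R -> {RV P >-> R}) :
  (0 < N)%N -> euler_maruyama T H al sigma x0 W f N y ->
  (forall t, 0 <= t <= T -> wiener_integral T H W (k t) (G t)) ->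
  {ae P, forall w n, (n <= N)%N -> y n w =
     x0 + (Gamma al)^-1 * \sum_(l < n) fw (T / N%:R) (n - l) * f (y l w) +
     sigma / Gamma al * G (n%:R * (T / N%:R)) w}.
Proof.
move=> N0 [y0 ye] wG; apply: ae_foralln => n.
have [nN|_] := leqP n N; last by apply: aeW.
have N0' : 0 < N%:R :> R by rewrite ltr0n.
have h0 : 0 < T / N%:R by exact: divr_gt0.
have nT : 0 <= n%:R * (T / N%:R) <= T.
  rewrite mulr_ge0 ?(ltW h0)//= mulrA ler_pdivrMr// mulrC ler_wpM2l ?(ltW T_gt0)//.
  by rewrite ler_nat.
case: n => [|n] in nN nT *.
  have := wG _ nT; rewrite mul0r => /wiener_integral0; apply: filterS => w Gw _.
  by rewrite y0 big_ord0 Gw !mulr0 !addr0.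
have [G' wG' e] := ye n.+1 nN.
have v := wiener_versions nT wG' (wG _ nT).
apply: filterS2 e v => w -> -> _; congr (_ + _ * _ + _).
rewrite big_add1 big_mkord; apply: eq_bigr => l _ /=.
rewrite mulrC -(cell_weight al_gt0 al_lt1 h0 (ltn_ord l)); congr (_ * _).
apply: eq_Rintegral => s; rewrite inE/= in_itv/= => /andP[_ sl].
rewrite ger0_norm// subr_ge0 (le_trans sl)// ler_wpM2r ?(ltW h0)// ler_nat.
exact: ltn_ord.
Qed.

End driving_noise.

(** * Application to the equation and its Euler scheme *)

Lemma Cb2_derivatives (R : realType) (f : R -> R) : Cb 2 f -> exists f1 f2 : R -> R, exists2 L : R, 0 < L &
  [/\ forall x : R, is_derive x 1 f (f1 x), forall x : R, is_derive x 1 f1 (f2 x), continuous f2,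
      forall x, `|f1 x| <= L & forall x, `|f2 x| <= L].
Proof.
move=> fC; have [d1 _ [M1 B1]] := fC 1%N isT; have [d2 c2 [M2 B2]] := fC 2%N isT.
exists (derive1n 1 f), (derive1n 2 f), (`|M1| + `|M2| + 1).
  by rewrite ltr_wpDl// addr_ge0.
split=> [x|x||x|x].
- by apply: DeriveDef; [exact: d1|symmetry; exact: derive1E].
- by apply: DeriveDef; [exact: d2|symmetry; exact: derive1E].
- exact: c2.
- by apply: (le_trans (B1 x)); have := ler_norm M1; have := normr_ge0 M2; lra.
- by apply: (le_trans (B2 x)); have := ler_norm M2; have := normr_ge0 M1; lra.
Qed.

Theorem theorem2p5 (R : realType) (d : measure_display)
    (Omega : measurableType d) (P : probability Omega R)
    (T H alpha sigma x0 : R) (f : R -> R)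
    (F : R -> set (set Omega)) (W x : R -> {RV P >-> R})
    (T_gt0 : 0 < T) (H_range : 2^-1 < H < 1)
    (alpha_range : 1 - H < alpha < 1) (sigma_neq0 : sigma != 0)
    (f_Cb2 : Cb 2 f)
    (F_usual : usual_filtration P T F)
    (W_adapted : adapted T F W) (W_fbm : is_fbm T H W)
    (x_sol : strong_solution T H alpha sigma x0 F W f x) :
  exists2 C : R, 0 < C &
    forall (N : nat) (y : nat -> {RV P >-> R}), (1 <= N)%N ->
      euler_maruyama T H alpha sigma x0 W f N y ->
      let h := T / N%:R in
      forall n : nat, (1 <= n <= N)%N ->
      forall qx qy : R -> R,
        is_pdf (x (n%:R * h)) qx -> is_pdf (y n) qy ->
        ('N[lebesgue_measure]_1 [EFin \o (qx \- qy)%R]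
           <= (C * h `^ (alpha + H - 1))%:E)%E.
Proof.
have /andP[H_gt H_lt1] := H_range; have /andP[al_gt al_lt1] := alpha_range.
have al_gt0 : 0 < alpha by move: H_lt1 al_gt; lra.
have mRV (X : {RV P >-> R}) : measurable_fun setT (X : Omega -> R) by exact: measurable_funPT.
pose ab := alpha + H - 1.
(* It is enough to bound continuous test functions: their bound passes to Borel sets, and then to
   the densities at the cost of a factor 2. *)
suff [C C0 HC] : exists2 C : R, 0 < C & forall (N : nat) (y : nat -> {RV P >-> R}), (1 <= N)%N ->
    euler_maruyama T H alpha sigma x0 W f N y -> forall n : nat, (1 <= n <= N)%N ->
    forall g : R -> R, continuous g -> (forall t, `|g t| <= 1) ->
    `|\int[P]_w (g (x (n%:R * (T / N%:R)) w) - g (y n w))| <= C * (T / N%:R) `^ ab.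
  exists (2 * C); first by rewrite mulr_gt0.
  move=> N y N1 ey h n nN qx qy hx hy.
  have := pdf_L1_le hx hy (continuous_test_functions (mRV _) (mRV _) (HC N y N1 ey n nN)).
  by rewrite mulrA.
pose kap := (Gamma alpha)^-1; pose sk := sigma / Gamma alpha.
have inT N n : (1 <= N)%N -> (n <= N)%N -> 0 <= n%:R * (T / N%:R) <= T.
  move=> N1 nN; have N0 : 0 < N%:R :> R by rewrite ltr0n.
  have h0 : 0 < T / N%:R by exact: divr_gt0.
  by rewrite mulr_ge0 ?(ltW h0)//= mulrA ler_pdivrMr// mulrC ler_wpM2l ?(ltW T_gt0)// ler_nat.
(* The inverse of 0 is 0, so this case would make both x and the scheme equal to x0 almost surely;
   in the other case the noise coefficient [sk] is nonzero. *)
have [k0|k0] := eqVneq kap 0.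
  exists 1 => // N y N1 ey n /andP[n1 nN].
  have tT : n%:R * (T / N%:R) \in `[0, T] by rewrite in_itv/= inT.
  have [Gx _ ex] := sol_equation x_sol tT.
  have [_ /(_ n)] := ey; rewrite n1 nN => /(_ isT)[Gy _ eyn].
  apply: (@ae_weak_limit _ _ _ P _ _ (fun _ _ => x0) (fun _ _ => x0)) => //.
  - apply: filterS ex => w ->; rewrite -/kap k0 mulr0 !mul0r !addr0; exact: cvg_cst.
  - by move=> m _; apply: filterS eyn => w ->; rewrite -/kap k0 mulr0 !mul0r !addr0.
  - near=> m => g _ _; rewrite /Rintegral integral0_eq ?normr0 ?mul1r ?powR_ge0//.
    by move=> w _; rewrite subrr.
have [f1 [f2 [L L0 [ff1 f1f2 cf2 f1L f2L]]]] := Cb2_derivatives f_Cb2.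
have cf : continuous f by exact: (is_derive_continuous ff1).
have flip := lipschitz_of_derive ff1 f1L.
have T0T : (0 : R) \in `[0, T] by rewrite in_itv/= lexx ltW.
(* One version of the noise is chosen for each time. Outside [0, T] that of time 0 is taken, so that
   every chosen variable lies in the Gaussian space. *)
have GE t : exists Gt : {RV P >-> R}, wiener_space T W Gt /\ (0 <= t <= T ->
    wiener_integral T H W (frac_kernel alpha t) Gt /\
    {ae P, forall w, x t w = x0 + kap * (\int[lebesgue_measure]_(s in `[0, t])
      ((t - s) `^ (alpha - 1) * f (x s w))) + sk * Gt w}).
  have [tT|tT] := boolP (0 <= t <= T).
    have tT' : t \in `[0, T] by rewrite in_itv.
    have [Gt wGt et] := sol_equation x_sol tT'.
    by exists Gt; split=> //; exact: (wiener_integral_space W_fbm wGt).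
  have [G0 wG0 _] := sol_equation x_sol T0T.
  by exists G0; split=> //; exact: (wiener_integral_space W_fbm wG0).
have [G GP] := choice GE.
have wG t : 0 <= t <= T -> wiener_integral T H W (frac_kernel alpha t) (G t).
  by move=> tT; have [_ /(_ tT)[]] := GP t.
pose xi : Omega -> R := W T; pose Gf (t : R) : Omega -> R := G t.
have v0 : 0 < ip P xi xi by exact: (variance_terminal_gt0 T_gt0 H_gt W_fbm).
pose s := Num.sqrt (ip P xi xi).
have s2 : s ^+ 2 = ip P xi xi by rewrite sqr_sqrtr// ltW.
have s20 : 0 < s ^+ 2 by rewrite s2.
have s0 : s != 0 by rewrite gt_eqF// sqrtr_gt0.
(* [rho] is the regression coefficient of the noise on the terminal value and [p] the function of
   which it is the fractional integral; [pm] is the lower bound of [p] on [0, T]. *)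
pose rho t := ip P (Gf t) xi / s ^+ 2.
pose p t := H * (2 * H - 1) / s ^+ 2 * kernel_marginal T H t.
pose pm := H * (2 * H - 1) / s ^+ 2 * ((T / 2) `^ (2 * H - 1) / (2 * H - 1)).
have H0 : 0 < H by move: H_gt; lra.
have be0 : 0 < 2 * H - 1 by move: H_gt; lra.
have a0 : 0 < H * (2 * H - 1) / s ^+ 2 by exact: (divr_gt0 (mulr_gt0 H0 be0) s20).
have T20 : 0 < T / 2 by rewrite divr_gt0.
have pm0 : 0 < pm by exact: (mulr_gt0 a0 (divr_gt0 (powR_gt0 _ T20) be0)).
have [CI CI0 HCI] := wiener_increment T_gt0 H_gt H_lt1 W_fbm al_gt al_lt1.
have ab0 : 0 < ab by rewrite /ab; move: al_gt; lra.
have aba : ab <= alpha by rewrite /ab; move: H_lt1; lra.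
have sG t : sqint P (Gf t) by have [[]] := GP t.
have T1T : T \in `[0, T] by rewrite in_itv/= lexx ltW.
have sx : sqint P xi by have [] := wiener_space_W W_fbm T1T.
have G_incr t u : 0 <= t <= T -> 0 <= u <= T ->
    ip P (fun w => Gf u w - Gf t w) (fun w => Gf u w - Gf t w) <= CI * `|u - t| `^ (2 * ab).
  by move=> tT uT; exact: (HCI _ _ _ _ tT uT (wG _ tT) (wG _ uT)).
pose CG0 := 2 * (CI * T `^ (2 * ab)) + 2 * ip P (Gf 0) (Gf 0).
have CG00 : 0 <= CG0.
  have i1 := mulr_ge0 (ltW CI0) (powR_ge0 T (2 * ab)); have i2 := ip_ge0 P (Gf 0).
  by rewrite /CG0; lra.
have T00 : (0 : R) <= 0 <= T by apply/andP; split=> //; exact: ltW.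
have G_bound t : 0 <= t <= T -> ip P (Gf t) (Gf t) <= CG0.
  move=> tT; have -> : ip P (Gf t) (Gf t) = ip P (fun w => (Gf t w - Gf 0 w) + Gf 0 w) (fun w => (Gf t w - Gf 0 w) + Gf 0 w).
    by apply: eq_ip => w; rewrite subrK.
  apply: (le_trans (ip_sqr_le2 (sqintB (sG t) (sG 0)) (sG 0))).
  have i1 := G_incr 0 t T00 tT.
  have i2 : CI * `|t - 0| `^ (2 * ab) <= CI * T `^ (2 * ab).
    apply: ler_wpM2l; first exact: ltW.
    have /andP[t0 t1] := tT; rewrite subr0 ger0_norm//.
    apply: ge0_ler_powR; rewrite ?nnegrE ?(ltW T_gt0)//.
    by apply: mulr_ge0 => //; exact: ltW.
  by move: (le_trans i1 i2); rewrite /CG0; lra.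
have p_ge t : 0 <= t <= T -> pm <= p t.
  by move=> tT; apply: ler_wpM2l; [exact: ltW|exact: (kernel_marginal_ge T_gt0 H_gt tT)].
have rho_sum (e : R) : 0 < e -> exists2 h1 : R, 0 < h1 & forall h K n,
     0 < h -> h <= h1 -> K%:R * h <= T -> (n <= K)%N ->
     `|rho (n%:R * h) - \sum_(l < n) fweight alpha h (n - l) * p (l%:R * h)| <= e * (n%:R * h) `^ alpha.
  move=> e0; have [h1 h10 Hh] := terminal_correlation_sum T_gt0 H_gt H_lt1 W_fbm al_gt al_lt1 s20 e0.
  exists h1 => // h K n h0 hh1 KT nK; apply: (Hh h K n _ h0 hh1 KT nK); apply: wG.
  rewrite mulr_ge0 ?(ltW h0)//=; apply: le_trans KT.
  by apply: ler_wpM2r; [exact: ltW|rewrite ler_nat].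
pose V (J : Type) (tm : J -> R) (l : seq (J * R)) : R :=
  ip P (linform (fun j w => Gf (tm j) w - rho (tm j) * xi w) l)
       (linform (fun j w => Gf (tm j) w - rho (tm j) * xi w) l).
have hcos (J : Type) (tm : J -> R) a l b :
    \int[P]_w cos (a * xi w + linform (fun j w => Gf (tm j) w - rho (tm j) * xi w) l w + b) =
    expR (- (s ^+ 2 / 2 * a ^+ 2)) * expR (- (V J tm l / 2)) * cos b.
  rewrite /V s2.
  apply: (@residual_noise_cos _ _ _ P T H W T_gt0 H_gt W_fbm J (fun j => Gf (tm j)) (fun j => rho (tm j)) a b l).
    by move=> j; have [] := GP (tm j).
  by move=> j; rewrite /rho s2.
have sk0 : sk != 0 by exact: (mulf_neq0 sigma_neq0 k0).
have [C C0 HC] := @euler_weak_error _ _ _ P T alpha ab x0 kap sk L s pm CI CG0 f f1 f2 p rho xi Gf V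
  T_gt0 al_gt0 al_lt1 ab0 aba k0 sk0 L0 s0 ff1 f1f2 cf2 f1L f2L sx sG (ltW CI0) CG00 G_bound G_incr pm0 p_ge
  (fun t => erefl) rho_sum hcos.
exists C => // N y N1 ey n nN; have /andP[n1 nN'] := nN.
have n0N : (0 < n <= N)%N by [].
have N0 : 0 < N%:R :> R by rewrite ltr0n.
pose Z m i w := fine_euler alpha x0 kap sk f rho xi Gf (T / N%:R / m%:R) i (xi w, w).
pose Y m j w := coarse_euler alpha x0 kap sk f rho xi Gf (T / N%:R / m%:R) m j (xi w, w).
apply: (@ae_weak_limit _ _ _ P _ _ (fun m => Z m (n * m)%N) (fun m => Y m n)) => //.
- by move=> m; exact: (@measurable_fine_euler _ _ _ P alpha x0 kap sk f f1 rho xi Gf ff1 sx sG).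
- by move=> m; exact: (@measurable_coarse_euler _ _ _ P alpha x0 kap sk f f1 rho xi Gf ff1 sx sG).
(* The equation holds almost surely at each time. The grids of all refinements contain countably
   many points, so one null set suffices. *)
- have grid : {ae P, forall w m i, (0 < m)%N -> (i <= N * m)%N ->
      x (i%:R * (T / N%:R / m%:R)) w = x0 + kap * \int[lebesgue_measure]_(s in `[0, i%:R * (T / N%:R / m%:R)])
        ((i%:R * (T / N%:R / m%:R) - s) `^ (alpha - 1) * f (x s w)) + sk * Gf (i%:R * (T / N%:R / m%:R)) w}.
    apply: ae_foralln => m; apply: ae_foralln => i.
    have [m0|_] := ltnP 0 m; last exact: aeW.
    have [iN|_] := leqP i (N * m); last exact: aeW.
    have m0' : 0 < m%:R :> R by rewrite ltr0n.
    have iT : 0 <= i%:R * (T / N%:R / m%:R) <= T.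
      have -> : T / N%:R / m%:R = T / (N * m)%:R by rewrite natrM; field; rewrite !gt_eqF.
      by apply: inT => //; rewrite muln_gt0 m0 andbT.
    have [_ /(_ iT)[_]] := GP (i%:R * (T / N%:R / m%:R)).
    by apply: filterS => w.
  apply: filterS2 (sol_continuous x_sol) grid => w cw Ew.
  apply: (euler_path_cvg al_gt0 al_lt1 T_gt0 L0 cf flip (u := fun t => x t w) (g := fun t => Gf t w)
    (Z := fun m i => Z m i w) N1 nN' cw Ew) => m i.
  exact: (@fine_scheme _ _ _ alpha x0 kap sk f rho xi Gf (T / N%:R / m%:R) i i (leqnn i) w).
- move=> m m0; have m0' : 0 < m%:R :> R by rewrite ltr0n.
  have mh : m%:R * (T / N%:R / m%:R) = T / N%:R by field; rewrite !gt_eqF.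
  have := euler_maruyama_fweight T_gt0 H_gt H_lt1 W_fbm al_gt al_lt1 N1 ey wG.
  apply: filterS => w Ew.
  have : forall j, (j <= N)%N -> Y m j w = y j w; last exact.
  (* Evaluated at the actual terminal value, regression plus residual gives back the noise at the
     coarse grid points, and the coarse recursion is that of the Euler scheme. *)
  elim/ltn_ind => j IH jN; rewrite Ew// /Y /coarse_euler eulerE/=.
  congr (_ + _ * _ + _ * _).
    apply: eq_bigr => l _; congr (fweight _ _ _ * f _); first exact: mh.
    by apply: (IH l) => //; exact: (leq_trans (ltnW (ltn_ord l)) jN).
  have -> : (j * m)%:R * (T / N%:R / m%:R) = j%:R * (T / N%:R) by rewrite natrM -mulrA mh.
  by rewrite addrC subrK.
- exact: (HC N n N1 n0N).
Unshelve. all: by end_near. Qed.
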